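(* Assume that the conductances $\omega$ are such that the variable speed random walk on $\mathcal{C}(\omega)$ is transient and the map $\mathcal{C}(\omega)\ni x\mapsto G^\omega(x,x)=\int_0^\infty p^\omega_t(x,x)\,dt$ is an element of $\mathcal{S}'$, and assume that there is some $\epsilon>0$ with $$\sup_{x\in\mathbb{Z}^d}\langle x\rangle^{-2+\epsilon}\sum_{y\sim x}\omega(x,y)<\infty .$$ Then for any probability measure $\nu$ on $\mathcal{S}'$ the following statements are equivalent. (i) $\nu$ is a stationary measure for the SDE $$d\phi_t(x)=\sum_{y\sim x}\omega(x,y)(\phi_t(y)-\phi_t(x))\,dt+\sqrt{2}\,dB_t(x),\qquad x\in\mathcal{C}(\omega).$$ (ii) $\nu$ is a reversible measure for this SDE. (iii) $\nu$ is a Gibbs measure with respect to the specification $\gamma^\omega$.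
   Context: Let $d\ge1$; $x\sim y$ means that $x,y\in\mathbb{Z}^d$ are nearest neighbours. The conductances $\omega=(\omega(x,y))_{x,y\in\mathbb{Z}^d}$ are non-negative, symmetric and vanish unless $x\sim y$. Standing assumption: the graph on $\mathbb{Z}^d$ whose edges are the pairs $\{x,y\}$ with $\omega(x,y)>0$ has exactly one infinite connected component, denoted $\mathcal{C}(\omega)$. The formal Laplacian is $(\Delta_\omega u)(x)=\sum_{y\sim x}\omega(x,y)[u(x)-u(y)]$. The variable speed random walk is the continuous-time Markov chain $(X_t)_{t\geq 0}$ on $\mathcal{C}(\omega)$ with generator $-\Delta_\omega$ (jump rate $\omega(x,y)$ from $x$ to $y$); it is non-explosive here, and $p^\omega_t(x,y)=\mathbf{P}^\omega_x[X_t=y]$. Write $\langle x\rangle=(1+|x|^2)^{1/2}$. For $N\ge0$, $H_{\pm N}$ is the space of $f:\mathcal{C}(\omega)\to\mathbb{R}$ with $\|f\|^2_{H_{\pm N}}=\sum_x\langle x\rangle^{\pm2N}|f(x)|^2<\infty$; $\mathcal{S}=\bigcap_{N\ge0}H_N$, $\mathcal{S}'=\bigcup_{N\ge0}H_{-N}$, with pairing $\langle\xi,u\rangle=\langle u,\xi\rangle=\sum_x\xi(x)u(x)$. Under the growth assumption, for every $\phi_0\in\mathcal{S}'$ the SDE (with independent standard Brownian motions $(B_t(x))$) has a unique adapted solution with continuous paths in some $H_{-N}$, namely $\phi_t(x)=\sum_y p^\omega_t(x,y)\phi_0(y)+\sqrt2\sum_y\int_0^tp^\omega_{t-s}(x,y)\,dB_s(y)$.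 Let $\mathbb{E}_\phi$ denote expectation for the solution with $\phi_0=\phi$, and let $T_tF(\phi)=\mathbb{E}_\phi[F(\phi_t)]$ for bounded measurable $F:\mathcal{S}'\to\mathbb{R}$. A probability measure $\nu$ on $\mathcal{S}'$ is stationary if $\int T_tF\,d\nu=\int F\,d\nu$ for all such $F$ and all $t\ge0$. It is reversible if for all $0\le s<t<\infty$ and all $u,v\in\mathcal{S}$, $$\int_{\mathcal{S}'}\mathbb{E}_\phi\big[e^{i(\langle u,\phi_t\rangle+\langle v,\phi_s\rangle)}\big]\nu(d\phi)=\int_{\mathcal{S}'}\mathbb{E}_\phi\big[e^{i(\langle u,\phi_s\rangle+\langle v,\phi_t\rangle)}\big]\nu(d\phi).$$ Gibbs measures: for finite $\Lambda\subset\mathcal{C}(\omega)$ put $\mathscr{H}^\omega_\Lambda(\phi)=\frac12\sum_{\{i,j\}:\,i\sim j,\ \{i,j\}\cap\Lambda\neq\varnothing}\omega(i,j)(\phi_i-\phi_j)^2$ and, for $\eta\in\mathbb{R}^{\mathcal{C}(\omega)}$ and $B$ in the product $\sigma$-algebra $\mathscr{F}$ of $\mathbb{R}^{\mathcal{C}(\omega)}$, $$\gamma^\omega_\Lambda(B|\eta)=\frac1{\mathbf{Z}^\eta_{\Lambda;\omega}}\int e^{-\mathscr{H}^\omega_\Lambda(\phi_\Lambda\eta_{\Lambda^c})}\mathbf{1}_B(\phi_\Lambda\eta_{\Lambda^c})\prod_{x\in\Lambda}d\phi_x,$$ where $\Lambda^c=\mathcal{C}(\omega)\setminus\Lambda$,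 $\phi_\Lambda\eta_{\Lambda^c}$ equals $\phi$ on $\Lambda$ and $\eta$ on $\Lambda^c$, and $\mathbf{Z}^\eta_{\Lambda;\omega}$ is the normalising constant. A probability measure $\mu$ supported on $\mathcal{S}'$ is a Gibbs measure for the specification $\gamma^\omega=(\gamma^\omega_\Lambda)_\Lambda$ if for all finite $\Lambda$ and all $B\in\mathscr{F}$, $\mu(B|\mathscr{F}_{\Lambda^c})(\phi)=\gamma^\omega_\Lambda(B|\phi)$ for $\mu$-a.e. $\phi$, where $\mathscr{F}_{\Lambda^c}=\sigma(\phi_x:x\in\Lambda^c)$. *)

(* Defs.v *)
From HB Require Import structures.
From mathcomp Require Import all_boot all_order all_algebra finmap complex.
From mathcomp Require Import all_classical all_reals all_analysis.

Set Implicit Arguments.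
Unset Strict Implicit.
Unset Printing Implicit Defensive.

Import Order.TTheory GRing.Theory Num.Theory.
Import numFieldNormedType.Exports.

Local Open Scope classical_set_scope.
Local Open Scope ring_scope.

Section Conductances.
Context {R : realType} {d : nat}.
Implicit Types (x y : 'rV[int]_d) (w : 'rV[int]_d -> 'rV[int]_d -> R).

Definition neighbour x y : bool := \sum_(i < d) `|x 0 i - y 0 i| == 1 :> int.

(* (1 + |x|^2)^(1/2), with |x| the Euclidean norm *)
Definition bracket x : R := Num.sqrt (1 + \sum_(i < d) (x 0 i)%:~R ^+ 2).

Definition conductances w : Prop :=
  [/\ forall x y, 0 <= w x y,
      forall x y, w x y = w y x
    & forall x y, ~~ neighbour x y -> w x y = 0].

Definition joined w x y : Prop :=
  exists2 p : seq 'rV[int]_d,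
    path (fun a b => 0 < w a b) x p & last x p = y.

Definition component w (A : set 'rV[int]_d) : Prop :=
  exists x, A = [set y | joined w x y].

Definition unique_infinite_component w (C : set 'rV[int]_d) : Prop :=
  [/\ component w C, infinite_set C
    & forall A, component w A -> infinite_set A -> A = C].

Definition total_conductance w x : R :=
  \sum_(y \in [set y | neighbour x y]) w x y.

Definition growth_bound w (eps : R) : Prop :=
  has_ubound (range (fun x => bracket x `^ (- 2 + eps) * total_conductance w x)).

End Conductances.

(* The cluster is a set C of lattice points, used as a type through the
   coercion [set_type]; real functions on the cluster have type [C -> R]. *)
Section Cluster.
Context {R : realType} {d : nat}.
Context {C : set 'rV[int]_d}.
Variable w : 'rV[int]_d -> 'rV[int]_d -> R.

(* Neighbours outside the cluster are left out: w vanishes on those edges. *)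
Definition laplacian (u : C -> R) (x : C) : R :=
  \sum_(y \in [set y : C | neighbour (val x) (val y)])
    w (val x) (val y) * (u x - u y).

Definition coordinate_sets (A : set C) : set (set (C -> R)) :=
  \bigcup_(x in A) preimage_set_system setT (fun f => f x) measurable.

Definition sigma_coordinates (A : set C) : set (set (C -> R)) :=
  <<s coordinate_sets A >>.

(* The functions on the cluster with the product sigma-algebra. Measures on
   [tempered] are measures on this space giving it full mass, and a function
   on [tempered] is a function on this space whose values elsewhere are not
   used. *)
Definition configuration : Type := g_sigma_algebraType (coordinate_sets setT).

HB.instance Definition _ := Measurable.on configuration.

Definition weighted_norm2 (s : R) (f : C -> R) : \bar R :=
  \esum_(x in [set: C]) (bracket (val x) `^ (2 * s) * f x ^+ 2)%:E.

Definition weighted_space (s : R) : set (C -> R) :=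
  [set f | (weighted_norm2 s f < +oo)%E].

Definition rapidly_decreasing : set (C -> R) :=
  \bigcap_(N in [set N : R | 0 <= N]) weighted_space N.

Definition tempered : set configuration :=
  \bigcup_(N in [set N : R | 0 <= N]) weighted_space (- N).

(* The sum over x of u x * f x, as the difference of the sums of the positive
   and negative parts; both are finite for u in [rapidly_decreasing] and f in
   [tempered]. *)
Definition pairing (u f : C -> R) : R :=
  let g x := (u x * f x)%:E in
  fine (\esum_(x in [set: C]) (g^\+ x)%E) -
  fine (\esum_(x in [set: C]) (g^\- x)%E).

Section Walk.
Context {dT : measure_display} {T : measurableType dT}.
Variables (P : C -> probability T R) (X : R -> T -> C).

Definition history (s : R) : set (set T) :=
  <<s [set A | exists r y, 0 <= r <= s /\ A = [set o | X r o = y]] >>.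

Definition transition (t : R) (x y : C) : R :=
  fine (P x [set o | X t o = y]).

(* The last clause says that the generator is - [laplacian], i.e. that the
   matrix of jump rates is (x, y) |-> (- laplacian \1_[set y]) x, which is
   w x y for y != x. *)
Definition variable_speed_walk : Prop :=
  [/\ forall t y, 0 <= t -> measurable [set o | X t o = y],
      forall x, P x [set o | X 0 o = x] = 1%E,
      forall o t, 0 <= t -> \forall s \near t^'+, X s o = X t o,
      forall x y z s t A, 0 <= s -> 0 <= t -> history s A ->
        P x (A `&` [set o | X s o = y] `&` [set o | X (s + t) o = z]) =
        (P x (A `&` [set o | X s o = y]) * P y [set o | X t o = z])%E
    & forall x y,
        h^-1 * (transition h x y - \1_[set y] x) @[h --> 0^'+] -->
        - laplacian \1_[set y] x].

Definition transient : Prop :=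
  forall x, {ae P x, forall o, exists t0, forall t, t0 <= t -> X t o <> x}.

Definition green (x : C) : \bar R :=
  (\int[lebesgue_measure]_(t in `[0%R, +oo[) (transition t x x)%:E)%E.

Definition tempered_green : Prop :=
  (forall x, green x \is a fin_num) /\ tempered (fun x => fine (green x)).

End Walk.

Section SDE.
Context {dT : measure_display} {T : measurableType dT}.
Variable (P : probability T R).

Definition filtration (F : R -> set (set T)) : Prop :=
  [/\ forall t, 0 <= t -> sigma_algebra setT (F t),
      forall t, 0 <= t -> F t `<=` measurable
    & forall s t, 0 <= s -> s <= t -> F s `<=` F t].

Definition adapted (F : R -> set (set T)) (Z : R -> T -> C -> R) : Prop :=
  forall t x Y, 0 <= t -> measurable Y -> F t [set o | Y (Z t o x)].

(* Independent standard Brownian motions with respect to F: the increments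
   over ]s, t] at distinct sites are jointly independent of F s and of each
   other, with law N(0, t - s). *)
Definition brownian_family (F : R -> set (set T)) (B : R -> T -> C -> R) : Prop :=
  [/\ adapted F B,
      {ae P, forall o, forall x, B 0 o x = 0},
      {ae P, forall o, forall x,
        {within `[0, +oo[%classic, continuous (fun t => B t o x)}}
    & forall s t (A : set T) (J : {fset C}) (Y : C -> set R),
        0 <= s -> s < t -> F s A -> (forall x, measurable (Y x)) ->
        P (A `&` [set o | forall x, x \in J -> Y x (B t o x - B s o x)]) =
        (P A * \prod_(x <- J) normal_prob 0 (Num.sqrt (t - s)) (Y x))%E].

(* The noise is additive, so the stochastic differential equation is an
   ordinary integral equation along each path. *)
Definition sde_solution (F : R -> set (set T)) (B : R -> T -> C -> R)
    (f0 : C -> R) (Z : R -> T -> C -> R) : Prop :=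
  [/\ adapted F Z,
      {ae P, forall o, Z 0 o = f0},
      exists2 N : R, 0 <= N & forall o t, 0 <= t ->
        weighted_space (- N) (Z t o) /\
        weighted_norm2 (- N) (fun x => Z s o x - Z t o x)
          @[s --> within `[0, +oo[%classic (nbhs t)] --> 0%E
    & {ae P, forall o, forall t x, 0 <= t ->
        Z t o x = Z 0 o x
          + \int[lebesgue_measure]_(s in `[0, t])
              (\sum_(y \in [set y : C | neighbour (val x) (val y)])
                 w (val x) (val y) * (Z s o y - Z s o x))
          + Num.sqrt 2 * B t o x}].

(* [Phi f] plays the role of the solution started from f. *)
Variables (Phi : (C -> R) -> R -> T -> C -> R) (nu : probability configuration R).

Definition semigroup (t : R) (G : configuration -> R) (f : configuration) : R :=
  \int[P]_o G (Phi f t o).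

Definition stationary : Prop :=
  forall G : configuration -> R, measurable_fun tempered G ->
    (exists M, forall f, tempered f -> `|G f| <= M) ->
    forall t, 0 <= t ->
      \int[nu]_(f in tempered) semigroup t G f = \int[nu]_(f in tempered) G f.

Definition expi (a : R) : R[i] := (cos a +i* sin a)%C.

Definition cintegral dS (S : measurableType dS) (mu : probability S R)
    (D : set S) (g : S -> R[i]) : R[i] :=
  ((\int[mu]_(z in D) complex.Re (g z)) +i*
   (\int[mu]_(z in D) complex.Im (g z)))%C.

Definition reversible : Prop :=
  forall s t u v, 0 <= s -> s < t ->
    rapidly_decreasing u -> rapidly_decreasing v ->
    cintegral nu tempered (fun f => cintegral P setT (fun o =>
      expi (pairing u (Phi f t o) + pairing v (Phi f s o)))) =
    cintegral nu tempered (fun f => cintegral P setT (fun o =>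
      expi (pairing u (Phi f s o) + pairing v (Phi f t o)))).

End SDE.

(* The sum runs over ordered pairs, so each edge {i, j} is counted twice; hence
   the factor 1/4 instead of 1/2. *)
Definition hamiltonian (L : {fset C}) (f : C -> R) : R :=
  4^-1 * \sum_(e \in [set e : C * C | neighbour (val e.1) (val e.2) /\
                                      ((e.1 \in L) || (e.2 \in L))])
           w (val e.1) (val e.2) * (f e.1 - f e.2) ^+ 2.

(* The integral of g over the values at the sites of s with respect to product
   Lebesgue measure, the values at the other sites being those of f. *)
Fixpoint lebesgue_sites (s : seq C) (g : (C -> R) -> \bar R) (f : C -> R) : \bar R :=
  if s is x :: s' then
    (\int[lebesgue_measure]_(a in [set: R])
       lebesgue_sites s' g [eta f with x |-> a])%E
  else g f.

Definition partition_function (L : {fset C}) (eta : C -> R) : \bar R :=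
  lebesgue_sites L (fun f => (expR (- hamiltonian L f))%:E) eta.

Definition specification (L : {fset C}) (B : set (C -> R)) (eta : C -> R) : R :=
  fine (lebesgue_sites L (fun f => (expR (- hamiltonian L f) * \1_B f)%:E) eta)
  / fine (partition_function L eta).

Definition conditional_probability (mu : probability configuration R)
    (F : set (set configuration)) (B : set configuration) (g : configuration -> R) : Prop :=
  (forall Y : set R, measurable Y -> F (g @^-1` Y)) /\
  (forall A, F A -> (\int[mu]_(f in A) (g f)%:E)%E = mu (A `&` B)).

Definition gibbs (mu : probability configuration R) : Prop :=
  mu tempered = 1%E /\
  forall (L : {fset C}) (B : set configuration), measurable B ->
    exists2 g, conditional_probability mu
                 (sigma_coordinates [set x | x \notin L]) B g
    & {ae mu, forall f, g f = specification L B f}.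

End Cluster.

Arguments configuration R {d} C.

(* Main.v *)
(** Write [P_t] for the heat flow of the weighted Laplacian [Delta] on rapidly
    decreasing functions, [G_t = \int_0^t P_s ds] and
    [V_t(u) = <G_2t u, u> / 2], the variance of the noise tested against [u].
    All three properties of [nu] are equivalent to the invariance
    [E_nu e^(i<u,phi>) = E_nu e^(i<P_t u,phi>) e^(-V_t(u))].

    The growth condition gives a carre du champ bound for a small power of
    [bracket], hence weighted energy estimates: moderate solutions of the heat
    equation are unique, and rapid decrease is preserved. The flow itself is the
    difference of two solutions of the equation driven by the same noise. A
    Riemann sum argument along the paths then identifies the joint
    characteristic functionals of a solution, and stationarity is invariance of
    the characteristic functional.

    Invariance says nothing directly on [u + v - P_t v]. But for large [k] the
    iterated differences [(1 - P_t)^k P_T v], tested against [phi], vanish as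
    [T] grows, by the decay of the flow, and downward induction on [k] with the
    help of invariance extends this to [k = 1]. So [P_T u] and
    [P_T (u + v - P_t v)] have asymptotically the same law, and comparing the
    variances in the invariance identity gives the law of the shift
    [u -> u + v - P_t v]. It is the reversibility identity; for [t] small it
    becomes the law of the shift [u -> u + Delta v], which for [v] supported at
    one site is the one-site equation of the Gibbs specification, by a Gaussian
    integral, and conversely determines the conditional laws in finite sets,
    where the Dirichlet problem can be solved. *)
Require Import Defs.
From HB Require Import structures.
From mathcomp Require Import all_boot all_order all_algebra finmap complex.
From mathcomp Require Import all_classical all_reals all_analysis.
From mathcomp Require Import measurable_realfun.
From mathcomp Require Import ring lra zify.
Import Order.TTheory GRing.Theory Num.Theory.
Import numFieldNormedType.Exports.
Set Implicit Arguments.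
Unset Strict Implicit.
Unset Printing Implicit Defensive.
Local Open Scope classical_set_scope.
Local Open Scope ring_scope.

(** * Sums over the cluster *)

(** Two consequences of invariance drive the argument. Since [V_T(u) >= T |P_T u|^2] and the
    characteristic functional tends to 1 at small multiples of [u], the variances of such a multiple
    stay bounded in [T], which forces [|P_T u| -> 0]. Moreover [P_T u], tested against [phi],
    oscillates at most as much as [u], uniformly in [T]. The second fact makes the downward
    induction work: [J] times a first difference equals a difference of two boundary values plus
    second differences. Applied to a small multiple [v / J], the boundary values are uniformly small
    and the second differences vanish by induction.

    The induction starts from a race of powers. The numbers [|P_(i t/2) u|^2] decrease, are convex
    in [i], and have second difference [|P_(i t/2) (1 - P_t) u|^2], so each factor [1 - P_t] gains
    [T^-2] in squared norm. The squared norm with weight [a^j] grows only like [T^j]: the carre du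
    champ bound makes the error term of the energy inequality two powers of the weight smaller, so
    that each order is driven by the preceding one. For [k] large the gain beats the growth of any
    tempered [phi]. *)

Section WeightedSums.
Context {R : realType} {I : Type} (e : nat -> I) (q : I -> R).

(** A limit of real partial sums along an enumeration. It is used on functions dominated by the
    summable weight [q], where the series converges absolutely and the sum is linear and
    monotone. *)
Definition tsum (f : I -> R) : R := limn (series (fun i => f (e i))).

Definition dominated (f : I -> R) := exists K, forall x, `|f x| <= K * q x.

Lemma eq_tsum f g : (forall x, f x = g x) -> tsum f = tsum g.
Proof. by move=> fg; congr tsum; apply/funext. Qed.

Lemma eq_tsum_le f g : (forall x, f x = g x) -> tsum f <= tsum g.
Proof. by move=> /eq_tsum->. Qed.

Lemma tsum_finite (f : I -> R) n : (forall i, (n <= i)%N -> f (e i) = 0) ->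
  tsum f = \sum_(i < n) f (e i).
Proof.
move=> f0; apply/cvg_lim => //; rewrite -(big_mkord xpredT (fun i => f (e i))).
apply: cvg_near_cst; near=> m; rewrite /series /= (big_cat_nat _ (n := n))//=.
  by rewrite addrC big_nat_cond big1 ?add0r// => i /andP[/andP[ni _] _]; exact: f0.
by near: m; exact: nbhs_infty_ge.
Unshelve. all: by end_near. Qed.

Hypotheses (q0 : forall x, 0 < q x) (cq : cvgn (series (fun i => q (e i)))).

Lemma dominatedP f : dominated f ->
  exists2 K, 0 <= K & forall x, `|f x| <= K * q x.
Proof.
move=> [K fK]; exists (Num.max K 0); first by rewrite le_max lexx orbT.
by move=> x; apply: (le_trans (fK x)); apply: ler_wpM2r; [exact: ltW|rewrite le_max lexx].
Qed.

Lemma dominated_le f g : dominated g -> (forall x, `|f x| <= `|g x|) -> dominated f.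
Proof. by move=> [K gK] fg; exists K => x; exact: le_trans (fg x) (gK x). Qed.

Lemma dominatedD f g : dominated f -> dominated g -> dominated (fun x => f x + g x).
Proof.
move=> [K fK] [L gL]; exists (K + L) => x.
by rewrite (le_trans (ler_normD _ _))// mulrDl lerD.
Qed.

Lemma dominatedZ c f : dominated f -> dominated (fun x => c * f x).
Proof.
move=> [K fK]; exists (`|c| * K) => x; rewrite normrM -mulrA.
by apply: ler_wpM2l.
Qed.

Lemma dominatedN f : dominated f -> dominated (fun x => - f x).
Proof. by move=> [K fK]; exists K => x; rewrite normrN. Qed.

Lemma dominatedB f g : dominated f -> dominated g -> dominated (fun x => f x - g x).
Proof. by move=> df dg; apply: dominatedD => //; exact: dominatedN. Qed.

Lemma dominated_cvg f : dominated f -> cvgn (series (fun i => f (e i))).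
Proof.
move=> /dominatedP[K K0 fK]; apply: normed_cvg.
apply: (@series_le_cvg _ _ (fun i => K * q (e i))) => //.
- by move=> n; rewrite normr_ge0.
- by move=> n; rewrite mulr_ge0// ltW.
- by move=> n; exact: fK.
- exact: (is_cvg_seriesZ cq).
Qed.

Lemma dominated_cvg_tsum f : dominated f ->
  series (fun i => f (e i)) @ \oo --> tsum f.
Proof. by move=> df; exact: dominated_cvg. Qed.

Lemma tsumD f g : dominated f -> dominated g ->
  tsum (fun x => f x + g x) = tsum f + tsum g.
Proof. by move=> df dg; exact: (lim_seriesD (dominated_cvg df) (dominated_cvg dg)). Qed.

Lemma tsumZ c f : dominated f -> tsum (fun x => c * f x) = c * tsum f.
Proof. by move=> df; exact: (lim_seriesZ c (dominated_cvg df)). Qed.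

Lemma tsumN f : dominated f -> tsum (fun x => - f x) = - tsum f.
Proof. by move=> df; exact: (lim_seriesN (dominated_cvg df)). Qed.

Lemma tsumB f g : dominated f -> dominated g ->
  tsum (fun x => f x - g x) = tsum f - tsum g.
Proof. by move=> df dg; exact: (lim_seriesB (dominated_cvg df) (dominated_cvg dg)). Qed.

Lemma ler_tsum f g : dominated f -> dominated g -> (forall x, f x <= g x) ->
  tsum f <= tsum g.
Proof.
move=> df dg fg; apply: lim_series_le => //; exact: dominated_cvg.
Qed.

Lemma tsum0 : tsum (fun=> 0) = 0.
Proof. by rewrite (@tsum_finite _ 0)// big_ord0. Qed.

Lemma dominated0 : dominated (fun=> 0).
Proof. by exists 0 => x; rewrite normr0 mul0r. Qed.

Lemma tsum_ge0 f : dominated f -> (forall x, 0 <= f x) -> 0 <= tsum f.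
Proof. by move=> df f0; rewrite -tsum0; apply: ler_tsum => //; exact: dominated0. Qed.

Lemma dominated_q K : dominated (fun x => K * q x).
Proof. by exists `|K| => x; rewrite normrM (gtr0_norm (q0 x)). Qed.

Lemma ler_norm_tsum f K : (forall x, `|f x| <= K * q x) -> `|tsum f| <= K * tsum q.
Proof.
move=> fK; have df : dominated f by exists K.
rewrite -tsumZ; last by exists 1 => x; rewrite mul1r gtr0_norm.
rewrite ler_norml -tsumN; last exact: dominated_q.
apply/andP; split; apply: ler_tsum => //; first by apply: dominatedN; exact: dominated_q.
- by move=> x; have := fK x; rewrite ler_norml => /andP[].
- exact: dominated_q.
- by move=> x; have := fK x; rewrite ler_norml => /andP[].
Qed.

Lemma ler_tsum_term f n : dominated f -> (forall x, 0 <= f x) -> f (e n) <= tsum f.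
Proof.
move=> df f0; apply: (@le_trans _ _ (series (fun i => f (e i)) n.+1)).
  by rewrite seriesSr lerDr /series /= sumr_ge0.
apply: nondecreasing_cvgn_le; last exact: dominated_cvg.
by apply/nondecreasing_seqP => k; rewrite seriesSr lerDl.
Qed.

(** The tail of [f] is bounded by the tail of [K * q], so the rank depends on [K] alone. This
    uniformity in [f] justifies every exchange of limits below. *)
Lemma tail_small K eps : 0 < eps -> \forall n \near \oo,
  forall f, (forall x, `|f x| <= K * q x) ->
   `|series (fun i => f (e i)) n - tsum f| <= eps.
Proof.
move=> eps0.
have dq : dominated q by exists 1 => x; rewrite mul1r gtr0_norm.
have /cvgrPdist_le/(_ eps eps0) : series (fun i => K * q (e i)) @ \oo --> tsum (fun x => K * q x).
  exact/dominated_cvg_tsum/dominated_q.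
apply: filterS => n nK f fK.
have df : dominated f by exists K.
have K0 x : 0 <= K * q x by exact: le_trans (normr_ge0 _) (fK x).
apply: le_trans nK; rewrite distrC.
have ca : cvgn (series (fun i => f (e i))) by exact: dominated_cvg.
have cb : cvgn (series (fun i => K * q (e i))) by exact: (dominated_cvg (dominated_q K)).
have H g : cvgn (series (fun i => g (e i))) ->
   (fun m => series (fun i => g (e i)) m - series (fun i => g (e i)) n) @ \oo --> tsum g - series (fun i => g (e i)) n.
  by move=> cg; apply: cvgB => //; exact: cvg_cst.
apply: (ler_cvg_to (cvg_norm (H _ ca)) (cvg_norm (H (fun x => K * q x) cb))).
near=> m; have nm : (n <= m)%N by near: m; exact: nbhs_infty_ge.
rewrite !sub_series_geq// (le_trans (ler_norm_sum _ _ _))//.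
rewrite [leRHS]ger0_norm ?sumr_ge0// ler_sum//.
Unshelve. all: by end_near. Qed.

(** Dominated convergence for series: [tail_small] provides one finite set of sites outside which
    all the sums are small, and on it the limit is taken termwise. *)
Lemma tannery (F : nat -> I -> R) f K : (forall n x, `|F n x| <= K * q x) ->
  (forall x, F ^~ x @ \oo --> f x) -> tsum (F n) @[n --> \oo] --> tsum f.
Proof.
move=> FK Ff.
have fK x : `|f x| <= K * q x.
  apply: (ler_cvg_to (cvg_norm (Ff x)) (cvg_cst _)); exact: nearW.
apply/cvgrPdist_le => eps eps0.
have e3 : 0 < eps / 3 by lra.
have [N _ /(_ N (leqnn N)) HN] := tail_small K e3.
have : series (fun i => F n (e i)) N @[n --> \oo] --> series (fun i => f (e i)) N.
  by rewrite /series /=; apply: cvg_big => [|i _]; [exact: add_continuous|exact: Ff].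
move=> /cvgrPdist_le/(_ _ e3); apply: filterS => n Hn.
have := HN _ fK; have := HN _ (FK n); move: Hn; rewrite !ler_norml; lra.
Qed.

Lemma is_derive_series (h : nat -> R -> R) (dh : nat -> R) n x :
  (forall i, is_derive x (1 : R) (h i) (dh i)) ->
  is_derive x (1 : R) (fun s => series (fun i => h i s) n) (series dh n).
Proof.
move=> hd; elim: n => [|n IH].
  rewrite (_ : (fun _ => _) = cst 0); last by apply/funext => s; rewrite /series /= big_nil.
  by rewrite /series /= big_nil; exact: is_derive_cst.
rewrite (_ : (fun _ => _) = (fun s => series (fun i => h i s) n) + h n).
  by rewrite seriesSr; exact: is_deriveD.
by apply/funext => s; rewrite seriesSr.
Qed.

Lemma within_continuous_series (h : nat -> R -> R) (A : set R) n :
  (forall i, {within A, continuous (h i)}) ->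
  {within A, continuous (fun s => series (fun i => h i s) n)}.
Proof.
move=> hc z; rewrite /series /=; apply: cvg_big => [|i _]; first exact: add_continuous.
exact: hc.
Qed.

(** The infinite sum is never differentiated. The mean value theorem is applied to a partial sum,
    whose derivative at the unknown intermediate time is close to [tsum (f' r)] uniformly in [r] by
    [tail_small]. *)
Lemma tsum_mvt (f f' : R -> I -> R) (s t K m : R) : s <= t ->
  (forall r, s < r < t -> forall x, is_derive r (1 : R) (f ^~ x) (f' r x)) ->
  (forall x, {within `[s, t], continuous (f ^~ x)}) ->
  (forall r, s < r < t -> forall x, `|f' r x| <= K * q x) ->
  (forall r, s < r < t -> tsum (f' r) <= m) ->
  dominated (f s) ->
  dominated (f t) /\ tsum (f t) - tsum (f s) <= m * (t - s).
Proof.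
rewrite le_eqVlt => /orP[/eqP->|st] fd fc fK fm ds; first by rewrite !subrr mulr0.
have dt : dominated (f t).
  have [L HL] := ds; exists (L + K * (t - s)) => x.
  have [c /[!in_itv]/= cst H] := MVT st (fun r (H : r \in `]s, t[) => fd r H x) (fc x).
  rewrite -[f t x](subrK (f s x)) addrC (le_trans (ler_normD _ _))// mulrDl lerD//.
  rewrite H normrM (@gtr0_norm _ (t - s)) ?subr_gt0// mulrAC.
  by apply: ler_wpM2r; [rewrite subr_ge0 ltW|exact: fK].
split=> //; apply/ler_addgt0Pr => eps eps0.
have e0 : 0 < eps / (t - s) by rewrite divr_gt0 ?subr_gt0.
have H1 : (fun n => series (fun i => f t (e i)) n - series (fun i => f s (e i)) n) @ \oo
   --> tsum (f t) - tsum (f s) by apply: cvgB; exact: dominated_cvg.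
apply: (ler_cvg_to H1 (cvg_cst _)).
apply: filterS (tail_small K e0) => n Hn.
have := MVT st (fun r H => is_derive_series n (fun i => fd r H (e i)))
  (@within_continuous_series (fun i s => f s (e i)) _ n (fun i => fc (e i))).
move=> [c /[!in_itv]/= cst ->].
have := Hn _ (fK c cst); rewrite ler_norml => /andP[_ Hc].
rewrite -lerBlDl -[leLHS]mulr1.
have -> : eps = eps / (t - s) * (t - s) by rewrite divfK// gt_eqF// subr_gt0.
rewrite mulr1 -mulrBl ler_pM2r ?subr_gt0//.
by have := fm c cst; lra.
Qed.

Lemma tsum_mvt_norm (f f' : R -> I -> R) (s t K m : R) : s <= t ->
  (forall r, s < r < t -> forall x, is_derive r (1 : R) (f ^~ x) (f' r x)) ->
  (forall x, {within `[s, t], continuous (f ^~ x)}) ->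
  (forall r, s < r < t -> forall x, `|f' r x| <= K * q x) ->
  (forall r, s < r < t -> `|tsum (f' r)| <= m) ->
  dominated (f s) ->
  `|tsum (f t) - tsum (f s)| <= m * (t - s).
Proof.
move=> st fd fc fK fm ds.
have [dt H] : dominated (f t) /\ tsum (f t) - tsum (f s) <= m * (t - s).
  apply: (@tsum_mvt f f' s t K) => // r sr.
  by rewrite (le_trans (ler_norm _))// fm.
have [|||||_] := @tsum_mvt (fun r x => - f r x) (fun r x => - f' r x) s t K m st.
- by move=> r sr x; apply: is_deriveN; exact: fd.
- by move=> x z; apply: cvgN; exact: fc.
- by move=> r sr x; rewrite normrN fK.
- move=> r sr; rewrite tsumN; last by exists K => x; exact: fK.
  by rewrite (le_trans (ler_norm _))// normrN fm.
- exact: dominatedN.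
rewrite !tsumN// ler_norml H andbT => H'; lra.
Qed.

Lemma tsum_mvt0 (f f' : R -> I -> R) (s t K : R) : s <= t ->
  (forall r, s < r < t -> forall x, is_derive r (1 : R) (f ^~ x) (f' r x)) ->
  (forall x, {within `[s, t], continuous (f ^~ x)}) ->
  (forall r, s < r < t -> forall x, `|f' r x| <= K * q x) ->
  (forall r, s < r < t -> tsum (f' r) = 0) ->
  dominated (f s) -> tsum (f t) = tsum (f s).
Proof.
move=> st fd fc fK fm ds; apply/eqP; rewrite -subr_eq0 -normr_le0.
rewrite -(mul0r (t - s)); apply: (@tsum_mvt_norm f f' s t K) => //.
by move=> r sr; rewrite fm// normr0.
Qed.

End WeightedSums.

(** * Energy estimates on a weighted graph *)

Section WeightedGraph.
Context {R : realType} {I : choiceType} (e : nat -> I) (ix : I -> nat).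
Context (nb : I -> seq I) (w : I -> I -> R) (a : I -> R) (k0 k2 : nat) (K0 K1 : R).

(** What the analysis retains of the cluster. [w_carre], the bound on the squared gradient of [a],
    is the form in which the growth condition enters the energy estimates; [w_total] only says that
    the Laplacian costs [k0] powers of [a], and [a_summable] that summation costs [k2]. *)
Record weighted_graph := WeightedGraph {
  eK : cancel e ix;
  ixK : cancel ix e;
  nb_uniq : forall x, uniq (nb x);
  nb_sym : forall x y, (y \in nb x) = (x \in nb y);
  w_ge0 : forall x y, 0 <= w x y;
  w_sym : forall x y, w x y = w y x;
  w_nb : forall x y, y \notin nb x -> w x y = 0;
  a_ge1 : forall x, 1 <= a x;
  a_nb : forall x y, y \in nb x -> a y <= 2 * a x;
  w_total : forall x, \sum_(y <- nb x) w x y <= K0 * a x ^ k0;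
  w_carre : forall x, \sum_(y <- nb x) w x y * (a x - a y) ^+ 2 <= K1;
  a_summable : cvgn (series (fun i => a (e i) ^ (- k2%:Z))) }.

Definition lap (u : I -> R) x := \sum_(y <- nb x) w x y * (u x - u y).

(** Growth and decay are measured pointwise by an integer order, negative for decay. Orders add
    under products, so the conditions for convergence become linear integer arithmetic. *)
Definition bnd M (z : int) (f : I -> R) := forall x, `|f x| <= M * a x ^ z.

Hypothesis G : weighted_graph.

Let q x := a x ^ (- k2%:Z).
Let S := @tsum R I e.

Lemma a_gt0 x : 0 < a x. Proof. exact: lt_le_trans ltr01 (a_ge1 G x). Qed.

Lemma az_gt0 x (z : int) : 0 < a x ^ z. Proof. by rewrite exprz_gt0// a_gt0. Qed.

Lemma az_le x (z z' : int) : z <= z' -> a x ^ z <= a x ^ z'.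
Proof. by move=> zz; apply: ler_weXz2l => //; exact: a_ge1. Qed.

Lemma azD x (z z' : int) : a x ^ (z + z') = a x ^ z * a x ^ z'.
Proof. by rewrite expfzDr// gt_eqF// a_gt0. Qed.

Lemma az_sqr x (z : int) : a x ^ (2%:Z * z) = (a x ^ z) ^+ 2.
Proof. by rewrite (_ : 2%:Z * z = z + z) ?azD ?expr2//; lia. Qed.

Lemma K0_ge0 : 0 <= K0.
Proof.
have := w_total G (e 0); have := az_gt0 (e 0) k0.
have : 0 <= \sum_(y <- nb (e 0)) w (e 0) y by apply: sumr_ge0 => y _; exact: (w_ge0 G).
move=> h1 h2 h3; have := le_trans h1 h3.
by rewrite pmulr_lge0.
Qed.

Lemma bnd_ge0 M z f : bnd M z f -> 0 <= M.
Proof.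
move=> /(_ (e 0)) h; have := le_trans (normr_ge0 _) h.
by rewrite pmulr_lge0// az_gt0.
Qed.

Lemma bnd_le M z f M' z' : M <= M' -> z <= z' -> bnd M z f -> bnd M' z' f.
Proof.
move=> MM zz H x; have M0 := bnd_ge0 H.
apply: (le_trans (H x)); apply: ler_pM => //; [exact: ltW (az_gt0 _ _)|exact: az_le].
Qed.

Lemma bndD M N z f g : bnd M z f -> bnd N z g -> bnd (M + N) z (fun x => f x + g x).
Proof. by move=> F H x; rewrite (le_trans (ler_normD _ _))// mulrDl lerD. Qed.

Lemma bndN M z f : bnd M z f -> bnd M z (fun x => - f x).
Proof. by move=> F x; rewrite normrN. Qed.

Lemma bndB M N z f g : bnd M z f -> bnd N z g -> bnd (M + N) z (fun x => f x - g x).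
Proof. by move=> F H; apply: bndD => //; exact: bndN. Qed.

Lemma bndM M N z z' f g : bnd M z f -> bnd N z' g ->
  bnd (M * N) (z + z') (fun x => f x * g x).
Proof. by move=> F H x; rewrite normrM azD mulrACA; apply: ler_pM. Qed.

Lemma bndZ c M z f : bnd M z f -> bnd (`|c| * M) z (fun x => c * f x).
Proof. by move=> F x; rewrite normrM -mulrA; apply: ler_wpM2l. Qed.

Lemma bnd_dominated M z f : z <= - k2%:Z -> bnd M z f -> forall x, `|f x| <= M * q x.
Proof. by move=> zk F; exact: (bnd_le (lexx M) zk F). Qed.

Lemma bnd_dom M z f : z <= - k2%:Z -> bnd M z f -> dominated q f.
Proof. by move=> zk F; exists M; exact: bnd_dominated F. Qed.

Lemma q_gt0 x : 0 < q x. Proof. exact: az_gt0. Qed.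
Lemma q_cvg : cvgn (series (fun i => q (e i))). Proof. exact: (a_summable G). Qed.
Hint Resolve q_gt0 q_cvg : core.

Lemma a_nbz x y (z : int) : y \in nb x -> a y ^ z <= 2 ^+ `|z|%N * a x ^ z.
Proof.
move=> yx; have xy : x \in nb y by rewrite (nb_sym G).
have ax := a_gt0 x; have ay := a_gt0 y.
case: z => n.
  rewrite absz_nat -!exprnP -exprMn; apply: lerXn2r; last exact: (a_nb G).
    by rewrite nnegrE ltW.
  by rewrite nnegrE mulr_ge0// ltW.
rewrite NegzE abszN absz_nat -!exprnN -!exprVn -exprMn.
apply: lerXn2r.
- by rewrite nnegrE invr_ge0 ltW.
- by rewrite nnegrE mulr_ge0// invr_ge0 ltW.
by rewrite -[leLHS]mul1r ler_pdivrMr// mulrAC ler_pdivlMr// mul1r; exact: (a_nb G).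
Qed.

Definition lapC (z : int) : R := K0 * (1 + 2 ^+ `|z|%N).

Lemma bnd_lap M z f : bnd M z f -> bnd (lapC z * M) (k0%:Z + z) (lap f).
Proof.
move=> F x; have M0 := bnd_ge0 F; have az := az_gt0 x z.
apply: (@le_trans _ _ (\sum_(y <- nb x) w x y * ((1 + 2 ^+ `|z|%N) * M * a x ^ z))).
  rewrite (le_trans (ler_norm_sum _ _ _))// [leLHS]big_seq [leRHS]big_seq.
  apply: ler_sum => y yx; rewrite normrM (ger0_norm (w_ge0 G _ _)).
  apply: ler_wpM2l; first exact: (w_ge0 G).
  rewrite (le_trans (ler_normB _ _))// mulrDl mul1r mulrDl lerD// (le_trans (F y))//.
  by rewrite -mulrA mulrCA ler_wpM2l// a_nbz.
rewrite -mulr_suml azD (le_trans (ler_wpM2r _ (w_total G x)))//.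
  by rewrite !mulr_ge0// ?addr_ge0 ?exprn_ge0// ltW.
by rewrite /lapC le_eqVlt; apply/orP; left; apply/eqP; ring.
Qed.

Lemma lapD f g x : lap (fun y => f y + g y) x = lap f x + lap g x.
Proof. by rewrite /lap -big_split; apply: eq_bigr => y _ /=; ring. Qed.

Lemma lapZ c f x : lap (fun y => c * f y) x = c * lap f x.
Proof. by rewrite /lap mulr_sumr; apply: eq_bigr => y _ /=; ring. Qed.

Lemma lapB f g x : lap (fun y => f y - g y) x = lap f x - lap g x.
Proof. by rewrite /lap -sumrB; apply: eq_bigr => y _ /=; ring. Qed.

Lemma sum_nb_truncated (h : I -> R) x n :
  \sum_(y <- nb x | (ix y < n)%N) h y = \sum_(j < n) (if e j \in nb x then h (e j) else 0).
Proof.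
rewrite -big_mkcond -(big_mkord (fun j => e j \in nb x) (fun j => h (e j))).
rewrite -[LHS]big_filter -[RHS]big_filter -(big_map e xpredT h).
apply: perm_big; apply: uniq_perm.
- by rewrite filter_uniq// (nb_uniq G).
- by rewrite (map_inj_uniq (can_inj (eK G))) filter_uniq// iota_uniq.
move=> y; rewrite mem_filter; apply/andP/mapP.
- move=> [yn yx]; exists (ix y); last by rewrite (ixK G).
  by rewrite mem_filter (ixK G) yx mem_index_iota.
- move=> [j]; rewrite mem_filter mem_index_iota => /andP[jx /andP[_ jn]] ->.
  by rewrite (eK G).
Qed.

(** Symmetrisation over ordered edges: the two endpoints are exchanged in the finite double sum over
    the first [n] sites, where every pair contributes a nonnegative term, and [tannery] carries the
    sign to the limit. *)
Lemma nb_sum_ge0 (F : I -> I -> R) K :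
  (forall x, \sum_(y <- nb x) w x y * `|F x y| <= K * q x) ->
  (forall x y, y \in nb x -> 0 <= F x y + F y x) ->
  0 <= S (fun x => \sum_(y <- nb x) w x y * F x y).
Proof.
move=> FK Fge0.
pose T n x := if (ix x < n)%N then \sum_(y <- nb x | (ix y < n)%N) w x y * F x y else 0.
have TK n x : `|T n x| <= K * q x.
  apply: le_trans (FK x); rewrite /T; case: ifP => _; last first.
    by rewrite normr0 sumr_ge0// => y _; rewrite mulr_ge0// (w_ge0 G).
  rewrite (le_trans (ler_norm_sum _ _ _))// big_mkcond; apply: ler_sum => y _.
  by rewrite normrM (ger0_norm (w_ge0 G _ _)); case: ifP => // _; rewrite mulr_ge0// (w_ge0 G).
have Tc x : T ^~ x @ \oo --> \sum_(y <- nb x) w x y * F x y.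
  apply: cvg_near_cst; near=> n.
  have xn : (ix x < n)%N by near: n; exact: nbhs_infty_gt.
  rewrite /T xn big_seq_cond [RHS]big_seq; apply: eq_bigl => y.
  case yx : (y \in nb x) => //=.
  have : (\max_(z <- nb x) ix z < n)%N by near: n; exact: nbhs_infty_gt.
  by apply: leq_ltn_trans; apply: leq_bigmax_seq.
apply: (cvgr_to_ge (tannery q_gt0 q_cvg TK Tc)); apply: nearW => n.
rewrite (@tsum_finite _ _ _ _ n); last first.
  by move=> i ni; rewrite /T (eK G) ltnNge ni.
set s := (X in 0 <= X).
have -> : s = \sum_(i < n) \sum_(j < n) w (e i) (e j) * F (e i) (e j).
  apply: eq_bigr => i _; rewrite /T (eK G) ltn_ord sum_nb_truncated.
  by apply: eq_bigr => j _; case: ifPn => // h; rewrite (w_nb G h) mul0r.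
rewrite -(pmulr_rge0 _ (@ltr0Sn R 1)) mulrDl mul1r {1}exchange_big -big_split/=.
apply: sumr_ge0 => i _; rewrite -big_split sumr_ge0//= => j _.
case: (boolP (e j \in nb (e i))) => h; last first.
  by rewrite (w_sym G (e j)) (w_nb G h) !mul0r addr0.
by rewrite (w_sym G (e j)) -mulrDr mulr_ge0 ?(w_ge0 G)// addrC Fge0.
Unshelve. all: by end_near. Qed.

Lemma nb_sum_eq0 (F : I -> I -> R) K :
  (forall x, \sum_(y <- nb x) w x y * `|F x y| <= K * q x) ->
  (forall x y, y \in nb x -> F x y + F y x = 0) ->
  S (fun x => \sum_(y <- nb x) w x y * F x y) = 0.
Proof.
move=> FK F0; apply/eqP; rewrite eq_le; apply/andP; split; last first.
  by apply: (nb_sum_ge0 FK) => x y yx; rewrite F0.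
have d : dominated q (fun x => \sum_(y <- nb x) w x y * F x y).
  exists K => x; apply: le_trans (FK x); rewrite (le_trans (ler_norm_sum _ _ _))//.
  by apply: ler_sum => y _; rewrite normrM (ger0_norm (w_ge0 G _ _)).
rewrite -oppr_ge0 /S -(tsumN q_gt0 q_cvg d).
rewrite (@eq_tsum _ _ _ _ (fun x => \sum_(y <- nb x) w x y * - F x y)).
  apply: (@nb_sum_ge0 (fun x y => - F x y) K).
    by move=> x; under eq_bigr do rewrite normrN.
  by move=> x y yx; rewrite -opprD F0// oppr0.
by move=> x; rewrite -sumrN; apply: eq_bigr => y _; rewrite mulrN.
Qed.

(** The difference of the two sides is an antisymmetric sum over edges. The margin [k0 + k2] in the
    orders pays for the Laplacian and for the summation. *)
Lemma lap_sym M N (z z' : int) u v : z + z' <= - (k2%:Z) - k0%:Z ->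
  bnd M z u -> bnd N z' v -> S (fun x => lap u x * v x) = S (fun x => u x * lap v x).
Proof.
move=> zz Hu Hv; have M0 := bnd_ge0 Hu; have N0 := bnd_ge0 Hv.
have d1 : dominated q (fun x => lap u x * v x).
  apply: bnd_dom (bndM (bnd_lap Hu) Hv); lia.
have d2 : dominated q (fun x => u x * lap v x).
  apply: bnd_dom (bndM Hu (bnd_lap Hv)); lia.
apply/eqP; rewrite -subr_eq0 /S -(tsumB q_gt0 q_cvg d1 d2); apply/eqP.
rewrite (@eq_tsum _ _ _ _ (fun x => \sum_(y <- nb x) w x y * (u x * v y - u y * v x))); last first.
  by move=> x; rewrite /lap mulr_suml mulr_sumr -sumrB; apply: eq_bigr => y _; ring.
apply: (@nb_sum_eq0 (fun x y => u x * v y - u y * v x) (K0 * (M * N * (2 ^+ `|z'|%N + 2 ^+ `|z|%N)))); last by move=> x y _; ring.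
move=> x.
apply: (@le_trans _ _ (\sum_(y <- nb x) w x y * (M * N * (2 ^+ `|z'|%N + 2 ^+ `|z|%N) * a x ^ (z + z')))).
  rewrite big_seq [leRHS]big_seq; apply: ler_sum => y yx; apply: ler_wpM2l; first exact: (w_ge0 G).
  have H1 : `|u x * v y| <= (M * a x ^ z) * (N * (2 ^+ `|z'|%N * a x ^ z')).
    rewrite normrM; apply: ler_pM => //; apply: (le_trans (Hv y)).
    by apply: ler_wpM2l => //; exact: a_nbz.
  have H2 : `|u y * v x| <= (M * (2 ^+ `|z|%N * a x ^ z)) * (N * a x ^ z').
    rewrite normrM; apply: ler_pM => //; apply: (le_trans (Hu y)).
    by apply: ler_wpM2l => //; exact: a_nbz.
  rewrite (le_trans (ler_normB _ _))// (le_trans (lerD H1 H2))// azD.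
  by rewrite le_eqVlt; apply/orP; left; apply/eqP; ring.
rewrite -mulr_suml (le_trans (ler_wpM2r _ (w_total G x)))//.
  by rewrite mulr_ge0 ?mulr_ge0// ?addr_ge0// ?exprn_ge0// ltW// az_gt0.
have -> : K0 * a x ^ k0 * (M * N * (2 ^+ `|z'|%N + 2 ^+ `|z|%N) * a x ^ (z + z')) =
   K0 * (M * N * (2 ^+ `|z'|%N + 2 ^+ `|z|%N)) * (a x ^ k0 * a x ^ (z + z')) by ring.
rewrite -azD; apply: ler_wpM2l.
  by rewrite mulr_ge0 ?K0_ge0// mulr_ge0 ?mulr_ge0// addr_ge0// exprn_ge0.
apply: az_le; lia.
Qed.

(** A symmetric bound for [|log a x - log a y|]. The weights whose relative increments it controls
    ([loglip]) are closed under products, inverses, powers and truncation, so one energy inequality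
    serves all the weights used below. *)
Definition gap x y : R := `|a x - a y| * ((a x)^-1 + (a y)^-1).

Definition loglip (c : R) (g : I -> R) := (forall x, 0 < g x) /\
  forall x y, y \in nb x -> `|g x - g y| <= c * gap x y * g x.

Lemma gap_sym x y : gap x y = gap y x.
Proof. by rewrite /gap distrC [X in _ * X]addrC. Qed.

Lemma gap_ge0 x y : 0 <= gap x y.
Proof. by rewrite mulr_ge0// addr_ge0// invr_ge0 ltW// a_gt0. Qed.

Lemma gap_le2 x y : y \in nb x -> gap x y <= 2.
Proof.
move=> yx; have xy : x \in nb y by rewrite (nb_sym G).
have ax := a_gt0 x; have ay := a_gt0 y.
have h1 := a_nb G yx; have h2 := a_nb G xy.
have d1 : `|a x - a y| <= a x by rewrite ler_norml; apply/andP; split; lra.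
have d2 : `|a x - a y| <= a y by rewrite ler_norml; apply/andP; split; lra.
rewrite /gap mulrDr (_ : 2 = 1 + 1)//; apply: lerD; by rewrite ler_pdivrMr// mul1r.
Qed.

Lemma loglip_nb c g x y : 0 <= c -> loglip c g -> y \in nb x -> g y <= (1 + 2 * c) * g x.
Proof.
move=> c0 [g0 gl] yx; have gx := g0 x.
have H : c * gap x y * g x <= c * 2 * g x.
  by apply: ler_wpM2r; [exact: ltW|apply: ler_wpM2l => //; exact: gap_le2].
by have := gl x y yx; rewrite ler_norml => /andP[]; lra.
Qed.

Lemma loglipM c c' g h : 0 <= c -> 0 <= c' -> loglip c g -> loglip c' h ->
  loglip (c + (1 + 2 * c) * c') (fun x => g x * h x).
Proof.
move=> c0 c0' Lg Lh; split=> [x|x y yx]; first by rewrite mulr_gt0 ?Lg.1 ?Lh.1.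
have gx := Lg.1 x; have hx := Lh.1 x; have gy := Lg.1 y.
have -> : g x * h x - g y * h y = (g x - g y) * h x + g y * (h x - h y) by ring.
rewrite (le_trans (ler_normD _ _))// !normrM (gtr0_norm hx) (gtr0_norm gy).
have -> : (c + (1 + 2 * c) * c') * gap x y * (g x * h x) =
  (c * gap x y * g x) * h x + ((1 + 2 * c) * g x) * (c' * gap x y * h x) by ring.
apply: lerD; first by apply: ler_wpM2r; [exact: ltW|exact: Lg.2].
by apply: ler_pM => //; [exact: ltW|exact: loglip_nb|exact: Lh.2].
Qed.

Lemma loglipV c g : loglip c g -> loglip c (fun x => (g x)^-1).
Proof.
move=> [g0 gl]; split=> [x|x y yx]; first by rewrite invr_gt0.
have gx := g0 x; have gy := g0 y.
have -> : (g x)^-1 - (g y)^-1 = (g y - g x) / (g x * g y) by field; rewrite !gt_eqF.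
rewrite normrM normfV (gtr0_norm (mulr_gt0 gx gy)) ler_pdivrMr ?mulr_gt0//.
have -> : c * gap x y / g x * (g x * g y) = c * gap x y * g y by field; rewrite gt_eqF.
by rewrite gap_sym; apply: gl; rewrite (nb_sym G).
Qed.

Lemma loglip1 : loglip 0 (fun=> 1).
Proof. by split=> // x y _; rewrite subrr normr0 !mul0r. Qed.

Fixpoint powC (c : R) (n : nat) : R := if n is n'.+1 then c + (1 + 2 * c) * powC c n' else 0.

Lemma powC_ge0 c n : 0 <= c -> 0 <= powC c n.
Proof. by move=> c0; elim: n => //= n IH; rewrite addr_ge0// mulr_ge0// addr_ge0// mulr_ge0. Qed.

Lemma loglipX c g n : 0 <= c -> loglip c g -> loglip (powC c n) (fun x => g x ^+ n).
Proof.
move=> c0 Lg; elim: n => [|n IH] /=.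
  by under eq_fun do rewrite expr0; exact: loglip1.
by under eq_fun do rewrite exprS; apply: loglipM => //; exact: powC_ge0.
Qed.

Lemma loglip_a : loglip 1 a.
Proof.
split=> [|x y yx]; first exact: a_gt0.
have ax := a_gt0 x; have ay := a_gt0 y.
rewrite mul1r /gap -mulrA ler_peMr// mulrDl mulVf ?gt_eqF// lerDl mulr_ge0 ?invr_ge0 ?ltW//.
Qed.

(** What matters is that the constant does not depend on [L]: estimates for the truncated weight
    then survive the removal of the truncation. *)
Lemma loglip_min L : 0 < L -> loglip 1 (fun x => Num.min (a x) L).
Proof.
move=> L0; split=> [x|x y yx]; first by rewrite lt_min a_gt0 L0.
have ax := a_gt0 x; have ay := a_gt0 y.
have H : `|a x - a y| <= gap x y * a x by have := loglip_a.2 x y yx; rewrite mul1r.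
have g0 := gap_ge0 x y.
rewrite mul1r /Num.min; case: ltP => xL; case: ltP => yL.
- exact: H.
- apply: le_trans H; rewrite ler_norml; apply/andP; split; last first.
    have := normr_ge0 (a x - a y); lra.
  by have := ler_norm (- (a x - a y)); rewrite normrN; lra.
(* The relative loss [1 - a y / L] only grows when [L] is replaced by the larger [a x]. *)
- have -> : `|L - a y| = L * (1 - a y / L).
    by rewrite mulrBr mulr1 mulrCA divff ?mulr1 ?gt_eqF// gtr0_norm// subr_gt0.
  rewrite mulrC; apply: ler_wpM2r; first exact: ltW.
  apply: (@le_trans _ _ (1 - a y / a x)).
    by rewrite lerD2l lerN2 ler_wpM2l ?(ltW ay)// lef_pV2.
  have -> : 1 - a y / a x = (a x - a y) / a x by field; rewrite gt_eqF.
  rewrite ler_pdivrMr//; exact: le_trans (ler_norm _) H.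
- by rewrite subrr normr0 mulr_ge0// ltW.
Qed.

(** Neighbouring weights differ by a factor at most 2, so the sum of the inverses in [gap] is at
    most [3 / a x], whence the 9. The factor [a x ^ -2] gained here makes the growth in
    [flow_growth] polynomial. *)
Lemma sum_w_gap2 x : \sum_(y <- nb x) w x y * gap x y ^+ 2 <= 9 * K1 * (a x)^-1 ^+ 2.
Proof.
have ax := a_gt0 x.
apply: (@le_trans _ _ (\sum_(y <- nb x) w x y * (a x - a y) ^+ 2 * (9 * (a x)^-1 ^+ 2))).
  rewrite big_seq [leRHS]big_seq; apply: ler_sum => y yx.
  rewrite -mulrA; apply: ler_wpM2l; first exact: (w_ge0 G).
  have ay := a_gt0 y; have xy : x \in nb y by rewrite (nb_sym G).
  rewrite /gap exprMn real_normK ?num_real//; apply: ler_wpM2l; first exact: sqr_ge0.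
  have -> : 9 * (a x)^-1 ^+ 2 = (3 * (a x)^-1) ^+ 2 :> R by ring.
  apply: lerXn2r; rewrite ?nnegrE ?addr_ge0 ?mulr_ge0 ?invr_ge0 ?(ltW ax) ?(ltW ay)//.
  have : (a y)^-1 <= 2 * (a x)^-1.
    by rewrite -[leLHS]mul1r ler_pdivrMr// mulrAC ler_pdivlMr// mul1r; exact: (a_nb G).
  lra.
rewrite -mulr_suml mulrC mulrAC; apply: ler_wpM2r; first exact: sqr_ge0.
by apply: ler_wpM2l => //; exact: (w_carre G).
Qed.

(* Integrating [u] against its weighted Laplacian by parts, the cross term is controlled by the carre du champ of the logarithm of the weight. *)
Lemma energy c g M (z : int) u : 0 <= c -> loglip c g -> 2%:Z * z <= - k2%:Z - k0%:Z ->
  bnd M z (fun x => g x * u x) ->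
  - 2 * S (fun x => g x ^+ 2 * u x * lap u x) <=
  c ^+ 2 * (9 * K1) * S (fun x => (a x)^-1 ^+ 2 * (g x * u x) ^+ 2).
Proof.
move=> c0 Lg zk Hu; have M0 := bnd_ge0 Hu.
have gM x y : y \in nb x -> g x * `|u y| <= (1 + 2 * c) * (M * 2 ^+ `|z|%N * a x ^ z).
  move=> yx; have xy : x \in nb y by rewrite (nb_sym G).
  have gy := Lg.1 y.
  apply: (@le_trans _ _ ((1 + 2 * c) * (g y * `|u y|))).
    by rewrite mulrA ler_wpM2r//; exact: loglip_nb.
  rewrite ler_wpM2l ?addr_ge0 ?mulr_ge0//.
  have := Hu y; rewrite normrM (gtr0_norm gy) => /le_trans; apply.
  by rewrite -mulrA ler_wpM2l// a_nbz.
have gMx x : g x * `|u x| <= M * a x ^ z.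
  by have := Hu x; rewrite normrM (gtr0_norm (Lg.1 x)).
(* The inequality is distributed over oriented edges: [F x y + F y x] is the square of
   [g x * u x - g y * u y] plus a remainder that [e4] shows to be nonnegative. *)
pose F x y := g x ^+ 2 * u x * (u x - u y) + 2^-1 * c ^+ 2 * gap x y ^+ 2 * (g x * u x) ^+ 2.
pose C := M * (M + (1 + 2 * c) * (M * 2 ^+ `|z|%N)) + 2 * c ^+ 2 * M ^+ 2.
have C0 : 0 <= C by rewrite addr_ge0 ?mulr_ge0 ?addr_ge0 ?exprn_ge0 ?mulr_ge0 ?addr_ge0 ?exprn_ge0 ?mulr_ge0.
have FC x y : y \in nb x -> `|F x y| <= C * a x ^ (2%:Z * z).
  move=> yx; have gx := Lg.1 x; have az := az_gt0 x z.
  have -> : a x ^ (2%:Z * z) = (a x ^ z) ^+ 2 by rewrite az_sqr.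
  have -> : F x y = (g x * u x) * (g x * u x - g x * u y) + 2^-1 * c ^+ 2 * gap x y ^+ 2 * (g x * u x) ^+ 2.
    by rewrite /F; ring.
  rewrite (le_trans (ler_normD _ _))// /C mulrDl lerD//.
    rewrite normrM.
    have -> : M * (M + (1 + 2 * c) * (M * 2 ^+ `|z|%N)) * (a x ^ z) ^+ 2 =
      (M * a x ^ z) * (M * a x ^ z + (1 + 2 * c) * (M * 2 ^+ `|z|%N * a x ^ z)) by ring.
    apply: ler_pM => //; rewrite (le_trans (ler_normB _ _))// lerD//.
    by rewrite normrM (gtr0_norm gx); exact: gM.
  have h0 : 0 <= 2^-1 * c ^+ 2 by apply: mulr_ge0 => //; exact: sqr_ge0.
  have h1 : 0 <= 2^-1 * c ^+ 2 * gap x y ^+ 2 by apply: mulr_ge0 => //; exact: sqr_ge0.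
  rewrite normrM [X in _ * X](ger0_norm (sqr_ge0 _)) (ger0_norm h1).
  have -> : 2 * c ^+ 2 * M ^+ 2 * (a x ^ z) ^+ 2 = (2^-1 * c ^+ 2 * 2 ^+ 2) * (M * a x ^ z) ^+ 2 by field.
  apply: ler_pM => //; first exact: sqr_ge0.
    apply: ler_wpM2l => //.
    by apply: lerXn2r; rewrite ?nnegrE ?gap_ge0//; exact: gap_le2.
  by rewrite -real_normK ?num_real//; apply: lerXn2r; rewrite ?nnegrE// (le_trans _ (Hu x)).
have Fsum : 0 <= S (fun x => \sum_(y <- nb x) w x y * F x y).
  apply: (@nb_sum_ge0 F (K0 * C)).
    move=> x; apply: (@le_trans _ _ (\sum_(y <- nb x) w x y * (C * a x ^ (2%:Z * z)))).
      rewrite big_seq [leRHS]big_seq; apply: ler_sum => y yx.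
      by apply: ler_wpM2l; [exact: (w_ge0 G)|exact: FC].
    rewrite -mulr_suml (le_trans (ler_wpM2r _ (w_total G x)))//.
      by rewrite mulr_ge0// ltW// az_gt0.
    rewrite mulrACA -azD; apply: ler_wpM2l; first by rewrite mulr_ge0// K0_ge0.
    apply: az_le; lia.
  move=> x y yx; rewrite /F gap_sym.
  have gx := Lg.1 x; have gy := Lg.1 y; have xy : x \in nb y by rewrite (nb_sym G).
  set d := gap y x.
  have d0 : 0 <= d by exact: gap_ge0.
  have e1 : `|g x - g y| <= c * d * g x by rewrite /d gap_sym; exact: Lg.2.
  have e2 : `|g x - g y| <= c * d * g y by rewrite distrC; exact: Lg.2.
  have e3 : (g x - g y) ^+ 2 <= (c * d) ^+ 2 * (g x * g y).
    rewrite -real_normK ?num_real//.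
    have -> : (c * d) ^+ 2 * (g x * g y) = (c * d * g x) * (c * d * g y) by ring.
    by rewrite expr2; apply: ler_pM.
  have e4 : `|(g x - g y) ^+ 2 * (u x * u y)| <= 2^-1 * (c * d) ^+ 2 * ((g x * u x) ^+ 2 + (g y * u y) ^+ 2).
    rewrite normrM ger0_norm ?sqr_ge0//.
    apply: (@le_trans _ _ ((c * d) ^+ 2 * (g x * g y) * `|u x * u y|)); first by apply: ler_wpM2r.
    rewrite normrM.
    have -> : (c * d) ^+ 2 * (g x * g y) * (`|u x| * `|u y|) = 2^-1 * (c * d) ^+ 2 * (2 * (g x * `|u x|) * (g y * `|u y|)) by field.
    apply: ler_wpM2l; first by rewrite mulr_ge0 ?sqr_ge0.
    have -> : (g x * u x) ^+ 2 = (g x * `|u x|) ^+ 2 by rewrite !exprMn real_normK ?num_real.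
    have -> : (g y * u y) ^+ 2 = (g y * `|u y|) ^+ 2 by rewrite !exprMn real_normK ?num_real.
    have := sqr_ge0 (g x * `|u x| - g y * `|u y|); lra.
  have e5 := sqr_ge0 (g x * u x - g y * u y).
  set E := (X in 0 <= X).
  have -> : E = (g x * u x - g y * u y) ^+ 2 + (2^-1 * (c * d) ^+ 2 * ((g x * u x) ^+ 2 + (g y * u y) ^+ 2)
     - (g x - g y) ^+ 2 * (u x * u y)) by rewrite /E; ring.
  by rewrite addr_ge0// subr_ge0 (le_trans (ler_norm _)).
have d1 : dominated q (fun x => g x ^+ 2 * u x * lap u x + 2^-1 * c ^+ 2 * \sum_(y <- nb x) w x y * (gap x y ^+ 2 * (g x * u x) ^+ 2)).
  exists (K0 * C) => x.
  have -> : g x ^+ 2 * u x * lap u x + 2^-1 * c ^+ 2 * \sum_(y <- nb x) w x y * (gap x y ^+ 2 * (g x * u x) ^+ 2) = \sum_(y <- nb x) w x y * F x y.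
    by rewrite /lap !mulr_sumr -big_split; apply: eq_bigr => y _ /=; rewrite /F; ring.
  apply: (@le_trans _ _ (\sum_(y <- nb x) w x y * (C * a x ^ (2%:Z * z)))).
    rewrite (le_trans (ler_norm_sum _ _ _))// big_seq [leRHS]big_seq; apply: ler_sum => y yx.
    rewrite normrM (ger0_norm (w_ge0 G _ _)); apply: ler_wpM2l; [exact: (w_ge0 G)|exact: FC].
  rewrite -mulr_suml (le_trans (ler_wpM2r _ (w_total G x)))//.
    by rewrite mulr_ge0// ltW// az_gt0.
  rewrite mulrACA -azD; apply: ler_wpM2l; first by rewrite mulr_ge0// K0_ge0.
  apply: az_le; lia.
have gu2 x : (g x * u x) ^+ 2 <= M ^+ 2 * a x ^ (2%:Z * z).
  have -> : a x ^ (2%:Z * z) = (a x ^ z) ^+ 2 by rewrite az_sqr.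
  rewrite -exprMn -real_normK ?num_real//; apply: lerXn2r; rewrite ?nnegrE//.
  by rewrite (le_trans _ (Hu x)).
have K1_ge0 : 0 <= K1.
  apply: le_trans (w_carre G (e 0)); apply: sumr_ge0 => y _.
  by rewrite mulr_ge0 ?sqr_ge0 ?(w_ge0 G).
have hs x : \sum_(y <- nb x) w x y * (gap x y ^+ 2 * (g x * u x) ^+ 2) <=
    9 * K1 * ((a x)^-1 ^+ 2 * (g x * u x) ^+ 2).
  under eq_bigr do rewrite mulrA.
  by rewrite -mulr_suml [leRHS]mulrA; apply: ler_wpM2r; [exact: sqr_ge0|exact: sum_w_gap2].
have hs0 x : 0 <= \sum_(y <- nb x) w x y * (gap x y ^+ 2 * (g x * u x) ^+ 2).
  by apply: sumr_ge0 => y _; rewrite mulr_ge0 ?(w_ge0 G)// mulr_ge0 ?sqr_ge0.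
have d3 : dominated q (fun x => (a x)^-1 ^+ 2 * (g x * u x) ^+ 2).
  exists (M ^+ 2) => x; rewrite ger0_norm; last by apply: mulr_ge0; exact: sqr_ge0.
  apply: (@le_trans _ _ (1 * (M ^+ 2 * a x ^ (2%:Z * z)))).
    apply: ler_pM => //; [exact: sqr_ge0|exact: sqr_ge0|apply: exprn_ile1].
      by rewrite invr_ge0 ltW// a_gt0.
    by rewrite invf_le1 ?a_gt0//; exact: (a_ge1 G).
  rewrite mul1r; apply: ler_wpM2l; [exact: sqr_ge0|apply: az_le; lia].
have d2 : dominated q (fun x => \sum_(y <- nb x) w x y * (gap x y ^+ 2 * (g x * u x) ^+ 2)).
  apply: (dominated_le (dominatedZ (9 * K1) d3)) => x; rewrite ger0_norm//.
  exact: le_trans (hs x) (ler_norm _).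
have d4 : dominated q (fun x => g x ^+ 2 * u x * lap u x).
  have := dominatedB d1 (dominatedZ (2^-1 * c ^+ 2) d2).
  by under eq_fun do rewrite addrK.
move: Fsum; rewrite /S (@eq_tsum _ _ _ _ (fun x => g x ^+ 2 * u x * lap u x + 2^-1 * c ^+ 2 * \sum_(y <- nb x) w x y * (gap x y ^+ 2 * (g x * u x) ^+ 2))); last first.
  move=> x; rewrite /lap !mulr_sumr -big_split; apply: eq_bigr => y _ /=; rewrite /F; ring.
rewrite (tsumD q_gt0 q_cvg)//; last exact: dominatedZ.
rewrite (tsumZ q_gt0 q_cvg)// => Fsum.
have : tsum e (fun x => \sum_(y <- nb x) w x y * (gap x y ^+ 2 * (g x * u x) ^+ 2)) <=
   9 * K1 * tsum e (fun x => (a x)^-1 ^+ 2 * (g x * u x) ^+ 2).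
  rewrite -(tsumZ q_gt0 q_cvg)//; apply: (ler_tsum q_gt0 q_cvg) => //; exact: dominatedZ.
move=> /(ler_wpM2l (sqr_ge0 c)); rewrite mulrA; lra.
Qed.

End WeightedGraph.

(** * Uniqueness and propagation of decay for the heat equation *)

Section HeatFlow.
Context {R : realType} {I : choiceType} (e : nat -> I) (ix : I -> nat).
Context (nb : I -> seq I) (w : I -> I -> R) (a : I -> R) (k0 k2 : nat) (K0 K1 : R).
Hypothesis G : weighted_graph e ix nb w a k0 k2 K0 K1.

Let q x := a x ^ (- k2%:Z).
Local Notation S := (@tsum R I e).
Local Notation lap := (lap nb w).
Local Notation bnd := (bnd a).
Let q0 : forall x, 0 < q x := q_gt0 G.
Let cq : cvgn (series (fun i => q (e i))) := q_cvg G.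

Definition heat (D : R -> I -> R) :=
  (forall r : R, 0 < r -> forall x, is_derive r (1 : R) (D ^~ x) (- lap (D r) x)) /\
  (forall (t : R) x, {within `[0, t], continuous (D ^~ x)}).

(** The uniqueness class. The order [z] is the same at all times because the decaying weight of the
    energy estimate is chosen from it once and for all. *)
Definition slow (D : R -> I -> R) := exists z : int,
  forall T, exists M, forall t, 0 <= t <= T -> bnd M z (D t).

Definition rapid (f : I -> R) := forall z : int, exists M, bnd M z f.
Definition moderate (f : I -> R) := exists (z : int) M, bnd M z f.

Definition fast (D : R -> I -> R) := forall (z : int) T,
  exists M, forall t, 0 <= t <= T -> bnd M z (D t).

Lemma within_sub (f : R -> R) s t : 0 <= s ->
  {within `[0, t], continuous f} -> {within `[s, t], continuous f}.
Proof.
move=> s0; apply: continuous_subspaceW => r /=; rewrite !in_itv /= => /andP[sr ->].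
by rewrite (le_trans s0 sr).
Qed.

Lemma bnd_mul_lap c g M (z : int) u : 0 <= c -> loglip nb a c g -> bnd M z (fun x => g x * u x) ->
  bnd (K0 * (M + (1 + 2 * c) * (M * 2 ^+ `|z|%N))) (k0%:Z + z) (fun x => g x * lap u x).
Proof.
move=> c0 Lg Hu x; have M0 := bnd_ge0 G Hu; have gx := Lg.1 x.
have az := az_gt0 G x z.
rewrite /lap mulr_sumr.
apply: (@le_trans _ _ (\sum_(y <- nb x) w x y * ((M + (1 + 2 * c) * (M * 2 ^+ `|z|%N)) * a x ^ z))).
  rewrite (le_trans (ler_norm_sum _ _ _))// big_seq [leRHS]big_seq; apply: ler_sum => y yx.
  rewrite mulrCA normrM (ger0_norm (w_ge0 G _ _)); apply: ler_wpM2l; first exact: (w_ge0 G).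
  rewrite mulrBr (le_trans (ler_normB _ _))// mulrDl lerD//.
  have xy : x \in nb y by rewrite (nb_sym G).
  have gy := Lg.1 y.
  rewrite normrM (gtr0_norm gx); apply: (@le_trans _ _ ((1 + 2 * c) * (g y * `|u y|))).
    by rewrite mulrA; apply: ler_wpM2r => //; exact: (loglip_nb G).
  rewrite -[leRHS]mulrA; apply: ler_wpM2l; first by rewrite addr_ge0// mulr_ge0.
  have := Hu y; rewrite normrM (gtr0_norm gy) => /le_trans; apply.
  by rewrite -mulrA; apply: ler_wpM2l => //; exact: (a_nbz G).
have C0 : 0 <= M + (1 + 2 * c) * (M * 2 ^+ `|z|%N).
  by rewrite addr_ge0// mulr_ge0 ?addr_ge0 ?mulr_ge0// exprn_ge0.
rewrite -mulr_suml (le_trans (ler_wpM2r _ (w_total G x)))//; first by apply: mulr_ge0 => //; exact: ltW.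
by rewrite (azD G) le_eqVlt; apply/orP; left; apply/eqP; ring.
Qed.

Lemma bnd_sqr M (z : int) u : 2%:Z * z <= - k2%:Z -> bnd M z u ->
  forall x, `|u x ^+ 2| <= M ^+ 2 * q x.
Proof.
move=> zk Hu x; have M0 := bnd_ge0 G Hu.
rewrite normrX (@le_trans _ _ ((M * a x ^ z) ^+ 2))//.
  by apply: lerXn2r => //; rewrite nnegrE// (le_trans _ (Hu x)).
rewrite exprMn -(az_sqr G); apply: ler_wpM2l; first exact: sqr_ge0.
exact: (az_le G).
Qed.

Lemma dominated_sqr M (z : int) u : 2%:Z * z <= - k2%:Z -> bnd M z u ->
  dominated q (fun x => u x ^+ 2).
Proof. by move=> zk Hu; exists (M ^+ 2) => x; exact: bnd_sqr zk Hu x. Qed.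

Lemma energy_growth D c g M (z : int) (s t m : R) : 0 <= c -> loglip nb a c g ->
  2%:Z * z <= - k2%:Z - k0%:Z -> heat D -> 0 <= s -> s <= t ->
  (forall r, s <= r <= t -> bnd M z (fun x => g x * D r x)) ->
  (forall r, s < r < t ->
    c ^+ 2 * (9 * K1) * S (fun x => (a x)^-1 ^+ 2 * (g x * D r x) ^+ 2) <= m) ->
  S (fun x => (g x * D t x) ^+ 2) - S (fun x => (g x * D s x) ^+ 2) <= m * (t - s).
Proof.
move=> c0 Lg zk [Dd Dc] s0 st DM Dm.
pose f r x := (g x * D r x) ^+ 2.
pose f' r x := - 2 * (g x ^+ 2 * D r x * lap (D r) x).
have MM : bnd M z (fun x => g x * D s x) by apply: DM; rewrite lexx.
have M0 := bnd_ge0 G MM.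
pose N := K0 * (M + (1 + 2 * c) * (M * 2 ^+ `|z|%N)).
have fN r : s <= r <= t -> forall x, `|g x ^+ 2 * D r x * lap (D r) x| <= M * N * q x.
  move=> sr; apply: (bnd_dominated G (z := z + (k0%:Z + z))); first by lia.
  have := bndM G (DM r sr) (bnd_mul_lap c0 Lg (DM r sr)).
  by move=> H x; have := H x; rewrite (_ : g x * D r x * _ = g x ^+ 2 * D r x * lap (D r) x)//; ring.
have [|||||_] := @tsum_mvt _ _ e q q0 cq f f' s t (2 * (M * N)) m st.
- move=> r /andP[sr rt] x; rewrite /f /f'.
  have H := Dd r (le_lt_trans s0 sr) x.
  have -> : - 2 * (g x ^+ 2 * D r x * lap (D r) x) = (g x ^+ 2) *: (2 *: (D r x) *: (- lap (D r) x)) :> R.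
    rewrite /GRing.scale /=; ring.
  rewrite (_ : (fun _ => _) = (g x ^+ 2) *: (D ^~ x) ^+ 2); last first.
    by apply/funext => y; rewrite exprMn.
  by apply: is_deriveZ; apply: is_derive_eq.
- move=> x y; rewrite /f; apply: cvgM; apply: cvgM; (try exact: cvg_cst); exact: within_sub (Dc t x) y.
- move=> r /andP[sr rt] x; rewrite /f' normrM normrN (ger0_norm (ler0n _ 2)) -[leRHS]mulrA; apply: ler_wpM2l => //.
  by apply: fN; rewrite !ltW.
- move=> r sr; rewrite /f' (tsumZ q0 cq); last first.
    by exists (M * N) => x; apply: fN; case/andP: sr => *; rewrite !ltW.
  apply: (le_trans (energy G c0 Lg zk (DM r _))); first by case/andP: sr => *; rewrite !ltW.
  exact: Dm.
- rewrite /f; apply: dominated_sqr MM; lia.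
by [].
Qed.

Lemma K1_ge0 : 0 <= K1.
Proof.
apply: le_trans (w_carre G (e 0)); apply: sumr_ge0 => y _.
by apply: mulr_ge0; [exact: (w_ge0 G)|exact: sqr_ge0].
Qed.

(* The weight [min(a, L)^J a^-p] decays at infinity, so that the weighted energy of a moderate solution is finite, and equals [a^j] where [a <= L]; its logarithmic gradient is bounded independently of [L]. *)
Lemma heat_weighted_bound D j : heat D -> slow D ->
  dominated q (fun x => (a x ^+ j * D 0 x) ^+ 2) ->
  exists2 tau, 0 < tau & forall n t x, 0 <= t <= n%:R * tau ->
    (a x ^+ j * D t x) ^+ 2 <= 2 ^+ n * S (fun x => (a x ^+ j * D 0 x) ^+ 2).
Proof.
move=> hD [z0 Dz] d0.
(* Enough powers to bring a function of order [z0] to an order at which [energy] and the summation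
   of squares apply. *)
pose p := (`|z0|%N + k0 + k2)%N; pose z := z0 - p%:Z.
have [zk zk2] : 2%:Z * z <= - k2%:Z - k0%:Z /\ 2%:Z * z <= - k2%:Z.
  by rewrite /z /p; split; lia.
pose J := (j + p)%N.
pose c1 := powC (1 : R) J; pose c2 := powC (1 : R) p; pose c := c1 + (1 + 2 * c1) * c2.
have c10 : 0 <= c1 by exact: powC_ge0.
have c20 : 0 <= c2 by exact: powC_ge0.
have c0 : 0 <= c by rewrite addr_ge0// mulr_ge0// addr_ge0// mulr_ge0.
pose kappa := c ^+ 2 * (9 * K1).
have k0' : 0 <= kappa by apply: mulr_ge0; [exact: sqr_ge0|apply: mulr_ge0 => //; exact: K1_ge0].
(* Chosen so that [kappa * tau <= 1 / 2]: over a time [tau] the energy inequality returns at most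
   half of the bound fed into it. It does not involve the truncation level. *)
pose tau := (2 * (kappa + 1))^-1.
have tau0 : 0 < tau by rewrite invr_gt0 mulr_gt0// ltr_wpDl.
have ktau : kappa * tau <= 2^-1.
  rewrite /tau invfM mulrCA -[leRHS]mulr1; apply: ler_wpM2l => //.
  by rewrite ler_pdivrMr ?ltr_wpDl// mul1r lerDl.
exists tau => // n t x tn.
(* The truncation level is the weight of the site under consideration, where the truncated weight
   still equals [a x ^+ j]. *)
pose L := a x.
have L0 : 0 < L by exact: a_gt0 G x.
have L1 : 1 <= L by exact: (a_ge1 G).
pose g y := (Num.min (a y) L) ^+ J * (a y)^-1 ^+ p.
have Lg : loglip nb a c g.
  apply: (loglipM G) => //; apply: (loglipX G) => //; first exact: (loglip_min G).
  apply: (loglipV G); exact: (loglip_a G).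
have gle y : g y <= L ^+ J * a y ^ (- p%:Z).
  rewrite /g exprVn -exprnN; apply: ler_wpM2r; first by rewrite invr_ge0 exprn_ge0// ltW// (a_gt0 G).
  apply: lerXn2r; rewrite ?nnegrE ?(ltW L0)//; last by rewrite ge_min lexx orbT.
  by rewrite ltW// lt_min L0 (a_gt0 G).
have gle2 y : g y <= a y ^+ j.
  have ay := a_gt0 G y.
  apply: (@le_trans _ _ (a y ^+ J * (a y)^-1 ^+ p)).
    apply: ler_wpM2r; first by rewrite exprn_ge0// invr_ge0 ltW.
    apply: lerXn2r; rewrite ?nnegrE ?(ltW ay)//; last by rewrite ge_min lexx.
    by rewrite ltW// lt_min L0 ay.
  by rewrite /J exprD -mulrA -exprMn divff ?expr1n ?mulr1// gt_eqF.
have g0 y : 0 < g y := Lg.1 y.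
have gB r M : bnd M z0 (D r) -> bnd (L ^+ J * M) z (fun y => g y * D r y).
  move=> H y; rewrite normrM (gtr0_norm (g0 y)) /z addrC (azD G) mulrACA.
  by apply: ler_pM => //; exact: ltW.
pose Y r := S (fun y => (g y * D r y) ^+ 2).
have Ydom r M : bnd M z0 (D r) -> dominated q (fun y => (g y * D r y) ^+ 2).
  by move=> /gB; exact: dominated_sqr zk2.
have half s r : 0 <= s -> s <= r <= s + tau -> Y r <= 2 * Y s.
  move=> s0 /andP[sr rs].
  have [M HM] := Dz r.
  have HM' v : s <= v <= r -> bnd M z0 (D v) by case/andP=> sv vr; apply: HM; rewrite (le_trans s0 sv).
  have Y0 v : s <= v <= r -> 0 <= Y v.
    by move=> /HM'/Ydom d; apply: (tsum_ge0 q0 cq) => // y; exact: sqr_ge0.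
  pose B := (L ^+ J * M) ^+ 2 * S q.
  have YB v : s <= v <= r -> Y v <= B.
    move=> /HM' /gB H; apply: le_trans (ler_norm _) _; apply: (ler_norm_tsum q0 cq) => y.
    exact: (bnd_sqr zk2 H).
  (* A bound [B'] improves to [Y s + B' / 2]. Iterating from the crude bound [B], which depends on
     [L], leaves [2 * Y s] with no trace of [B]. *)
  have step B' : (forall v, s <= v <= r -> Y v <= B') -> forall v, s <= v <= r -> Y v <= Y s + B' / 2.
    move=> H v /andP[sv vr].
    have := @energy_growth D c g (L ^+ J * M) z s v (kappa * B') c0 Lg zk hD s0 sv.
    rewrite -/(Y v) -/(Y s) -/kappa => E; have {}E : Y v - Y s <= kappa * B' * (v - s).
      apply: E => [u /andP[su uv]|u /andP[su uv]].
        by apply/gB/HM'; rewrite su (le_trans uv vr).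
      have su' : s <= u <= r by rewrite (ltW su) (le_trans (ltW uv) vr).
      apply: ler_wpM2l => //; apply: le_trans (H u su'); have d := Ydom _ _ (HM' u su').
      have le1 y : (a y)^-1 ^+ 2 * (g y * D u y) ^+ 2 <= (g y * D u y) ^+ 2.
        apply: ler_piMl; first exact: sqr_ge0.
        apply: exprn_ile1; first by rewrite invr_ge0 ltW// (a_gt0 G).
        by rewrite invf_le1 ?(a_gt0 G)//; exact: (a_ge1 G).
      apply: (ler_tsum q0 cq) => //; apply: (dominated_le d) => y.
      rewrite ger0_norm; last by apply: mulr_ge0; exact: sqr_ge0.
      by rewrite ger0_norm ?sqr_ge0.
    have B0 : 0 <= B' by apply: le_trans (H s _); [apply: Y0|]; rewrite lexx sr.
    have : kappa * B' * (v - s) <= B' / 2.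
      rewrite mulrAC mulrC; apply: ler_wpM2l => //; apply: le_trans ktau.
      by apply: ler_wpM2l => //; lra.
    lra.
  have iter k : forall v, s <= v <= r -> Y v <= 2 * Y s + B / 2 ^+ k.
    elim: k => [|k IH] v sv.
      by rewrite expr0 divr1 (le_trans (YB v sv))// lerDr mulr_ge0// Y0// lexx sr.
    have := step _ IH v sv; rewrite exprS invfM; lra.
  apply/ler_addgt0Pr => eps eps0.
  have h2 : `|2^-1 : R| < 1 by rewrite ger0_norm//; lra.
  have /cvgrPdist_le/(_ eps eps0)[k _ /(_ k (leqnn k))] /= := @cvg_geometric R B _ h2.
  rewrite sub0r normrN => H.
  have := iter k r; rewrite sr lexx => /(_ isT); rewrite -exprVn.
  have := ler_norm (B * 2^-1 ^+ k); lra.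
have Yn : forall n t, 0 <= t <= n%:R * tau -> Y t <= 2 ^+ n * Y 0.
  elim=> [|m IH] s.
    rewrite mul0r -eq_le => /eqP <-; by rewrite expr0 mul1r.
  move=> /andP[s0 sm]; case: (lerP s tau) => st.
    have := half 0 s (lexx 0); rewrite s0 add0r st => /(_ isT) H.
    have [M HM] := Dz 0.
    have Y0 : 0 <= Y 0.
      apply: (tsum_ge0 q0 cq); last by move=> y; exact: sqr_ge0.
      by apply: (Ydom 0 M); apply: HM; rewrite lexx.
    apply: (le_trans H); apply: ler_wpM2r => //.
    by rewrite exprS ler_peMr// exprn_ege1// ler1n.
  have := half (s - tau) s; rewrite subr_ge0 (ltW st) subrK lexx gerBl (ltW tau0) => /(_ isT isT) H.
  apply: (le_trans H); rewrite exprS -mulrA; apply: ler_wpM2l => //; apply: IH.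
  by rewrite subr_ge0 (ltW st)/= lerBlDr; move: sm; rewrite -natr1 mulrDl mul1r.
have [M HM] := Dz (Num.max t 0).
have dt : dominated q (fun y => (g y * D t y) ^+ 2).
  by apply: (Ydom _ M); apply: HM; case/andP: tn => -> _; rewrite le_max lexx.
apply: (@le_trans _ _ (Y t)).
  have -> : a x ^+ j = g x.
    by rewrite /g /L minxx /J exprD -mulrA -exprMn divff ?expr1n ?mulr1// gt_eqF.
  rewrite -[in leLHS](ixK G x).
  by apply: (ler_tsum_term q0 cq (ix x) dt) => y; exact: sqr_ge0.
apply: (le_trans (Yn n t tn)); apply: ler_wpM2l; first exact: exprn_ge0.
apply: (ler_tsum q0 cq) => //.
  by apply: (Ydom 0 M); apply: HM; rewrite lexx le_max lexx orbT.
move=> y; rewrite [leLHS]exprMn [leRHS]exprMn; apply: ler_wpM2r; first exact: sqr_ge0.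
by apply: lerXn2r; rewrite ?nnegrE ?(ltW (g0 _))// exprn_ge0// ltW// (a_gt0 G).
Qed.

(** The weighted bound with [j = 0]: zero initial energy remains zero through any number of
    doublings. *)
Lemma heat_unique D : heat D -> slow D -> (forall x, D 0 x = 0) ->
  forall t x, 0 <= t -> D t x = 0.
Proof.
move=> hD sD D0 t x t0.
have z0 y : (a y ^+ 0 * D 0 y) ^+ 2 = 0 by rewrite D0 mulr0 expr0n.
have [|tau tau0 H] := @heat_weighted_bound D 0 hD sD.
  by exists 0 => y; rewrite z0 normr0 mul0r.
have := H (Num.bound (t / tau)) t x.
have -> : 0 <= t <= (Num.bound (t / tau))%:R * tau.
  rewrite t0 -ler_pdivrMr//= ltW//.
  by have := archi_boundP (divr_ge0 t0 (ltW tau0)).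
rewrite (@eq_tsum _ _ e _ (fun=> 0))// tsum0 mulr0 expr0 mul1r => /(_ isT) h.
by apply/eqP; rewrite -sqrf_eq0 eq_le h sqr_ge0.
Qed.

Lemma heat_fast D : heat D -> slow D -> rapid (D 0) -> fast D.
Proof.
move=> hD sD rD z T.
pose j := `|z|%N.
have [M0 HM0] := rD (- (j + k2)%:Z).
have d0 : dominated q (fun x => (a x ^+ j * D 0 x) ^+ 2).
  apply: (@dominated_sqr M0 (- k2%:Z)); first by lia.
  move=> x; rewrite normrM ger0_norm ?exprn_ge0 ?(ltW (a_gt0 G x))//.
  have -> : M0 * a x ^ (- k2%:Z) = a x ^+ j * (M0 * a x ^ (- (j + k2)%:Z)).
    rewrite [RHS]mulrCA exprnP -(azD G); congr (_ * a x ^ _); lia.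
  by apply: ler_wpM2l => //; rewrite exprn_ge0// ltW// (a_gt0 G).
have [tau tau0 H] := heat_weighted_bound hD sD d0.
pose n := Num.bound (`|T| / tau).
pose B := 2 ^+ n * S (fun x => (a x ^+ j * D 0 x) ^+ 2).
exists (Num.sqrt B) => t /andP[t0 tT] x.
have ax := az_gt0 G x.
have Tn : 0 <= t <= n%:R * tau.
  rewrite t0 -ler_pdivrMr//= ltW//; apply: (@le_lt_trans _ _ (`|T| / tau)).
    by apply: ler_wpM2r; [rewrite invr_ge0 ltW|exact: le_trans tT (ler_norm _)].
  by apply: archi_boundP; rewrite divr_ge0// ltW.
have h := H n t x Tn.
have : a x ^+ j * `|D t x| <= Num.sqrt B.
  rewrite -(@ger0_norm _ (a x ^+ j)) ?exprn_ge0 ?(ltW (a_gt0 G x))// -normrM -sqrtr_sqr.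
  by apply: ler_wsqrtr.
rewrite -ler_pdivlMl ?exprn_gt0 ?(a_gt0 G)// mulrC => /le_trans; apply.
apply: ler_wpM2l; first exact: sqrtr_ge0.
by rewrite exprnN; apply: (az_le G); rewrite /j; lia.
Qed.

End HeatFlow.

(** * Continuity, derivatives and primitives on an interval *)

Lemma within_itvP {R : realType} (f : R -> R) (s t : R) :
  {within `[s, t], continuous f} <->
  forall x, s <= x <= t -> forall eps, 0 < eps ->
    exists2 d, 0 < d & forall y, s <= y <= t -> `|x - y| < d -> `|f x - f y| <= eps.
Proof.
split.
  move=> /subspace_continuousP cf x xst eps eps0.
  have {}cf := cf x; rewrite /= in_itv /= in cf.
  have /cvgrPdist_le/(_ eps eps0) := cf xst.
  move=> /nbhs_ballP[d d0 H]; exists d => // y yst xy.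
  by apply: (H y) => //=; rewrite in_itv.
move=> H; apply/subspace_continuousP => x /=; rewrite in_itv /= => xst.
apply/cvgrPdist_le => eps eps0; have [d d0 Hd] := H x xst eps eps0.
apply/nbhs_ballP; exists d => // y xy /=; rewrite in_itv /= => yst; exact: Hd.
Qed.

Lemma within_reflect {R : realType} (h : R -> R) (t : R) :
  {within `[0, t], continuous h} -> {within `[0, t], continuous (fun s => h (t - s))}.
Proof.
move=> /within_itvP H; apply/within_itvP => x x0 eps eps0.
have [|d d0 Hd] := H (t - x) _ eps eps0; first by lra.
exists d => // y y0 xy; apply: Hd; first by lra.
by rewrite (_ : t - x - (t - y) = y - x) 1?distrC//; ring.
Qed.

Lemma within_shift {R : realType} (h : R -> R) (c t : R) : 0 <= c ->
  {within `[0, c + t], continuous h} -> {within `[0, t], continuous (fun s => h (c + s))}.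
Proof.
move=> c0 /within_itvP H; apply/within_itvP => x x0 eps eps0.
have [|d d0 Hd] := H (c + x) _ eps eps0; first by lra.
exists d => // y y0 xy; apply: Hd; first by lra.
by rewrite (_ : c + x - (c + y) = x - y)//; ring.
Qed.

Lemma is_derive_reflect {R : realType} (h : R -> R) (t x dh : R) :
  is_derive (t - x) (1 : R) h dh -> is_derive x (1 : R) (fun s => h (t - s)) (- dh).
Proof.
move=> hd; have H : is_derive x (1 : R) (fun s : R => t - s) (- 1).
  rewrite (_ : (fun s => t - s) = cst t - id)// -[- 1]sub0r; exact: is_deriveB.
have := @is_derive1_comp _ h (fun s : R => t - s) x _ _ hd H.
by rewrite mulrN1.
Qed.

Lemma is_derive_shift {R : realType} (h : R -> R) (c x dh : R) :
  is_derive (c + x) (1 : R) h dh -> is_derive x (1 : R) (fun s => h (c + s)) dh.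
Proof.
move=> hd; have H : is_derive x (1 : R) (fun s : R => c + s) 1.
  rewrite (_ : (fun s => c + s) = cst c + id)// -[X in is_derive _ _ _ X]add0r; exact: is_deriveD.
have := @is_derive1_comp _ h (fun s : R => c + s) x _ _ hd H.
by rewrite mulr1.
Qed.

Section Primitive.
Context {R : realType} (h : R -> R).
Hypothesis hc : forall t : R, {within `[0, t], continuous h}.

Definition primitive (t : R) : R := \int[lebesgue_measure]_(s in `[0, t]) h s.

Lemma primitive0 : primitive 0 = 0.
Proof. by rewrite /primitive set_itv1 Rintegral_set1. Qed.

Let hint (t : R) : lebesgue_measure.-integrable `[0, t] (EFin \o h).
Proof.
by apply: continuous_compact_integrable; [exact: segment_compact|exact: hc].
Qed.

Lemma primitive_continuous (t : R) : {within `[0, t], continuous primitive}.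
Proof.
have [t0|t0] := leP 0 t; first exact: parameterized_integral_continuous.
by rewrite set_itv_ge ?bnd_simp -?ltNge//; exact: continuous_subspace0.
Qed.

Lemma primitive_derive (t : R) : 0 < t -> is_derive t (1 : R) primitive (h t).
Proof.
move=> t0.
have t1 : t < t + 1 by rewrite ltrDl.
have ct : {for t, continuous h}.
  have t1' : 0 < t + 1 by rewrite addr_gt0.
  have hc1 : {within `[0, t + 1], continuous h} by exact: hc.
  move: hc1 => /(continuous_within_itvP _ t1')[+ _ _]; apply.
  by rewrite in_itv /= t0 ltrDl ltr01.
have [dP <-] := @continuous_FTC1_closed R h 0 t (t + 1) t1 (hint _) t0 ct.
by rewrite derive1E; exact/derivableP.
Qed.

End Primitive.

(** * The heat flow on rapidly decreasing functions *)

Section HeatSemigroup.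
Context {R : realType} {I : choiceType} (e : nat -> I) (ix : I -> nat).
Context (nb : I -> seq I) (w : I -> I -> R) (a : I -> R) (k0 k2 : nat) (K0 K1 : R).
Hypothesis G : weighted_graph e ix nb w a k0 k2 K0 K1.

Let q x := a x ^ (- k2%:Z).
Local Notation S := (@tsum R I e).
Local Notation lap := (lap nb w).
Local Notation bnd := (bnd a).
Local Notation heat := (heat nb w).
Local Notation slow := (slow a).
Local Notation fast := (fast a).
Local Notation rapid := (rapid a).
Local Notation moderate := (moderate a).
Let q0 : forall x, 0 < q x := q_gt0 G.
Let cq : cvgn (series (fun i => q (e i))) := q_cvg G.

Lemma rapid_lin c u v : rapid u -> rapid v -> rapid (fun x => c * u x + v x).
Proof.
move=> ru rv z; have [M HM] := ru z; have [N HN] := rv z.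
by exists (`|c| * M + N); apply: bndD => //; exact: bndZ.
Qed.

Lemma rapidD u v : rapid u -> rapid v -> rapid (fun x => u x + v x).
Proof. by move=> ru rv z; have [M ?] := ru z; have [N ?] := rv z; exists (M + N); exact: bndD. Qed.

Lemma rapidB u v : rapid u -> rapid v -> rapid (fun x => u x - v x).
Proof. by move=> ru rv z; have [M ?] := ru z; have [N ?] := rv z; exists (M + N); exact: bndB. Qed.

Lemma rapidZ c u : rapid u -> rapid (fun x => c * u x).
Proof. by move=> ru z; have [M ?] := ru z; exists (`|c| * M); exact: bndZ. Qed.

Lemma rapid_lap u : rapid u -> rapid (lap u).
Proof.
move=> ru z; have [M HM] := ru (z - k0%:Z).
exists (lapC K0 (z - k0%:Z) * M); have := bnd_lap G HM.
by rewrite (_ : k0%:Z + _ = z)//; lia.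
Qed.

Lemma moderate_lap u : moderate u -> moderate (lap u).
Proof. by move=> [z [M HM]]; exists (k0%:Z + z), (lapC K0 z * M); exact: (bnd_lap G HM). Qed.

Lemma rapid_moderate u : rapid u -> moderate u.
Proof. by move=> /(_ 0)[M HM]; exists 0, M. Qed.

Lemma rapid_mul u f : rapid u -> moderate f -> rapid (fun x => u x * f x).
Proof.
move=> ru [z' [N HN]] z; have [M HM] := ru (z - z').
by exists (M * N); have := bndM G HM HN; rewrite subrK.
Qed.

Lemma rapid_dom u : rapid u -> dominated q u.
Proof. by move=> /(_ (- k2%:Z))[M HM]; exact: (bnd_dom G (lexx _) HM). Qed.

Lemma rapid_mul_dom u f : rapid u -> moderate f -> dominated q (fun x => u x * f x).
Proof. by move=> ru mf; apply/rapid_dom/rapid_mul. Qed.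

Lemma rapid_pow u j : rapid u -> rapid (fun x => a x ^+ j * u x).
Proof.
move=> ru z; have [M HM] := ru (z - j%:Z); exists M => x.
have ax := a_gt0 G x.
rewrite normrM ger0_norm ?exprn_ge0 ?(ltW ax)// (_ : z = j%:Z + (z - j%:Z)); last by lia.
rewrite (azD G) -exprnP mulrCA; apply: ler_wpM2l; first by rewrite exprn_ge0// ltW.
exact: HM.
Qed.

Lemma lap_symS u f : rapid u -> moderate f -> S (fun x => lap u x * f x) = S (fun x => u x * lap f x).
Proof.
move=> ru [z [N HN]]; have [M HM] := ru (- k2%:Z - k0%:Z - z).
by apply: (lap_sym G _ HM HN); rewrite subrK.
Qed.

Lemma heat_lin c D E : heat D -> heat E -> heat (fun t x => c * D t x + E t x).
Proof.
move=> [Dd Dc] [Ed Ec]; split=> [r r0 x|t x].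
  rewrite (_ : - lap _ x = c * (- lap (D r) x) + - lap (E r) x); last by rewrite lapD lapZ; ring.
  have -> : (fun t => c * D t x + E t x) = c *: (D ^~ x) + (E ^~ x) by [].
  by apply: is_deriveD; [apply: is_deriveZ; exact: Dd|exact: Ed].
by move=> z; apply: cvgD; [apply: cvgM; [exact: cvg_cst|exact: Dc]|exact: Ec].
Qed.

Lemma slow_lin c D E : slow D -> slow E -> slow (fun t x => c * D t x + E t x).
Proof.
move=> [z Dz] [z' Ez]; exists (Num.max z z') => T.
have [M HM] := Dz T; have [N HN] := Ez T.
exists (`|c| * M + N) => t tT; apply: bndD; first apply: bndZ.
  by apply: (bnd_le G (lexx M) _ (HM t tT)); rewrite le_max lexx.
by apply: (bnd_le G (lexx N) _ (HN t tT)); rewrite le_max lexx orbT.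
Qed.

Lemma heat_shift s D : 0 <= s -> heat D -> heat (fun t => D (s + t)).
Proof.
move=> s0 [Dd Dc]; split=> [r r0 x|t x]; first by apply: (@is_derive_shift _ (D ^~ x)); apply: Dd; rewrite ltr_wpDl.
by apply: (@within_shift _ (D ^~ x)) => //; exact: Dc.
Qed.

Lemma slow_shift s D : 0 <= s -> slow D -> slow (fun t => D (s + t)).
Proof.
move=> s0 [z Dz]; exists z => T; have [M HM] := Dz (s + T); exists M => t tT.
by apply: HM; lra.
Qed.

(** The flow is a parameter at this stage: it will be constructed from the solutions of the
    stochastic equation, and by uniqueness [flowP] determines it for nonnegative times. *)
Variable flow : (I -> R) -> R -> I -> R.
Hypothesis flowP : forall f, rapid f -> [/\ heat (flow f), slow (flow f) & flow f 0 = f].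

Lemma flow_fast u : rapid u -> fast (flow u).
Proof. by move=> ru; have [h s E] := flowP ru; apply: (heat_fast G) => //; rewrite E. Qed.

Lemma flow_rapid u t : rapid u -> 0 <= t -> rapid (flow u t).
Proof. by move=> ru t0 z; have [M HM] := flow_fast ru z t; exists M; apply: HM; rewrite t0 lexx. Qed.

(** Linearity and the semigroup property are read off from this, by exhibiting a second solution
    with the same initial value. *)
Lemma flow_unique u D t : rapid u -> heat D -> slow D -> D 0 = u -> 0 <= t -> flow u t = D t.
Proof.
move=> ru hD sD D0 t0; have [h s E] := flowP ru; apply/funext => x.
have := @heat_unique _ _ _ _ _ _ _ _ _ _ _ G (fun t x => -1 * D t x + flow u t x) _ _ _ t x t0.
rewrite mulN1r addrC => H; apply/eqP; rewrite -subr_eq0; apply/eqP; apply: H.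
- exact: heat_lin.
- exact: slow_lin.
- by move=> y; rewrite E D0 mulN1r addNr.
Qed.

Lemma flow0 u : rapid u -> flow u 0 = u.
Proof. by move=> ru; case: (flowP ru). Qed.

Lemma flow_lin c u v t : rapid u -> rapid v -> 0 <= t ->
  flow (fun x => c * u x + v x) t = (fun x => c * flow u t x + flow v t x).
Proof.
move=> ru rv t0; have [hu su Eu] := flowP ru; have [hv sv Ev] := flowP rv.
by rewrite (flow_unique (rapid_lin c ru rv) (heat_lin c hu hv) (slow_lin c su sv)) ?Eu ?Ev.
Qed.

Lemma flowD u v t : rapid u -> rapid v -> 0 <= t ->
  flow (fun x => u x + v x) t = (fun x => flow u t x + flow v t x).
Proof.
move=> ru rv t0; have := flow_lin 1 ru rv t0; rewrite (_ : (fun x => 1 * u x + v x) = (fun x => u x + v x)).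
  by move=> ->; apply/funext => x; rewrite mul1r.
by apply/funext => x; rewrite mul1r.
Qed.

Lemma flowB u v t : rapid u -> rapid v -> 0 <= t ->
  flow (fun x => u x - v x) t = (fun x => flow u t x - flow v t x).
Proof.
move=> ru rv t0; have := flow_lin (-1) rv ru t0; rewrite (_ : (fun x => -1 * v x + u x) = (fun x => u x - v x)).
  by move=> ->; apply/funext => x; rewrite mulN1r addrC.
by apply/funext => x; rewrite mulN1r addrC.
Qed.

Lemma flowZ c u t : rapid u -> 0 <= t -> flow (fun x => c * u x) t = (fun x => c * flow u t x).
Proof.
move=> ru t0.
have [h s E] := flowP ru; have h2 := heat_lin (c - 1) h h; have s2 := slow_lin (c - 1) s s.
rewrite (@flow_unique _ _ t (rapidZ c ru) h2 s2)//; apply/funext => x; rewrite ?E; ring.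
Qed.

Lemma flow_comp u s t : rapid u -> 0 <= s -> 0 <= t -> flow (flow u s) t = flow u (s + t).
Proof.
move=> ru s0 t0; have [h sl _] := flowP ru.
by rewrite (flow_unique (flow_rapid ru s0) (heat_shift s0 h) (slow_shift s0 sl)) ?addr0.
Qed.

(** The pairing of [flow u (t - s)] with [D s] has zero derivative in [s], since the Laplacian is
    symmetric. As [D] is only required to be slow, this also covers initial data that merely have
    polynomial growth. *)
Lemma flow_dual u D t : rapid u -> heat D -> slow D -> 0 <= t ->
  S (fun x => u x * D t x) = S (fun x => flow u t x * D 0 x).
Proof.
move=> ru hD sD t0; have [[Ud Uc] _ U0] := flowP ru.
have [z Dz] := sD; have [N HN] := Dz t.
have fU := flow_fast ru.
have [M HM] := fU (- k2%:Z - k0%:Z - z) t.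
have [M' HM'] := fU (- k2%:Z - z) t.
have HN0 r : 0 <= r <= t -> moderate (D r) by move=> r0; exists z, N; exact: HN.
pose f s x := flow u (t - s) x * D s x.
pose f' s x := lap (flow u (t - s)) x * D s x - flow u (t - s) x * lap (D s) x.
have E1 : (fun x => u x * D t x) = f t by rewrite /f subrr U0.
have E2 : (fun x => flow u t x * D 0 x) = f 0 by rewrite /f subr0.
rewrite E1 E2.
have C1 r : 0 < r < t -> bnd (lapC K0 (- k2%:Z - k0%:Z - z) * M * N + M * (lapC K0 z * N)) (- k2%:Z) (f' r).
  move=> /andP[r0 rt]; have H1 : 0 <= t - r <= t by lra.
  have H2 : 0 <= r <= t by lra.
  have B1 := bndM G (bnd_lap G (HM _ H1)) (HN _ H2).
  have B2 := bndM G (HM _ H1) (bnd_lap G (HN _ H2)).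
  apply: bndB.
    apply: (bnd_le G (lexx _) _ B1); lia.
  apply: (bnd_le G (lexx _) _ B2); lia.
apply: (@tsum_mvt0 _ _ e q q0 cq f f' 0 t _ t0) => [r rt x|x|r rt|r rt|].
- rewrite /f /f'.
  have H1 : is_derive r (1 : R) (fun s => flow u (t - s) x) (lap (flow u (t - r)) x).
    rewrite -[lap _ _]opprK; apply: (@is_derive_reflect _ ((flow u) ^~ x)); apply: Ud; lra.
  have H2 : is_derive r (1 : R) (D ^~ x) (- lap (D r) x) by apply: hD.1; lra.
  have := is_deriveM H1 H2; rewrite /GRing.scale /= => H.
  by apply: is_derive_eq; rewrite /GRing.scale/=; ring.
- move=> y; apply: cvgM; last exact: (hD.2 t x y).
  exact: (@within_reflect _ (fun s => flow u s x) t (Uc t x) y).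
- exact: C1.
- have H2 : 0 <= r <= t by lra.
  have rU : rapid (flow u (t - r)) by apply: flow_rapid => //; lra.
  rewrite /f' (tsumB q0 cq).
  + by rewrite lap_symS ?subrr//; exact: HN0.
  + by apply: rapid_mul_dom; [exact: rapid_lap|exact: HN0].
  + by apply: rapid_mul_dom => //; apply: moderate_lap; exact: HN0.
- rewrite /f subr0; apply: rapid_mul_dom; first exact: flow_rapid.
  by apply: HN0; rewrite lexx.
Qed.

Lemma flow_sym u v t : rapid u -> rapid v -> 0 <= t ->
  S (fun x => flow u t x * v x) = S (fun x => u x * flow v t x).
Proof.
move=> ru rv t0; have [h s E] := flowP rv.
by rewrite (flow_dual ru h s t0) E.
Qed.

Lemma flow_energy u c g j t m : rapid u -> 0 <= c -> loglip nb a c g ->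
  (forall x, g x <= a x ^+ j) -> 0 <= t ->
  (forall r, 0 < r < t ->
    c ^+ 2 * (9 * K1) * S (fun x => (a x)^-1 ^+ 2 * (g x * flow u r x) ^+ 2) <= m) ->
  S (fun x => (g x * flow u t x) ^+ 2) - S (fun x => (g x * u x) ^+ 2) <= m * t.
Proof.
move=> ru c0 Lg gj t0 H; have [h _ U0] := flowP ru.
pose z := - k2%:Z - k0%:Z; have zk : 2%:Z * z <= z by rewrite /z; lia.
have [M HM] := flow_fast ru (z - j%:Z) t.
have := @energy_growth _ _ _ _ _ _ _ _ _ _ _ G (flow u) c g M z 0 t m c0 Lg zk h (lexx 0) t0.
rewrite subr0 U0; apply => // r rt x.
rewrite normrM (gtr0_norm (Lg.1 x)).
rewrite (_ : z = j%:Z + (z - j%:Z)); last by lia.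
rewrite (azD G) -exprnP mulrCA; apply: ler_pM => //; [exact: ltW (Lg.1 x)|exact: HM].
Qed.

Lemma flow_contract u t : rapid u -> 0 <= t ->
  S (fun x => flow u t x ^+ 2) <= S (fun x => u x ^+ 2).
Proof.
move=> ru t0.
have := @flow_energy u 0 (fun=> 1) 0 t 0 ru (lexx 0) (loglip1 _ _) _ t0.
have E v : S (fun x => (1 * v x) ^+ 2) = S (fun x => v x ^+ 2).
  by apply: eq_tsum => x; rewrite mul1r.
rewrite !E mul0r subr_le0; apply => [x|r rt]; first by rewrite expr0.
by rewrite expr0n/= !mul0r.
Qed.

Lemma rapid_sqr_dom u j : rapid u -> dominated q (fun x => (a x ^+ j * u x) ^+ 2).
Proof.
move=> ru; have rr := rapid_pow j ru.
by under eq_fun do rewrite expr2; apply: rapid_mul_dom => //; exact: rapid_moderate.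
Qed.

(** The factor [(a x)^-1 ^+ 2] in the energy inequality turns the weight of order [j.+1] on the
    right into order [j]. Each order is thus driven by the previous one, and integration in time
    adds one power of [1 + t]. *)
Lemma flow_growth u j : rapid u -> exists2 C, 0 <= C & forall t, 0 <= t ->
  S (fun x => (a x ^+ j * flow u t x) ^+ 2) <= C * (1 + t) ^+ j.
Proof.
move=> ru; have [h _ U0] := flowP ru.
elim: j => [|j [C C0 IH]].
  exists (S (fun x => (u x) ^+ 2)).
    apply: (tsum_ge0 q0 cq); last by move=> x; exact: sqr_ge0.
    by have := rapid_sqr_dom 0 ru; under eq_fun do rewrite expr0 mul1r.
  move=> t t0; rewrite expr0 mulr1; apply: le_trans (flow_contract ru t0).
  by apply: eq_tsum_le => x; rewrite expr0 mul1r.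
pose c := powC (1 : R) j.+1.
have c0 : 0 <= c by exact: powC_ge0.
have kap0 : 0 <= c ^+ 2 * (9 * K1).
  by apply: mulr_ge0; [exact: sqr_ge0|apply: mulr_ge0 => //; exact: (K1_ge0 G)].
have Y0 : 0 <= S (fun x => (a x ^+ j.+1 * u x) ^+ 2).
  apply: (tsum_ge0 q0 cq); last by move=> x; exact: sqr_ge0.
  exact: rapid_sqr_dom.
exists (S (fun x => (a x ^+ j.+1 * u x) ^+ 2) + c ^+ 2 * (9 * K1) * C); first by rewrite addr_ge0// mulr_ge0.
move=> t t0; have t1 : 1 <= 1 + t by rewrite lerDl.
have p1 k : 1 <= (1 + t) ^+ k by exact: exprn_ege1.
have := @flow_energy u c (fun x => a x ^+ j.+1) j.+1 t (c ^+ 2 * (9 * K1) * (C * (1 + t) ^+ j)) ru c0.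
move=> /(_ (loglipX G _ ler01 (loglip_a G)) (fun=> lexx _) t0) H.
rewrite mulrDl.
have {}H : S (fun x => (a x ^+ j.+1 * flow u t x) ^+ 2) - S (fun x => (a x ^+ j.+1 * u x) ^+ 2)
    <= c ^+ 2 * (9 * K1) * (C * (1 + t) ^+ j) * t.
  apply: H => r /andP[r0 rt]; apply: ler_wpM2l => //.
  apply: (@le_trans _ _ (C * (1 + r) ^+ j)).
    apply: le_trans (IH r (ltW r0)); apply: eq_tsum_le => x.
    by rewrite -exprMn mulrA [a x ^+ j.+1]exprS mulrA mulVf ?mul1r// gt_eqF// (a_gt0 G).
  apply: ler_wpM2l => //; apply: lerXn2r; rewrite ?nnegrE; lra.
have X0 : 0 <= c ^+ 2 * (9 * K1) * C * (1 + t) ^+ j.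
  by apply: mulr_ge0; [exact: mulr_ge0|rewrite exprn_ge0// addr_ge0].
have := ler_wpM2l Y0 (p1 j.+1); rewrite mulr1 exprSr; lra.
Qed.

End HeatSemigroup.

(** * Time integrals of the flow and the variance of the noise *)

Definition vanishes {R : realType} (f : R -> R) :=
  forall eps, 0 < eps -> exists2 T0, 0 <= T0 & forall T, T0 <= T -> `|f T| <= eps.

Section GreenForm.
Context {R : realType} {I : choiceType} (e : nat -> I) (ix : I -> nat).
Context (nb : I -> seq I) (w : I -> I -> R) (a : I -> R) (k0 k2 : nat) (K0 K1 : R).
Hypothesis G : weighted_graph e ix nb w a k0 k2 K0 K1.

Let q x := a x ^ (- k2%:Z).
Local Notation S := (@tsum R I e).
Local Notation lap := (lap nb w).
Local Notation bnd := (bnd a).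
Local Notation heat := (heat nb w).
Local Notation slow := (slow a).
Local Notation fast := (fast a).
Local Notation rapid := (rapid a).
Local Notation moderate := (moderate a).
Let q0 : forall x, 0 < q x := q_gt0 G.
Let cq : cvgn (series (fun i => q (e i))) := q_cvg G.

Variable flow : (I -> R) -> R -> I -> R.
Hypothesis flowP : forall f, rapid f -> [/\ heat (flow f), slow (flow f) & flow f 0 = f].

Local Notation flow_fast := (flow_fast G flowP).
Local Notation flow_rapid := (flow_rapid G flowP).

Definition gint (u : I -> R) (t : R) x : R := primitive ((flow u) ^~ x) t.
Definition green_form (t : R) (u v : I -> R) : R := S (fun x => gint u t x * v x).
(** This is [\int_0^t |P_s u|^2 ds], half of the variance of the noise [sqrt 2 dB] accumulated up to
    time [t] and tested against [u], hence the exponent in its characteristic function. *)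
Definition noise_var (t : R) (u : I -> R) : R := 2^-1 * green_form (2 * t) u u.

Let flow_cont u x : rapid u -> forall t : R, {within `[0, t], continuous ((flow u) ^~ x)}.
Proof. by move=> ru t; case: (flowP ru) => -[_ +] _ _; apply. Qed.

Lemma gint0 u x : gint u 0 x = 0.
Proof. exact: primitive0. Qed.

Lemma gint_derive u x (r : R) : rapid u -> 0 < r -> is_derive r (1 : R) ((gint u) ^~ x) (flow u r x).
Proof. by move=> ru r0; apply: primitive_derive => //; exact: flow_cont. Qed.

Lemma gint_cont u x (t : R) : rapid u -> {within `[0, t], continuous ((gint u) ^~ x)}.
Proof. by move=> ru; apply: primitive_continuous => //; exact: flow_cont. Qed.

Lemma gint_rapid u (t : R) : rapid u -> 0 <= t -> rapid (gint u t).
Proof.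
move=> ru t0 z; have [M HM] := flow_fast ru z t; exists (M * t) => x.
move: t0; rewrite le_eqVlt => /orP[/eqP<-|t0]; first by rewrite gint0 normr0 mulr0 mul0r.
have H (r : R) : r \in `]0, t[ -> is_derive r (1 : R) ((gint u) ^~ x) (flow u r x).
  by rewrite in_itv /= => /andP[r0 _]; exact: gint_derive.
have [c] := MVT t0 H (@gint_cont u x t ru).
rewrite in_itv /= => /andP[c0 ct]; rewrite gint0 !subr0 => ->.
rewrite normrM (gtr0_norm t0) mulrAC; apply: ler_wpM2r; first exact: ltW.
by apply: HM; rewrite !ltW.
Qed.

Let mod_dom u v (t : R) : rapid u -> moderate v -> 0 <= t -> dominated q (fun x => gint u t x * v x).
Proof. by move=> ru mv t0; apply: (rapid_mul_dom G) => //; exact: gint_rapid. Qed.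

Lemma flow_mul_bound u v (t : R) : rapid u -> moderate v -> exists M, forall r, 0 <= r <= t ->
  forall x, `|flow u r x * v x| <= M * q x.
Proof.
move=> ru [z [N HN]]; have [M HM] := flow_fast ru (- k2%:Z - z) t.
exists (M * N) => r rt x; have := bndM G (HM r rt) HN x.
by rewrite subrK.
Qed.

Lemma green_form_step u v (s t m : R) : rapid u -> moderate v -> 0 <= s -> s <= t ->
  (forall r, s < r < t -> S (fun x => flow u r x * v x) <= m) ->
  green_form t u v - green_form s u v <= m * (t - s).
Proof.
move=> ru mv s0 st H.
have [M HM] := flow_mul_bound t ru mv.
have [|||||//] := @tsum_mvt _ _ e q q0 cq (fun r x => gint u r x * v x) (fun r x => flow u r x * v x) s t M m st.
- move=> r /andP[sr rt] x.
  have -> : (fun r => gint u r x * v x) = v x *: ((gint u) ^~ x) by apply/funext => y; rewrite /GRing.scale /= mulrC.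
  by rewrite mulrC; apply: is_deriveZ; apply: gint_derive => //; exact: le_lt_trans sr.
- move=> x y; apply: cvgM; last exact: cvg_cst.
  by apply: (@within_sub _ ((gint u) ^~ x)) => //; exact: gint_cont.
- by move=> r /andP[sr rt] x; apply: HM; rewrite (le_trans s0 (ltW sr)) ltW.
- exact: H.
- exact: mod_dom.
Qed.

Lemma green_form_stepN u v (s t m : R) : rapid u -> moderate v -> 0 <= s -> s <= t ->
  (forall r, s < r < t -> m <= S (fun x => flow u r x * v x)) ->
  m * (t - s) <= green_form t u v - green_form s u v.
Proof.
move=> ru mv s0 st H.
have mN : moderate (fun x => - v x).
  by have [z [N HN]] := mv; exists z, N; exact: bndN.
have E r : 0 <= r -> green_form r u (fun x => - v x) = - green_form r u v.
  move=> r0; rewrite -(tsumN q0 cq) //; last exact: mod_dom.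
  by apply: eq_tsum => x; rewrite mulrN.
have := @green_form_step u (fun x => - v x) s t (- m) ru mN s0 st.
rewrite !E ?(le_trans s0 st)// => H'.
have {}H' : - green_form t u v - - green_form s u v <= - m * (t - s).
  apply: H' => r rs; have r0 : 0 <= r by case/andP: rs => sr _; rewrite (le_trans s0)// ltW.
  rewrite (@eq_tsum _ _ e _ (fun x => - (flow u r x * v x))); last by move=> x; rewrite mulrN.
  rewrite (tsumN q0 cq) ?lerN2 ?H//.
  by apply: (rapid_mul_dom G) => //; exact: flow_rapid.
move: H'; rewrite mulNr; move: (green_form _ _ _) (green_form _ _ _) (m * _) => A B X; lra.
Qed.

Lemma green_form0 u v : green_form 0 u v = 0.
Proof. by rewrite /green_form (@eq_tsum _ _ e _ (fun=> 0)) ?tsum0// => x; rewrite gint0 mul0r. Qed.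

Lemma green_form_norm u v (t m : R) : rapid u -> moderate v -> 0 <= t ->
  (forall r, 0 < r < t -> `|S (fun x => flow u r x * v x)| <= m) ->
  `|green_form t u v| <= m * t.
Proof.
move=> ru mv t0 H.
have h1 : green_form t u v <= m * t.
  have := @green_form_step u v 0 t m ru mv (lexx 0) t0; rewrite green_form0 !subr0; apply => r rt.
  exact: le_trans (ler_norm _) (H r rt).
have h2 : - m * t <= green_form t u v.
  have := @green_form_stepN u v 0 t (- m) ru mv (lexx 0) t0; rewrite green_form0 !subr0; apply => r rt.
  by have := H r rt; rewrite ler_norml => /andP[].
by rewrite ler_norml h1 -mulNr h2.
Qed.

(** Both forms vanish at time zero and have the same derivative, by the symmetry of the flow. *)
Lemma green_form_sym u v t : rapid u -> rapid v -> 0 <= t -> green_form t u v = green_form t v u.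
Proof.
move=> ru rv t0.
have [M HM] := flow_mul_bound t ru (rapid_moderate rv).
have [N HN] := flow_mul_bound t rv (rapid_moderate ru).
apply/eqP; rewrite -subr_eq0 -(tsumB q0 cq); try by apply: mod_dom => //; exact: rapid_moderate.
have -> : S (fun x => gint u t x * v x - gint v t x * u x) = S (fun x => gint u 0 x * v x - gint v 0 x * u x).
  apply: (@tsum_mvt0 _ _ e q q0 cq (fun r x => gint u r x * v x - gint v r x * u x)
     (fun r x => flow u r x * v x - flow v r x * u x) 0 t (M + N) t0).
  - move=> r /andP[sr rt] x.
    have -> : (fun r => gint u r x * v x - gint v r x * u x) = v x *: ((gint u) ^~ x) - u x *: ((gint v) ^~ x).
      by apply/funext => y; transitivity (v x * gint u y x - u x * gint v y x) => //; congr (_ - _); exact: mulrC.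
    rewrite [flow u _ _ * _]mulrC [flow v _ _ * _]mulrC.
    by apply: is_deriveB; apply: is_deriveZ; exact: gint_derive.
  - by move=> x y; apply: cvgB; apply: cvgM; try exact: cvg_cst; exact: gint_cont.
  - move=> r /andP[r0 rt] x; rewrite (le_trans (ler_normB _ _))// mulrDl lerD// ?HM ?HN// !ltW//.
  - move=> r /andP[r0 rt].
    rewrite (tsumB q0 cq); try by apply: (rapid_mul_dom G); [apply: flow_rapid => //; exact: ltW|exact: rapid_moderate].
    rewrite (flow_sym G flowP ru rv (ltW r0)).
    by apply/eqP; rewrite subr_eq0; apply/eqP/eq_tsum => x; rewrite mulrC.
  - by apply: dominatedB; apply: mod_dom => //; exact: rapid_moderate.
by apply/eqP; rewrite (@eq_tsum _ _ e _ (fun=> 0)) ?tsum0// => x; rewrite !gint0 !mul0r subrr.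
Qed.

Lemma green_formDr t u v v' : rapid u -> moderate v -> moderate v' -> 0 <= t ->
  green_form t u (fun x => v x + v' x) = green_form t u v + green_form t u v'.
Proof.
move=> ru mv mv' t0; rewrite -(tsumD q0 cq); try exact: mod_dom.
by apply: eq_tsum => x; rewrite mulrDr.
Qed.

Lemma green_formBr t u v v' : rapid u -> moderate v -> moderate v' -> 0 <= t ->
  green_form t u (fun x => v x - v' x) = green_form t u v - green_form t u v'.
Proof.
move=> ru mv mv' t0; rewrite -(tsumB q0 cq); try exact: mod_dom.
by apply: eq_tsum => x; rewrite mulrBr.
Qed.

Lemma green_formZr t c u v : rapid u -> moderate v -> 0 <= t ->
  green_form t u (fun x => c * v x) = c * green_form t u v.
Proof.
move=> ru mv t0; rewrite -(tsumZ q0 cq); try exact: mod_dom.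
by apply: eq_tsum => x; rewrite mulrCA.
Qed.

(** Differentiation in [t] reduces the additivity of the time integral to the semigroup property. *)
Lemma green_form_add s t u v : rapid u -> rapid v -> 0 <= s -> 0 <= t ->
  green_form (s + t) u v = green_form s u v + green_form t (flow u s) v.
Proof.
move=> ru rv s0 t0; have mv := rapid_moderate rv.
have rs := flow_rapid ru s0.
have st0 r : 0 <= r -> 0 <= s + r by move=> ?; rewrite addr_ge0.
have [M HM] := flow_mul_bound (s + t) ru mv.
have [N HN] := flow_mul_bound t rs mv.
apply/eqP; rewrite -subr_eq -(tsumB q0 cq); [|exact: (mod_dom _ _ (st0 _ t0))|exact: mod_dom].
have -> : S (fun x => gint u (s + t) x * v x - gint (flow u s) t x * v x) =
    S (fun x => gint u (s + 0) x * v x - gint (flow u s) 0 x * v x).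
  apply: (@tsum_mvt0 _ _ e q q0 cq (fun r x => gint u (s + r) x * v x - gint (flow u s) r x * v x)
     (fun r x => flow u (s + r) x * v x - flow (flow u s) r x * v x) 0 t (M + N) t0).
  - move=> r /andP[sr rt] x.
    have -> : (fun r => gint u (s + r) x * v x - gint (flow u s) r x * v x) = v x *: (fun r => gint u (s + r) x) - v x *: ((gint (flow u s)) ^~ x).
      by apply/funext => y; transitivity (v x * gint u (s + y) x - v x * gint (flow u s) y x) => //; congr (_ - _); exact: mulrC.
    rewrite [flow u _ _ * _]mulrC [flow (flow u s) _ _ * _]mulrC.
    apply: is_deriveB; apply: is_deriveZ; last exact: gint_derive.
    by apply: (@is_derive_shift _ ((gint u) ^~ x)); apply: gint_derive => //; rewrite ltr_wpDl.
  - move=> x y; apply: cvgB; apply: cvgM; try exact: cvg_cst; last exact: gint_cont.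
    by apply: (@within_shift _ ((gint u) ^~ x)) => //; exact: gint_cont.
  - move=> r /andP[r0 rt] x; rewrite (le_trans (ler_normB _ _))// mulrDl lerD// ?HM ?HN//; lra.
  - move=> r /andP[r0 rt].
    rewrite (@eq_tsum _ _ e _ (fun=> 0)) ?tsum0// => x.
    by rewrite (flow_comp G flowP ru s0 (ltW r0)) subrr.
  - by apply: dominatedB; apply: mod_dom => //; rewrite addr0.
by apply/eqP; rewrite /green_form; apply: eq_tsum => x; rewrite addr0 gint0 mul0r subr0.
Qed.

Lemma green_form_ge0 u t : rapid u -> 0 <= t -> 0 <= green_form t u u.
Proof.
move=> ru t0; have := @green_form_stepN u u 0 t 0 ru (rapid_moderate ru) (lexx 0) t0.
rewrite green_form0 mul0r subr0; apply => r /andP[r0 _].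
have h2 : 0 <= r / 2 by lra.
have -> : r = r / 2 + r / 2 by field.
rewrite -(flow_comp G flowP ru h2 h2) (flow_sym G flowP _ ru h2); last exact: flow_rapid.
apply: (tsum_ge0 q0 cq); last by move=> x; rewrite -expr2 sqr_ge0.
by apply: (rapid_mul_dom G); [|apply: rapid_moderate]; exact: flow_rapid.
Qed.

Lemma noise_var_ge0 u t : rapid u -> 0 <= t -> 0 <= noise_var t u.
Proof. by move=> ru t0; rewrite mulr_ge0// green_form_ge0// mulr_ge0. Qed.

Lemma flow_norm u r : rapid u -> 0 <= r ->
  S (fun x => flow u (2 * r) x * u x) = S (fun x => flow u r x ^+ 2).
Proof.
move=> ru r0; rewrite (_ : 2 * r = r + r); last by ring.
rewrite -(flow_comp G flowP ru r0 r0) (flow_sym G flowP _ ru r0); last exact: flow_rapid.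
by apply: eq_tsum => x; rewrite expr2.
Qed.

Lemma flow_norm_nincr u r s : rapid u -> 0 <= r -> r <= s ->
  S (fun x => flow u s x ^+ 2) <= S (fun x => flow u r x ^+ 2).
Proof.
move=> ru r0 rs; rewrite -(subrKC r s) -(flow_comp G flowP ru r0) ?subr_ge0//.
by apply: (flow_contract G flowP); [exact: flow_rapid|rewrite subr_ge0].
Qed.

(** The norm of [flow u r] decreases in [r], so the increment lies between the two rectangles. This
    sandwich does the work of the integral formula for the variance. *)
Lemma noise_var_step u s t : rapid u -> 0 <= s -> s <= t ->
  S (fun x => flow u t x ^+ 2) * (t - s) <= noise_var t u - noise_var s u <=
  S (fun x => flow u s x ^+ 2) * (t - s).
Proof.
move=> ru s0 st; have mu := rapid_moderate ru.
have s20 : 0 <= 2 * s by lra.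
have st2 : 2 * s <= 2 * t by lra.
have H r : 2 * s < r < 2 * t -> S (fun x => flow u t x ^+ 2) <= S (fun x => flow u r x * u x) <= S (fun x => flow u s x ^+ 2).
  move=> /andP[sr rt]; have -> : r = 2 * (r / 2) by field.
  by rewrite flow_norm ?flow_norm_nincr//; lra.
have h1 := @green_form_step u u _ _ (S (fun x => flow u s x ^+ 2)) ru mu s20 st2 (fun r hr => proj2 (andP (H r hr))).
have h2 := @green_form_stepN u u _ _ (S (fun x => flow u t x ^+ 2)) ru mu s20 st2 (fun r hr => proj1 (andP (H r hr))).
move: h1 h2; rewrite /noise_var.
move: (green_form _ _ _) (green_form _ _ _) (S _) (S _) => A B X Y h1 h2.
by apply/andP; split; lra.
Qed.

End GreenForm.

Lemma nincr_mul_le_sum {R : realType} (f : nat -> R) k n : (forall i, f i.+1 <= f i) ->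
  n%:R * f (k + n)%N <= \sum_(i < n) f (k + i)%N.
Proof.
move=> fn; have fle i j : (i <= j)%N -> f j <= f i.
  by move=> /subnKC <-; elim: (j - i)%N => [|m IH]; rewrite ?addn0// addnS (le_trans (fn _)).
rewrite mulr_natl -[n in _ *+ n]card_ord -sumr_const; apply: ler_sum => i _.
by apply: fle; rewrite leq_add2l ltnW.
Qed.

(** A nonincreasing sequence of length [n] has its last term bounded by its sum over [n]. Applied to
    the first differences up to [2n], and then to the second differences between [3n] and [4n], it
    gains a factor [n] each time because the sums telescope. *)
Lemma second_difference_decay {R : realType} (m : nat -> R) n : (forall i, 0 <= m i) ->
  (forall i, m i.+1 <= m i) -> (forall i, 0 <= m i - 2 * m i.+1 + m i.+2) ->
  (forall i, m i.+1 - 2 * m i.+2 + m i.+3 <= m i - 2 * m i.+1 + m i.+2) ->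
  n%:R ^+ 2 * (m (4 * n)%N - 2 * m (4 * n).+1 + m (4 * n).+2) <= m 0%N.
Proof.
move=> m0 m1 m2 m3.
pose d1 i := m i - m i.+1; pose d2 i := m i - 2 * m i.+1 + m i.+2.
have E1 k l : \sum_(i < l) d1 (k + i)%N = m k - m (k + l)%N.
  elim: l => [|l IH]; first by rewrite big_ord0 addn0 subrr.
  by rewrite big_ord_recr /= IH /d1 -!addnS; ring.
have E2 k l : \sum_(i < l) d2 (k + i)%N = d1 k - d1 (k + l)%N.
  elim: l => [|l IH]; first by rewrite big_ord0 addn0 subrr.
  by rewrite big_ord_recr /= IH /d1 /d2 -!addnS; ring.
have d1n i : d1 i.+1 <= d1 i by have := m2 i; rewrite /d1; lra.
have d10 i : 0 <= d1 i by rewrite subr_ge0.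
have mle i j : (i <= j)%N -> m j <= m i.
  by move=> /subnKC <-; elim: (j - i)%N => [|l IH]; rewrite ?addn0// addnS (le_trans (m1 _)).
have d1le i j : (i <= j)%N -> d1 j <= d1 i.
  by move=> /subnKC <-; elim: (j - i)%N => [|l IH]; rewrite ?addn0// addnS (le_trans (d1n _)).
have A : n%:R * d1 (n + n)%N <= m 0%N.
  apply: (le_trans (nincr_mul_le_sum _ _ d1n)); rewrite E1.
  by have := m0 (n + n)%N; have := mle _ _ (leq0n n); lra.
have B : n%:R * d2 (3 * n + n)%N <= d1 (n + n)%N.
  apply: (le_trans (nincr_mul_le_sum _ _ m3)); rewrite E2.
  have := d10 (3 * n + n)%N; have : d1 (3 * n)%N <= d1 (n + n)%N by apply: d1le; lia.
  lra.
have -> : (4 * n = 3 * n + n)%N by lia.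
rewrite -/(d2 (3 * n + n)%N) expr2 -mulrA; apply: le_trans A.
by apply: ler_wpM2l.
Qed.

Lemma half_le1 (R : realType) : 1 / 2 <= 1 :> R. Proof. lra. Qed.

Lemma sandwich_sqr (R : realType) (A B K t : R) :
  A <= (B + K * t) * t -> (B - K * t) * t <= A -> - (K * t ^+ 2) <= A - t * B <= K * t ^+ 2.
Proof. by move=> h1 h2; apply/andP; split; lra. Qed.

Lemma sandwich_cube (R : realType) (A B K t : R) :
  A <= (t * B + 5 * K * t ^+ 2) * t -> (t * B - 5 * K * t ^+ 2) * t <= A ->
  - (5 * K * t ^+ 3) <= A - t ^+ 2 * B <= 5 * K * t ^+ 3.
Proof. by move=> h1 h2; apply/andP; split; lra. Qed.

Lemma taylor_difference (R : realType) (A A' A0 B K r t : R) :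
  K * r ^+ 2 <= K * t ^+ 2 -> K * (r + t) ^+ 2 <= K * (2 * t) ^+ 2 ->
  - (K * (r + t) ^+ 2) <= A' - A0 + (r + t) * B <= K * (r + t) ^+ 2 ->
  - (K * r ^+ 2) <= A - A0 + r * B <= K * r ^+ 2 ->
  t * B - 5 * K * t ^+ 2 <= A - A' <= t * B + 5 * K * t ^+ 2.
Proof. by move=> h1 h2 /andP[h3 h4] /andP[h5 h6]; apply/andP; split; lra. Qed.

(** * Decay of iterated differences of the flow *)

Section Decay.
Context {R : realType} {I : choiceType} (e : nat -> I) (ix : I -> nat).
Context (nb : I -> seq I) (w : I -> I -> R) (a : I -> R) (k0 k2 : nat) (K0 K1 : R).
Hypothesis G : weighted_graph e ix nb w a k0 k2 K0 K1.

Let q x := a x ^ (- k2%:Z).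
Local Notation S := (@tsum R I e).
Local Notation lap := (lap nb w).
Local Notation bnd := (bnd a).
Local Notation heat := (heat nb w).
Local Notation slow := (slow a).
Local Notation fast := (fast a).
Local Notation rapid := (rapid a).
Local Notation moderate := (moderate a).
Let q0 : forall x, 0 < q x := q_gt0 G.
Let cq : cvgn (series (fun i => q (e i))) := q_cvg G.

Variable flow : (I -> R) -> R -> I -> R.
Hypothesis flowP : forall f, rapid f -> [/\ heat (flow f), slow (flow f) & flow f 0 = f].

Local Notation flow_fast := (flow_fast G flowP).
Local Notation flow_rapid := (flow_rapid G flowP).
Local Notation green_form := (green_form e flow).

Let Sq0 : 0 <= S q.
Proof. by apply: (tsum_ge0 q0 cq) => [|x]; [exists 1 => x; rewrite mul1r gtr0_norm|exact: ltW]. Qed.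

Lemma flow_lip u v : rapid u -> moderate v -> exists2 K, 0 <= K &
  forall t, 0 <= t <= 1 -> `|S (fun x => flow u t x * v x) - S (fun x => u x * v x)| <= K * t.
Proof.
move=> ru [z [N HN]]; have [M HM] := flow_fast ru (- k2%:Z - k0%:Z - z) 1.
have [[hd hc] _ U0] := flowP ru.
have H r : 0 <= r <= 1 -> forall x, `|- (lap (flow u r) x * v x)| <= lapC K0 (- k2%:Z - k0%:Z - z) * M * N * q x.
  move=> r1 x; rewrite normrN; have := bndM G (bnd_lap G (HM r r1)) HN x.
  by rewrite (_ : k0%:Z + _ + z = - k2%:Z)//; lia.
have M0 : 0 <= lapC K0 (- k2%:Z - k0%:Z - z) * M * N.
  have := le_trans (normr_ge0 _) (H 0 _ (e 0%N)); rewrite lexx ler01 => /(_ isT).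
  by rewrite pmulr_lge0.
exists (lapC K0 (- k2%:Z - k0%:Z - z) * M * N * S q); first exact: mulr_ge0.
move=> t /andP[t0 t1].
have := @tsum_mvt_norm _ _ e q q0 cq (fun r x => flow u r x * v x) (fun r x => - (lap (flow u r) x * v x)) 0 t
 (lapC K0 (- k2%:Z - k0%:Z - z) * M * N) (lapC K0 (- k2%:Z - k0%:Z - z) * M * N * S q) t0.
rewrite U0 subr0; apply.
- move=> r /andP[r0 rt] x.
  have -> : (fun r => flow u r x * v x) = v x *: ((flow u) ^~ x) by apply/funext => y; exact: mulrC.
  rewrite -mulNr mulrC; apply: is_deriveZ; exact: hd.
- by move=> x y; apply: cvgM; [exact: hc|exact: cvg_cst].
- by move=> r /andP[r0 rt] x; apply: H; rewrite (ltW r0) (le_trans (ltW rt)).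
- move=> r /andP[r0 rt]; apply: (ler_norm_tsum q0 cq); apply: H.
  by rewrite (ltW r0) (le_trans (ltW rt)).
- by apply: (rapid_mul_dom G) => //; exists z, N.
Qed.

(** The derivative of the left side is a difference of pairings of [flow u r] and [u] with [lap v],
    once the Laplacian has been moved to [v]; the remainder is then [flow_lip] integrated. *)
Lemma flow_taylor u v : rapid u -> moderate v -> exists2 K, 0 <= K &
  forall t, 0 <= t <= 1 ->
  `|S (fun x => flow u t x * v x) - S (fun x => u x * v x) + t * S (fun x => lap u x * v x)| <= K * t ^+ 2.
Proof.
move=> ru mv; have [K K0' HK] := flow_lip ru (moderate_lap G mv).
exists K => // t /andP[t0 t1].
have [[hd hc] _ U0] := flowP ru.
have ml := rapid_lap G ru.
have dd r : 0 <= r -> dominated q (fun x => lap (flow u r) x * v x).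
  by move=> r0; apply: (rapid_mul_dom G) => //; apply: (rapid_lap G); exact: flow_rapid.
have d0 : dominated q (fun x => lap u x * v x) by apply: (rapid_mul_dom G).
have d1 : dominated q (fun x => u x * v x) by apply: (rapid_mul_dom G).
have d2 r : 0 <= r -> dominated q (fun x => flow u r x * v x).
  by move=> r0; apply: (rapid_mul_dom G) => //; exact: flow_rapid.
have [z [N HN]] := mv; have [M HM] := flow_fast ru (- k2%:Z - k0%:Z - z) 1.
have H r : 0 <= r <= 1 -> forall x, `|lap (flow u r) x * v x| <= lapC K0 (- k2%:Z - k0%:Z - z) * M * N * q x.
  move=> r1 x; have := bndM G (bnd_lap G (HM r r1)) HN x.
  by rewrite (_ : k0%:Z + _ + z = - k2%:Z)//; lia.
have := @tsum_mvt_norm _ _ e q q0 cq (fun r x => flow u r x * v x + r * (lap u x * v x))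
 (fun r x => - (lap (flow u r) x * v x) + lap u x * v x) 0 t
 (2 * (lapC K0 (- k2%:Z - k0%:Z - z) * M * N)) (K * t) t0.
rewrite U0 subr0 (tsumD q0 cq) ?(tsumZ q0 cq)//; [|exact: d2|exact: dominatedZ].
have -> : S (fun x => u x * v x + 0 * (lap u x * v x)) = S (fun x => u x * v x).
  by apply: eq_tsum => x; rewrite mul0r addr0.
move=> HH; rewrite expr2 mulrA addrAC; apply: HH.
- move=> r /andP[r0 rt] x.
  have -> : (fun r => flow u r x * v x + r * (lap u x * v x)) = v x *: ((flow u) ^~ x) + (lap u x * v x) *: id.
    by apply/funext => y; congr (_ + _); exact: mulrC.
  have -> : - (lap (flow u r) x * v x) + lap u x * v x = v x *: (- lap (flow u r) x) + (lap u x * v x) *: (1 : R).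
    by rewrite /GRing.scale /=; ring.
  by apply: is_deriveD; apply: is_deriveZ; exact: hd.
- move=> x y; apply: cvgD; first by apply: cvgM; [exact: hc|exact: cvg_cst].
  by apply: cvgM; [exact: (@continuous_subspaceT _ _ _ id (fun x => cvg_id))|exact: cvg_cst].
- move=> r /andP[r0 rt] x; rewrite (le_trans (ler_normD _ _))// normrN mulrAC mulr_natl mulr2n.
  have -> : lap u x = lap (flow u 0) x by rewrite U0.
  have r1 : 0 <= r <= 1 by rewrite (ltW r0) (le_trans (ltW rt)).
  have h0 : 0 <= (0 : R) <= 1 by rewrite lexx ler01.
  by have := H r r1 x; have := H 0 h0 x; lra.
- move=> r /andP[r0 rt].
  rewrite (tsumD q0 cq (dominatedN (dd r (ltW r0))) d0) (tsumN q0 cq (dd r (ltW r0))).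
  rewrite (lap_symS G) ?(lap_symS G ru mv)//; last exact/flow_rapid/ltW.
  rewrite -normrN opprD opprK; apply: le_trans (HK r _) _; first by rewrite (ltW r0) (le_trans (ltW rt)).
  by apply: ler_wpM2l => //; exact: ltW.
- by apply: dominatedD => //; exists 0 => x; rewrite mul0r normr0 mul0r.
Qed.

Lemma green_form_small u v : rapid u -> moderate v -> exists2 K, 0 <= K &
  forall t, 0 <= t <= 1 -> `|green_form t u v - t * S (fun x => u x * v x)| <= K * t ^+ 2.
Proof.
move=> ru mv; have [K K0' HK] := flow_lip ru mv; exists K => // t /andP[t0 t1].
have H r : 0 < r < t -> S (fun x => u x * v x) - K * t <= S (fun x => flow u r x * v x) <= S (fun x => u x * v x) + K * t.
  move=> /andP[r0 rt]; have r1 : 0 <= r <= 1 by rewrite (ltW r0) (le_trans (ltW rt)).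
  have : K * r <= K * t by apply: ler_wpM2l => //; exact: ltW.
  have := HK r r1; rewrite ler_norml => /andP[].
  move: (S _) (S _) (K * r) (K * t) => A B X Y; lra.
have h1 := @green_form_step _ _ _ _ _ _ _ _ _ _ _ G flow flowP u v _ _ _ ru mv (lexx 0) t0 (fun r hr => proj2 (andP (H r hr))).
have h2 := @green_form_stepN _ _ _ _ _ _ _ _ _ _ _ G flow flowP u v _ _ _ ru mv (lexx 0) t0 (fun r hr => proj1 (andP (H r hr))).
move: h1 h2; rewrite green_form0 !subr0 ler_norml => h1 h2.
exact: sandwich_sqr h1 h2.
Qed.

(** Since [2 G_t - G_2t = G_t (1 - P_t)], the first order in [t] cancels. The coefficient of
    [t ^+ 2] is what remains of [phase_shift] when [v] is rescaled by [t^-1]. The range stops at one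
    half because the times [r + t] must stay below 1. *)
Lemma green_form_small2 v : rapid v -> exists2 K, 0 <= K & forall t, 0 <= t <= 1 / 2 ->
  `|2 * green_form t v v - green_form (2 * t) v v - t ^+ 2 * S (fun x => lap v x * v x)| <= K * t ^+ 3.
Proof.
move=> rv; have mv := rapid_moderate rv.
have [K K0' HK] := flow_taylor rv mv; exists (5 * K); first exact: mulr_ge0.
move=> t /andP[t0 t1].
have rP := flow_rapid rv t0.
have mw : moderate (fun x => v x - flow v t x) by apply/rapid_moderate/(rapidB rv).
have E : 2 * green_form t v v - green_form (2 * t) v v = green_form t v (fun x => v x - flow v t x).
  rewrite (_ : 2 * t = t + t); last by ring.
  rewrite (green_form_add G flowP rv rv t0 t0).
  rewrite (green_formBr G flowP rv mv (rapid_moderate rP) t0).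
  rewrite (green_form_sym G flowP rP rv t0); ring.
rewrite E.
pose B := S (fun x => lap v x * v x).
have H r : 0 < r < t -> t * B - 5 * K * t ^+ 2 <= S (fun x => flow v r x * (v x - flow v t x)) <= t * B + 5 * K * t ^+ 2.
  move=> /andP[r0 rt]; have r1 : 0 <= r <= 1 by rewrite (ltW r0) (le_trans (ltW rt))//; exact: le_trans t1 (half_le1 R).
  have rt1 : 0 <= r + t <= 1 by rewrite addr_ge0 ?(ltW r0)//= [leRHS](splitr 1) lerD// (le_trans (ltW rt)).
  have -> : S (fun x => flow v r x * (v x - flow v t x)) = S (fun x => flow v r x * v x) - S (fun x => flow v (r + t) x * v x).
    have rr := flow_rapid rv (ltW r0).
    rewrite -(flow_comp G flowP rv (ltW r0) t0) (flow_sym G flowP rr rv t0) -(tsumB q0 cq).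
    - by apply: eq_tsum => x; rewrite mulrBr.
    - exact: (rapid_mul_dom G).
    - by apply: (rapid_mul_dom G) => //; exact: rapid_moderate.
  have r2 : K * r ^+ 2 <= K * t ^+ 2.
    by apply: ler_wpM2l => //; apply: lerXn2r; rewrite ?nnegrE ?(ltW r0) ?(ltW rt).
  have rt2 : K * (r + t) ^+ 2 <= K * (2 * t) ^+ 2.
    by apply: ler_wpM2l => //; apply: lerXn2r; rewrite ?nnegrE ?addr_ge0 ?mulr_ge0 ?(ltW r0)// mulr_natl mulr2n lerD2r ltW.
  have := HK _ r1; have := HK _ rt1; rewrite -/B !ler_norml => b1 b2.
  exact: taylor_difference r2 rt2 b1 b2.
have h1 := @green_form_step _ _ _ _ _ _ _ _ _ _ _ G flow flowP _ _ _ _ _ rv mw (lexx 0) t0 (fun r hr => proj2 (andP (H r hr))).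
have h2 := @green_form_stepN _ _ _ _ _ _ _ _ _ _ _ G flow flowP _ _ _ _ _ rv mw (lexx 0) t0 (fun r hr => proj1 (andP (H r hr))).
move: h1 h2; rewrite green_form0 !subr0 ler_norml -/B => h1 h2.
exact: sandwich_cube h1 h2.
Qed.

Variable tau : R.
Hypothesis tau0 : 0 < tau.

Definition dif (u : I -> R) x := u x - flow u tau x.
Definition difn k := iter k dif.

Lemma dif_rapid u : rapid u -> rapid (dif u).
Proof. by move=> ru; apply: rapidB => //; apply: flow_rapid => //; exact: ltW. Qed.

Lemma difn_rapid k u : rapid u -> rapid (difn k u).
Proof. by move=> ru; elim: k => //= k IH; exact: dif_rapid. Qed.

Lemma flow_dif u T : rapid u -> 0 <= T -> flow (dif u) T = dif (flow u T).
Proof.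
move=> ru T0; rewrite (flowB G flowP ru (flow_rapid ru (ltW tau0)) T0); apply/funext => x.
by rewrite /dif (flow_comp G flowP ru (ltW tau0) T0) (flow_comp G flowP ru T0 (ltW tau0)) [T + tau]addrC.
Qed.

(** Along steps of length [tau / 2], the squared norm of [flow (dif u)] is the second difference of
    the squared norms of [flow u], by the symmetry of the flow. Both decrease in time, so
    [second_difference_decay] applies; its index [4n] is the time [2n * tau]. *)
Lemma dif_decay u n T : rapid u -> (2 * n)%:R * tau <= T ->
  n%:R ^+ 2 * S (fun x => flow (dif u) T x ^+ 2) <= S (fun x => u x ^+ 2).
Proof.
move=> ru nT; pose h := tau / 2; have h0 : 0 <= h by rewrite /h divr_ge0// ltW.
pose m i := S (fun x => flow u (i%:R * h) x ^+ 2).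
have ih i : 0 <= i%:R * h by exact: mulr_ge0.
have iS i : i.+1%:R * h = i%:R * h + h by rewrite -natr1 mulrDl mul1r.
have rf i := flow_rapid ru (ih i).
have ds v : rapid v -> dominated q (fun x => v x ^+ 2).
  by move=> rv; apply: (dominated_le (rapid_sqr_dom G 0%N rv)) => x; rewrite expr0 mul1r.
have E2 i : S (fun x => flow (dif u) (i%:R * h) x ^+ 2) = m i - 2 * m i.+1 + m i.+2.
  have Ef : flow (dif u) (i%:R * h) = fun x => flow u (i%:R * h) x - flow u (i.+2%:R * h) x.
    rewrite flow_dif//; apply/funext => x; rewrite /dif (flow_comp G flowP)// ?(ltW tau0)//.
    by rewrite !iS /h -addrA -splitr.
  have Em : m i.+1 = S (fun x => flow u (i%:R * h) x * flow u (i.+2%:R * h) x).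
    rewrite /m !iS -[X in _ = S (fun x => _ * X x)](flow_comp G flowP ru (addr_ge0 (ih i) h0) h0).
    rewrite -(flow_sym G flowP (rf i))//; last by apply: flow_rapid => //; exact: addr_ge0.
    by rewrite (flow_comp G flowP)//; apply: eq_tsum => x; rewrite expr2.
  have d12 : dominated q (fun x => flow u (i%:R * h) x * flow u (i.+2%:R * h) x).
    by apply: (rapid_mul_dom G) => //; exact: rapid_moderate.
  rewrite Ef Em /m -(tsumZ q0 cq)// -(tsumB q0 cq)//; [|exact: ds|exact: dominatedZ].
  rewrite -(tsumD q0 cq); [|by apply: dominatedB; [exact: ds|exact: dominatedZ]|exact: ds].
  by apply: eq_tsum => x; ring.
have nn v s t : rapid v -> 0 <= s -> s <= t -> S (fun x => flow v t x ^+ 2) <= S (fun x => flow v s x ^+ 2).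
  by move=> *; exact: (flow_norm_nincr G flowP).
have ihS i : i%:R * h <= i.+1%:R * h by rewrite iS lerDl.
have rd := dif_rapid ru.
have := @second_difference_decay _ m n.
have m0E : m 0%N = S (fun x => u x ^+ 2) by rewrite /m mul0r (flow0 flowP ru).
rewrite -E2 m0E => H.
apply: (@le_trans _ _ (n%:R ^+ 2 * S (fun x => flow (dif u) ((4 * n)%:R * h) x ^+ 2))).
  apply: ler_wpM2l; first exact: exprn_ge0.
  apply: nn => //; apply: le_trans nT.
  by rewrite /h !natrM (_ : 4%:R * n%:R * (tau / 2) = 2%:R * n%:R * tau)//; field.
apply: H => [i|i|i|i].
- by apply: (tsum_ge0 q0 cq) => [|x]; [exact: ds|exact: sqr_ge0].
- exact: nn.
- rewrite -E2; apply: (tsum_ge0 q0 cq) => [|x]; [apply: ds; exact: flow_rapid|exact: sqr_ge0].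
- by rewrite -!E2; exact: nn.
Qed.

(** Each difference spends a time [2n * tau] and gains [n ^+ 2]; the differences commute with the
    flow, so the costs add. *)
Lemma difn_decay k u n T : rapid u -> (2 * n * k)%:R * tau <= T ->
  n%:R ^+ (2 * k) * S (fun x => flow (difn k u) T x ^+ 2) <= S (fun x => u x ^+ 2).
Proof.
move=> ru; elim: k T => [|k IH] T nT.
  rewrite expr0 mul1r /=; apply: (flow_contract G flowP) => //.
  by move: nT; rewrite muln0 mul0r.
have n0 : 0 <= (2 * n)%:R * tau by rewrite mulr_ge0// ltW.
have k00 : 0 <= (2 * n * k)%:R * tau by rewrite mulr_ge0// ltW.
have E : (2 * n * k.+1)%:R * tau = (2 * n)%:R * tau + (2 * n * k)%:R * tau.
  by rewrite mulnS natrD mulrDl.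
pose T' := T - (2 * n)%:R * tau.
have T'0 : (2 * n * k)%:R * tau <= T' by rewrite /T'; lra.
have T'ge := le_trans k00 T'0.
have rk := difn_rapid k ru.
have -> : flow (difn k.+1 u) T = flow (dif (flow (difn k u) T')) ((2 * n)%:R * tau).
  rewrite -flow_dif// (flow_comp G flowP) ?subrK//; exact: dif_rapid.
apply: le_trans (IH T' T'0).
rewrite mulnS exprD mulrAC mulrC; apply: ler_wpM2l; first exact: exprn_ge0.
by apply: dif_decay => //; exact: flow_rapid.
Qed.

Lemma difn_vanishes (z : int) N : 0 <= N -> exists k, forall u, rapid u ->
  forall eps, 0 < eps -> exists2 T0, 0 <= T0 & forall T, T0 <= T ->
  forall f, bnd N z f -> `|S (fun x => flow (difn k u) T x * f x)| <= eps.
Proof.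
have zj : z <= `|z|%N%:Z by lia.
have k2n : - k2%:Z <= 0 by lia.
(* [j] powers of the weight absorb the growth of [f] and leave [q] for the summation; one more
   difference than that suffices, because each gains two powers of [T]. *)
move=> N0; pose j := (`|z|%N + k2)%N; exists j.+1 => u ru; set k := j.+1.
have rk := difn_rapid k ru.
have [C C0 HC] := flow_growth G flowP (2 * j)%N rk.
pose c := 1 + (4 * k)%:R * tau.
have c0 : 0 <= c by rewrite addr_ge0// mulr_ge0// ltW.
pose A := S (fun x => u x ^+ 2).
have sqd v : rapid v -> dominated q (fun x => v x ^+ 2).
  by move=> rv; apply: (dominated_le (rapid_sqr_dom G 0%N rv)) => x; rewrite expr0 mul1r.
have A0 : 0 <= A by apply: (tsum_ge0 q0 cq) => [|x]; [exact: sqd|exact: sqr_ge0].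
pose C' := c ^+ (2 * k) * A + C.
have C'0 : 0 <= C' by rewrite addr_ge0// mulr_ge0// exprn_ge0.
have key T : (2 * k)%:R * tau <= T -> S (fun x => (a x ^+ j * flow (difn k u) T x) ^+ 2) <= C' / (1 + T).
  move=> kT; have kt0 : 0 < (2 * k)%:R * tau by rewrite mulr_gt0// ltr0n.
  have T0 : 0 < T by exact: lt_le_trans kt0 kT.
  have T1 : 0 < 1 + T by lra.
  have rh := flow_rapid rk (ltW T0).
  (* The largest [n] for which [difn_decay] applies at time [T]; it is at least a constant times
     [1 + T]. *)
  pose n := Num.truncn (T / ((2 * k)%:R * tau)).
  have := truncn_itv (divr_ge0 (ltW T0) (ltW kt0)); rewrite -/n => /andP[n1 n2].
  have nT : (2 * n * k)%:R * tau <= T.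
    by move: n1; rewrite ler_pdivlMr// (_ : (2 * n * k)%:R * tau = n%:R * ((2 * k)%:R * tau))// !natrM; ring.
  have ngt0 : (0 < n)%N.
    by rewrite -ltnS -(ltr_nat R); apply: le_lt_trans n2; rewrite ler_pdivlMr// mul1r.
  have nr1 : 1 <= n%:R :> R by rewrite ler1n.
  have Tc : 1 + T <= n%:R * c.
    have : T < n.+1%:R * ((2 * k)%:R * tau) by move: n2; rewrite ltr_pdivrMr.
    rewrite /c !natrM -natr1; set x := n%:R; set y := k%:R * tau.
    have y0 : 0 <= y by rewrite mulr_ge0// ltW.
    have : 0 <= (x - 1) * y by rewrite mulr_ge0// subr_ge0.
    rewrite /y; nra.
  have h1 : S (fun x => flow (difn k u) T x ^+ 2) <= (c / (1 + T)) ^+ (2 * k) * A.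
    have := difn_decay ru nT; rewrite -/A => h.
    have nk0 : 0 < n%:R ^+ (2 * k) :> R by rewrite exprn_gt0// ltr0n.
    rewrite -ler_pdivlMl// in h; apply: (le_trans h); apply: ler_wpM2r => //.
    rewrite -exprVn; apply: lerXn2r; rewrite ?nnegrE ?invr_ge0 ?divr_ge0 ?(ltW T1)//.
    by rewrite ler_pdivlMr// mulrC ler_pdivrMr ?ltr0n// mulrC.
  (* Interpolation [a^(2j) <= L + a^(4j) / L]. The energy without weight is of order [T^(-2j-2)] and
     the one with weight [a^(2j)] of order [T^(2j)], so this [L] makes both terms of order
     [1 / T]. *)
  pose L := (1 + T) ^+ (2 * j).+1.
  have L0 : 0 < L by rewrite exprn_gt0.
  have rj i := rapid_sqr_dom G i rh.
  apply: (@le_trans _ _ (L * S (fun x => flow (difn k u) T x ^+ 2) + L^-1 * S (fun x => (a x ^+ (2 * j) * flow (difn k u) T x) ^+ 2))).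
    rewrite -!(tsumZ q0 cq)//; [|exact: sqd].
    rewrite -(tsumD q0 cq); [|by apply: dominatedZ; exact: sqd|exact: dominatedZ].
    apply: (ler_tsum q0 cq) => //; first by apply: dominatedD; apply: dominatedZ => //; exact: sqd.
    move=> x; set y := flow _ _ x; have -> : a x ^+ (2 * j) = (a x ^+ j) ^+ 2 by rewrite mulnC exprM.
    have b0 : 0 <= (a x ^+ j) ^+ 2 by exact: sqr_ge0.
    rewrite -subr_ge0 (_ : _ - _ = L^-1 * ((L - (a x ^+ j) ^+ 2) ^+ 2 + L * (a x ^+ j) ^+ 2) * y ^+ 2); last first.
      by field; rewrite gt_eqF.
    apply: mulr_ge0; last exact: sqr_ge0.
    apply: mulr_ge0; first by rewrite invr_ge0 ltW.
    by apply: addr_ge0; [exact: sqr_ge0|apply: mulr_ge0 => //; exact: ltW].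
  rewrite /C' mulrDl; apply: lerD.
    apply: le_trans (ler_wpM2l (ltW L0) h1) _.
    rewrite /L /k mulnS add2n.
    rewrite le_eqVlt; apply/orP; left; apply/eqP.
    rewrite expr_div_n [(1 + T) ^+ (2 * j).+2]exprS; field.
    by rewrite expf_neq0 ?gt_eqF.
  have := HC T (ltW T0) => h2.
  rewrite mulrC ler_pdivrMr// (le_trans h2)// /L exprS mulrA divfK// gt_eqF//.
move=> eps eps0.
(* The parameter of a Young inequality: the term with [q] sums to at most half of [eps], and the
   other one is divided by [rho] but vanishes with [T]. *)
pose rho := eps / (N * S q + 1).
have Nq : 0 <= N * S q by rewrite mulr_ge0.
have rho0 : 0 < rho by rewrite divr_gt0// ltr_wpDl.
exists (Num.max ((2 * k)%:R * tau) (N * C' / (rho * eps))).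
  by rewrite le_max; apply/orP; left; rewrite mulr_ge0// ltW.
move=> T; rewrite ge_max => /andP[T1 T2] f Hf.
have kt0 : 0 < (2 * k)%:R * tau by rewrite mulr_gt0// ltr0n.
have T0 : 0 < T by exact: lt_le_trans kt0 T1.
have rh := flow_rapid rk (ltW T0).
have hk := key T T1.
have rj := rapid_sqr_dom G j rh.
set h := flow (difn k u) T in hk rh rj *.
have b1 x : `|h x * f x| <= 2^-1 * N * rho * q x + 2^-1 * N / rho * (a x ^+ j * h x) ^+ 2.
  have ax := a_gt0 G x; have qx := q0 x.
  rewrite normrM; apply: (@le_trans _ _ (N * (`|h x| * a x ^+ `|z|%N))).
    rewrite [N * _]mulrCA; apply: ler_wpM2l => //; apply: (le_trans (Hf x)); apply: ler_wpM2l => //.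
    by rewrite exprnP; exact: (az_le G).
  have Eq : a x ^+ j * `|h x| * q x = `|h x| * a x ^+ `|z|%N.
    rewrite /j exprD /q -exprnN -!mulrA mulrC mulrA; field.
    by rewrite expf_neq0// gt_eqF.
  have q1 : q x <= 1.
    by rewrite /q -[leRHS](expr0z (a x)); exact: (az_le G).
  rewrite -Eq; set y := a x ^+ j * `|h x|.
  have -> : (a x ^+ j * h x) ^+ 2 = y ^+ 2 by rewrite !exprMn real_normK// num_real.
  have : 0 <= (rho - y) ^+ 2 by exact: sqr_ge0.
  have y0 : 0 <= y by rewrite mulr_ge0// exprn_ge0// ltW.
  have -> : 2^-1 * N * rho * q x + 2^-1 * N / rho * y ^+ 2 = N * (y * q x) + 2^-1 * N * (rho^-1 * (q x * (rho - y) ^+ 2 + (1 - q x) * y ^+ 2)).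
    by field; rewrite gt_eqF.
  move=> h2; rewrite lerDl; apply: mulr_ge0; first by rewrite mulr_ge0.
  apply: mulr_ge0; first by rewrite invr_ge0 ltW.
  by rewrite addr_ge0// mulr_ge0 ?sqr_ge0 ?subr_ge0// ltW.
have dq : dominated q q by exists 1 => x; rewrite mul1r gtr0_norm.
have hb : `|S (fun x => h x * f x)| <= 2^-1 * N * rho * S q + 2^-1 * N / rho * S (fun x => (a x ^+ j * h x) ^+ 2).
  have dh : dominated q (fun x => h x * f x) by apply: (rapid_mul_dom G) => //; exists z, N.
  have db : dominated q (fun x => 2^-1 * N * rho * q x + 2^-1 * N / rho * (a x ^+ j * h x) ^+ 2).
    by apply: dominatedD; exact: dominatedZ.
  rewrite -!(tsumZ q0 cq)// -(tsumD q0 cq); try exact: dominatedZ.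
  rewrite ler_norml -(tsumN q0 cq)//; apply/andP; split; apply: (ler_tsum q0 cq) => //.
  - exact: dominatedN.
  - by move=> x; have := b1 x; rewrite ler_norml => /andP[].
  - by move=> x; have := b1 x; rewrite ler_norml => /andP[].
apply: (le_trans hb).
have p1 : 2^-1 * N * rho * S q <= 2^-1 * eps.
  rewrite -!mulrA; apply: ler_wpM2l => //; rewrite /rho.
  rewrite (_ : N * (eps * ((N * S q + 1)^-1 * S q)) = eps * (N * S q / (N * S q + 1))); last by ring.
  by rewrite ler_piMr ?(ltW eps0)// ler_pdivrMr ?ltr_wpDl// mul1r lerDl.
have p2 : 2^-1 * N / rho * S (fun x => (a x ^+ j * h x) ^+ 2) <= 2^-1 * eps.
  have nr : 0 <= 2^-1 * N / rho by apply: divr_ge0; [exact: mulr_ge0|exact: ltW].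
  apply: (le_trans (ler_wpM2l nr hk)).
  rewrite (_ : 2^-1 * N / rho * (C' / (1 + T)) = 2^-1 * (N * C' / rho / (1 + T))); last first.
    by field; rewrite !gt_eqF// ltr_wpDl// ltW.
  apply: ler_wpM2l => //; rewrite ler_pdivrMr; last by lra.
  move: T2; rewrite invfM mulrA ler_pdivrMr// => T2.
  by apply: (le_trans T2); rewrite mulrC; apply: ler_wpM2l; [exact: ltW|rewrite lerDr].
lra.
Qed.

End Decay.

(** * Expectations and characteristic functionals *)

Section Expectation.
Context {d : measure_display} {T : measurableType d} {R : realType} (P : probability T R).

Definition bounded_mfun (h : T -> R) := measurable_fun setT h /\ exists M, forall x, `|h x| <= M.

Local Notation EE h := (\int[P]_x h x)%R.

Lemma bm_integrable h : bounded_mfun h -> P.-integrable setT (EFin \o h).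
Proof.
move=> [mh [M HM]]; apply: measurable_bounded_integrable => //.
  by rewrite ltey_eq fin_num_measure.
exists M; split; first exact: num_real.
by move=> x Mx y _; exact: le_trans (HM y) (ltW Mx).
Qed.

Lemma bm_cst c : bounded_mfun (fun=> c).
Proof. by split => //; exists `|c|. Qed.

Lemma bmD f g : bounded_mfun f -> bounded_mfun g -> bounded_mfun (fun x => f x + g x).
Proof.
move=> [mf [M HM]] [mg [N HN]]; split; first exact: measurable_funD.
by exists (M + N) => x; rewrite (le_trans (ler_normD _ _))// lerD.
Qed.

Lemma bmM f g : bounded_mfun f -> bounded_mfun g -> bounded_mfun (fun x => f x * g x).
Proof.
move=> [mf [M HM]] [mg [N HN]]; split; first exact: measurable_funM.
by exists (M * N) => x; rewrite normrM; apply: ler_pM.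
Qed.

Lemma bmZ c f : bounded_mfun f -> bounded_mfun (fun x => c * f x).
Proof. by move=> bf; apply: bmM => //; exact: bm_cst. Qed.

Lemma bmN f : bounded_mfun f -> bounded_mfun (fun x => - f x).
Proof. by move=> bf; under eq_fun do rewrite -mulN1r; exact: bmZ. Qed.

Lemma bmB f g : bounded_mfun f -> bounded_mfun g -> bounded_mfun (fun x => f x - g x).
Proof. by move=> bf bg; apply: bmD => //; exact: bmN. Qed.

Lemma bm_cos f : measurable_fun setT f -> bounded_mfun (fun x => cos (f x)).
Proof.
move=> mf; split; last by exists 1 => x; rewrite ler_norml cos_geN1 cos_le1.
by apply: (measurableT_comp _ mf); apply: continuous_measurable_fun; exact: continuous_cos.
Qed.

Lemma bm_indic (A : set T) : measurable A -> bounded_mfun (\1_A : T -> R).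
Proof.
move=> mA; split; first exact: measurable_indic.
by exists 1 => x; rewrite indicE; case: (_ \in _); rewrite ?normr1 ?normr0.
Qed.

Lemma expD f g : bounded_mfun f -> bounded_mfun g -> EE (fun x => f x + g x) = EE f + EE g.
Proof. by move=> /bm_integrable bf /bm_integrable bg; rewrite -RintegralD. Qed.

Lemma expB f g : bounded_mfun f -> bounded_mfun g -> EE (fun x => f x - g x) = EE f - EE g.
Proof. by move=> /bm_integrable bf /bm_integrable bg; rewrite -RintegralB. Qed.

Lemma expZ c f : bounded_mfun f -> EE (fun x => c * f x) = c * EE f.
Proof. by move=> /bm_integrable bf; rewrite -RintegralZl. Qed.

Lemma exp_cst c : EE (fun=> c) = c.
Proof. by have := @Rintegral_cst _ _ _ P _ measurableT c => /= ->; rewrite probability_setT mulr1. Qed.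

Lemma exp_le f g : bounded_mfun f -> bounded_mfun g -> (forall x, f x <= g x) -> EE f <= EE g.
Proof. by move=> /bm_integrable bf /bm_integrable bg fg; apply: le_Rintegral. Qed.

Lemma exp_norm f g : bounded_mfun f -> bounded_mfun g -> (forall x, `|f x| <= g x) -> `|EE f| <= EE g.
Proof.
move=> bf bg fg; rewrite ler_norml; apply/andP; split.
  have -> : - EE g = EE (fun x => -1 * g x) by rewrite expZ// mulN1r.
  apply: exp_le => //; first exact: bmZ.
  by move=> x; have := fg x; rewrite mulN1r ler_norml => /andP[].
by apply: exp_le => // x; exact: le_trans (ler_norm _) (fg x).
Qed.

Lemma exp_ge0 f : (forall x, 0 <= f x) -> 0 <= EE f.
Proof. by move=> f0; exact: Rintegral_ge0. Qed.

Lemma exp_indic (A : set T) : measurable A -> EE (\1_A) = fine (P A).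
Proof. by move=> mA; rewrite /Rintegral integral_indic// setIT. Qed.

Lemma exp_cvg (h : nat -> T -> R) (f : T -> R) M : (forall n, measurable_fun setT (h n)) ->
  measurable_fun setT f -> (forall n x, `|h n x| <= M) ->
  {ae P, forall x, h n x @[n --> \oo] --> f x} ->
  EE (h n) @[n --> \oo] --> EE f.
Proof.
move=> mh mf hM hf.
have [|||||iF _ cF] := @dominated_convergence _ _ _ P setT measurableT (fun n => EFin \o h n) (EFin \o f) (EFin \o (cst M)).
- by move=> n; exact/measurable_EFinP.
- exact/measurable_EFinP.
- by apply: filterS hf => x hx _; apply: cvg_EFin => //; exact: nearW.
- exact: bm_integrable (bm_cst M).
- by apply: aeW => x n _; rewrite lee_fin.
have fE : (\int[P]_x (f x)%:E)%E = (EE f)%:E.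
  by rewrite /Rintegral fineK//; exact: integrable_fin_num.
rewrite /Rintegral; apply: fine_cvg; rewrite fineK//; exact: integrable_fin_num.
Qed.

Lemma exp_ae_eq f g : measurable_fun setT f -> measurable_fun setT g ->
  {ae P, forall x, f x = g x} -> EE f = EE g.
Proof.
move=> mf mg fg; rewrite /Rintegral; congr fine.
apply: ae_eq_integral => //; [exact/measurable_EFinP|exact/measurable_EFinP|].
by apply: filterS fg => x /= ->.
Qed.

End Expectation.

Lemma bernoulli_ge {R : realType} (t : R) n : 0 <= t -> 1 + n%:R * t <= (1 + t) ^+ n.
Proof.
move=> t0; elim: n => [|n IH]; first by rewrite mul0r addr0 expr0.
rewrite exprS; apply: (@le_trans _ _ ((1 + t) * (1 + n%:R * t))).
  have : 0 <= n%:R * t * t by rewrite !mulr_ge0.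
  by rewrite -natr1; lra.
by apply: ler_wpM2l => //; rewrite addr_ge0.
Qed.

Lemma bernoulli_le {R : realType} (t : R) n : 0 <= t <= 1 -> 1 - n%:R * t <= (1 - t) ^+ n.
Proof.
move=> /andP[t0 t1]; elim: n => [|n IH]; first by rewrite mul0r subr0 expr0.
rewrite exprS; apply: (@le_trans _ _ ((1 - t) * (1 - n%:R * t))).
  have : 0 <= n%:R * t * t by rewrite !mulr_ge0.
  by rewrite -natr1; lra.
by apply: ler_wpM2l => //; rewrite subr_ge0.
Qed.

Lemma bernoulli_inv {R : realType} (t : R) n : 0 <= t <= 1 -> (1 - t) ^+ n <= (1 + n%:R * t)^-1.
Proof.
move=> /andP[t0 t1]; have p : 0 < 1 + n%:R * t by rewrite ltr_wpDr// mulr_ge0.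
rewrite -[leLHS]mul1r -[leRHS]mul1r ler_pdivlMr// mulrAC mul1r.
apply: (@le_trans _ _ ((1 + t) ^+ n * (1 - t) ^+ n)).
  by apply: ler_wpM2r; rewrite ?bernoulli_ge// exprn_ge0// subr_ge0.
rewrite -exprMn (_ : (1 + t) * (1 - t) = 1 - t ^+ 2); last by ring.
apply: exprn_ile1; first by rewrite subr_ge0 exprn_ile1.
by rewrite lerBlDr lerDl sqr_ge0.
Qed.

Lemma cvg_mul_expr {R : realType} (r : R) : 0 <= r -> r < 1 -> n%:R * r ^+ n @[n --> \oo] --> (0 : R).
Proof.
move=> r0 r1; pose s := Num.sqrt r.
have s0 : 0 <= s by exact: sqrtr_ge0.
have s1 : s < 1 by rewrite -[ltRHS]sqrtr1 ltr_sqrt.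
have rs : r = s ^+ 2 by rewrite sqr_sqrtr.
have B n : n%:R * s ^+ n <= (1 - s)^-1.
  rewrite -[leRHS]mul1r ler_pdivlMr ?subr_gt0//.
  elim: n => [|n IH]; first by rewrite !mul0r.
  apply: (@le_trans _ _ (s * (n%:R * s ^+ n * (1 - s)) + s ^+ n.+1 * (1 - s))).
    by rewrite -natr1 exprS le_eqVlt; apply/orP; left; apply/eqP; ring.
  have : s * (n%:R * s ^+ n * (1 - s)) <= s * 1 by apply: ler_wpM2l.
  have : s ^+ n.+1 * (1 - s) <= 1 * (1 - s).
    by apply: ler_wpM2r; [rewrite subr_ge0 ltW|apply: exprn_ile1 => //; exact: ltW].
  lra.
apply: (@squeeze_cvgr _ _ _ _ (cst 0) (fun n => (1 - s)^-1 * s ^+ n)).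
- near=> n; rewrite mulr_ge0 ?exprn_ge0//= rs -exprM mulnC exprM expr2 mulrA.
  by apply: ler_wpM2r; [exact: exprn_ge0|exact: B].
- exact: cvg_cst.
- by have := @cvg_geometric R (1 - s)^-1 s; rewrite ger0_norm// => /(_ s1).
Unshelve. all: by end_near. Qed.

(** Polynomials in [x] approximating a step, as in elementary proofs of the Weierstrass theorem. By
    the Bernoulli inequalities everything depends on whether [n * (2x)^n] tends to 0 or is at least
    [n]. *)
Lemma cvg_step {R : realType} (x : R) : 0 <= x <= 1 ->
  (1 - x ^+ n) ^+ (n * 2 ^ n) @[n --> \oo] --> (if x < 2^-1 then 1 else 0 : R).
Proof.
move=> /andP[x0 x1].
have t1 n : 0 <= x ^+ n <= 1 by rewrite exprn_ge0// exprn_ile1.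
case: ltrP => x2.
  apply: (@squeeze_cvgr _ _ _ _ (fun n => 1 - n%:R * (2 * x) ^+ n) (cst 1)).
  - near=> n; apply/andP; split.
      apply: le_trans (bernoulli_le _ (t1 n)).
      by rewrite natrM natrX exprMn mulrA.
    by apply: exprn_ile1; have := t1 n; lra.
  - rewrite -[X in _ --> X]subr0; apply: cvgB; first exact: cvg_cst.
    by apply: cvg_mul_expr; lra.
  - exact: cvg_cst.
apply: (@squeeze_cvgr _ _ _ _ (cst 0) (fun n => n.+1%:R^-1)).
- near=> n; apply/andP; split; first by rewrite exprn_ge0// subr_ge0; case/andP: (t1 n).
  apply: (le_trans (bernoulli_inv _ (t1 n))).
  rewrite lef_pV2 ?posrE ?ltr0n//; last first.
    by rewrite ltr_wpDr// mulr_ge0//; case/andP: (t1 n).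
  rewrite -natr1 addrC lerD2l natrM natrX -mulrA -exprMn ler_peMr// exprn_ege1//; lra.
- exact: cvg_cst.
- exact: cvg_harmonic.
Unshelve. all: by end_near. Qed.

(** * Characteristic functions determine a law on configurations *)

Section CharacteristicFunction.
Context {R : realType} {d : nat} {C : set 'rV[int]_d}.
Local Notation conf := (configuration R C).

Definition lincomb (l : seq (C * R)) (f : C -> R) : R := \sum_(p <- l) p.2 * f p.1.

Lemma measurable_coord (x : C) : measurable_fun setT (fun f : conf => f x).
Proof.
move=> _ Y mY; apply: sub_sigma_algebra; exists x => //.
by exists Y => //; rewrite setTI.
Qed.

Lemma measurable_to_conf dT (T : measurableType dT) (z : T -> conf) :
  (forall x, measurable_fun setT (fun o => z o x)) -> measurable_fun setT z.
Proof.
move=> mz; apply: (@measurability _ _ _ _ setT z (coordinate_sets setT)) => //.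
move=> _ [_ [x _ [Y mY <-]] <-]; rewrite setTI.
have := mz x measurableT Y mY; rewrite setTI.
by congr measurable; apply/seteqP; split => o /=; [split|case].
Qed.

Lemma measurable_lincomb l : measurable_fun setT (lincomb l : conf -> R).
Proof.
rewrite /lincomb; apply: measurable_sum => p.
by apply: measurable_funM => //; exact: measurable_coord.
Qed.

(** A real phase [a] replaces the complex exponential: the phases 0 and [- pi / 2] give the real and
    imaginary parts. *)
Definition char_fun (m : probability conf R) (l : seq (C * R)) (a : R) : R :=
  \int[m]_f cos (lincomb l f + a).

Variables m1 m2 : probability conf R.
Hypothesis m12 : forall l a, char_fun m1 l a = char_fun m2 l a.

(** The multipliers that do not distinguish the two measures. The quantifiers over [l] and [a] make
    the class stable under multiplication by a cosine of a coordinate, through the product formula;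
    it is also stable under linear combinations and bounded limits. *)
Let test (k : conf -> R) := bounded_mfun k /\ forall l a,
  \int[m1]_f (k f * cos (lincomb l f + a)) = \int[m2]_f (k f * cos (lincomb l f + a)).

Let bmcos l a : bounded_mfun (fun f : conf => cos (lincomb l f + a)).
Proof. by apply: bm_cos; apply: measurable_funD => //; exact: measurable_lincomb. Qed.

Let test1 : test (fun=> 1).
Proof.
split; first exact: bm_cst.
by move=> l a; have := m12 l a; rewrite /char_fun; under eq_Rintegral do rewrite -[cos _]mul1r;
  under [X in _ = X -> _]eq_Rintegral do rewrite -[cos _]mul1r.
Qed.

Let test_lin c k k' : test k -> test k' -> test (fun f => c * k f + k' f).
Proof.
move=> [bk kE] [bk' kE']; split; first by apply: bmD => //; exact: bmZ.
move=> l a.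
have E (m : probability conf R) : \int[m]_f ((c * k f + k' f) * cos (lincomb l f + a)) =
  c * \int[m]_f (k f * cos (lincomb l f + a)) + \int[m]_f (k' f * cos (lincomb l f + a)).
  rewrite -expZ; last exact: bmM.
  rewrite -expD; [|by apply: bmZ; exact: bmM|exact: bmM].
  by apply: eq_Rintegral => f _; rewrite mulrDl mulrA.
by rewrite !E kE kE'.
Qed.

Let test_cos k x s b : test k -> test (fun f => k f * cos (s * f x + b)).
Proof.
move=> [bk kE]; split.
  apply: bmM => //; apply: bm_cos; apply: measurable_funD => //.
  by apply: measurable_funM => //; exact: measurable_coord.
move=> l a.
have E (m : probability conf R) : \int[m]_f (k f * cos (s * f x + b) * cos (lincomb l f + a)) =
  2^-1 * (\int[m]_f (k f * cos (lincomb ((x, s) :: l) f + (a + b))) +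
          \int[m]_f (k f * cos (lincomb ((x, - s) :: l) f + (a - b)))).
  rewrite -expD; [|exact: bmM|exact: bmM].
  rewrite -expZ; last by apply: bmD; exact: bmM.
  apply: eq_Rintegral => f _; rewrite /lincomb !big_cons /=.
  set L := \sum_(_ <- _) _.
  rewrite (_ : s * f x + L + (a + b) = (L + a) + (s * f x + b)); last by ring.
  rewrite (_ : - s * f x + L + (a - b) = (L + a) - (s * f x + b)); last by ring.
  move: (s * f x + b) (L + a) => u v; by rewrite cosB cosD; field.
by rewrite !E !kE.
Qed.

Let test_lim (k : nat -> conf -> R) k' M : (forall n, test (k n)) -> (forall n f, `|k n f| <= M) ->
  (forall f, k n f @[n --> \oo] --> k' f) -> test k'.
Proof.
move=> tk kM kk.
have mk' : measurable_fun setT k' by apply: (measurable_fun_cvg (fun n => (tk n).1.1)) => f _; exact: kk.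
have bk' : bounded_mfun k'.
  split=> //; exists M => f; apply: (ler_cvg_to (cvg_norm (kk f)) (cvg_cst _)); exact: nearW.
split=> // l a.
have E (m : probability conf R) : \int[m]_f (k n f * cos (lincomb l f + a)) @[n --> \oo] -->
    \int[m]_f (k' f * cos (lincomb l f + a)).
  apply: (@exp_cvg _ _ _ m _ _ M).
  - by move=> n; apply: measurable_funM; [exact: (tk n).1.1|exact: (bmcos l a).1].
  - by apply: measurable_funM => //; exact: (bmcos l a).1.
  - move=> n f; rewrite normrM -[leRHS]mulr1; apply: ler_pM => //.
    by rewrite ler_norml cos_geN1 cos_le1.
  - by apply: aeW => f; apply: cvgM => //; exact: cvg_cst.
have EE : (fun n => \int[m1]_f (k n f * cos (lincomb l f + a))) =
    (fun n => \int[m2]_f (k n f * cos (lincomb l f + a))) by apply/funext => n; rewrite (tk n).2.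
by have := E m1; rewrite EE => E1; exact: (cvg_unique _ E1 (E m2)).
Qed.

Let test_halfline k x p : test k -> test (fun f => k f * (if p < f x then 1 else 0)).
Proof.
move=> tk; have [[mk [M HM]] _] := tk.
(* The phase makes this [1/2 - 1/2 sin ((f x - p) / j.+1)]: affine in a cosine of [f x], with values
   in [[0, 1]], and below one half exactly when the sine is positive. The powers from [cvg_step]
   then detect that sign. *)
pose y j (f : conf) := 2^-1 + - 2^-1 * cos (j.+1%:R^-1 * f x + (- (j.+1%:R^-1 * p) - pi / 2)).
have y01 j f : 0 <= y j f <= 1.
  have h1 := cos_le1 (j.+1%:R^-1 * f x + (- (j.+1%:R^-1 * p) - pi / 2)).
  have h2 := cos_geN1 (j.+1%:R^-1 * f x + (- (j.+1%:R^-1 * p) - pi / 2)).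
  by rewrite /y; apply/andP; split; lra.
have ty j h : test h -> test (fun f => h f * y j f).
  move=> th; have := test_lin (- 2^-1) (test_cos x j.+1%:R^-1 (- (j.+1%:R^-1 * p) - pi / 2) th)
     (test_lin 2^-1 th (test_lin (-1) th th)).
  by congr test; apply/funext => f; rewrite /y; ring.
have tyn j n h : test h -> test (fun f => h f * y j f ^+ n).
  move=> th; elim: n => [|n IH]; first by under eq_fun do rewrite expr0 mulr1.
  by under eq_fun do rewrite exprSr mulrA; exact: ty.
have typ j n m h : test h -> test (fun f => h f * (1 - y j f ^+ n) ^+ m).
  move=> th; elim: m => [|m IH]; first by under eq_fun do rewrite expr0 mulr1.
  have := test_lin (-1) (tyn j n _ IH) IH.
  by congr test; apply/funext => f; rewrite exprSr; ring.
have ts j : test (fun f => k f * (if y j f < 2^-1 then 1 else 0)).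
  apply: (@test_lim (fun n f => k f * (1 - y j f ^+ n) ^+ (n * 2 ^ n)) _ M).
  - by move=> n; exact: typ.
  - move=> n f; rewrite normrM -[leRHS]mulr1; apply: ler_pM => //.
    have /andP[h0 h1] := y01 j f.
    have h2 : 0 <= y j f ^+ n <= 1 by rewrite exprn_ge0// exprn_ile1.
    by rewrite normrX exprn_ile1// ger0_norm; case/andP: h2 => *; rewrite ?subr_ge0// lerBlDr lerDl.
  - by move=> f; apply: cvgM; [exact: cvg_cst|exact: cvg_step].
apply: (@test_lim (fun j f => k f * (if y j f < 2^-1 then 1 else 0)) _ M) => //.
- move=> j f; case: ifP => _; rewrite ?mulr1// mulr0 normr0; exact: le_trans (normr_ge0 _) (HM f).
move=> f; apply: cvgM; first exact: cvg_cst.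
have yE j : y j f = 2^-1 - 2^-1 * sin ((f x - p) / j.+1%:R).
  rewrite /y mulNr; congr (_ - _ * _).
  rewrite (_ : j.+1%:R^-1 * f x + _ = (f x - p) / j.+1%:R - pi / 2); last by ring.
  by rewrite cosB cos_pihalf sin_pihalf mulr0 add0r mulr1.
(* As soon as [|f x - p| < j.+1 * pi], the sine has the sign of [f x - p], so the sequence is
   eventually constant. *)
apply: cvg_near_cst; near=> j.
have j0 : 0 < j.+1%:R :> R by rewrite ltr0n.
have jb : `|f x - p| < j.+1%:R * pi.
  rewrite -ltr_pdivrMr ?pi_gt0//; near: j.
  exists (Num.bound (`|f x - p| / pi)) => // n /= bn.
  apply: lt_le_trans (archi_boundP _) _; first by rewrite divr_ge0// ltW// pi_gt0.
  by rewrite ler_nat (leq_trans bn).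
rewrite yE; congr (if _ then _ else _).
rewrite gtrBl; have [fp|fp|->] := ltrgtP p (f x).
- rewrite pmulr_rgt0//; apply: sin_gt0_pi; rewrite divr_gt0 ?subr_gt0//=.
  by rewrite ltr_pdivrMr// mulrC (le_lt_trans _ jb)// ler_norm.
- apply/negbTE; rewrite -leNgt pmulr_rle0// -oppr_ge0 -sinN -mulNr opprB ltW//.
  apply: sin_gt0_pi; rewrite divr_gt0 ?subr_gt0//=.
  by rewrite ltr_pdivrMr// mulrC (le_lt_trans _ jb)// distrC ler_norm.
- by rewrite subrr mul0r sin0 mulr0 ltxx.
Unshelve. all: by end_near. Qed.

(** Products of half-lines are a generating class stable under intersection; their indicators are
    admissible multipliers, and the cosine with no coordinates and phase 0 is 1. *)
Lemma char_fun_inj B : measurable B -> m1 B = m2 B.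
Proof.
pose rays (l : seq (C * R)) : set conf := [set f | all (fun p => p.2 < f p.1) l].
have tr l : test (\1_(rays l)).
  elim: l => [|p l IH].
    have -> : \1_(rays [::]) = (fun=> 1) :> (conf -> R); last exact: test1.
    by apply/funext => f; rewrite indicE (_ : f \in _)//; apply/mem_set.
  have := test_halfline p.1 p.2 IH; congr test; apply/funext => f.
  rewrite !indicE; case: (boolP (f \in rays (p :: l))) => [/set_mem/=/andP[-> h]|h].
    by rewrite mulr1 mem_set.
  case: ltP => h1; last by rewrite mulr0.
  rewrite mulr1 (_ : (f \in rays l) = false)//; apply/negbTE; apply: contra h => /set_mem h.
  by apply/mem_set; rewrite /rays /= h1.
have mrays l : measurable (rays l).
  have [[m _] _] := tr l.
  have := m measurableT [set 1] (measurable_set1 _); rewrite setTI.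
  congr measurable; apply/seteqP; split => f /=; rewrite indicE.
    by case: (boolP (f \in rays l)) => [/set_mem//|_ /eqP]; rewrite eq_sym oner_eq0.
  by move=> h; rewrite mem_set.
apply: (@measure_unique _ _ _ [set rays l | l in setT] (fun=> setT)).
- apply/seteqP; split.
    apply: smallest_sub; first exact: smallest_sigma_algebra.
    move=> _ [x _ [Y mY <-]].
    have : measurable_fun setT (fun f : g_sigma_algebraType (range rays) => f x).
      apply: (measurability (@RGenOInfty.G R)) => [|_ [_ [p ->] <-]]; first exact: RGenOInfty.measurableE.
      apply: sub_sigma_algebra; exists [:: (x, p)] => //.
      rewrite setTI; apply/seteqP; split => f; by rewrite /rays /= in_itv /= !andbT.
    by move=> /(_ measurableT Y mY).
  apply: smallest_sub; [exact: smallest_sigma_algebra|move=> _ [l _ <-]; exact: mrays].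
- move=> _ _ [l _ <-] [l' _ <-]; exists (l ++ l') => //.
  by apply/seteqP; split => f; rewrite /rays /= all_cat => /andP.
- by move=> _; exists [::] => //; apply/seteqP; split.
- by rewrite bigcup_const.
- move=> _ [l _ <-]; have [_ /(_ [::] 0)] := tr l.
  have E (m : probability conf R) : \int[m]_f (\1_(rays l) f * cos (lincomb [::] f + 0)) = fine (m (rays l)).
    rewrite -exp_indic//; apply: eq_Rintegral => f _.
    by rewrite /lincomb big_nil addr0 cos0 mulr1.
  have F (m : probability conf R) : m (rays l) = (fine (m (rays l)))%:E.
    by rewrite fineK// fin_num_measure.
  rewrite !E => h; apply: (etrans (F m1)); apply: esym; apply: (etrans (F m2)).
  by rewrite h.
- by move=> _; rewrite ltey_eq fin_num_measure.
Qed.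

End CharacteristicFunction.

(** * Trigonometric inequalities and the pairing as a series *)

Lemma cos_lip {R : realType} (x y : R) : `|cos x - cos y| <= `|x - y|.
Proof.
wlog xy : x y / x <= y.
  move=> H; case: (leP x y) => [|/ltW yx]; first exact: H.
  by rewrite distrC (distrC x) H.
move: xy; rewrite le_eqVlt => /orP[/eqP->|xy]; first by rewrite !subrr.
have [c _ H] := @MVT R (@cos R) (fun z => - sin z) x y xy (fun z _ => is_derive_cos z)
  (continuous_subspaceT (@continuous_cos R)).
rewrite distrC H normrM normrN (distrC x) ler_piMl// ler_norml sin_geN1 sin_le1//.
Qed.

(** A substitute for the triangle inequality: with [1 - cos (2s) = 2 sin^2 s] it reduces to the
    square of a sum. It lets oscillations be added in [oscD]. *)
Lemma one_sub_cosD {R : realType} (x y : R) :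
  1 - cos (x + y) <= 2 * (1 - cos x) + 2 * (1 - cos y).
Proof.
have [s ->] : exists s, x = s + s by exists (x / 2); field.
have [t ->] : exists t, y = t + t by exists (y / 2); field.
rewrite (_ : s + s + (t + t) = (s + t) + (s + t)); last by ring.
have D (z : R) : 1 - cos (z + z) = 2 * sin z ^+ 2.
  by rewrite cosD -!expr2; have := cos2Dsin2 z => h; lra.
rewrite !D sinD.
have c1 : cos s ^+ 2 <= 1 by have := cos2Dsin2 s; have := sqr_ge0 (sin s); lra.
have c2 : cos t ^+ 2 <= 1 by have := cos2Dsin2 t; have := sqr_ge0 (sin t); lra.
have h : (sin s * cos t + cos s * sin t) ^+ 2 <= 2 * (sin s * cos t) ^+ 2 + 2 * (cos s * sin t) ^+ 2.
  by have := sqr_ge0 (sin s * cos t - cos s * sin t); lra.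
have h1 : (sin s * cos t) ^+ 2 <= sin s ^+ 2 by rewrite exprMn ler_piMr// sqr_ge0.
have h2 : (cos s * sin t) ^+ 2 <= sin t ^+ 2 by rewrite exprMn ler_piMl// sqr_ge0.
lra.
Qed.

(** The sine of [y] is only of the order of the square root of [1 - cos y]; the parameter [l] comes
    from the arithmetic-geometric inequality that linearises this root. *)
Lemma cos_perturb {R : realType} (x y l : R) : 0 < l ->
  `|cos (x + y) - cos x| <= l + (1 + l^-1) * (1 - cos y).
Proof.
move=> l0.
have c0 : 0 <= 1 - cos y by rewrite subr_ge0 cos_le1.
have s2 : sin y ^+ 2 <= 2 * (1 - cos y).
  have := cos2Dsin2 y; have := cos_geN1 y; have := cos_le1 y; nra.
have sl : `|sin y| <= l + l^-1 * (1 - cos y).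
  apply: (@le_trans _ _ (l + l^-1 * (2^-1 * sin y ^+ 2))).
    rewrite -subr_ge0 (_ : l + l^-1 * (2^-1 * sin y ^+ 2) - `|sin y| =
       (2 * l)^-1 * ((`|sin y| - l) ^+ 2 + l ^+ 2)); last first.
      by rewrite -(real_normK (num_real (sin y))); field; rewrite gt_eqF.
    by rewrite mulr_ge0 ?invr_ge0 ?addr_ge0 ?sqr_ge0// mulr_ge0// ltW.
  by rewrite lerD2l; apply: ler_wpM2l; [rewrite invr_ge0 ltW|lra].
rewrite cosD (_ : _ - cos x = - (cos x * (1 - cos y)) - sin x * sin y); last by ring.
rewrite (le_trans (ler_normB _ _))// normrN !normrM (ger0_norm c0).
have h1 : `|cos x| * (1 - cos y) <= 1 - cos y by rewrite ler_piMl// ler_norml cos_geN1 cos_le1.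
have h2 : `|sin x| * `|sin y| <= `|sin y| by rewrite ler_piMl// ler_norml sin_geN1 sin_le1.
lra.
Qed.

Section Pairing.
Context {R : realType} {d : nat} {C : set 'rV[int]_d}.
Local Notation conf := (configuration R C).
Context (e : nat -> C) (ix : C -> nat) (q : C -> R).
Hypotheses (eK : cancel e ix) (ixK : cancel ix e).
Hypotheses (q0 : forall x, 0 < q x) (cq : cvgn (series (fun i => q (e i)))).
Local Notation S := (tsum e).

Lemma esum_nneseries (h : C -> \bar R) : (forall x, (0 <= h x)%E) ->
  (\esum_(x in [set: C]) h x = \sum_(0 <= i <oo) h (e i))%E.
Proof.
move=> h0; rewrite nneseries_esumT//; apply: (@reindex_esum _ _ _ setT setT e).
split => //; first by move=> i j _ _; exact: can_inj.
by move=> x _; exists (ix x) => //; rewrite ixK.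
Qed.

Lemma esum_tsum (h : C -> R) : dominated q h -> (forall x, 0 <= h x) ->
  (\esum_(x in [set: C]) (h x)%:E)%E = (S h)%:E.
Proof.
move=> dh h0; rewrite esum_nneseries//.
rewrite /tsum -EFin_lim; last exact: dominated_cvg dh.
by congr (limn _); apply/funext => n; rewrite /series /= sumEFin.
Qed.

Lemma pairing_tsum (u f : C -> R) : dominated q (fun x => u x * f x) ->
  pairing u f = S (fun x => u x * f x).
Proof.
move=> df; rewrite /pairing.
have Ep x : ((fun x => (u x * f x)%:E)^\+ x)%E = (Num.max (u x * f x) 0)%:E by rewrite funeposE EFin_max.
have En x : ((fun x => (u x * f x)%:E)^\- x)%E = (Num.max (- (u x * f x)) 0)%:E by rewrite funenegE EFin_max.
have dp : dominated q (fun x => Num.max (u x * f x) 0).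
  by apply: (dominated_le df) => x; rewrite ger0_norm ?le_max ?lexx ?orbT// ge_max ler_norm normr_ge0.
have dn : dominated q (fun x => Num.max (- (u x * f x)) 0).
  by apply: (dominated_le df) => x; rewrite ger0_norm ?le_max ?lexx ?orbT// ge_max -normrN ler_norm normr_ge0.
under eq_esum do rewrite Ep.
under [X in _ - fine X]eq_esum do rewrite En.
rewrite !esum_tsum//; [|by move=> x; rewrite le_max lexx orbT|by move=> x; rewrite le_max lexx orbT].
rewrite /= -(tsumB q0 cq)//; apply: eq_tsum => x.
move: (u x * f x) => y; case: (leP 0 y) => y0.
  by rewrite (max_idPr _) ?subr0// oppr_le0.
by rewrite (max_idPl _) ?sub0r ?opprK// oppr_ge0 ltW.
Qed.

Lemma measurable_pairing (u : C -> R) : measurable_fun setT (pairing u : conf -> R).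
Proof.
have mg (x : C) : measurable_fun setT (fun f : conf => (u x * f x)%:E).
  by apply/measurable_EFinP; apply: measurable_funM => //; exact: measurable_coord.
rewrite /pairing; apply: measurable_funB; apply: measurableT_comp => //.
  have -> : (fun f : conf => (\esum_(x in [set: C]) ((fun x => (u x * f x)%:E)^\+ x))%E) =
     (fun f : conf => (\sum_(0 <= i <oo) (maxe (u (e i) * f (e i))%:E 0))%E).
    apply/funext => f; rewrite esum_nneseries; last by move=> x; rewrite funeposE le_max lexx orbT.
    by apply: eq_eseriesr => i _; rewrite funeposE.
  apply: ge0_emeasurable_sum => [i f _ _|i _]; first by rewrite le_max lexx orbT.
  by apply: measurable_maxe => //; exact: mg.
have -> : (fun f : conf => (\esum_(x in [set: C]) ((fun x => (u x * f x)%:E)^\- x))%E) =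
   (fun f : conf => (\sum_(0 <= i <oo) (maxe (- (u (e i) * f (e i))%:E) 0))%E).
  apply/funext => f; rewrite esum_nneseries; last by move=> x; rewrite funenegE le_max lexx orbT.
  by apply: eq_eseriesr => i _; rewrite funenegE.
apply: ge0_emeasurable_sum => [i f _ _|i _]; first by rewrite le_max lexx orbT.
by apply: measurable_maxe => //; apply: measurableT_comp => //; exact: mg.
Qed.

End Pairing.

Lemma ae_mono {dT} {T : measurableType dT} {R : realType} (mu : {measure set T -> \bar R})
  (A B : T -> Prop) : {ae mu, forall x, A x} -> (forall x, A x -> B x) -> {ae mu, forall x, B x}.
Proof. by move=> h AB; apply: filterS h. Qed.

Lemma ae_and {dT} {T : measurableType dT} {R : realType} (mu : {measure set T -> \bar R})
  (A B : T -> Prop) : {ae mu, forall x, A x} -> {ae mu, forall x, B x} ->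
  {ae mu, forall x, A x /\ B x}.
Proof. by move=> h k; apply: filterS2 h k. Qed.

(** * From invariance to the law of shifts *)

Section CharacteristicFunctional.
Context {R : realType} {d : nat} {C : set 'rV[int]_d}.
Local Notation conf := (configuration R C).
Context (e : nat -> C) (ix : C -> nat).
Context (nb : C -> seq C) (w : C -> C -> R) (a : C -> R) (k0 k2 : nat) (K0 K1 : R).
Hypothesis G : weighted_graph e ix nb w a k0 k2 K0 K1.

Let q x := a x ^ (- k2%:Z).
Local Notation S := (@tsum R C e).
Local Notation lap := (lap nb w).
Local Notation bnd := (bnd a).
Local Notation heat := (heat nb w).
Local Notation slow := (slow a).
Local Notation rapid := (rapid a).
Local Notation moderate := (moderate a).
Let q0 : forall x, 0 < q x := q_gt0 G.
Let cq : cvgn (series (fun i => q (e i))) := q_cvg G.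
Let eK := eK G.
Let ixK := ixK G.

Lemma pairingE u f : rapid u -> moderate f -> pairing u f = S (fun x => u x * f x).
Proof. by move=> ru mf; apply: (pairing_tsum eK ixK q0 cq); exact: (rapid_mul_dom G). Qed.

Lemma measurable_pair u : measurable_fun setT (pairing u : conf -> R).
Proof. exact: (measurable_pairing eK ixK). Qed.

Lemma pairingD u v f : rapid u -> rapid v -> moderate f ->
  pairing (fun x => u x + v x) f = pairing u f + pairing v f.
Proof.
move=> ru rv mf; rewrite !pairingE//; last exact: rapidD.
rewrite -(tsumD q0 cq); [|exact: (rapid_mul_dom G)|exact: (rapid_mul_dom G)].
by apply: eq_tsum => x; rewrite mulrDl.
Qed.

Lemma pairingZ c u f : rapid u -> moderate f -> pairing (fun x => c * u x) f = c * pairing u f.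
Proof.
move=> ru mf; rewrite !pairingE//; last exact: rapidZ.
rewrite -(tsumZ q0 cq); last exact: (rapid_mul_dom G).
by apply: eq_tsum => x; rewrite mulrA.
Qed.

Lemma pairingB u v f : rapid u -> rapid v -> moderate f ->
  pairing (fun x => u x - v x) f = pairing u f - pairing v f.
Proof.
move=> ru rv mf; rewrite !pairingE//; last exact: rapidB.
rewrite -(tsumB q0 cq); [|exact: (rapid_mul_dom G)|exact: (rapid_mul_dom G)].
by apply: eq_tsum => x; rewrite mulrBl.
Qed.

Variable nu : probability conf R.
Hypothesis numod : {ae nu, forall f, moderate f}.

Local Notation EE h := (\int[nu]_f h f)%R.
Definition cf (u : C -> R) (th : R) : R := EE (fun f => cos (pairing u f + th)).

Lemma measurable_phase u th : measurable_fun setT (fun f : conf => pairing u f + th).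
Proof. by apply: measurable_funD => //; exact: measurable_pair. Qed.

Lemma cf_small u eps : rapid u -> 0 < eps ->
  \forall n \near \oo, `|cf (fun x => n.+1%:R^-1 * u x) 0 - 1| <= eps.
Proof.
move=> ru eps0.
have H : cf (fun x => n.+1%:R^-1 * u x) 0 @[n --> \oo] --> EE (fun=> cos 0).
  apply: (@exp_cvg _ _ _ _ _ _ 1) => [n|//|n f|].
  - exact: (bm_cos (measurable_phase _ _)).1.
  - by rewrite ler_norml cos_geN1 cos_le1.
  - apply: (ae_mono numod) => f mf.
    have H : n.+1%:R^-1 * pairing u f @[n --> \oo] --> (0 : R).
      rewrite -[X in _ --> X](mul0r (pairing u f)).
      by apply: cvgM; [exact: cvg_harmonic|exact: cvg_cst].
    apply: continuous_cvg; first exact: continuous_cos.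
    under eq_fun do rewrite (pairingZ _ ru mf) addr0.
    exact: H.
rewrite exp_cst cos0 in H.
move/cvgrPdist_le: H => /(_ _ eps0); apply: filterS => n; by rewrite distrC.
Qed.

(** The boxes increase to the moderate functions, so one of them carries almost all the mass, and
    inside a box the decay given by [difn_vanishes] is uniform. A single index bounds both the
    constant and the order. *)
Definition box (N : nat) : set conf := [set f | bnd N%:R N f].

Lemma measurable_box N : measurable (box N).
Proof.
have -> : box N = \bigcap_i [set f : conf | `|f (e i)| <= N%:R * a (e i) ^ N].
  apply/seteqP; split => [f h i _|f h x]; first exact: h.
  by have := h (ix x) I; rewrite /= ixK.
apply: bigcapT_measurable => i.
rewrite -[X in measurable X]setTI.
have m : measurable_fun setT (fun f : conf => `|f (e i)|).
  by apply: measurableT_comp => //; exact: measurable_coord.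
rewrite (_ : [set f : conf | _] = (fun f : conf => `|f (e i)|) @^-1` `]-oo, N%:R * a (e i) ^ N]).
  exact: m.
by apply/seteqP; split => f /=; rewrite in_itv.
Qed.

Lemma moderate_box f : moderate f -> exists N, forall n, (N <= n)%N -> box n f.
Proof.
move=> [z [M b]]; exists (maxn `|z|%N (Num.bound M)) => n; rewrite geq_max => /andP[zn Mn].
apply: (bnd_le G) b.
  have [M0|/ltW M0] := leP 0 M; last exact: le_trans M0 _.
  by apply: (le_trans (ltW (archi_boundP M0))); rewrite ler_nat.
by apply: (le_trans (ler_norm z)); rewrite -abszE lez_nat.
Qed.

Lemma box_moderate N f : box N f -> moderate f.
Proof. by exists N%:Z, N%:R. Qed.

Lemma box_small eps : 0 < eps -> exists N, EE (\1_(~` box N)) <= eps.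
Proof.
move=> eps0.
have H : EE (\1_(~` box n)) @[n --> \oo] --> EE (fun=> 0).
  apply: (@exp_cvg _ _ _ _ _ _ 1) => [n|//|n f|].
  - by apply: measurable_indic; apply: measurableC; exact: measurable_box.
  - by rewrite indicE; case: (_ \in _); rewrite ?normr1 ?normr0.
  - apply: (ae_mono numod) => f mf; have [N h] := moderate_box mf.
    apply: cvg_near_cst; exists N => // n /= Nn.
    by rewrite indicE memNset//=; apply; exact: h.
rewrite exp_cst in H; move/cvgrPdist_le: H => /(_ _ eps0)[N _ h].
by exists N; have := h N (leqnn N); rewrite sub0r normrN; apply: le_trans; exact: ler_norm.
Qed.

Variable flow : (C -> R) -> R -> C -> R.
Hypothesis flowP : forall f, rapid f -> [/\ heat (flow f), slow (flow f) & flow f 0 = f].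
Local Notation flow_rapid := (flow_rapid G flowP).
Local Notation green_form := (green_form e flow).
Local Notation noise_var := (noise_var e flow).

Definition flow_law := forall u t th, rapid u -> 0 <= t ->
  cf u th = cf (flow u t) th * expR (- noise_var t u).

Section FlowLaw.
Hypothesis cf_flow : flow_law.

Lemma cf_le1 u th : `|cf u th| <= 1.
Proof.
rewrite -[X in _ <= X](exp_cst nu); apply: exp_norm.
- exact: bm_cos (measurable_phase _ _).
- exact: bm_cst.
- by move=> f; rewrite ler_norml cos_geN1 cos_le1.
Qed.

(** For a small multiple [c v] the characteristic functional is at least one half, so invariance
    keeps the exponent [noise_var] bounded in [T]. It dominates [T] times the squared norm of
    [flow (c v) T], which therefore decays like [1 / T]. *)
Lemma flow_norm_vanishes v : rapid v -> vanishes (fun T => S (fun x => flow v T x ^+ 2)).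
Proof.
move=> rv; have h2 : (0 : R) < 2^-1 by rewrite invr_gt0.
have [n _ Hn] := cf_small rv h2; have {Hn} := Hn n (leqnn n).
set c := n.+1%:R^-1; have c0 : 0 < c by rewrite invr_gt0.
rewrite ler_distl => /andP[cf0 _].
have rcv : rapid (fun x => c * v x) by exact: rapidZ.
have B T : 0 <= T -> c ^+ 2 * T * S (fun x => flow v T x ^+ 2) <= 1.
  move=> T0.
  have /andP[low _] := noise_var_step G flowP rcv (lexx 0) T0.
  have V0 : noise_var 0 (fun x => c * v x) = 0 by rewrite /noise_var mulr0 green_form0 mulr0.
  rewrite V0 !subr0 (flowZ G flowP)// in low.
  have E : S (fun x => (c * flow v T x) ^+ 2) = c ^+ 2 * S (fun x => flow v T x ^+ 2).
    rewrite -(tsumZ q0 cq); last by apply: (rapid_mul_dom G); [exact: flow_rapid|exact/rapid_moderate/flow_rapid].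
    by apply: eq_tsum => x; rewrite exprMn.
  have V := noise_var_ge0 G flowP rcv T0.
  have ex : 2^-1 <= expR (- noise_var T (fun x => c * v x)).
    apply: (@le_trans _ _ (cf (fun x => c * v x) 0)); first by rewrite (_ : 2^-1 = 1 - 2^-1)//; field.
    rewrite (cf_flow _ rcv T0) ler_piMl ?expR_ge0//.
    by apply: le_trans (ler_norm _) (cf_le1 _ _).
  have ex1 : 1 + noise_var T (fun x => c * v x) <= 2.
    apply: (le_trans (expR_ge1Dx _)); rewrite -[X in X <= _]invrK -expRN -[X in _ <= X]invrK.
    by rewrite lef_pV2// ?posrE ?expR_gt0.
  rewrite E in low; rewrite mulrAC; apply: (le_trans low).
  by rewrite -(lerD2l 1) (le_trans ex1).
move=> eps eps0; exists (c ^+ 2 * eps)^-1.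
  by rewrite invr_ge0 mulr_ge0 ?sqr_ge0// ltW.
move=> T T1; have ce : 0 < c ^+ 2 * eps by rewrite mulr_gt0 ?exprn_gt0.
have T0 : 0 < T by apply: lt_le_trans T1; rewrite invr_gt0.
rewrite ger0_norm; last first.
  by apply: (tsum_ge0 q0 cq) => [|x]; [apply: (rapid_mul_dom G); [exact: flow_rapid (ltW _)|exact/rapid_moderate/flow_rapid/ltW]|exact: sqr_ge0].
have {}B := B _ (ltW T0); move: (S _) B => y B.
have c2 : 0 < c ^+ 2 by rewrite exprn_gt0.
have k1 : 1 <= c ^+ 2 * eps * T by rewrite -ler_pdivrMl// mulr1.
rewrite -(ler_pM2l (mulr_gt0 c2 T0)); apply: (le_trans B); apply: (le_trans k1).
by rewrite le_eqVlt; apply/orP; left; apply/eqP; ring.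
Qed.

(** Cauchy-Schwarz in Young form, at every time of the interval: [K] is so large that the part with
    [z] stays below [k], and the decay of [flow v T] then makes the other part as small. *)
Lemma green_form_vanishes t v z : rapid v -> rapid z -> 0 <= t ->
  vanishes (fun T => green_form t (flow v T) z).
Proof.
move=> rv rz t0 eps eps0.
have Sz0 : 0 <= S (fun x => z x ^+ 2).
  by apply: (tsum_ge0 q0 cq) => [|x]; [apply: (rapid_mul_dom G) => //; exact: rapid_moderate|exact: sqr_ge0].
set k := eps / (t + 1).
have k0' : 0 < k by rewrite divr_gt0// ltr_wpDl.
set K := S (fun x => z x ^+ 2) / k + 1.
have K_gt0 : 0 < K by rewrite ltr_wpDl// divr_ge0// ltW.
have [T0 T00 HT] := flow_norm_vanishes rv (divr_gt0 k0' K_gt0).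
exists T0 => // T TT; have T_0 := le_trans T00 TT.
apply: (@le_trans _ _ (k * t)); last first.
  rewrite /k mulrAC ler_pdivrMr; last by rewrite ltr_wpDl.
  by rewrite ler_pM2l// lerDl.
apply: (green_form_norm G flowP) => //; first exact: flow_rapid.
  exact: rapid_moderate.
move=> r /andP[/ltW r0 _]; rewrite (flow_comp G flowP)//.
have T1 : T0 <= T + r by rewrite (le_trans TT)// lerDl.
have rf : rapid (flow v (T + r)) by apply: flow_rapid => //; rewrite addr_ge0.
have D1 : dominated q (fun x => flow v (T + r) x ^+ 2).
  by apply: (rapid_mul_dom G) => //; exact: rapid_moderate.
have D2 : dominated q (fun x => z x ^+ 2) by apply: (rapid_mul_dom G) => //; exact: rapid_moderate.
have D3 : dominated q (fun x => flow v (T + r) x * z x) by apply: (rapid_mul_dom G) => //; exact: rapid_moderate.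
have HT' : S (fun x => flow v (T + r) x ^+ 2) <= k / K by apply: le_trans (ler_norm _) (HT _ T1).
have b : 2^-1 * (K * S (fun x => flow v (T + r) x ^+ 2) + K^-1 * S (fun x => z x ^+ 2)) <= k.
  have h1 : K * S (fun x => flow v (T + r) x ^+ 2) <= k.
    by rewrite mulrC -ler_pdivlMr.
  have h2 : K^-1 * S (fun x => z x ^+ 2) <= k.
    by rewrite mulrC ler_pdivrMr// /K mulrDr mulr1 mulrCA divff ?gt_eqF// mulr1 lerDl ltW.
  by rewrite ler_pdivrMl// mulr_natl mulr2n lerD.
apply: le_trans b.
have P c : c = 1 \/ c = -1 -> c * S (fun x => flow v (T + r) x * z x) <=
  2^-1 * (K * S (fun x => flow v (T + r) x ^+ 2) + K^-1 * S (fun x => z x ^+ 2)).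
  move=> c1.
  rewrite -!(tsumZ q0 cq)// -(tsumD q0 cq) -?(tsumZ q0 cq); try exact: dominatedZ.
    apply: (ler_tsum q0 cq) => [||x]; try exact: dominatedZ.
      by apply: dominatedZ; apply: dominatedD; exact: dominatedZ.
    rewrite -subr_ge0 (_ : _ - _ = 2^-1 * (K^-1 * (K * flow v (T + r) x - c * z x) ^+ 2)).
      apply: mulr_ge0; first by rewrite invr_ge0.
      by apply: mulr_ge0; [rewrite invr_ge0 ltW|exact: sqr_ge0].
    by case: c1 => ->; field; rewrite gt_eqF.
  by apply: dominatedD; exact: dominatedZ.
have h1 := P 1 (or_introl erefl); have h2 := P (-1) (or_intror erefl).
by rewrite ler_norml; rewrite mul1r in h1; rewrite mulN1r in h2; rewrite h1 lerNl h2.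
Qed.

(** Smallness of [Y] modulo [2 pi] on one box, which is all that characteristic functionals see and
    what invariance controls. *)
Definition osc N (Y : conf -> R) : R := EE (fun f => \1_(box N) f * (1 - cos (Y f))).

Lemma bm_osc N (Y : conf -> R) : measurable_fun setT Y ->
  bounded_mfun (fun f : conf => \1_(box N) f * (1 - cos (Y f)) : R).
Proof.
move=> mY; apply: bmM; first by apply: bm_indic; exact: measurable_box.
by apply: bmB; [exact: bm_cst|exact: bm_cos].
Qed.

Lemma osc_ge0 N Y : 0 <= osc N Y.
Proof.
apply: exp_ge0 => f; apply: mulr_ge0; first by rewrite indicE ler0n.
by rewrite subr_ge0 cos_le1.
Qed.

Lemma eq_osc N (Y Z : conf -> R) : (forall f, moderate f -> Y f = Z f) -> osc N Y = osc N Z.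
Proof.
move=> YZ; rewrite /osc; congr (Rintegral _ _ _); apply/funext => f; rewrite indicE.
by case: (boolP (f \in box N)) => [|_]; rewrite ?mul0r// inE => /box_moderate/YZ->.
Qed.

Lemma oscD N (Y Z : conf -> R) : measurable_fun setT Y -> measurable_fun setT Z ->
  osc N (fun f => Y f + Z f) <= 2 * osc N Y + 2 * osc N Z.
Proof.
move=> mY mZ; rewrite /osc -!(expZ nu); [|exact: bm_osc..].
rewrite -(expD nu); [|by apply: bmZ; exact: bm_osc..].
apply: exp_le; first by apply: bm_osc; exact: measurable_funD.
  by apply: bmD; apply: bmZ; exact: bm_osc.
move=> f; rewrite mulrCA (mulrCA 2) -mulrDr; apply: ler_wpM2l; first by rewrite indicE ler0n.
exact: one_sub_cosD.
Qed.

Lemma osc_lip N (Y : conf -> R) m : measurable_fun setT Y -> 0 <= m ->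
  (forall f, box N f -> `|Y f| <= m) -> osc N Y <= m.
Proof.
move=> mY m0 h; rewrite -[X in _ <= X](exp_cst nu); apply: exp_le; first exact: bm_osc.
  exact: bm_cst.
move=> f; rewrite indicE; case: (boolP (f \in box N)) => [|_]; last by rewrite mul0r.
rewrite inE mul1r => /h; apply: le_trans; have := cos_lip 0 (Y f).
by rewrite cos0 sub0r normrN; apply: le_trans; exact: ler_norm.
Qed.

(** Invariance gives [cf (flow u T) 0 >= cf u 0], because the Gaussian factor is at most 1. The
    bound does not depend on [T], and it is small for small multiples of any [u]. *)
Lemma osc_le_cf N u T : rapid u -> 0 <= T -> 0 <= cf u 0 ->
  osc N (pairing (flow u T)) <= 1 - cf u 0.
Proof.
move=> ru T0 c0; apply: (@le_trans _ _ (1 - cf (flow u T) 0)); last first.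
  rewrite lerD2l lerN2 (cf_flow _ ru T0) ler_piMr//; last by rewrite -expR0 ler_expR oppr_le0 (noise_var_ge0 G flowP).
  by move: c0; rewrite (cf_flow _ ru T0) pmulr_lge0// expR_gt0.
rewrite -[X in X - _](exp_cst nu) -(expB nu); [|exact: bm_cst|exact: bm_cos (measurable_phase _ _)].
apply: exp_le; first by apply: bm_osc; exact: measurable_pair.
  by apply: bmB; [exact: bm_cst|exact: bm_cos (measurable_phase _ _)].
by move=> f; rewrite addr0 ler_piMl ?subr_ge0 ?cos_le1// indicE.
Qed.

Lemma vanishesD (f g : R -> R) c : vanishes f -> vanishes g -> vanishes (fun T => c * f T + g T).
Proof.
move=> vf vg eps eps0.
have k0' : 0 < eps / (2 * (`|c| + 1)) by rewrite divr_gt0// mulr_gt0// ltr_wpDl.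
have [Tf f0 Hf] := vf _ k0'; have [Tg g0 Hg] := vg (eps / 2) (divr_gt0 eps0 (ltr0Sn _ _)).
exists (Num.max Tf Tg); first by rewrite le_max f0.
move=> T; rewrite ge_max => /andP[/Hf h1 /Hg h2].
apply: (le_trans (ler_normD _ _)); rewrite [eps]splitr lerD// normrM.
apply: (@le_trans _ _ ((`|c| + 1) * (eps / (2 * (`|c| + 1))))).
  by apply: ler_pM => //; rewrite lerDl.
by rewrite le_eqVlt; apply/orP; left; apply/eqP; field; rewrite gt_eqF// ltr_wpDl.
Qed.

Lemma vanishes_le (f g : R -> R) : (forall T, 0 <= T -> `|f T| <= `|g T|) -> vanishes g -> vanishes f.
Proof.
move=> fg vg eps /vg[T0 T00 H]; exists T0 => // T TT; apply: le_trans (H _ TT); apply: fg.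
exact: le_trans TT.
Qed.

Lemma vanishes_shift (f : R -> R) c : 0 <= c -> vanishes f -> vanishes (fun T => f (T + c)).
Proof.
move=> c0 vf eps /vf[T0 T00 H]; exists T0 => // T TT; apply: H.
by rewrite (le_trans TT)// lerDl.
Qed.

Lemma osc_sum N (Y : nat -> R -> conf -> R) n : (forall j T, measurable_fun setT (Y j T)) ->
  (forall j, vanishes (fun T => osc N (Y j T))) ->
  vanishes (fun T => osc N (fun f => \sum_(j < n) Y j T f)).
Proof.
move=> mY vY; elim: n => [|n IH].
  move=> eps eps0; exists 0 => // T _; rewrite ger0_norm ?osc_ge0//.
  refine (le_trans (@osc_lip N _ 0 _ (lexx 0) _) (ltW eps0)).
    by apply: measurable_sum => i.
  by move=> f _; rewrite big_ord0 normr0.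
apply: vanishes_le (vanishesD 2 IH (vanishesD 2 (vY n) (vY n))) => T T0.
rewrite !ger0_norm ?osc_ge0//; last first.
  by rewrite !addr_ge0// ?mulr_ge0// osc_ge0.
have -> : (fun f => \sum_(j < n.+1) Y j T f) = (fun f => \sum_(j < n) Y j T f + Y n T f).
  by apply/funext => f; rewrite big_ord_recr.
apply: (le_trans (oscD N _ _)) => //; first exact: measurable_sum.
by rewrite lerD2l lerDl osc_ge0.
Qed.

Section Difference.
Variable tau : R.
Hypothesis tau0 : 0 < tau.
Local Notation dif := (dif flow tau).
Local Notation difn := (difn flow tau).
Local Notation dif_rapid := (dif_rapid G flowP tau0).
Local Notation difn_rapid := (difn_rapid G flowP tau0).

Lemma measurable_pairZ c u : measurable_fun setT (fun f : conf => c * pairing u f).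
Proof. by apply: measurable_funM => //; exact: measurable_pair. Qed.

(** Each later first difference is the initial one minus the second differences in between. A first
    difference is thus small, up to second differences, if [c] itself is small compared with [J]. *)
Lemma first_difference_sum (c : nat -> R) J :
  J%:R * (c 0%N - c 1%N) = c 0%N - c J +
   \sum_(j < J) \sum_(i < j) ((c i - c i.+1) - (c i.+1 - c i.+2)).
Proof.
have D j : \sum_(i < j) ((c i - c i.+1) - (c i.+1 - c i.+2)) = c 0%N - c 1%N - (c j - c j.+1).
  by elim: j => [|j IH]; rewrite ?big_ord0 ?subrr// big_ord_recr/= IH; ring.
elim: J => [|J IH]; first by rewrite big_ord0 mul0r subrr addr0.
rewrite big_ord_recr/= D -addn1 natrD mulrDl IH mul1r; ring.
Qed.

(** Downward induction on the number of differences. From [k1] on, the decay of the flow suffices;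
    below, one difference is removed by [first_difference_sum], whose boundary terms are controlled
    uniformly in time by invariance. *)
Lemma osc_difn_vanishes N k u r : rapid u ->
  vanishes (fun T => osc N (fun f => r * pairing (flow (difn k.+1 u) T) f)).
Proof.
have [k1 Hk1] := difn_vanishes G flowP tau0 N%:Z (ler0n R N).
have base m : (k1 <= m)%N -> forall u r, rapid u ->
    vanishes (fun T => osc N (fun f => r * pairing (flow (difn m u) T) f)).
  move=> km {}u {}r ru eps eps0; rewrite -(subnKC km) /difn iterD -/(difn _ _).
  have d0 : 0 < eps / (`|r| + 1) by rewrite divr_gt0// ltr_wpDl.
  have [T0 T00 H] := Hk1 _ (difn_rapid (m - k1) ru) _ d0.
  exists T0 => // T TT; rewrite ger0_norm ?osc_ge0//.
  apply: osc_lip; [exact: measurable_pairZ|exact: ltW|move=> f bf].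
  rewrite pairingE; last exact: (box_moderate bf).
    rewrite normrM (le_trans (ler_wpM2l _ (H T TT f bf)))//.
    by rewrite mulrCA ger_pMr// ler_pdivrMr ?ltr_wpDl// mul1r lerDl.
  by apply: flow_rapid; [exact: difn_rapid (difn_rapid _ _)|exact: le_trans TT].
(* [m] counts how many steps [k.+1] is short of [k1]. *)
move: u r; have [m km] : exists m, (k1 <= k.+1 + m)%N by exists k1; rewrite leq_addl.
elim: m k km => [|m IH] k km; first by apply: base; rewrite addn0 in km.
have {}IH := IH k.+1 ltac:(by rewrite addSnnS).
move=> u r ru eps eps0.
set v := difn k u; have rv : rapid v by exact: difn_rapid.
have e16 : 0 < eps / 16 by rewrite divr_gt0.
have rrv : rapid (fun x => r * v x) by exact: rapidZ.
(* [J] is so large that [v1 = r v / J.+1] oscillates by at most [eps / 16] at all times; the cap 1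
   makes [cf v1 0] nonnegative. The denominators 16 and 4 absorb the factors 2 from two uses of
   [oscD]. *)
have [J _ /(_ _ (leqnn J))] := cf_small rrv (ltac:(by rewrite lt_min e16 (ltr01 : 0 < 1)) : 0 < Num.min (eps / 16) 1).
set c := J.+1%:R^-1; have c0 : 0 < c by rewrite invr_gt0.
set v1 := fun x => c * (r * v x); have rv1 : rapid v1 by exact: rapidZ.
rewrite ler_distl => /andP[cf0 _].
have cfp : 0 <= cf v1 0.
  by apply: le_trans cf0; rewrite subr_ge0 ge_min lexx orbT.
have cf1 : 1 - cf v1 0 <= eps / 16.
  by rewrite lerBlDl -lerBlDr (le_trans _ cf0)// lerD2l lerN2 ge_min lexx.
pose Y j T (f : conf) := \sum_(i < j) (c * r) * pairing (flow (difn k.+2 u) (T + i%:R * tau)) f.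
have mY j T : measurable_fun setT (Y j T).
  by apply: measurable_sum => i; exact: measurable_pairZ.
have vY : vanishes (fun T => osc N (fun f => \sum_(j < J.+1) Y j T f)).
  apply: (@osc_sum N Y) => // j.
  apply: (@osc_sum N (fun i T f => (c * r) * pairing (flow (difn k.+2 u) (T + i%:R * tau)) f)) => [i T|i]; first exact: measurable_pairZ.
  apply: (@vanishes_shift (fun T => osc N (fun f => c * r * pairing (flow (difn k.+2 u) T) f))).
    by rewrite mulr_ge0// ltW.
  exact: IH.
have e4 : 0 < eps / 4 by rewrite divr_gt0.
have [T0 T00 H] := vY _ e4; exists T0 => // T TT.
have T_0 := le_trans T00 TT.
rewrite ger0_norm ?osc_ge0//.
pose tj j := T + j%:R * tau.
have tj0 j : 0 <= tj j by rewrite addr_ge0// mulr_ge0// ltW.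
have tjS j : tj j.+1 = tj j + tau by rewrite /tj -natr1; ring.
have E : osc N (fun f => r * pairing (flow (difn k.+1 u) T) f) =
  osc N (fun f => (pairing (flow v1 T) f + - 1 * pairing (flow v1 (tj J.+1)) f) + \sum_(j < J.+1) Y j T f).
  apply: eq_osc => f mf.
  pose b j := pairing (flow v1 (tj j)) f.
  have db j x : rapid x -> pairing (flow (dif x) (tj j)) f =
      pairing (flow x (tj j)) f - pairing (flow x (tj j.+1)) f.
    move=> rx; rewrite (flow_dif G flowP)// pairingB//; [|exact: flow_rapid..|].
      by rewrite (flow_comp G flowP)// ?tjS// ltW.
    by apply: flow_rapid; [exact: flow_rapid|exact: ltW].
  have bE j x : rapid x -> pairing (flow (fun y => c * (r * x y)) (tj j)) f = (c * r) * pairing (flow x (tj j)) f.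
    move=> rx; rewrite (flowZ G flowP)//; last exact: rapidZ.
    rewrite (flowZ G flowP)// !pairingZ//; [by rewrite mulrA|exact: flow_rapid|].
    by apply: rapidZ; exact: flow_rapid.
  have := first_difference_sum b J.+1.
  have tE : tj 0%N = T by rewrite /tj mul0r addr0.
  have -> : b 0%N - b 1%N = c * (r * pairing (flow (difn k.+1 u) T) f).
    rewrite /b !bE// -mulrBr -db// tE mulrA //.
  rewrite mulrA divff ?mul1r// => ->.
  rewrite {1 2}/b tE mulN1r; congr (_ + _); apply: eq_bigr => j _; apply: eq_bigr => i _.
  rewrite /b !bE// -!mulrBr -!db//; exact: dif_rapid.
rewrite E; have m1 : measurable_fun setT (fun f : conf => pairing (flow v1 T) f) by exact: measurable_pair.
have m2 : measurable_fun setT (fun f : conf => - 1 * pairing (flow v1 (tj J.+1)) f) by exact: measurable_pairZ.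
apply: (le_trans (oscD N (measurable_funD m1 m2) _)); first by apply: measurable_sum => j; exact: mY.
have h1 := oscD N m1 m2.
have h2 : osc N (fun f => pairing (flow v1 T) f) <= eps / 16 by apply: le_trans cf1; exact: osc_le_cf.
have h3 : osc N (fun f => - 1 * pairing (flow v1 (tj J.+1)) f) <= eps / 16.
  apply: le_trans cf1; apply: le_trans (osc_le_cf N rv1 (tj0 J.+1) cfp).
  rewrite /osc le_eqVlt; apply/orP; left; apply/eqP; congr (Rintegral _ _ _); apply/funext => f.
  by rewrite mulN1r cosN.
have h4 := le_trans (ler_norm _) (H T TT).
move: h1 h2 h3 h4; move: (osc _ _) (osc _ _) (osc _ _) (osc _ _) => A1 A2 A3 A4 h1 h2 h3 h4.
by lra.
Qed.

Lemma vanishes_cvg (f : R -> R) : vanishes f -> f n%:R @[n --> \oo] --> 0.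
Proof.
move=> vf; apply/cvgrPdist_le => eps /vf[T0 T00 H].
exists (Num.bound T0) => // n /= Tn; rewrite sub0r normrN; apply: H.
by apply: (le_trans (ltW (archi_boundP T00))); rewrite ler_nat.
Qed.

Lemma cos_perturb_osc N (X Y : conf -> R) l : measurable_fun setT X -> measurable_fun setT Y -> 0 < l ->
  `|EE (fun f => cos (X f + Y f)) - EE (fun f => cos (X f))| <=
  l + (1 + l^-1) * osc N Y + 2 * EE (\1_(~` box N)).
Proof.
move=> mX mY l0.
have b1 : bounded_mfun (fun f : conf => l) by exact: bm_cst.
have b2 := bmZ (1 + l^-1) (bm_osc N mY).
have b3 : bounded_mfun (fun f : conf => 2 * \1_(~` box N) f : R).
  by apply: bmZ; apply: bm_indic; apply: measurableC; exact: measurable_box.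
rewrite -(expB nu); [|apply: bm_cos; exact: measurable_funD|exact: bm_cos].
have -> : l + (1 + l^-1) * osc N Y + 2 * EE (\1_(~` box N)) =
    EE (fun f => l + (1 + l^-1) * (\1_(box N) f * (1 - cos (Y f))) + 2 * \1_(~` box N) f).
  rewrite !(expD nu)//; last exact: bmD.
  rewrite exp_cst !(expZ nu)//; last exact: bm_osc.
  by apply: bm_indic; apply: measurableC; exact: measurable_box.
apply: exp_norm.
- by apply: bmB; apply: bm_cos => //; exact: measurable_funD.
- by apply: bmD => //; exact: bmD.
move=> f; rewrite !indicE in_setC; case: (_ \in _) => /=.
  by rewrite mulr0 addr0 mul1r; exact: cos_perturb.
rewrite mul0r mulr0 addr0 mulr1; apply: (@le_trans _ _ 2); last by rewrite lerDr ltW.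
apply: (le_trans (ler_normB _ _)).
by have := cos_lip (X f + Y f) 0; rewrite (_ : 2 = 1 + 1 :> R)// lerD// ler_norml cos_geN1 cos_le1.
Qed.

(** The case of one difference in [osc_difn_vanishes]. Half of [eps] goes to the oscillation on the
    box, a quarter to the parameter of [cos_perturb], a quarter to the complement of the box. *)
Lemma cf_difference_vanishes u v th : rapid u -> rapid v ->
  vanishes (fun T => cf (flow (fun x => u x + dif v x) T) th - cf (flow u T) th).
Proof.
move=> ru rv eps eps0.
have l0 : 0 < eps / 4 by rewrite divr_gt0.
have e8 : 0 < eps / 8 by rewrite divr_gt0.
have [N HN] := box_small e8.
have rd : rapid (dif v) by exact: dif_rapid.
have d0 : 0 < eps / 2 / (1 + (eps / 4)^-1).
  by rewrite divr_gt0 ?divr_gt0// ltr_wpDr// invr_ge0 ltW.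
have [T0 T00 H] := osc_difn_vanishes N 0%N 1 rv d0.
exists T0 => // T TT; have T_0 := le_trans T00 TT.
have := cos_perturb_osc N (measurable_phase (flow u T) th) (measurable_pair (flow (dif v) T)) l0.
have -> : EE (fun f => cos (pairing (flow u T) f + th + pairing (flow (dif v) T) f)) =
    cf (flow (fun x => u x + dif v x) T) th.
  apply: exp_ae_eq.
  - by apply: (bm_cos _).1; apply: measurable_funD => //; [exact: measurable_phase|exact: measurable_pair].
  - exact: (bm_cos (measurable_phase _ _)).1.
  apply: (ae_mono numod) => f mf.
  rewrite (flowD G flowP ru rd T_0).
  by rewrite (pairingD (flow_rapid ru T_0) (flow_rapid rd T_0) mf) addrAC.
move=> /le_trans; apply.
have := H T TT; rewrite ger0_norm ?osc_ge0// => {}H.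
have -> : osc N (pairing (flow (dif v) T)) = osc N (fun f => 1 * pairing (flow (difn 1 v) T) f).
  by apply: eq_osc => f _; rewrite mul1r.
have e1 : 0 < 1 + (eps / 4)^-1 by rewrite ltr_wpDr// invr_ge0 ltW.
have {}H : (1 + (eps / 4)^-1) * osc N (fun f => 1 * pairing (flow (difn 1 v) T) f) <= eps / 2.
  by rewrite mulrC -ler_pdivlMr.
by move: H HN; move: (_ * osc _ _) (\int[nu]_f _)%R => A B h1 h2; lra.
Qed.

(** Telescoping in time: [G_2T (1 - P_tau) = G_tau (1 - P_2T)]. A form that involves the long time
    interval becomes one over [[0, tau]] plus a vanishing term. *)
Lemma green_form_dif v z T : rapid v -> rapid z -> 0 <= T ->
  green_form (2 * T) (dif v) z = green_form tau v z - green_form tau (flow v (2 * T)) z.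
Proof.
move=> rv rz T0; have T2 : 0 <= 2 * T by rewrite mulr_ge0.
have t0 := ltW tau0; have rf := flow_rapid rv t0.
rewrite (green_form_sym G flowP)//; last exact: dif_rapid.
rewrite (green_formBr G flowP)//; [|exact: rapid_moderate..].
rewrite (green_form_sym G flowP rz)// (green_form_sym G flowP rz rf)//.
have := green_form_add G flowP rv rz T2 t0; have := green_form_add G flowP rv rz t0 T2.
rewrite addrC => -> H; apply/eqP; rewrite eq_sym subr_eq addrAC -H addrK//.
Qed.

(** The limit for large [T] of the difference of the exponents [V_T] at [u + dif v] and at [u]. *)
Definition phase_shift u v : R :=
  green_form tau v u + 2^-1 * (2 * green_form tau v v - green_form (2 * tau) v v).

Lemma noise_var_dif u v : rapid u -> rapid v ->
  vanishes (fun T => noise_var T (fun x => u x + dif v x) - noise_var T u - phase_shift u v).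
Proof.
move=> ru rv; have rd : rapid (dif v) by exact: dif_rapid.
have t0 := ltW tau0; have rf := flow_rapid rv t0.
have E T : 0 <= T -> noise_var T (fun x => u x + dif v x) - noise_var T u - phase_shift u v =
  - 1 * green_form tau (flow v (2 * T)) u + (- 2^-1 * green_form tau (flow v (2 * T)) (dif v) + 0).
  move=> T0; have T2 : 0 <= 2 * T by rewrite mulr_ge0.
  have Ev : green_form (2 * tau) v v = green_form tau v v + green_form tau v (flow v tau).
    rewrite (_ : 2 * tau = tau + tau); last by rewrite mulr_natl mulr2n.
    by rewrite (green_form_add G flowP)// (green_form_sym G flowP rf).
  rewrite /phase_shift Ev /noise_var.
  have mu := rapid_moderate ru; have md := rapid_moderate rd; have rud := rapidD ru rd.
  rewrite (green_formDr G flowP rud mu md T2).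
  rewrite (green_form_sym G flowP rud ru T2) (green_form_sym G flowP rud rd T2).
  rewrite (green_formDr G flowP ru mu md T2) (green_formDr G flowP rd mu md T2).
  rewrite (green_form_sym G flowP ru rd T2) (green_form_dif rv ru T0) (green_form_dif rv rd T0).
  have -> : green_form tau v (dif v) = green_form tau v v - green_form tau v (flow v tau).
    by rewrite (green_formBr G flowP)//; exact: rapid_moderate.
  by field.
have van z : rapid z -> vanishes (fun T => green_form tau (flow v (2 * T)) z).
  move=> rz eps eps0; have [T0 T00 H] := green_form_vanishes rv rz t0 eps0.
  exists T0 => // T TT; apply: H; apply: (le_trans TT).
  by rewrite ler_peMl ?ler1n// (le_trans T00).
have van0 : vanishes (fun=> 0 : R) by move=> eps e0; exists 0 => // T _; rewrite normr0 ltW.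
apply: vanishes_le (vanishesD (-1) (van _ ru) (vanishesD (- 2^-1) (van _ rd) van0)) => T T0.
by rewrite -E.
Qed.

(** Invariance is written at time [T] for both functions. The functionals of their flows become
    equal by [cf_difference_vanishes], and only the difference of the exponents survives. *)
Lemma cf_dif u v th : rapid u -> rapid v ->
  cf (fun x => u x + dif v x) th = cf u th * expR (- phase_shift u v).
Proof.
move=> ru rv; have rd : rapid (dif v) by exact: dif_rapid.
pose V1 T := noise_var T (fun x => u x + dif v x); pose V0 T := noise_var T u.
pose D T := cf (flow (fun x => u x + dif v x) T) th - cf (flow u T) th.
(* The left side is independent of [T]. The error [D T] comes with a factor at most 1, since the
   exponent [V1] is nonnegative. *)
have E T : 0 <= T -> cf (fun x => u x + dif v x) th =
    cf u th * expR (- (V1 T - V0 T - phase_shift u v) - phase_shift u v) + expR (- V1 T) * D T.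
  move=> T0; rewrite (cf_flow _ (rapidD ru rd) T0) (cf_flow _ ru T0).
  rewrite -mulrA -expRD (_ : - V0 T + _ = - V1 T); last by ring.
  by rewrite /D; ring.
have c1 : (cf u th * expR (- (V1 n%:R - V0 n%:R - phase_shift u v) - phase_shift u v)) @[n --> \oo] -->
    cf u th * expR (- 0 - phase_shift u v).
  apply: cvgM; first exact: cvg_cst.
  apply: continuous_cvg; first exact: continuous_expR.
  apply: cvgB; last exact: cvg_cst.
  apply: cvgN; exact: (vanishes_cvg (noise_var_dif ru rv)).
have c2 : expR (- V1 n%:R) * D n%:R @[n --> \oo] --> (0 : R).
  apply: (@vanishes_cvg (fun T => expR (- V1 T) * D T)).
  apply: vanishes_le (cf_difference_vanishes th ru rv) => T T0.
  rewrite normrM ger0_norm ?expR_ge0// ler_piMl// -expR0 ler_expR oppr_le0.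
  by apply: (noise_var_ge0 G flowP) => //; exact: rapidD.
have H : (cf u th * expR (- (V1 n%:R - V0 n%:R - phase_shift u v) - phase_shift u v) +
    expR (- V1 n%:R) * D n%:R) @[n --> \oo] --> cf u th * expR (- 0 - phase_shift u v) + 0.
  exact: cvgD c1 c2.
rewrite addr0 oppr0 sub0r in H.
refine (cvg_unique _ _ H); first exact: norm_hausdorff.
by apply: cvg_near_cst; apply: nearW => n; rewrite /= -E.
Qed.

End Difference.
End FlowLaw.

(** Formally the effect of the complex translation [phi -> phi + i v] in a measure of density
    [exp (- <phi, lap phi> / 2)], completed to a square. *)
Definition shift_law := forall u v th, rapid u -> rapid v ->
  cf (fun x => u x + lap v x) th =
  cf u th * expR (- (S (fun x => u x * v x) + 2^-1 * S (fun x => lap v x * v x))).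

Definition dif_law := forall tau u v th, 0 < tau -> rapid u -> rapid v ->
  cf (fun x => u x + dif flow tau v x) th = cf u th * expR (- phase_shift tau u v).

Lemma flow_law_dif : flow_law -> dif_law.
Proof. by move=> H tau u v th t0; exact: cf_dif. Qed.

Lemma is_derive_sum_seq (J : Type) (s : seq J) (h : J -> R -> R) (dh : J -> R) (r : R) :
  (forall y, is_derive r (1 : R) (h y) (dh y)) ->
  is_derive r (1 : R) (fun t => \sum_(y <- s) h y t) (\sum_(y <- s) dh y).
Proof.
move=> H; elim: s => [|y s IH].
  rewrite big_nil; have -> : (fun t => \sum_(y <- [::]) h y t) = cst 0.
    by apply/funext => t; rewrite big_nil.
  exact: is_derive_cst.
have -> : (fun t => \sum_(y <- y :: s) h y t) = (fun t => h y t + \sum_(y <- s) h y t).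
  by apply/funext => t; rewrite big_cons.
by rewrite big_cons; exact: is_deriveD.
Qed.

Lemma within_continuous_sum (J : Type) (s : seq J) (h : J -> R -> R) (A : set R) :
  (forall y, {within A, continuous (h y)}) ->
  {within A, continuous (fun t => \sum_(y <- s) h y t)}.
Proof.
move=> H; elim: s => [|y s IH].
  have -> : (fun t => \sum_(y <- [::]) h y t) = cst 0.
    by apply/funext => t; rewrite big_nil.
  by move=> x; exact: cvg_cst.
have -> : (fun t => \sum_(y <- y :: s) h y t) = (fun t => h y t + \sum_(y <- s) h y t).
  by apply/funext => t; rewrite big_cons.
by move=> x; apply: cvgD; [exact: H|exact: IH].
Qed.

Local Notation gint := (gint flow).

(** The function [P_r v + lap G_r v] is constant in [r]. Hence [dif v] is the Laplacian of a rapidly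
    decreasing function, and [dif_law] is an instance of [shift_law]. *)
Lemma lap_gint v t x : rapid v -> 0 < t -> lap (gint v t) x = v x - flow v t x.
Proof.
move=> rv t0; have [[dv cv] _ v0] := flowP rv.
pose h r := flow v r x + lap (gint v r) x.
have dh (r : R) : 0 < r -> is_derive r (1 : R) h (- lap (flow v r) x + lap (flow v r) x).
  move=> r0; apply: is_deriveD; first exact: dv.
  apply: is_derive_sum_seq => y.
  have dg z := gint_derive flowP z rv r0.
  exact: (is_deriveZ (w x y) (is_deriveB (dg x) (dg y))).
have ch : {within `[0, t], continuous h}.
  have cg : {within `[0, t], continuous (fun r => lap (gint v r) x)}.
    apply: within_continuous_sum => y z; apply: cvgM; first exact: cvg_cst.
    by apply: cvgB; exact: (gint_cont flowP).
  by move=> z; apply: cvgD; [exact: cv|exact: cg].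
have dh0 r : r \in `]0, t[ -> is_derive r (1 : R) h ((fun=> 0) r).
  by rewrite in_itv/= => /andP[r0 _]; have := dh r r0; rewrite addNr.
have [c _] := @MVT R h (fun=> 0) 0 t t0 dh0 ch.
rewrite mul0r /h v0 => /eqP; rewrite subr_eq0 => /eqP E.
have g0 : lap (gint v 0) x = 0.
  by rewrite /lap big1// => y _; rewrite !gint0 subrr mulr0.
by move: E; rewrite g0 addr0 addrC => <-; rewrite addrK.
Qed.

Lemma shift_law_dif : shift_law -> dif_law.
Proof.
move=> H t u v th t0 ru rv; have t0' := ltW t0.
have rg := gint_rapid G flowP rv t0'; have rf := flow_rapid rv t0'.
have -> : (fun x => u x + dif flow t v x) = (fun x => u x + lap (gint v t) x).
  by apply/funext => x; rewrite lap_gint.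
rewrite (H _ _ th ru rg); suff -> : S (fun x => u x * gint v t x) +
  2^-1 * S (fun x => lap (gint v t) x * gint v t x) = phase_shift t u v by [].
have E : green_form (2 * t) v v = green_form t v v + green_form t v (flow v t).
  rewrite (_ : 2 * t = t + t); last by rewrite mulr_natl mulr2n.
  by rewrite (green_form_add G flowP)// (green_form_sym G flowP rf).
have E1 : S (fun x => u x * gint v t x) = green_form t v u.
  by apply: eq_tsum => x; rewrite mulrC.
have E2 : S (fun x => lap (gint v t) x * gint v t x) = green_form t v v - green_form t v (flow v t).
  rewrite /green_form -(tsumB q0 cq).
  - by apply: eq_tsum => x; rewrite lap_gint// mulrC mulrBr.
  - by apply: (rapid_mul_dom G) => //; exact: rapid_moderate.
  - by apply: (rapid_mul_dom G) => //; exact: rapid_moderate.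
by rewrite E1 E2 /phase_shift E; move: (green_form _ _ _) (green_form _ _ _) (green_form _ _ _) => x y z; field.
Qed.

(** Here [u + v] is [flow u t + v] shifted by [dif u]. With [v = 0] it is invariance; with general
    [v] it gives the two-time functional needed for reversibility. *)
Lemma dif_law_flow u v t th : dif_law -> rapid u -> rapid v -> 0 < t ->
  cf (fun x => u x + v x) th =
  cf (fun x => flow u t x + v x) th * expR (- (green_form t u v + noise_var t u)).
Proof.
move=> H ru rv t0; have t0' := ltW t0; have rf := flow_rapid ru t0'.
have -> : (fun x => u x + v x) = (fun x => (flow u t x + v x) + dif flow t u x).
  by apply/funext => x; rewrite /dif; ring.
rewrite H//; last exact: rapidD.
have -> // : phase_shift t (fun x => flow u t x + v x) u = green_form t u v + noise_var t u.
rewrite /phase_shift (green_formDr G flowP)//; [|exact: rapid_moderate..].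
have E : green_form (2 * t) u u = green_form t u u + green_form t u (flow u t).
  rewrite (_ : 2 * t = t + t); last by rewrite mulr_natl mulr2n.
  by rewrite (green_form_add G flowP)// (green_form_sym G flowP rf).
by rewrite /noise_var E; field.
Qed.

Lemma rapid0 : rapid (fun=> 0).
Proof. by move=> z; exists 0 => x; rewrite normr0 mul0r. Qed.

Lemma dif_flow_law : dif_law -> flow_law.
Proof.
move=> H u t th ru; rewrite le_eqVlt => /orP[/eqP<-|t0].
  by rewrite (flow0 flowP)// /noise_var mulr0 green_form0 mulr0 oppr0 expR0 mulr1.
have := dif_law_flow th H ru rapid0 t0; rewrite /green_form.
have -> : (fun x => u x + 0) = u by apply/funext => x; rewrite addr0.
have -> : (fun x => flow u t x + 0) = flow u t by apply/funext => x; rewrite addr0.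
rewrite (_ : S _ = 0) ?add0r// -[RHS](tsum0 e); apply: eq_tsum => x; exact: mulr0.
Qed.

(** The generator as a limit: [dif_law] is applied to [v / t] as [t] tends to 0, where
    [(v - P_t v) / t] tends to [lap v] against every moderate function. *)
Lemma dif_law_shift : dif_law -> shift_law.
Proof.
move=> H u v th ru rv.
(* The offset 2 keeps [t n] at most one half, as [green_form_small2] requires. *)
pose t n : R := n.+2%:R^-1.
have t0 n : 0 < t n by rewrite invr_gt0.
have t2 n : t n <= 1 / 2 by rewrite div1r lef_pV2 ?posrE// ler_nat.
have t1 n : 0 <= t n <= 1 by rewrite ltW// (le_trans (t2 n))// ler_pdivrMr// mul1r ler1n.
have tc : t n @[n --> \oo] --> (0 : R).
  by have := @cvg_harmonic R; rewrite -(cvg_shiftS (@harmonic R)).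
have lin (A B K : R) (x : nat -> R) : (forall n, `|x n - B| <= K * t n) -> x n @[n --> \oo] --> B.
  move=> hx; apply/cvgrPdist_le => eps eps0.
  have : `|K| * t n @[n --> \oo] --> `|K| * 0 by apply: cvgM; [exact: cvg_cst|exact: tc].
  rewrite mulr0 => /cvgrPdist_le/(_ _ eps0).
  apply: filterS => n; rewrite sub0r normrN normrM normr_id (ger0_norm (ltW (t0 n))) => h.
  by rewrite distrC (le_trans (hx n))// (le_trans _ h)// ler_wpM2r ?(ltW (t0 n))// ler_norm.
pose vn n x := (t n)^-1 * v x.
have rvn n : rapid (vn n) by exact: rapidZ.
have rd n := dif_rapid G flowP (t0 n) (rvn n).
have c1 : cf (fun x => u x + dif flow (t n) (vn n) x) th @[n --> \oo] --> cf (fun x => u x + lap v x) th.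
  apply: (@exp_cvg _ _ _ _ _ _ 1) => [n||n f|].
  - exact: (bm_cos (measurable_phase _ _)).1.
  - exact: (bm_cos (measurable_phase _ _)).1.
  - by rewrite ler_norml cos_geN1 cos_le1.
  apply: (ae_mono numod) => f mf; apply: continuous_cvg; first exact: continuous_cos.
  apply: cvgD; last exact: cvg_cst.
  have rl := rapid_lap G rv.
  rewrite (pairingD ru rl mf).
  have -> : (fun n => pairing (fun x => u x + dif flow (t n) (vn n) x) f) =
            (fun n => pairing u f + pairing (dif flow (t n) (vn n)) f).
    by apply/funext => n; rewrite pairingD.
  apply: cvgD; first exact: cvg_cst.
  have [K K_0 HK] := flow_taylor G flowP rv mf.
  apply: (lin 0 _ K) => n; have tn := ltW (t0 n); have rf := flow_rapid rv tn.
  have -> : pairing (dif flow (t n) (vn n)) f = (t n)^-1 * (pairing v f - pairing (flow v (t n)) f).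
    have fE : flow (vn n) (t n) = (fun x => (t n)^-1 * flow v (t n) x) := flowZ G flowP _ rv tn.
    have -> : dif flow (t n) (vn n) = (fun x => (t n)^-1 * (v x - flow v (t n) x)).
      by apply/funext => x; rewrite mulrBr -[RHS]/(vn n x - _) -[X in _ = _ - X]/((fun x => _) x) -fE.
    by rewrite (pairingZ _ (rapidB rv rf) mf) (pairingB rv rf mf).
  have := HK _ (t1 n); rewrite -!pairingE//.
  move: (pairing _ _) (pairing _ _) (pairing _ _) => A B D h.
  rewrite -(ler_pM2l (t0 n)) -{1}(ger0_norm tn) -normrM.
  rewrite mulrBr mulrA divff ?gt_eqF// mul1r distrC.
  rewrite (_ : t n * A - (B - D) = D - B + t n * A); last by ring.
  by apply: (le_trans h); rewrite le_eqVlt; apply/orP; left; apply/eqP; ring.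
have c2 : phase_shift (t n) u (vn n) @[n --> \oo] -->
    S (fun x => u x * v x) + 2^-1 * S (fun x => lap v x * v x).
  apply: cvgD.
    have [K K_0 HK] := green_form_small G flowP ru (rapid_moderate rv).
    apply: (lin 0 _ K) => n; have tn := ltW (t0 n).
    rewrite (green_form_sym G flowP)// (green_formZr G flowP)//; last exact: rapid_moderate.
    rewrite -(ler_pM2l (t0 n)) -{1}(ger0_norm tn) -normrM mulrBr mulrA divff ?gt_eqF// mul1r.
    by apply: (le_trans (HK _ (t1 n))); rewrite le_eqVlt; apply/orP; left; apply/eqP; ring.
  apply: cvgM; first exact: cvg_cst.
  have [K K_0 HK] := green_form_small2 G flowP rv.
  apply: (lin 0 _ K) => n; have tn := ltW (t0 n).
  have E s : 0 <= s -> green_form s (vn n) (vn n) = (t n)^-1 ^+ 2 * green_form s v v.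
    move=> s0; rewrite (green_formZr G flowP)//; last exact: rapid_moderate.
    rewrite (green_form_sym G flowP)// (green_formZr G flowP)//; last exact: rapid_moderate.
    by rewrite mulrA expr2.
  rewrite !E ?mulr_ge0//.
  have tn2 : 0 < t n ^+ 2 by rewrite exprn_gt0.
  have := HK (t n); rewrite tn t2 => /(_ isT).
  move: (green_form _ _ _) (green_form _ _ _) (S _) => A B D h.
  rewrite -(ler_pM2l tn2) -{1}(ger0_norm (ltW tn2)) -normrM.
  rewrite (_ : t n ^+ 2 * _ = 2 * B - A - t n ^+ 2 * D); last first.
    by field; rewrite gt_eqF.
  by apply: (le_trans h); rewrite le_eqVlt; apply/orP; left; apply/eqP; ring.
have c3 : cf u th * expR (- phase_shift (t n) u (vn n)) @[n --> \oo] -->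
    cf u th * expR (- (S (fun x => u x * v x) + 2^-1 * S (fun x => lap v x * v x))).
  apply: cvgM; first exact: cvg_cst.
  by apply: continuous_cvg; [exact: continuous_expR|exact: cvgN].
refine (cvg_unique _ c1 _); first exact: norm_hausdorff.
by have -> : (fun n => cf (fun x => u x + dif flow (t n) (vn n) x) th) =
  (fun n => cf u th * expR (- phase_shift (t n) u (vn n))) by apply/funext => n; rewrite H.
Qed.

End CharacteristicFunctional.

(** * One-site shifts and Gibbs measures *)

Section SiteLaw.
Context {R : realType} {d : nat} {C : set 'rV[int]_d}.
Local Notation conf := (configuration R C).
Context (e : nat -> C) (ix : C -> nat).
Context (nb : C -> seq C) (w : C -> C -> R) (a : C -> R) (k0 k2 : nat) (K0 K1 : R).
Hypothesis G : weighted_graph e ix nb w a k0 k2 K0 K1.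

Let q x := a x ^ (- k2%:Z).
Local Notation S := (@tsum R C e).
Local Notation lap := (lap nb w).
Local Notation bnd := (bnd a).
Local Notation rapid := (rapid a).
Local Notation moderate := (moderate a).
Let q0 : forall x, 0 < q x := q_gt0 G.
Let cq : cvgn (series (fun i => q (e i))) := q_cvg G.
Let eK := eK G.
Let ixK := ixK G.

Definition quad (u v : C -> R) : R := S (fun x => u x * v x) + 2^-1 * S (fun x => lap v x * v x).

Definition point (x : C) (c : R) (y : C) : R := if y == x then c else 0.

Lemma rapid_point x c : rapid (point x c).
Proof.
move=> z; exists (`|c| / a x ^ z) => y; rewrite /point; case: eqVneq => [->|_].
  by rewrite divfK// gt_eqF// (az_gt0 G).
by rewrite normr0; apply: mulr_ge0; [apply: divr_ge0 => //; exact/ltW/(az_gt0 G)|exact/ltW/(az_gt0 G)].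
Qed.

Lemma tsum_point x c f : S (fun y => point x c y * f y) = c * f x.
Proof.
rewrite (@tsum_finite _ _ _ _ (ix x).+1).
  rewrite /series /= ?big_mkord (bigD1 ord_max)//= ixK /point eqxx big1 ?addr0// => i ix'.
  case: eqVneq => [E|_]; last by rewrite mul0r.
  by case/eqP: ix'; apply: val_inj; move: (congr1 ix E); rewrite eK.
move=> i hi; rewrite /point; case: eqVneq => [E|_]; last by rewrite mul0r.
by move: hi; rewrite -E eK ltnn.
Qed.

(** The cocycle identity behind the composition of shifts: shifting by [v] and then by [v'] produces
    the cross term that symmetry of the Laplacian doubles. *)
Lemma quadD u v v' : rapid u -> rapid v -> rapid v' ->
  quad u (fun x => v x + v' x) = quad u v + quad (fun x => u x + lap v x) v'.
Proof.
move=> ru rv rv'.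
have D f g : rapid f -> rapid g -> dominated q (fun x => f x * g x).
  by move=> rf rg; apply: (rapid_mul_dom G) => //; exact: rapid_moderate.
have E f g h : rapid f -> rapid g -> rapid h ->
    S (fun x => f x * (g x + h x)) = S (fun x => f x * g x) + S (fun x => f x * h x).
  move=> rf rg rh; rewrite -(tsumD q0 cq); [|exact: D..].
  by apply: eq_tsum => x; rewrite mulrDr.
have rl := rapid_lap G rv; have rl' := rapid_lap G rv'.
rewrite /quad E//.
have -> : S (fun x => lap (fun y => v y + v' y) x * (v x + v' x)) =
    S (fun x => lap v x * v x) + S (fun x => lap v x * v' x) +
    (S (fun x => lap v' x * v x) + S (fun x => lap v' x * v' x)).
  rewrite -!E// -(tsumD q0 cq); last 2 first.
  - by apply: D => //; exact: rapidD.
  - by apply: D => //; exact: rapidD.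
  by apply: eq_tsum => x; rewrite lapD mulrDl.
have -> : S (fun x => lap v' x * v x) = S (fun x => lap v x * v' x).
  rewrite (lap_symS G)//; last exact: rapid_moderate.
  by apply: eq_tsum => x; rewrite mulrC.
have -> : S (fun x => (u x + lap v x) * v' x) = S (fun x => u x * v' x) + S (fun x => lap v x * v' x).
  rewrite -(tsumD q0 cq); [|exact: D..].
  by apply: eq_tsum => x; rewrite mulrDl.
by field.
Qed.

(** Stated for any functional [F], because it is used both for the characteristic functional of a
    measure and for the conditional one, [gcos]. *)
Definition site_law (F : (C -> R) -> R -> R) x := forall u c th, rapid u ->
  F (fun y => u y + lap (point x c) y) th = F u th * expR (- quad u (point x c)).

Lemma site_law_seq F (s : seq C) u v th : (forall x, x \in s -> site_law F x) -> rapid u ->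
  (forall x, x \notin s -> v x = 0) ->
  rapid v /\ F (fun y => u y + lap v y) th = F u th * expR (- quad u v).
Proof.
elim: s u v => [|x s IH] u v H ru vs.
  have -> : v = (fun=> 0) by apply/funext => x; rewrite vs.
  split; first exact: rapid0.
  have -> : (fun y => u y + lap (fun=> 0) y) = u.
    apply/funext => y; rewrite [X in _ + X](_ : _ = 0) ?addr0//.
    by rewrite /lap big1// => z _; rewrite subrr mulr0.
  rewrite /quad.
  have E (f : C -> R) : S (fun x => f x * 0) = 0.
    by rewrite -[RHS](tsum0 e); apply: eq_tsum => y; rewrite mulr0.
  by rewrite !E mulr0 addr0 oppr0 expR0 mulr1.
pose v0 y := if y == x then 0 else v y.
have E : v = (fun y => v0 y + point x (v x) y).
  by apply/funext => y; rewrite /v0 /point; case: eqVneq => [->|_]; rewrite ?add0r ?addr0.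
have [|y ys|r0 E0] := IH u v0 _ ru.
- by move=> y ys; apply: H; rewrite inE ys orbT.
- by rewrite /v0; case: eqVneq => // yx; apply: vs; rewrite inE negb_or yx.
have rp := rapid_point x (v x).
split; first by rewrite E; exact: rapidD.
have Hx := H x (mem_head _ _).
have -> : (fun y => u y + lap v y) = (fun y => (u y + lap v0 y) + lap (point x (v x)) y).
  by apply/funext => y; rewrite {1}E lapD addrA.
rewrite Hx; last by apply: rapidD => //; exact: (rapid_lap G).
by rewrite E0 -mulrA -expRD -opprD -quadD// -E.
Qed.

Variable nu : probability conf R.
Hypothesis numod : {ae nu, forall f, moderate f}.
Local Notation cf := (cf nu).

(** Shifts supported on finitely many sites are composed from one-site shifts by [site_law_seq]; a
    general [v] is reached by truncation, with [tannery] for the exponents and for the pairings. *)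
Lemma site_law_shift : (forall x, site_law cf x) -> shift_law e nb w a nu.
Proof.
move=> H u v th ru rv.
pose vn n x := if (ix x < n)%N then v x else 0.
have vv n x : `|vn n x| <= `|v x| by rewrite /vn; case: ifP; rewrite ?normr0.
have cvn x : vn n x @[n --> \oo] --> v x.
  by apply: cvg_near_cst; exists (ix x).+1 => // n /= h; rewrite /vn h.
have vnP n := @site_law_seq cf [seq e i | i <- iota 0 n] u (vn n) th (fun x _ => H x) ru.
have {}vnP n : rapid (vn n) /\ cf (fun y => u y + lap (vn n) y) th = cf u th * expR (- quad u (vn n)).
  apply: vnP => x xs; rewrite /vn; case: ifP => // h; case/negP: xs.
  by rewrite -(ixK x); apply: map_f; rewrite mem_iota.
have rvn n : rapid (vn n) by case: (vnP n).
have cl x : lap (vn n) x @[n --> \oo] --> lap v x.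
  rewrite /lap; apply: cvg_big => [|y _]; first exact: add_continuous.
  by apply: cvgM; [exact: cvg_cst|apply: cvgB].
have c1 : cf (fun y => u y + lap (vn n) y) th @[n --> \oo] --> cf (fun y => u y + lap v y) th.
  apply: (@exp_cvg _ _ _ _ _ _ 1) => [n||n f|].
  - exact: (bm_cos (measurable_phase G _ _)).1.
  - exact: (bm_cos (measurable_phase G _ _)).1.
  - by rewrite ler_norml cos_geN1 cos_le1.
  apply: (ae_mono numod) => f mf; apply: continuous_cvg; first exact: continuous_cos.
  apply: cvgD; last exact: cvg_cst.
  have E z : rapid z -> pairing (fun x => u x + lap z x) f = pairing u f + S (fun x => z x * lap f x).
    move=> rz; rewrite (pairingD G ru (rapid_lap G rz) mf); congr (_ + _).
    by rewrite (pairingE G)//; [exact: (lap_symS G)|exact: (rapid_lap G)].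
  rewrite E//; have -> : (fun n => pairing (fun x => u x + lap (vn n) x) f) =
      (fun n => pairing u f + S (fun x => vn n x * lap f x)) by apply/funext => n; rewrite E.
  apply: cvgD; first exact: cvg_cst.
  have [K HK] := rapid_mul_dom G rv (moderate_lap G mf).
  apply: (tannery q0 cq) => [n x|x]; last by apply: cvgM; [exact: cvn|exact: cvg_cst].
  by apply: le_trans (HK x); rewrite !normrM ler_wpM2r.
have c2 : quad u (vn n) @[n --> \oo] --> quad u v.
  apply: cvgD.
    have [K HK] := rapid_mul_dom G ru (rapid_moderate rv).
    apply: (tannery q0 cq) => [n x|x]; last by apply: cvgM; [exact: cvg_cst|exact: cvn].
    by apply: le_trans (HK x); rewrite !normrM ler_wpM2l.
  apply: cvgM; first exact: cvg_cst.
  have [K HK] := rapid_mul_dom G rv (rapid_moderate rv).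
  have [M' bM'] := rv (- k2%:Z - k0%:Z); have [M'' bM''] := rv 0%Z.
  have kE : k0%:Z + (- k2%:Z - k0%:Z) = - k2%:Z by rewrite addrC subrK.
  have bl n : bnd (lapC K0 (- k2%:Z - k0%:Z) * M') (- k2%:Z) (lap (vn n)).
    rewrite -[X in bnd _ X]kE; apply: (bnd_lap G) => x; exact: le_trans (vv n x) (bM' x).
  apply: (@tannery _ _ _ _ q0 cq _ _ (lapC K0 (- k2%:Z - k0%:Z) * M' * M'')) => [n x|x]; last first.
    by apply: cvgM; [exact: cl|exact: cvn].
  rewrite normrM mulrAC; apply: ler_pM => //.
    exact: bl.
  by apply: (le_trans (vv n x)); have := bM'' x; rewrite expr0z mulr1.
have c3 : cf u th * expR (- quad u (vn n)) @[n --> \oo] --> cf u th * expR (- quad u v).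
  apply: cvgM; first exact: cvg_cst.
  by apply: continuous_cvg; [exact: continuous_expR|exact: cvgN].
refine (cvg_unique _ c1 _); first exact: norm_hausdorff.
have -> // : (fun n => cf (fun y => u y + lap (vn n) y) th) = (fun n => cf u th * expR (- quad u (vn n))).
by apply/funext => n; case: (vnP n).
Qed.

End SiteLaw.

Lemma exists_probability {dT} {T : measurableType dT} {R : realType} (m : set T -> \bar R) :
  m set0 = 0%E -> (forall A, (0 <= m A)%E) -> semi_sigma_additive m -> m setT = 1%E ->
  exists P : probability T R, forall A, P A = m A.
Proof.
move=> m0 mge msig m1.
pose mixin := isMeasure.Build _ _ _ m m0 mge msig.
pose M : {measure set T -> \bar R} := HB.pack m mixin.
pose mixin' := Measure_isProbability.Build _ _ _ M m1.
by exists (HB.pack_for (probability T R) m mixin mixin').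
Qed.

(** * Positive functionals determined by indicators *)

Section LinearExtension.
Context {dT : measure_display} {T : measurableType dT} {R : realType}.
Implicit Types (Psi : (T -> R) -> R) (k : T -> R).

Definition positive_linear Psi :=
  [/\ forall h, bounded_mfun h -> (forall x, 0 <= h x) -> 0 <= Psi h,
      forall f g, bounded_mfun f -> bounded_mfun g -> (forall x, 0 <= f x) -> (forall x, 0 <= g x) ->
        Psi (fun x => f x + g x) = Psi f + Psi g
    & forall c f, 0 <= c -> bounded_mfun f -> (forall x, 0 <= f x) ->
        Psi (fun x => c * f x) = c * Psi f].

(** The integer part of [y], as a number of indicators, so that a functional can be applied to it
    term by term. *)
Lemma count_below (y : R) n : 0 <= y ->
  let m := (\sum_(i < n) ((i.+1%:R <= y)%R : bool))%N in
  [/\ (m <= n)%N, m%:R <= y & y <= n%:R -> y < m%:R + 1].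
Proof.
move=> y0 /=; elim: n => [|n [IH1 IH2 IH3]]; rewrite ?big_ord0 ?big_ord_recr/=.
  by split=> // yn; apply: (le_lt_trans yn); rewrite ltr_pwDr.
set m := (\sum_(i < n) _)%N in IH1 IH2 IH3 *.
case: (leP n.+1%:R y) => [ny|yn].
  have mn : m = n.
    apply/eqP; rewrite eqn_leq IH1 /m -[X in (X <= _)%N](card_ord n) -sum1_card.
    apply: leq_sum => i _; rewrite (le_trans _ ny)// ler_nat; exact: ltnW (ltn_ord i).
  rewrite mn addn1 leqnn; split => // yn.
  by apply: (le_lt_trans yn); rewrite ltr_pwDr.
rewrite addn0; split => //; first exact: leqW.
move=> _; case: (leP y n%:R) => [|ny]; first exact: IH3.
have -> : m = n; last by rewrite natr1.
apply/eqP; rewrite eqn_leq IH1 /m -[X in (X <= _)%N](card_ord n) -sum1_card.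
by apply: leq_sum => i _; rewrite (le_trans _ (ltW ny))// ler_nat.
Qed.

Lemma positive_linear_le Psi f g : positive_linear Psi -> bounded_mfun f -> bounded_mfun g ->
  (forall x, 0 <= f x) -> (forall x, f x <= g x) -> Psi f <= Psi g.
Proof.
move=> [P0 PD PZ] bf bg f0 fg.
have -> : g = (fun x => f x + (g x - f x)) by apply/funext => x; rewrite addrC subrK.
rewrite PD//; [|exact: bmB|by move=> x; rewrite subr_ge0].
by rewrite lerDl; apply: P0; [exact: bmB|move=> x; rewrite subr_ge0].
Qed.

Lemma positive_linear_sum Psi (c : R) (h : nat -> T -> R) n : positive_linear Psi -> 0 <= c ->
  (forall i, bounded_mfun (h i)) -> (forall i x, 0 <= h i x) ->
  bounded_mfun (fun x => \sum_(i < n) c * h i x) /\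
  Psi (fun x => \sum_(i < n) c * h i x) = \sum_(i < n) c * Psi (h i).
Proof.
move=> PP c0 bh h0; have [P0 PD PZ] := PP; elim: n => [|n [IH1 IH2]].
  have -> : (fun x => \sum_(i < 0) c * h i x) = (fun x => 0 * (h 0%N x)).
    by apply/funext => x; rewrite big_ord0 mul0r.
  by split; [exact: bmZ|rewrite PZ// big_ord0 mul0r].
have -> : (fun x => \sum_(i < n.+1) c * h i x) = (fun x => \sum_(i < n) c * h i x + c * h n x).
  by apply/funext => x; rewrite big_ord_recr.
split; first by apply: bmD => //; exact: bmZ.
rewrite PD//.
- by rewrite IH2 PZ// big_ord_recr.
- exact: bmZ.
- by move=> x; apply: sumr_ge0 => i _; exact: mulr_ge0.
- by move=> x; exact: mulr_ge0.
Qed.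

(** A function with values in [[0, 1]] is within [1 / n] of the mean of the indicators of its
    superlevel sets at the levels [i.+1 / n]. The approximation is uniform, so positivity and
    additivity suffice to pass to the limit. *)
Lemma positive_linear_ext Psi1 Psi2 k : positive_linear Psi1 -> positive_linear Psi2 ->
  (forall A, measurable A -> Psi1 \1_A = Psi2 \1_A) ->
  bounded_mfun k -> (forall x, 0 <= k x) -> Psi1 k = Psi2 k.
Proof.
move=> P1 P2 E.
suff H h : bounded_mfun h -> (forall x, 0 <= h x <= 1) -> Psi1 h = Psi2 h.
  move=> bk k0; have [_ [M kM]] := bk.
  have M0 : 0 < `|M| + 1 by rewrite ltr_wpDl.
  have := H (fun x => (`|M| + 1)^-1 * k x) (bmZ _ bk).
  have [[_ _ Z1] [_ _ Z2]] := (P1, P2).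
  rewrite Z1 ?invr_ge0 ?(ltW M0)// Z2 ?invr_ge0 ?(ltW M0)// => {}H.
  apply: (@mulfI _ (`|M| + 1)^-1); first by rewrite invr_eq0 gt_eqF.
  apply: H => x; apply/andP; split; first by rewrite mulr_ge0// invr_ge0 ltW.
  rewrite ler_pdivrMl// mulr1 (le_trans (ler_norm _))// (le_trans (kM x))//.
  by rewrite (le_trans (ler_norm _))// lerDl.
move=> bh h01.
have h0 x : 0 <= h x by case/andP: (h01 x).
pose A n i := [set x | i.+1%:R <= n%:R * h x].
have mA n i : measurable (A n i).
  rewrite -[X in measurable X]setTI.
  rewrite (_ : A n i = (fun x => n%:R * h x) @^-1` `[i.+1%:R, +oo[); last first.
    by apply/seteqP; split => x; rewrite /A /= in_itv/= andbT.
  by have [m _] := bmZ n%:R bh; exact: m.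
have bA n i : bounded_mfun (\1_(A n i) : T -> R) by exact: bm_indic.
have A0 n i x : 0 <= \1_(A n i) x :> R by rewrite indicE.
pose sk n x := \sum_(i < n) n%:R^-1 * (\1_(A n i) x : R).
have kE n x : sk n x = n%:R^-1 * (\sum_(i < n) ((i.+1%:R <= n%:R * h x)%R : bool))%N%:R.
  rewrite /sk -mulr_sumr natr_sum; congr (_ * _); apply: eq_bigr => i _.
  by rewrite indicE; congr (_%:R); congr nat_of_bool; apply/idP/idP; rewrite inE.
have kle n x : (0 < n)%N -> 0 <= sk n x /\ sk n x <= h x <= sk n x + n%:R^-1.
  move=> n0; have n0' : 0 < n%:R :> R by rewrite ltr0n.
  have [] := @count_below (n%:R * h x) n; first by rewrite mulr_ge0.
  move=> _ c1 c2; rewrite kE; split; first by rewrite mulr_ge0// invr_ge0 ltW.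
  rewrite ler_pdivrMl// c1/= -[X in _ + X]mulr1 -mulrDr ler_pdivlMl//; apply/ltW/c2.
  by rewrite ger_pMr//; case/andP: (h01 x).
have B Psi n : positive_linear Psi -> (0 < n)%N ->
    Psi (sk n) <= Psi h <= Psi (sk n) + n%:R^-1 * Psi (fun=> 1).
  move=> PP n0; have [b e] := @positive_linear_sum Psi n%:R^-1 (fun i => \1_(A n i)) n PP
    (ltac:(by rewrite invr_ge0)) (bA n) (A0 n).
  have [P0 PD PZ] := PP.
  have kp x : 0 <= sk n x by case: (kle n x n0).
  have ip : 0 <= n%:R^-1 :> R by rewrite invr_ge0.
  have b1 : bounded_mfun (fun _ : T => 1 : R) by exact: bm_cst.
  have b1' : bounded_mfun (fun _ : T => n%:R^-1 * 1 : R) by exact: bm_cst.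
  apply/andP; split.
    by apply: positive_linear_le => // x; case: (kle n x n0) => _ /andP[].
  rewrite -(PZ _ (fun=> 1))// -PD//.
  apply: positive_linear_le => //; first exact: bmD.
  by move=> x; rewrite mulr1; case: (kle n x n0) => _ /andP[].
have K n : Psi1 (sk n) = Psi2 (sk n).
  have ip : 0 <= n%:R^-1 :> R by rewrite invr_ge0.
  have [_ ->] := @positive_linear_sum Psi1 n%:R^-1 (fun i => \1_(A n i)) n P1 ip (bA n) (A0 n).
  have [_ ->] := @positive_linear_sum Psi2 n%:R^-1 (fun i => \1_(A n i)) n P2 ip (bA n) (A0 n).
  by apply: eq_bigr => i _; rewrite E.
have ET : Psi1 (fun=> 1) = Psi2 (fun=> 1).
  have -> : (fun=> 1) = \1_[set: T] :> (T -> R) by apply/funext => x; rewrite indicE in_setT.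
  exact: E measurableT.
have p1 : 0 <= Psi2 (fun=> 1) by have [P0 _ _] := P2; apply: P0 => //; exact: bm_cst.
apply/eqP; rewrite -subr_eq0 -normr_le0; apply/ler_addgt0Pl => eps eps0; rewrite addr0.
pose n := (Num.bound (Psi2 (fun=> 1) / eps)).+1.
have Hn : n%:R^-1 * Psi2 (fun=> 1) <= eps.
  rewrite ler_pdivrMl ?ltr0n// -ler_pdivrMr//.
  apply: le_trans (ltW (archi_boundP _)) _; first by rewrite divr_ge0// ltW.
  by rewrite ler_nat.
have := B Psi1 n P1 isT; have := B Psi2 n P2 isT; rewrite K ET ler_norml.
by move: (Psi1 h) (Psi2 h) (Psi2 (sk n)) (_ * _) Hn => a b c z; lra.
Qed.

End LinearExtension.

(** * Iterated Lebesgue integrals over finitely many sites *)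

Section LebesgueSites.
Context {R : realType} {d : nat} {C : set 'rV[int]_d}.
Local Notation conf := (configuration R C).
Local Open Scope ereal_scope.
Implicit Types (g h : conf -> \bar R) (f : conf) (s : seq C).

Definition upd (f : C -> R) (x : C) (a : R) : C -> R := [eta f with x |-> a].

Lemma updE f x a y : upd f x a y = if y == x then a else f y.
Proof. by []. Qed.

Lemma upd_comm f x y a b : x != y -> upd (upd f x a) y b = upd (upd f y b) x a.
Proof.
move=> xy; apply/funext => z; rewrite !updE; case: (eqVneq z y) => [->|//].
by rewrite eq_sym (negbTE xy).
Qed.

Lemma measurable_upd x : measurable_fun setT (fun p : conf * R => upd p.1 x p.2 : conf).
Proof.
apply: measurable_to_conf => y; rewrite /upd /=; case: eqVneq => _; first exact: measurable_snd.
by apply: (measurableT_comp (measurable_coord y)); exact: measurable_fst.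
Qed.

Lemma measurable_upd1 x f : measurable_fun setT (fun a : R => upd f x a : conf).
Proof.
apply: measurable_to_conf => y; rewrite /upd /=; case: eqVneq => _; first exact: measurable_id.
exact: measurable_cst.
Qed.

Local Notation mu := (@lebesgue_measure R).
Local Notation LS := lebesgue_sites.

Lemma lebesgue_sites_cons x s g f : LS (x :: s) g f = \int[mu]_a LS s g (upd f x a).
Proof. by []. Qed.

Lemma lebesgue_sites_ge0 s g f : (forall f, 0 <= g f) -> 0 <= LS s g f.
Proof.
move=> g0; elim: s f => [|x s IH] f; first exact: g0.
by rewrite lebesgue_sites_cons; apply: integral_ge0 => a _; exact: IH.
Qed.

Lemma measurable_integral_upd x g : measurable_fun setT g -> (forall f, 0 <= g f) ->
  measurable_fun setT (fun f : conf => \int[mu]_a g (upd f x a)).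
Proof.
move=> mg g0.
apply: (@measurable_fun_fubini_tonelli_F _ _ _ _ _ mu (fun p : conf * R => g (upd p.1 x p.2))) => //.
exact: measurableT_comp (measurable_upd x).
Qed.

Lemma measurable_lebesgue_sites s g : measurable_fun setT g -> (forall f, 0 <= g f) ->
  measurable_fun setT (LS s g : conf -> \bar R).
Proof.
move=> mg g0; elim: s => [//|x s IH].
by apply: measurable_integral_upd => // f; exact: lebesgue_sites_ge0.
Qed.

Lemma measurable_LS1 s g x f : measurable_fun setT g -> (forall f, 0 <= g f) ->
  measurable_fun setT (fun a : R => LS s g (upd f x a)).
Proof.
move=> mg g0; apply: (measurableT_comp (measurable_lebesgue_sites s mg g0)).
exact: measurable_upd1.
Qed.

Lemma lebesgue_sitesD s g h f : measurable_fun setT g -> measurable_fun setT h ->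
  (forall f, 0 <= g f) -> (forall f, 0 <= h f) ->
  LS s (fun f => g f + h f) f = LS s g f + LS s h f.
Proof.
move=> mg mh g0 h0; elim: s f => [//|x s IH] f; rewrite !lebesgue_sites_cons.
rewrite -ge0_integralD//; last 4 first.
- by move=> a _; exact: lebesgue_sites_ge0.
- exact: measurable_LS1.
- by move=> a _; exact: lebesgue_sites_ge0.
- exact: measurable_LS1.
by apply: eq_integral => a _; rewrite IH.
Qed.

Lemma lebesgue_sitesZ s g f (c : R) : measurable_fun setT g -> (forall f, 0 <= g f) -> (0 <= c)%R ->
  LS s (fun f => c%:E * g f) f = c%:E * LS s g f.
Proof.
move=> mg g0 c0; elim: s f => [//|x s IH] f; rewrite !lebesgue_sites_cons.
rewrite -ge0_integralZl//; [|exact: measurable_LS1|by move=> a _; exact: lebesgue_sites_ge0].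
by apply: eq_integral => a _; rewrite IH.
Qed.

Lemma eq_lebesgue_sites s g h f :
  (forall f', (forall y, y \notin s -> f' y = f y) -> g f' = h f') -> LS s g f = LS s h f.
Proof.
elim: s f => [|x s IH] f gh; first exact: gh.
rewrite !lebesgue_sites_cons; apply: eq_integral => a _; apply: IH => f' H; apply: gh => y.
by rewrite inE negb_or => /andP[yx ys]; rewrite H// updE (negbTE yx).
Qed.

Lemma le_lebesgue_sites s g h f : measurable_fun setT g -> measurable_fun setT h ->
  (forall f, 0 <= g f) -> (forall f, 0 <= h f) ->
  (forall f', (forall y, y \notin s -> f' y = f y) -> g f' <= h f') -> LS s g f <= LS s h f.
Proof.
move=> mg mh g0 h0; elim: s f => [|x s IH] f gh; first exact: gh.
rewrite !lebesgue_sites_cons; apply: ge0_le_integral => //.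
- by move=> a _; exact: lebesgue_sites_ge0.
- exact: measurable_LS1.
- exact: measurable_LS1.
- move=> a _; apply: IH => f' H; apply: gh => y.
  by rewrite inE negb_or => /andP[yx ys]; rewrite H// updE (negbTE yx).
Qed.

Lemma lebesgue_sites_nneseries s (g : nat -> conf -> \bar R) f :
  (forall n, measurable_fun setT (g n)) -> (forall n f, 0 <= g n f) ->
  LS s (fun f => \sum_(n <oo) g n f) f = \sum_(n <oo) LS s (g n) f.
Proof.
move=> mg g0; elim: s f => [//|x s IH] f; rewrite lebesgue_sites_cons.
under eq_integral do rewrite IH.
rewrite integral_nneseries// => [n|n a _]; first exact: measurable_LS1.
exact: lebesgue_sites_ge0.
Qed.

Lemma lebesgue_sites_swap x y s g f : measurable_fun setT g -> (forall f, 0 <= g f) ->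
  LS [:: x, y & s] g f = LS [:: y, x & s] g f.
Proof.
move=> mg g0; have [->//|xy] := eqVneq x y.
rewrite !lebesgue_sites_cons /=.
pose k (p : measurableTypeR R * measurableTypeR R) := LS s g (upd (upd f x p.1) y p.2).
have mk : measurable_fun setT k.
  apply: (measurableT_comp (measurable_lebesgue_sites s mg g0)).
  apply: measurable_to_conf => z; rewrite /upd /=; case: eqVneq => _; first exact: measurable_snd.
  by case: eqVneq => _; [exact: measurable_fst|exact: measurable_cst].
have k0 p : 0 <= k p by exact: lebesgue_sites_ge0.
transitivity (\int[mu]_b \int[mu]_a k (a, b)).
  exact: (@fubini_tonelli _ _ (measurableTypeR R) (measurableTypeR R) _ mu mu k mk k0).
by apply: eq_integral => b _; apply: eq_integral => a _; rewrite /k /= upd_comm.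
Qed.

Lemma lebesgue_sites_rcons s x g f :
  LS (rcons s x) g f = LS s (fun f => \int[mu]_a g (upd f x a)) f.
Proof.
elim: s f => [//|y s IH] f; rewrite rcons_cons !lebesgue_sites_cons.
by apply: eq_integral => a _; rewrite IH.
Qed.

Lemma lebesgue_sites_last s x g f : measurable_fun setT g -> (forall f, 0 <= g f) ->
  LS (x :: s) g f = LS (rcons s x) g f.
Proof.
move=> mg g0; elim: s f => [//|y s IH] f; rewrite lebesgue_sites_swap//.
rewrite rcons_cons !lebesgue_sites_cons; apply: eq_integral => a _; exact: IH.
Qed.

(** Tonelli moves a chosen site to the innermost position, so that a one-site integral can be
    computed explicitly with all the other values frozen. *)
Lemma lebesgue_sites_inner s x : x \in s -> exists s', {subset s' <= s} /\ 
  forall g f, measurable_fun setT g -> (forall f, 0 <= g f) ->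
  LS s g f = LS s' (fun f => \int[mu]_a g (upd f x a)) f.
Proof.
move=> /splitPr[s1 s2]; exists (s1 ++ s2); split.
  by move=> y; rewrite !mem_cat inE => /orP[->//|->]; rewrite !orbT.
move=> g f mg g0; rewrite -lebesgue_sites_rcons -cats1 -catA cats1.
elim: s1 f => [|y s1 IH] f; first exact: lebesgue_sites_last.
by rewrite !cat_cons !lebesgue_sites_cons; apply: eq_integral => a _; exact: IH.
Qed.

Lemma integral_gt0 (h : R -> \bar R) : measurable_fun setT h -> (forall a, 0 < h a) ->
  0 < \int[mu]_a h a.
Proof.
move=> mh h0; rewrite lt_def integral_ge0 ?andbT => [|a _]; last exact: ltW.
apply/negP => /eqP E.
have : \int[mu]_(a in setT) `|h a| = 0.
  by rewrite -[RHS]E; apply: eq_integral => a _; rewrite gee0_abs// ltW.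
move/(ae_eq_integral_abs mu measurableT mh) => [N [mN N0 sN]].
have : mu `[0%R, 1%R]%classic <= mu N.
  apply: le_measure; rewrite ?inE// => a _; apply: sN => /= /(_ I) ha.
  by have := h0 a; rewrite ha ltxx.
by rewrite N0 lebesgue_measure_itv/= lte_fin ltr01 oppr0 adde0 lee_fin ler10.
Qed.

Lemma lebesgue_sites_gt0 s g f : measurable_fun setT g -> (forall f, 0 < g f) -> 0 < LS s g f.
Proof.
move=> mg g0; have g0' f' : 0 <= g f' by exact: ltW.
elim: s f => [|x s IH] f; first exact: g0.
by rewrite lebesgue_sites_cons; apply: integral_gt0 => //; exact: measurable_LS1.
Qed.

End LebesgueSites.

(** * The Gaussian characteristic function *)

Section GaussianCharacteristicFunction.
Context {R : realType}.
Variables (m s : R).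
Hypothesis s0 : 0 < s.
Local Notation mu := (@lebesgue_measure R).
Local Notation p := (normal_pdf m s).
Local Notation II h := (\int[mu]_y h y)%R.

Let sn0 : s != 0. Proof. by rewrite gt_eqF. Qed.

Let pE y : p y = normal_peak s * expR (- (y - m) ^+ 2 / (s ^+ 2 *+ 2)).
Proof. by rewrite normal_pdfE. Qed.

(** Comparison with the density of standard deviation [sqrt 2 * s]: the factor [z = |y - m| / s] is
    absorbed by half of the exponent, since [z <= 1 + z^2 / 4 <= exp (z^2 / 4)]. *)
Lemma integrable_normal_pdf_abs : mu.-integrable setT (fun y => (`|y - m| * p y)%:E).
Proof.
pose s' := Num.sqrt 2 * s.
have s'0 : s' != 0 by rewrite gt_eqF// mulr_gt0// sqrtr_gt0.
pose c := s * normal_peak s / normal_peak s'.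
have I := integrableZl measurableT c (integrable_normal_pdf m s').
apply: (le_integrable measurableT _ _ I).
  apply/measurable_EFinP; apply: measurable_funM; last exact: measurable_normal_pdf.
  by apply: measurableT_comp => //; exact: measurable_funB.
move=> y _; rewrite /= lee_fin ger0_norm ?mulr_ge0 ?normal_pdf_ge0//.
apply: le_trans (ler_norm _).
have pE' : normal_pdf m s' y = normal_peak s' * normal_fun m s' y by rewrite (normal_pdfE _ s'0).
rewrite pE pE' [leRHS]mulrA /c [X in _ <= X * _]divfK; last first.
  by rewrite gt_eqF// normal_peak_gt0.
rewrite mulrCA -[leRHS]mulrA [leRHS]mulrCA ler_wpM2l ?normal_peak_ge0// /normal_fun.
have -> : s' ^+ 2 = s ^+ 2 * 2 by rewrite exprMn sqr_sqrtr// mulrC.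
pose z := `|y - m| / s.
have zE : (y - m) ^+ 2 / s ^+ 2 = z ^+ 2 by rewrite expr_div_n real_normK ?num_real.
have -> : - (y - m) ^+ 2 / (s ^+ 2 *+ 2) = - (z ^+ 2 / 4) - (z ^+ 2 / 4).
  by rewrite -zE -[s ^+ 2 *+ 2]mulr_natr; field.
have -> : - (y - m) ^+ 2 / (s ^+ 2 * 2 *+ 2) = - (z ^+ 2 / 4).
  by rewrite -zE -[_ *+ 2]mulr_natr; field.
have -> : `|y - m| = s * z by rewrite /z mulrC divfK.
rewrite -mulrA ler_pM2l// expRD mulrA ler_piMl ?expR_ge0//.
rewrite expRN ler_pdivrMr ?expR_gt0// mul1r (le_trans _ (expR_ge1Dx _))//.
have := sqr_ge0 (z / 2 - 1); rewrite (_ : (z / 2 - 1) ^+ 2 = 1 + z ^+ 2 / 4 - z); last by field.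
by rewrite subr_ge0.
Qed.

Lemma integrable_mul_pdf (h k : R -> R) K : measurable_fun setT h -> measurable_fun setT k ->
  (forall y, `|h y| <= K * `|k y|) -> mu.-integrable setT (fun y => (k y * p y)%:E) ->
  mu.-integrable setT (fun y => (h y * p y)%:E).
Proof.
move=> mh mk hk I; apply: (le_integrable measurableT _ _ (integrableZl measurableT K I)).
  by apply/measurable_EFinP; apply: measurable_funM => //; exact: measurable_normal_pdf.
move=> y _; rewrite /= lee_fin !normrM mulrA.
apply: ler_wpM2r => //; apply: (le_trans (hk y)).
by rewrite ler_wpM2r// ler_norm.
Qed.

Let mX : measurable_fun setT (fun y : R => y - m).
Proof. exact: measurable_funB. Qed.

Let mphase al b : measurable_fun setT (fun y : R => al + b * (y - m)).
Proof. by apply: measurable_funD => //; apply: measurable_funM. Qed.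

Let mcos al b : measurable_fun setT (fun y : R => cos (al + b * (y - m))).
Proof. exact: (measurableT_comp (continuous_measurable_fun (@continuous_cos R))). Qed.
Let msin al b : measurable_fun setT (fun y : R => sin (al + b * (y - m))).
Proof. exact: (measurableT_comp (continuous_measurable_fun (@continuous_sin R))). Qed.

Let icos al b : mu.-integrable setT (fun y => (cos (al + b * (y - m)) * p y)%:E).
Proof.
apply: (@integrable_mul_pdf _ (fun=> 1) 1) => //.
  by move=> y; rewrite normr1 mul1r ler_norml cos_geN1 cos_le1.
under eq_fun do rewrite mul1r; exact: integrable_normal_pdf.
Qed.

Let iXsin al b : mu.-integrable setT (fun y => ((y - m) * sin (al + b * (y - m)) * p y)%:E).
Proof.
apply: (@integrable_mul_pdf _ (fun y => `|y - m|) 1); last exact: integrable_normal_pdf_abs.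
- exact: measurable_funM.
- exact: measurableT_comp.
by move=> y; rewrite mul1r normrM normr_id ler_piMr// ler_norml sin_geN1 sin_le1.
Qed.

Let is_derive_pdf y : is_derive y (1 : R) p (- (y - m) / s ^+ 2 * p y).
Proof.
have -> : (p : R -> R) = (fun y => normal_peak s * expR (- (y - m) ^+ 2 / (s ^+ 2 *+ 2))).
  by apply/funext => z; rewrite pE.
have -> : (fun y => normal_peak s * expR (- (y - m) ^+ 2 / (s ^+ 2 *+ 2))) =
  (fun y => normal_peak s * expR (- (s ^+ 2 *+ 2)^-1 * (y - m) ^+ 2)).
  by apply/funext => z; congr (_ * expR _); rewrite mulrC mulrN -mulNr.
have -> : - (y - m) / s ^+ 2 = - (s ^+ 2 *+ 2)^-1 * (2 * (y - m)).
  by rewrite -mulr_natr; move: (y - m) => z; field.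
have -> : - (y - m) ^+ 2 / (s ^+ 2 *+ 2) = - (s ^+ 2 *+ 2)^-1 * (y - m) ^+ 2.
  by rewrite mulrC mulrN -mulNr.
move: (- _^-1) (normal_peak s) => k P.
apply: is_derive_eq; rewrite /GRing.scale /=.
by move: (expR _) => E; ring.
Qed.

Let is_derive_sin_pdf al b y : is_derive y (1 : R) (fun y => sin (al + b * (y - m)) * p y)
  (b * cos (al + b * (y - m)) * p y - s ^-2 * ((y - m) * sin (al + b * (y - m)) * p y)).
Proof.
have h := is_derive_pdf y.
apply: is_derive_eq; rewrite /GRing.scale /=; field.
exact: sn0.
Qed.

Let pdf_le y : p y <= normal_peak s * (2 * s ^+ 2) / (2 * s ^+ 2 + (y - m) ^+ 2).
Proof.
rewrite pE -mulrA ler_wpM2l ?normal_peak_ge0// mulNr expRN.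
have s2 : 0 < s ^+ 2 by rewrite exprn_gt0.
have k : 0 < 2 * s ^+ 2 + (y - m) ^+ 2 by rewrite ltr_pwDl ?sqr_ge0// mulr_gt0.
rewrite -[X in _ <= X]invrK lef_pV2 ?posrE ?expR_gt0// ?invr_gt0 ?divr_gt0// ?mulr_gt0//.
rewrite invf_div (le_trans _ (expR_ge1Dx _))// le_eqVlt; apply/orP; left; apply/eqP.
by rewrite -mulr_natr; field.
Qed.

Let pdf_cvg (u : nat -> R) : (forall n, n%:R <= `|u n|) -> p (u n) @[n --> \oo] --> 0.
Proof.
move=> un; apply/cvgrPdist_le => eps eps0.
pose K := normal_peak s * (2 * s ^+ 2) / eps + 1.
have K1 : 0 <= normal_peak s * (2 * s ^+ 2) / eps.
  apply: divr_ge0; last exact: ltW.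
  by apply: mulr_ge0; [exact: normal_peak_ge0|apply: mulr_ge0 => //; exact: sqr_ge0].
have K0 : 0 <= K by rewrite addr_ge0.
exists (Num.bound (K + `|m|)) => // n /= Kn.
have h1 : K <= `|u n - m|.
  rewrite (le_trans _ (lerB_dist _ _))// lerBrDr (le_trans _ (un n))//.
  by rewrite (le_trans (ltW (archi_boundP _)))// ?ler_nat// addr_ge0.
have h2 : K <= (u n - m) ^+ 2.
  rewrite -[X in _ <= X]real_normK ?num_real// expr2 (le_trans h1)// ler_peMl//.
  by rewrite (le_trans _ h1)// /K lerDr.
rewrite sub0r normrN ger0_norm ?normal_pdf_ge0// (le_trans (pdf_le _))//.
have s2 : 0 < s ^+ 2 by rewrite exprn_gt0.
have k : 0 < 2 * s ^+ 2 + (u n - m) ^+ 2 by rewrite ltr_pwDl ?sqr_ge0// mulr_gt0.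
rewrite ler_pdivrMr// -ler_pdivrMl// [leLHS]mulrC.
apply: (@le_trans _ _ ((u n - m) ^+ 2)); last by rewrite lerDr mulr_ge0// ltW.
by apply: le_trans h2; rewrite /K lerDl.
Qed.

(** The derivative of [sin (al + b (y - m))] times the density integrates to zero over the line:
    over [[-n, n]] it equals boundary terms, and the rational bound [pdf_le] makes them vanish. *)
Lemma gaussian_by_parts al b :
  II (fun y => (y - m) * sin (al + b * (y - m)) * p y) = s ^+ 2 * b * II (fun y => cos (al + b * (y - m)) * p y).
Proof.
pose h y := sin (al + b * (y - m)) * p y.
pose h' y := b * cos (al + b * (y - m)) * p y - s ^-2 * ((y - m) * sin (al + b * (y - m)) * p y).
have i1 : mu.-integrable setT (fun y => (b * (cos (al + b * (y - m)) * p y))%:E).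
  exact: (integrableZl measurableT b (icos al b)).
have i2 := integrableZl measurableT (s ^-2) (iXsin al b).
have ih' : mu.-integrable setT (EFin \o h').
  by have := integrableB measurableT i1 i2; apply: eq_integrable => // y _; rewrite /h' /= mulrA.
have dh y : is_derive y (1 : R) h (h' y) by exact: is_derive_sin_pdf.
have cp : continuous p by exact: continuous_normal_pdf.
have cph : continuous (fun y : R => al + b * (y - m)).
  by move=> y; apply: cvgD; [exact: cvg_cst|apply: cvgM; [exact: cvg_cst|apply: cvgB; [exact: cvg_id|exact: cvg_cst]]].
have cc : continuous (fun y : R => cos (al + b * (y - m))).
  by move=> y; apply: continuous_comp; [exact: cph|exact: continuous_cos].
have cs : continuous (fun y : R => sin (al + b * (y - m))).
  by move=> y; apply: continuous_comp; [exact: cph|exact: continuous_sin].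
have ch' : continuous h'.
  move=> y; apply: cvgB; first by apply: cvgM; [apply: cvgM; [exact: cvg_cst|exact: cc]|exact: cp].
  apply: cvgM; first exact: cvg_cst.
  by apply: cvgM; [apply: cvgM; [apply: cvgB; [exact: cvg_id|exact: cvg_cst]|exact: cs]|exact: cp].
have ch : continuous h by move=> y; apply: cvgM; [exact: cs|exact: cp].
have F n : (\int[mu]_(y in `[(- n.+1%:R)%R, n.+1%:R%R]) (h' y)%:E)%E = (h n.+1%:R - h (- n.+1%:R))%:E.
  rewrite EFinB; apply: continuous_FTC2.
  - by rewrite gtrN// ltr0n.
  - exact: continuous_subspaceT.
  - split; first by move=> y _; apply: ex_derive.
      by apply: cvg_at_right_filter; exact: ch.
    by apply: cvg_at_left_filter; exact: ch.
  - by move=> y _; rewrite derive1E; apply: derive_val.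
have L1 : (\int[mu]_(y in `[(- n.+1%:R)%R, n.+1%:R%R]) (h' y)%:E)%E @[n --> \oo] --> (\int[mu]_y (h' y)%:E)%E.
  under eq_fun do rewrite integral_mkcond.
  have := @dominated_convergence _ _ _ mu setT measurableT
    (fun n => (EFin \o h') \_ `[- n.+1%:R, n.+1%:R]) (EFin \o h') (fun y => `|(h' y)%:E|%E).
  case=> //.
  - by move=> n; apply/(measurable_restrictT _ _).1 => //; apply: measurable_funTS; apply/measurable_EFinP; exact: continuous_measurable_fun.
  - by apply/measurable_EFinP; exact: continuous_measurable_fun.
  - apply: aeW => y _; apply: cvg_near_cst; exists (Num.bound `|y|) => // n /= bn.
    rewrite patchE mem_set//= in_itv/= -ler_norml.
    by rewrite (le_trans (ltW (archi_boundP _)))// ler_nat leqW.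
  - exact: integrable_abse.
  - apply: aeW => y n _; rewrite patchE; case: ifP => // _.
    by rewrite abse0 abse_ge0.
have L2 : (\int[mu]_(y in `[(- n.+1%:R)%R, n.+1%:R%R]) (h' y)%:E)%E @[n --> \oo] --> (0 - 0)%:E.
  under eq_fun do rewrite F.
  apply: cvg_EFin; first exact: nearW.
  have hz (u : nat -> R) : (forall n, n%:R <= `|u n|) -> h (u n) @[n --> \oo] --> 0.
    move=> un; apply/cvgrPdist_le => eps eps0; have /cvgrPdist_le/(_ _ eps0) := pdf_cvg un.
    apply: filterS => n; rewrite !sub0r !normrN; apply: le_trans.
    by rewrite /h normrM ler_piMl// ler_norml sin_geN1 sin_le1.
  apply: cvgB; apply: hz => n; first by rewrite ger0_norm ?ler0n// ler_nat.
  by rewrite normrN ger0_norm ?ler0n// ler_nat.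
have E : (\int[mu]_y (h' y)%:E)%E = (0 - 0)%:E by exact: (cvg_unique _ L1 L2).
have {E} : II h' = 0 by rewrite /Rintegral E subrr.
rewrite /h' RintegralB//; last first.
  by apply: eq_integrable i1 => // y _; rewrite /= mulrA.
rewrite RintegralZl//; last exact: iXsin.
have -> : II (fun y => b * cos (al + b * (y - m)) * p y) = b * II (fun y => cos (al + b * (y - m)) * p y).
  by rewrite -RintegralZl//; last exact: icos; apply: eq_Rintegral => y _; rewrite mulrA.
move/eqP; rewrite subr_eq0 => /eqP E2; rewrite -mulrA E2 mulrA divff ?mul1r//.
by rewrite expf_neq0.
Qed.

(** As a function of [b], the integral solves [F' = - s^2 b F]: the derivative under the integral
    sign is the term treated by [gaussian_by_parts]. *)
Lemma gaussian_cos_pdf al b :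
  II (fun y => cos (al + b * (y - m)) * p y) = cos al * expR (- (s ^+ 2 * b ^+ 2 / 2)).
Proof.
pose F b := II (fun y => cos (al + b * (y - m)) * p y).
have dF (c : R) : is_derive c (1 : R) F (- (s ^+ 2 * c * F c)).
  pose f b y := cos (al + b * (y - m)) * p y.
  have df x y : is_derive x (1 : R) (f ^~ y) (- ((y - m) * sin (al + x * (y - m)) * p y)).
    by apply: is_derive_eq; rewrite /GRing.scale /=; ring.
  have dfE x y : partial1of2 f x y = - ((y - m) * sin (al + x * (y - m)) * p y).
    by rewrite partial1of2E; apply: derive_val.
  have c1 : `]c - 1, c + 1[%classic c by rewrite /= in_itv/= ltrBlDr !ltrDl ltr01.
  have A1 x : `]c - 1, c + 1[%classic x -> mu.-integrable setT (EFin \o f x) by move=> _; exact: icos.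
  have A2 x y : `]c - 1, c + 1[%classic x -> setT y -> derivable (f ^~ y) x 1.
    by move=> _ _; exact: ex_derive.
  have A3 y : 0 <= `|y - m| * p y by rewrite mulr_ge0 ?normal_pdf_ge0.
  have A4 x y : `]c - 1, c + 1[%classic x -> setT y -> `|partial1of2 f x y| <= `|y - m| * p y.
    move=> _ _; rewrite dfE normrN normrM [X in _ * X]ger0_norm ?normal_pdf_ge0//.
    by rewrite ler_wpM2r ?normal_pdf_ge0// normrM ler_piMr// ler_norml sin_geN1 sin_le1.
  have D1 := derivable_under_integral measurableT c1 A1 A2 A3 integrable_normal_pdf_abs A4.
  have D2 := differentiation_under_integral measurableT c1 A1 A2 A3 integrable_normal_pdf_abs A4.
  apply: DeriveDef => //; rewrite -derive1E D2 -gaussian_by_parts.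
  transitivity (II (fun y => -1 * ((y - m) * sin (al + c * (y - m)) * p y))).
    by apply: eq_Rintegral => y _; rewrite dfE mulN1r.
  by rewrite RintegralZl//; [rewrite mulN1r|exact: iXsin].
pose Psi c := F c * expR (s ^+ 2 * c ^+ 2 / 2).
have dP c : is_derive c (1 : R) Psi 0.
  by have h := dF c; apply: is_derive_eq; rewrite /GRing.scale /=; field.
have := @is_derive_0_is_cst _ Psi b 0 dP.
rewrite /Psi expr0n/= !(mulr0, mul0r) expR0 mulr1.
have -> : F 0 = cos al.
  rewrite /F; transitivity (II (fun y => cos al * p y)).
    by apply: eq_Rintegral => y _; rewrite mul0r addr0.
  rewrite RintegralZl//; last exact: integrable_normal_pdf.
  by rewrite /Rintegral integral_normal_pdf mulr1.
by rewrite expRN => <-; rewrite mulfK// gt_eqF// expR_gt0.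
Qed.

End GaussianCharacteristicFunction.

Lemma positive_linear_exp {dT} {T : measurableType dT} {R : realType} (P : probability T R) :
  positive_linear (fun h => (\int[P]_x h x)%R).
Proof.
split=> [h _ h0|f g bf bg _ _|c f _ bf _]; first exact: exp_ge0.
- exact: expD.
- exact: expZ.
Qed.

(** Passage from the density to the measure: both functionals agree on indicators, hence on the
    nonnegative function [1 + cos], and the constant is removed at the end. *)
Lemma normal_prob_cos {R : realType} (m s al b : R) : 0 < s ->
  (\int[normal_prob m s]_y cos (al + b * (y - m)))%R = cos al * expR (- (s ^+ 2 * b ^+ 2 / 2)).
Proof.
move=> s0; rewrite -(gaussian_cos_pdf m s0).
pose Psi (k : R -> R) := (\int[@lebesgue_measure R]_y (k y * normal_pdf m s y))%R.
have I (k : R -> R) : bounded_mfun k -> (@lebesgue_measure R).-integrable setT (fun y => (k y * normal_pdf m s y)%:E).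
  move=> [mk [M kM]]; apply: (@integrable_mul_pdf _ m s k (fun=> 1) M) => //.
    by move=> y; rewrite normr1 mulr1.
  by under eq_fun do rewrite mul1r; exact: integrable_normal_pdf.
have PP : positive_linear Psi.
  split.
  - move=> h _ h0; apply: fine_ge0; apply: integral_ge0 => y _.
    by rewrite lee_fin mulr_ge0// normal_pdf_ge0.
  - move=> f g bf bg _ _; rewrite /Psi -RintegralD//; [|exact: I..].
    by apply: eq_Rintegral => y _; rewrite mulrDl.
  - move=> c f _ bf _; rewrite /Psi -RintegralZl//; last exact: I.
    by apply: eq_Rintegral => y _; rewrite mulrA.
have mc : measurable_fun setT (fun y : R => cos (al + b * (y - m))).
  apply: (measurableT_comp (continuous_measurable_fun (@continuous_cos R))).
  by apply: measurable_funD => //; apply: measurable_funM => //; exact: measurable_funB.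
have bc : bounded_mfun (fun y : R => cos (al + b * (y - m))).
  by split => //; exists 1 => y; rewrite ler_norml cos_geN1 cos_le1.
have b1 : bounded_mfun (fun _ : R => 1 : R) by exact: bm_cst.
have E1 : (\int[normal_prob m s]_y (1 + cos (al + b * (y - m))))%R =
    Psi (fun y => 1 + cos (al + b * (y - m))).
  apply: (positive_linear_ext (positive_linear_exp (normal_prob m s)) PP); last 2 first.
  - exact: bmD.
  - by move=> y; rewrite -lerBlDl sub0r cos_geN1.
  move=> A mA; rewrite exp_indic// /Psi /= /normal_prob integral_mkcond; congr fine.
  apply: eq_integral => y _; rewrite patchE indicE.
  by case: (_ \in _); rewrite ?mul1r ?mul0r.
move: E1; rewrite (expD (normal_prob m s) b1 bc) exp_cst /Psi.
have -> : (\int[@lebesgue_measure R]_y ((1 + cos (al + b * (y - m))) * normal_pdf m s y))%R =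
    (\int[@lebesgue_measure R]_y (1 * normal_pdf m s y))%R +
    (\int[@lebesgue_measure R]_y (cos (al + b * (y - m)) * normal_pdf m s y))%R.
  rewrite -RintegralD//; [|exact: I..].
  by apply: eq_Rintegral => y _; rewrite mulrDl.
have -> : (\int[@lebesgue_measure R]_y (1 * normal_pdf m s y))%R = 1.
  under eq_Rintegral do rewrite mul1r.
  by rewrite /Rintegral integral_normal_pdf.
by move/addrI.
Qed.

(** Completing the square in a quadratic energy with linear coefficient [l] and curvature [W]: a
    Gaussian of mean [x0 - l / W] and variance [1 / W]. This is the one-site integral of the Gibbs
    specification. *)
Lemma gaussian_shift_integral {R : realType} (W h0 l p0 x0 b : R) : 0 < W ->
  (\int[@lebesgue_measure R]_a (expR (- (h0 + (a - x0) * l + 2^-1 * (a - x0) ^+ 2 * W)) *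
     (1 + cos (p0 + (a - x0) * b)))%:E)%E =
  (expR (- h0 + l ^+ 2 / (2 * W)) / normal_peak (Num.sqrt W^-1) *
    (1 + cos (p0 - l * b / W) * expR (- (b ^+ 2 / (2 * W)))))%:E.
Proof.
move=> W0; set s := Num.sqrt W^-1; pose m := x0 - l / W.
have s0 : 0 < s by rewrite sqrtr_gt0 invr_gt0.
have s2 : s ^+ 2 = W^-1 by rewrite sqr_sqrtr// invr_ge0 ltW.
set K := expR (- h0 + l ^+ 2 / (2 * W)) / normal_peak s.
pose al := p0 - l * b / W.
have W' : W != 0 by rewrite gt_eqF.
have E a : expR (- (h0 + (a - x0) * l + 2^-1 * (a - x0) ^+ 2 * W)) * (1 + cos (p0 + (a - x0) * b)) =
    K * ((1 + cos (al + b * (a - m))) * normal_pdf m s a).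
  have -> : p0 + (a - x0) * b = al + b * (a - m) by rewrite /al /m; field.
  rewrite normal_pdfE ?gt_eqF// /K [RHS]mulrCA mulrC; congr (_ * _).
  rewrite [RHS]mulrA [X in _ = X * _]divfK ?gt_eqF ?normal_peak_gt0 ?gt_eqF// /normal_fun -expRD s2; congr expR.
  by rewrite -mulr_natr /m; field.
under eq_integral do rewrite E.
have mc : measurable_fun setT (fun y : R => cos (al + b * (y - m))).
  apply: (measurableT_comp (continuous_measurable_fun (@continuous_cos R))).
  by apply: measurable_funD => //; apply: measurable_funM => //; exact: measurable_funB.
have i1 := integrable_normal_pdf m s.
have i2 : (@lebesgue_measure R).-integrable setT (fun y => (cos (al + b * (y - m)) * normal_pdf m s y)%:E).
  apply: (@integrable_mul_pdf _ m s _ (fun=> 1) 1) => //.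
    by move=> y; rewrite normr1 mul1r ler_norml cos_geN1 cos_le1.
  by under eq_fun do rewrite mul1r.
have i3 : (@lebesgue_measure R).-integrable setT (fun y => ((1 + cos (al + b * (y - m))) * normal_pdf m s y)%:E).
  have := integrableD measurableT i1 i2; apply: eq_integrable => // y _.
  by rewrite mulrDl mul1r.
have i4 := integrableZl measurableT K i3.
rewrite -[LHS]fineK; last exact: integrable_fin_num.
congr EFin; rewrite -/(Rintegral _ _ _) RintegralZl//; congr (_ * _).
under eq_Rintegral do rewrite mulrDl mul1r.
rewrite RintegralD// (gaussian_cos_pdf m s0) s2 /Rintegral integral_normal_pdf; congr (_ + _ * expR _).
by rewrite /=; field.
Qed.

(** * Conditional laws in a finite set of sites *)

Section Gibbs.
Context {R : realType} {d : nat} {C : set 'rV[int]_d}.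
Local Notation conf := (configuration R C).
Context (e : nat -> C) (ix : C -> nat).
Context (nb : C -> seq C) (w : C -> C -> R) (a : C -> R) (k0 k2 : nat) (K0 K1 : R).
Hypothesis G : weighted_graph e ix nb w a k0 k2 K0 K1.

Let q x := a x ^ (- k2%:Z).
Local Notation S := (@tsum R C e).
Local Notation lap := (lap nb w).
Local Notation bnd := (bnd a).
Local Notation rapid := (rapid a).
Local Notation moderate := (moderate a).
Local Notation point := (@point R d C).
Local Notation quad := (quad e nb w).
Local Notation mu := (@lebesgue_measure R).
Local Notation LS := lebesgue_sites.
Let q0 : forall x, 0 < q x := q_gt0 G.
Let cq : cvgn (series (fun i => q (e i))) := q_cvg G.

Implicit Types (k : conf -> R).
(** The energy enters through its sign, its measurability and its exact second-order expansion at
    each site of [s]; [solvable] is the Dirichlet problem in [s]. *)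
Variables (s : seq C) (H : conf -> R).
Definition degree x := lap (point x 1) x.
Hypothesis us : uniq s.
Hypothesis mH : measurable_fun setT H.
Hypothesis H0 : forall f, 0 <= H f.
Hypothesis HE : forall x f t, x \in s ->
  H (fun y => f y + point x t y) = H f + t * lap f x + 2^-1 * t ^+ 2 * degree x.
Hypothesis degree_gt0 : forall x, x \in s -> 0 < degree x.
Hypothesis solvable : forall u, exists2 v, forall y, y \notin s -> v y = 0 &
  forall y, y \in s -> lap v y = u y.

Lemma pointE x c : point x c = (fun y => c * point x 1 y).
Proof. by apply/funext => y; rewrite /point; case: eqP; rewrite ?mulr1 ?mulr0. Qed.

Lemma lap_point x c : lap (point x c) x = c * degree x.
Proof. by rewrite pointE lapZ. Qed.

Lemma upd_point (f : C -> R) x t : upd f x t = (fun y => f y + point x (t - f x) y).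
Proof.
by apply/funext => y; rewrite updE /point; case: eqVneq => [->|_]; rewrite ?addr0// addrC subrK.
Qed.

Lemma moderate_point x c : moderate (point x c).
Proof. exact: rapid_moderate (rapid_point G x c). Qed.

Lemma moderateD f g : moderate f -> moderate g -> moderate (fun x => f x + g x).
Proof.
move=> [z [M b]] [z' [M' b']].
exists (Num.max z z'), (M + M'); apply: bndD.
  by apply: (bnd_le G) b => //; rewrite le_max lexx.
by apply: (bnd_le G) b' => //; rewrite le_max lexx orbT.
Qed.

Lemma moderate_upd f x t : moderate f -> moderate (upd f x t).
Proof. by move=> mf; rewrite upd_point; apply: moderateD => //; exact: moderate_point. Qed.

Lemma moderate_off (l : seq C) f f' : moderate f -> (forall y, y \notin l -> f' y = f y) -> moderate f'.
Proof.
elim: l f => [|x l IH] f mf ff'.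
  by have -> : f' = f by apply/funext => y; exact: ff'.
apply: (IH (upd f x (f' x))); first exact: moderate_upd.
move=> y yl; rewrite updE; case: eqVneq => [->//|yx].
by apply: ff'; rewrite inE negb_or yx.
Qed.

Lemma pairing_upd u f x t : rapid u -> moderate f -> pairing u (upd f x t) = pairing u f + (t - f x) * u x.
Proof.
move=> ru mf; rewrite !(pairingE G)//; last exact: moderate_upd.
rewrite -(tsum_point G x (t - f x) u) -(tsumD q0 cq).
- by apply: eq_tsum => y; rewrite upd_point mulrDr [X in _ + X]mulrC.
- exact: (rapid_mul_dom G).
- by apply: (rapid_mul_dom G); [exact: (rapid_point G)|exact: rapid_moderate].
Qed.

Lemma pairing_lap_point u f x c : rapid u -> moderate f ->
  pairing (fun y => u y + lap (point x c) y) f = pairing u f + c * lap f x.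
Proof.
move=> ru mf; have rp := rapid_point G x c.
rewrite (pairingD G ru (rapid_lap G rp) mf) [X in _ + X](pairingE G)//; last exact: (rapid_lap G).
by rewrite (lap_symS G)// (tsum_point G).
Qed.

Lemma quad_point u x c : rapid u -> quad u (point x c) = u x * c + 2^-1 * c ^+ 2 * degree x.
Proof.
move=> ru; rewrite /quad; congr (_ + _).
  by rewrite mulrC -(tsum_point G); apply: eq_tsum => y; rewrite mulrC.
have -> : S (fun y => lap (point x c) y * point x c y) = c * lap (point x c) x.
  by rewrite -(tsum_point G); apply: eq_tsum => y; rewrite mulrC.
by rewrite lap_point; ring.
Qed.

Definition weighted (k : conf -> R) (f : conf) : \bar R := (expR (- H f) * k f)%:E.
Definition gsum (k : conf -> R) (f : conf) : \bar R := LS s (weighted k) f.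
(** The constant 1 makes the integrand nonnegative, so that Tonelli and linearity hold for integrals
    with values in the extended reals; [gcos] subtracts it again. *)
Definition wave (u : C -> R) (th : R) (f : conf) : R := 1 + cos (pairing u f + th).

Lemma measurable_expH : measurable_fun setT (fun f : conf => expR (- H f)).
Proof. by apply: measurableT_comp => //; exact: measurable_funN. Qed.

Lemma measurable_weighted k : measurable_fun setT k -> measurable_fun setT (weighted k).
Proof. by move=> mk; apply/measurable_EFinP; apply: measurable_funM => //; exact: measurable_expH. Qed.

Lemma weighted_ge0 k f : (forall f, 0 <= k f) -> (0 <= weighted k f)%E.
Proof. by move=> h; rewrite lee_fin mulr_ge0 ?expR_ge0. Qed.

Lemma gsum_ge0 k f : (forall f, 0 <= k f) -> (0 <= gsum k f)%E.
Proof. by move=> h; apply: lebesgue_sites_ge0 => f'; exact: weighted_ge0. Qed.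

Lemma measurable_gsum k : measurable_fun setT k -> (forall f, 0 <= k f) ->
  measurable_fun setT (gsum k : conf -> \bar R).
Proof.
move=> mk h; apply: measurable_lebesgue_sites; first exact: measurable_weighted.
by move=> f; exact: weighted_ge0.
Qed.

Lemma gsumD k k' f : measurable_fun setT k -> measurable_fun setT k' ->
  (forall f, 0 <= k f) -> (forall f, 0 <= k' f) ->
  gsum (fun f => k f + k' f) f = (gsum k f + gsum k' f)%E.
Proof.
move=> mk mk' h h'; rewrite /gsum -lebesgue_sitesD; try exact: measurable_weighted.
- by apply: eq_lebesgue_sites => f' _; rewrite /weighted mulrDr EFinD.
- by move=> f'; exact: weighted_ge0.
- by move=> f'; exact: weighted_ge0.
Qed.

Lemma gsumZ k c f : measurable_fun setT k -> (forall f, 0 <= k f) -> 0 <= c ->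
  gsum (fun f => c * k f) f = (c%:E * gsum k f)%E.
Proof.
move=> mk h c0; rewrite /gsum -lebesgue_sitesZ//; first last.
- by move=> f'; exact: weighted_ge0.
- exact: measurable_weighted.
by apply: eq_lebesgue_sites => f' _; rewrite /weighted mulrCA.
Qed.

Lemma le_gsum k k' f : measurable_fun setT k -> measurable_fun setT k' ->
  (forall f, 0 <= k f) -> (forall f, k f <= k' f) -> (gsum k f <= gsum k' f)%E.
Proof.
move=> mk mk' h kk'; apply: le_lebesgue_sites; try exact: measurable_weighted.
- by move=> f'; exact: weighted_ge0.
- by move=> f'; apply: weighted_ge0 => f''; exact: le_trans (kk' _).
- by move=> f' _; rewrite lee_fin ler_wpM2l ?expR_ge0.
Qed.

Lemma wave_ge0 u th f : 0 <= wave u th f.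
Proof. by rewrite /wave -lerBlDl sub0r cos_geN1. Qed.

Lemma measurable_wave u th : measurable_fun setT (wave u th).
Proof. by apply: measurable_funD => //; exact: (bm_cos (measurable_phase G _ _)).1. Qed.

Definition site_peak x f : R := expR (- H f + lap f x ^+ 2 / (2 * degree x)) / normal_peak (Num.sqrt (degree x)^-1).

Lemma site_integral x u th f : x \in s -> rapid u -> moderate f ->
  (\int[mu]_t weighted (wave u th) (upd f x t))%E =
  (site_peak x f * (1 + cos (pairing u f + th - lap f x * u x / degree x) *
     expR (- (u x ^+ 2 / (2 * degree x)))))%:E.
Proof.
move=> xs ru mf; rewrite -(gaussian_shift_integral _ _ _ (f x))//; last exact: degree_gt0.
apply: eq_integral => t _; congr EFin; rewrite /weighted /wave pairing_upd//.
congr (expR (- _) * (1 + cos _)); last by rewrite addrAC.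
by rewrite upd_point HE.
Qed.

Lemma gsum_wave_shift x u u' th r f : x \in s -> rapid u -> rapid u' -> moderate f -> 0 <= r <= 1 ->
  (forall f, moderate f -> pairing u' f - lap f x * u' x / degree x = pairing u f - lap f x * u x / degree x) ->
  expR (- (u' x ^+ 2 / (2 * degree x))) = r * expR (- (u x ^+ 2 / (2 * degree x))) ->
  (gsum (wave u' th) f = ((1 - r) / 2)%R%:E * gsum (wave (fun=> 0%R) 0%R) f + r%:E * gsum (wave u th) f)%E.
Proof.
move=> xs ru ru' mf /andP[r0 r1] ph er.
have r1' : 0 <= (1 - r) / 2 by rewrite divr_ge0// subr_ge0.
have [s' [ss' E]] := @lebesgue_sites_inner R _ _ _ _ xs.
have mw v t : measurable_fun setT (weighted (wave v t)) by apply: measurable_weighted; exact: measurable_wave.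
have w0 v t f' : (0 <= weighted (wave v t) f')%E by apply: weighted_ge0; exact: wave_ge0.
pose I v t (f : conf) := (\int[mu]_b weighted (wave v t) (upd f x b))%E.
have mI v t : measurable_fun setT (I v t) by exact: measurable_integral_upd.
have I0 v t f' : (0 <= I v t f')%E by apply: integral_ge0 => b _.
have E1 v t : LS s (weighted (wave v t)) f = LS s' (I v t) f := E _ f (mw v t) (w0 v t).
have EZ c v t : 0 <= c -> (c%:E * LS s' (I v t) f)%E = LS s' (fun f => c%:E * I v t f)%E f.
  by move=> c0; rewrite (lebesgue_sitesZ s' f (mI v t) (I0 v t) c0).
have ED c c' v t v' t' : 0 <= c -> 0 <= c' ->
    (LS s' (fun f => c%:E * I v t f) f + LS s' (fun f => c'%:E * I v' t' f) f)%E =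
    LS s' (fun f => c%:E * I v t f + c'%:E * I v' t' f)%E f.
  move=> c0 c0'; rewrite lebesgue_sitesD//; try exact: measurable_funeM.
  - by move=> f'; rewrite mule_ge0// I0.
  - by move=> f'; rewrite mule_ge0// I0.
rewrite /gsum !E1 !EZ// ED//.
apply: eq_lebesgue_sites => f' ff'.
have mf' := moderate_off mf ff'.
rewrite /I !site_integral//; last exact: rapid0.
have p0 : pairing (fun=> 0) f' = 0.
  rewrite (pairingE G)//; last exact: rapid0.
  by rewrite -[RHS](tsum0 e); apply: eq_tsum => y; rewrite mul0r.
rewrite p0 -!EFinM -EFinD; congr EFin.
have -> : cos (0 + 0 - lap f' x * 0 / degree x) * expR (- (0 ^+ 2 / (2 * degree x))) = 1.
  by rewrite mulr0 mul0r addr0 subr0 cos0 expr0n /= mul0r oppr0 expR0 mulr1.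
rewrite er.
have -> : pairing u' f' + th - lap f' x * u' x / degree x = pairing u f' + th - lap f' x * u x / degree x.
  by rewrite addrAC ph// addrAC.
by move: (site_peak _ _) (cos _) (expR _) => A b c; field.
Qed.

Definition gnorm : conf -> \bar R := gsum (fun=> 1).

Lemma energy_expand (l : seq C) v f : {subset l <= s} -> (forall x, x \notin l -> v x = 0) -> moderate f ->
  rapid v /\ H (fun y => f y + v y) = H f + S (fun x => v x * lap f x) + quad (fun=> 0) v.
Proof.
elim: l v => [|x l IH] v ls vl mf.
  have -> : v = (fun=> 0) by apply/funext => x; rewrite vl.
  split; first exact: rapid0.
  have -> : (fun y => f y + 0) = f by apply/funext => y; rewrite addr0.
  have E (g : C -> R) : S (fun x => 0 * g x) = 0.
    by rewrite -[RHS](tsum0 e); apply: eq_tsum => y; rewrite mul0r.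
  have E' (g : C -> R) : S (fun x => g x * 0) = 0.
    by rewrite -[RHS](tsum0 e); apply: eq_tsum => y; rewrite mulr0.
  by rewrite /quad E !E' !mulr0 !addr0.
pose v0 y := if y == x then 0 else v y.
have E : v = (fun y => v0 y + point x (v x) y).
  by apply/funext => y; rewrite /v0 /point; case: eqVneq => [->|_]; rewrite ?add0r ?addr0.
have [|y ys|//|r0 E0] := IH v0.
- by move=> y yl; apply: ls; rewrite inE yl orbT.
- by rewrite /v0; case: eqVneq => // yx; apply: vl; rewrite inE negb_or yx.
have rp := rapid_point G x (v x).
split; first by rewrite E; exact: rapidD.
have xs : x \in s by apply: ls; exact: mem_head.
have -> : (fun y => f y + v y) = (fun y => (f y + v0 y) + point x (v x) y).
  by apply/funext => y; rewrite {1}E addrA.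
rewrite HE// E0 lapD.
have -> : S (fun x => v x * lap f x) = S (fun x => v0 x * lap f x) + v x * lap f x.
  rewrite -(tsum_point G x (v x)) -(tsumD q0 cq).
  - by apply: eq_tsum => y; rewrite {1}E mulrDl.
  - by apply: (rapid_mul_dom G) => //; exact: (moderate_lap G).
  - by apply: (rapid_mul_dom G) => //; exact: (moderate_lap G).
have -> : quad (fun=> 0) v = quad (fun=> 0) v0 + (lap v0 x * v x + 2^-1 * v x ^+ 2 * degree x).
  rewrite {1}E (quadD G)//; last exact: rapid0.
  rewrite (_ : (fun y => 0 + lap v0 y) = lap v0); last by apply/funext => y; rewrite add0r.
  by rewrite quad_point//; exact: (rapid_lap G).
by move: (H f) (S _) (quad _ _) (lap f x) (lap v0 x) (degree x) => A B D E1 E2 E3; ring.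
Qed.

(** Let [v] solve [lap v = point x 1] on [s]. Minimising the nonnegative energy of [f' + t v] over
    [t] bounds the square of the pairing of [v] with [lap f'] by a multiple of [H f']; by symmetry
    that pairing is [f' x] up to a constant fixed by the values outside [s]. *)
Lemma energy_coercive f x : moderate f -> x \in s -> exists k c : R, 0 < k /\
  forall f' : conf, (forall y, y \notin s -> f' y = f y) -> k * (f' x - c) ^+ 2 <= H f'.
Proof.
move=> mf xs; have [v vs lv] := solvable (point x 1).
have [rv _] := energy_expand (fun=> id) vs mf.
(* [E'] replaces [E] as a positive upper bound by which one can divide. *)
pose E := quad (fun=> 0) v; pose E' := `|E| + 1.
have E'0 : 0 < E' by rewrite ltr_wpDl.
have EE' : E <= E' by rewrite (le_trans (ler_norm _))// lerDl.
have Zq t : quad (fun=> 0) (fun y => t * v y) = t ^+ 2 * E.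
  have O (g : C -> R) : S (fun x => 0 * g x) = 0.
    by rewrite -[RHS](tsum0 e); apply: eq_tsum => y; rewrite mul0r.
  rewrite /E /quad !O !add0r mulrCA; congr (_ * _).
  rewrite -(tsumZ q0 cq); last first.
    by apply: (rapid_mul_dom G); [exact: (rapid_lap G)|exact: rapid_moderate].
  by apply: eq_tsum => y; rewrite lapZ; ring.
pose B f' := S (fun y => v y * lap f' y).
have bound f' : moderate f' -> B f' ^+ 2 / (4 * E') <= H f'.
  move=> mf'; pose t := - (B f' / (2 * E')).
  have tvs y : y \notin s -> t * v y = 0 by move=> ys; rewrite vs// mulr0.
  have [_ Ht] := energy_expand (fun=> id) tvs mf'.
  have := H0 (fun y => f' y + t * v y); rewrite Ht Zq.
  have -> : S (fun y => t * v y * lap f' y) = t * B f'.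
    rewrite -(tsumZ q0 cq); first by apply: eq_tsum => y; rewrite mulrA.
    by apply: (rapid_mul_dom G) => //; exact: (moderate_lap G).
  move=> h; have h2 : t ^+ 2 * E <= t ^+ 2 * E' by rewrite ler_wpM2l ?sqr_ge0.
  have -> : B f' ^+ 2 / (4 * E') = - (t * B f' + t ^+ 2 * E').
    by rewrite /t; field; rewrite gt_eqF.
  by rewrite -subr_ge0 opprK (le_trans h)// addrA lerD2l.
exists (4 * E')^-1, (f x - B f); split; first by rewrite invr_gt0 mulr_gt0.
move=> f' ff'; have mf' := moderate_off mf ff'.
have -> : f' x - (f x - B f) = B f'; last by rewrite mulrC; exact: bound.
have LB g : moderate g -> B g = S (fun y => lap v y * g y).
  by move=> mg; rewrite (lap_symS G).
have rl := rapid_lap G rv.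
rewrite !LB// opprB addrCA addrC; apply/eqP; rewrite eq_sym -subr_eq -(tsumB q0 cq).
- rewrite (@eq_tsum _ _ _ _ (fun y => point x 1 y * (f' y - f y))).
    by rewrite (tsum_point G) mul1r.
  move=> y; rewrite -mulrBr; case: (boolP (y \in s)) => ys; first by rewrite lv.
  by rewrite ff'// subrr !mulr0.
- exact: (rapid_mul_dom G).
- exact: (rapid_mul_dom G).
Qed.

Lemma lebesgue_sites_prod_fin (l : seq C) (psi : C -> R -> R) : uniq l ->
  (forall x, measurable_fun setT (psi x)) -> (forall x t, 0 <= psi x t) ->
  (forall x, x \in l -> (\int[mu]_t (psi x t)%:E < +oo)%E) ->
  exists2 c : R, 0 <= c & forall f : conf, (LS l (fun f => (\prod_(x <- l) psi x (f x))%:E) f <= c%:E)%E.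
Proof.
move=> ul mp p0 ip; have mprod l' : measurable_fun setT (fun f : conf => (\prod_(x <- l') psi x (f x))%:E).
  apply/measurable_EFinP; apply: measurable_prod => x _.
  by apply: (measurableT_comp (mp x)); exact: measurable_coord.
have prod0 l' (f : conf) : 0 <= \prod_(x <- l') psi x (f x) by apply: prodr_ge0.
elim: l ul ip => [|x l IH] /=; first by move=> _ _; exists 1 => // f; rewrite big_nil.
move=> /andP[xl ul] ip; have [|c c0 Hc] := IH ul.
  by move=> y yl; apply: ip; rewrite inE yl orbT.
have ix0 : (0 <= \int[mu]_t (psi x t)%:E)%E by apply: integral_ge0 => t _; rewrite lee_fin.
have fi : (\int[mu]_t (psi x t)%:E)%E \is a fin_num.
  by rewrite ge0_fin_numE// ip// mem_head.
exists (fine (\int[mu]_t (psi x t)%:E)%E * c); first by rewrite mulr_ge0// fine_ge0.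
move=> f; rewrite EFinM fineK//.
apply: (@le_trans _ _ (\int[mu]_t ((psi x t)%:E * c%:E))%E); last first.
  rewrite ge0_integralZr//; last by move=> t _; rewrite lee_fin.
  by apply/measurable_EFinP; exact: mp.
apply: ge0_le_integral => //.
- by move=> t _; apply: lebesgue_sites_ge0 => f'; rewrite lee_fin.
- by apply: (@measurable_LS1 R d C l) => [|f']; [exact: mprod|rewrite lee_fin].
- by apply: emeasurable_funM; [apply/measurable_EFinP; exact: mp|exact: measurable_cst].
move=> t _; rewrite (@eq_lebesgue_sites _ _ _ _ _ (fun f => (psi x t)%:E * (\prod_(x <- l) psi x (f x))%:E)%E).
  rewrite lebesgue_sitesZ//; last by move=> f'; rewrite lee_fin.
  by apply: lee_wpmul2l => //; rewrite lee_fin.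
move=> f' ff'; rewrite big_cons EFinM; congr ((psi x _)%:E * _)%E.
by rewrite ff'// /= eqxx.
Qed.

(** Equal shares of the energy are given to the sites, and each share dominates a quadratic in the
    value at its site; the integral is then at most a product of one-dimensional Gaussian
    integrals. *)
Lemma gnorm_lty f : moderate f -> (gnorm f < +oo)%E.
Proof.
move=> mf.
have /choice[kc Hkc] : forall x, exists p : R * R, x \in s -> 0 < p.1 /\
    forall f' : conf, (forall y, y \notin s -> f' y = f y) -> p.1 * (f' x - p.2) ^+ 2 <= H f'.
  move=> x; case: (boolP (x \in s)) => xs; last by exists (0, 0).
  by have [k [c P]] := energy_coercive mf xs; exists (k, c).
(* One share more than there are sites, so that the divisor is positive for an empty [s] as well. *)
pose n := (size s).+1%:R : R.
have n0 : 0 < n by rewrite ltr0n.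
pose psi x t := if x \in s then expR (- ((kc x).1 / n * (t - (kc x).2) ^+ 2)) else 0.
have mpsi x : measurable_fun setT (psi x).
  rewrite /psi; case: (x \in s); last exact: measurable_cst.
  apply: measurableT_comp => //; apply: measurable_funN.
  by apply: measurable_funM => //; apply: measurable_funX; exact: measurable_funB.
have psi0 x t : 0 <= psi x t by rewrite /psi; case: ifP => // _; exact: expR_ge0.
have [|c c0 Hc] := lebesgue_sites_prod_fin us mpsi psi0.
  move=> x xs; have [k0' _] := Hkc x xs.
  have W0 : 0 < 2 * ((kc x).1 / n) by rewrite mulr_gt0// divr_gt0.
  (* [gaussian_shift_integral] without linear term and phase; its factor [1 + cos 0 = 2] only
     enlarges the integral. *)
  apply: (@le_lt_trans _ _ (\int[mu]_t (expR (- (0 + (t - (kc x).2) * 0 + 2^-1 * (t - (kc x).2) ^+ 2 * (2 * ((kc x).1 / n)))) *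
     (1 + cos (0 + (t - (kc x).2) * 0)))%:E)%E).
    apply: ge0_le_integral => //.
    - by move=> t _; rewrite lee_fin.
    - by apply/measurable_EFinP; exact: mpsi.
    - apply/measurable_EFinP; apply: measurable_funM.
        apply: measurableT_comp => //; apply: measurable_funN; apply: measurable_funD.
          by apply: measurable_funD => //; apply: measurable_funM => //; exact: measurable_funB.
        apply: measurable_funM => //; apply: measurable_funM => //.
        by apply: measurable_funX; exact: measurable_funB.
      apply: measurable_funD => //; apply: (measurableT_comp (continuous_measurable_fun (@continuous_cos R))).
      by apply: measurable_funD => //; apply: measurable_funM => //; exact: measurable_funB.
    move=> t _; rewrite lee_fin /psi xs !mulr0 !add0r cos0.
    rewrite (_ : 2^-1 * _ * _ = (kc x).1 / n * (t - (kc x).2) ^+ 2); last by field; rewrite gt_eqF.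
    by rewrite ler_peMr ?expR_ge0// lerDl.
  by rewrite gaussian_shift_integral// ltry.
apply: le_lt_trans (ltry c); apply: le_trans (Hc f).
apply: le_lebesgue_sites.
- by apply: measurable_weighted.
- apply/measurable_EFinP; apply: measurable_prod => x _.
  by apply: (measurableT_comp (mpsi x)); exact: measurable_coord.
- by move=> f'; exact: weighted_ge0.
- by move=> f'; rewrite lee_fin; apply: prodr_ge0.
move=> f' ff'; rewrite /weighted mulr1 lee_fin.
have -> : \prod_(x <- s) psi x (f' x) = expR (\sum_(x <- s) - ((kc x).1 / n * (f' x - (kc x).2) ^+ 2)).
  rewrite expR_sum; apply: eq_big_seq => x xs; by rewrite /psi xs.
rewrite ler_expR sumrN lerN2.
apply: (@le_trans _ _ (\sum_(x <- s) H f' / n)).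
  rewrite big_seq [leRHS]big_seq; apply: ler_sum => x xs; have [_ /(_ _ ff')] := Hkc x xs.
  by rewrite mulrAC ler_pM2r ?invr_gt0.
rewrite big_const_seq count_predT iter_addr addr0 -mulr_natr mulrAC ler_pdivrMr// ler_wpM2l//.
by rewrite ler_nat.
Qed.

Lemma gnorm_gt0 f : (0 < gnorm f)%E.
Proof.
apply: lebesgue_sites_gt0; first exact: measurable_weighted.
by move=> f'; rewrite lte_fin mulr1 expR_gt0.
Qed.

Lemma gnorm_fin f : moderate f -> gnorm f \is a fin_num.
Proof. by move=> mf; rewrite ge0_fin_numE ?gnorm_lty// ltW// gnorm_gt0. Qed.

Lemma fine_gnorm_gt0 f : moderate f -> 0 < fine (gnorm f).
Proof. by move=> mf; rewrite fine_gt0// gnorm_gt0 gnorm_lty. Qed.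

Lemma gsum_fin k M f : measurable_fun setT k -> (forall f, 0 <= k f <= M) -> moderate f ->
  gsum k f \is a fin_num.
Proof.
move=> mk kM mf; have k0' f' : 0 <= k f' by case/andP: (kM f').
have M0 : 0 <= M by apply: le_trans (k0' f) _; case/andP: (kM f).
rewrite ge0_fin_numE ?gsum_ge0//; apply: (@le_lt_trans _ _ (M%:E * gnorm f)%E).
  rewrite -gsumZ//.
  by apply: le_gsum => // f'; rewrite mulr1; case/andP: (kM f').
by rewrite -(fineK (gnorm_fin mf)) -EFinM ltry.
Qed.

Lemma wave_le2 u th f : 0 <= wave u th f <= 2.
Proof. by rewrite wave_ge0 (_ : 2 = 1 + 1 :> R)// lerD2l cos_le1. Qed.

Definition gcos u th f : R := fine (gsum (wave u th) f) - fine (gnorm f).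

Lemma gsum_wave u th f : moderate f -> gsum (wave u th) f = (gcos u th f + fine (gnorm f))%:E.
Proof.
move=> mf; rewrite /gcos subrK fineK//.
by apply: (@gsum_fin _ 2) => //; [exact: measurable_wave|exact: wave_le2].
Qed.

Lemma gsum_wave0 f : moderate f -> gsum (wave (fun=> 0) 0) f = (2 * fine (gnorm f))%:E.
Proof.
move=> mf; rewrite EFinM fineK ?gnorm_fin// -gsumZ//.
apply: eq_lebesgue_sites => f' ff'; rewrite /weighted /wave; congr (_ * _)%:E.
have mf' := moderate_off mf ff'.
rewrite (pairingE G)//; last exact: rapid0.
rewrite (_ : S _ = 0) ?addr0 ?cos0 ?mulr1//.
by rewrite -[RHS](tsum0 e); apply: eq_tsum => y; rewrite mul0r.
Qed.

(** Before normalisation, the conditional functional obeys the same one-site law as the measure. If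
    the factor [r] exceeds 1, the roles of [u] and its shift are exchanged. *)
Lemma gcos_site f x : moderate f -> x \in s -> site_law e nb w a (fun u th => gcos u th f) x.
Proof.
move=> mf xs u c th ru.
have rp := rapid_point G x c; have rl := rapid_lap G rp.
have rul : rapid (fun y => u y + lap (point x c) y) by exact: rapidD.
have W0 : degree x != 0 by rewrite gt_eqF// degree_gt0.
have ph g : moderate g -> pairing (fun y => u y + lap (point x c) y) g - lap g x * (u x + lap (point x c) x) / degree x =
    pairing u g - lap g x * u x / degree x.
  by move=> mg; rewrite pairing_lap_point// lap_point; field.
set r := expR (- quad u (point x c)).
have er : expR (- ((u x + lap (point x c) x) ^+ 2 / (2 * degree x))) = r * expR (- (u x ^+ 2 / (2 * degree x))).
  by rewrite /r quad_point// lap_point -expRD; congr expR; field.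
have key v v' (t : R) : rapid v -> rapid v' -> 0 <= t <= 1 ->
   (forall g, moderate g -> pairing v' g - lap g x * v' x / degree x = pairing v g - lap g x * v x / degree x) ->
   expR (- (v' x ^+ 2 / (2 * degree x))) = t * expR (- (v x ^+ 2 / (2 * degree x))) ->
   gcos v' th f = t * gcos v th f.
  move=> rv rv' t01 pv ev; have := gsum_wave_shift th xs rv rv' mf t01 pv ev.
  rewrite gsum_wave0// !gsum_wave// -!EFinM -EFinD => -[].
  move: (gcos _ _ _) (gcos _ _ _) (fine _) => A B Z h.
  by rewrite -[LHS](addrK Z) h; field.
have r0 : 0 < r by exact: expR_gt0.
case: (leP r 1) => r1.
  rewrite mulrC; apply: key => //; by rewrite (ltW r0).
have E : gcos u th f = r^-1 * gcos (fun y => u y + lap (point x c) y) th f.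
  apply: key => //.
  - by rewrite invr_ge0 (ltW r0)/= invf_le1// ltW.
  - by move=> g mg; rewrite ph.
  - by rewrite er mulrA mulVf ?mul1r// gt_eqF.
by rewrite E mulrC mulrA divff ?mul1r// gt_eqF.
Qed.

(** When [lap v = - u] on [s], the shifted function vanishes on [s], so its cosine comes out of the
    integral. This computes the conditional functional from the values outside [s]. *)
Lemma gcos_solve f u v th : moderate f -> rapid u -> (forall x, x \notin s -> v x = 0) ->
  (forall x, x \in s -> lap v x = - u x) ->
  gcos u th f = fine (gnorm f) * cos (pairing (fun y => u y + lap v y) f + th) * expR (quad u v).
Proof.
move=> mf ru vs lv.
have [rv E] := site_law_seq G th (fun x xs => gcos_site mf xs) ru vs.
have {E} -> : gcos u th f = gcos (fun y => u y + lap v y) th f * expR (quad u v).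
  by rewrite E -mulrA -expRD addNr expR0 mulr1.
congr (_ * _); set u' := (fun y => u y + lap v y).
have ru' : rapid u' by apply: rapidD => //; exact: (rapid_lap G).
set c := cos _.
have c0 : 0 <= 1 + c by rewrite -lerBlDl sub0r cos_geN1.
have E : gsum (wave u' th) f = ((1 + c)%:E * gnorm f)%E.
  rewrite -gsumZ//.
  apply: eq_lebesgue_sites => f' ff'; rewrite /weighted /wave; congr (_ * _)%:E.
  have mf' := moderate_off mf ff'.
  rewrite mulr1 /c; congr (1 + cos (_ + _)).
  rewrite !(pairingE G)//; apply: eq_tsum => y.
  case: (boolP (y \in s)) => ys; last by rewrite ff'.
  by rewrite /u' lv// subrr !mul0r.
by rewrite /gcos E fineM ?gnorm_fin//= mulrDl mul1r addrAC subrr add0r mulrC.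
Qed.

Variable nu : probability conf R.
Hypothesis numod : {ae nu, forall f, moderate f}.

(** The integral of [k] after resampling the sites of [s] by the specification under [nu]. The Gibbs
    property will be read as the invariance of [nu] under this resampling. *)
Definition mixture k : \bar R := (\int[nu]_f ((fine (gnorm f))^-1%:E * gsum k f))%E.

Lemma measurable_gnorm_inv : measurable_fun setT (fun f : conf => (fine (gnorm f))^-1).
Proof.
have -> : (fun f : conf => (fine (gnorm f))^-1) = (fun f => fine (gnorm f) `^ (-1)).
  by apply/funext => f; rewrite powR_inv1// fine_ge0// ltW// gnorm_gt0.
apply: (measurableT_comp (measurable_powR _)); apply: measurableT_comp => //.
by apply: measurable_gsum.
Qed.

Lemma mixture_integrand_ge0 k f : (forall f, 0 <= k f) -> (0 <= (fine (gnorm f))^-1%:E * gsum k f)%E.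
Proof.
by move=> h; rewrite mule_ge0 ?gsum_ge0// lee_fin invr_ge0 fine_ge0// ltW// gnorm_gt0.
Qed.

Lemma measurable_mixture_integrand k : measurable_fun setT k -> (forall f, 0 <= k f) ->
  measurable_fun setT (fun f : conf => (fine (gnorm f))^-1%:E * gsum k f)%E.
Proof.
move=> mk h; apply: emeasurable_funM; last exact: measurable_gsum.
by apply/measurable_EFinP; exact: measurable_gnorm_inv.
Qed.

Lemma mixtureE k (h : conf -> R) : (forall f, moderate f -> gsum k f = (h f * fine (gnorm f))%:E) ->
  measurable_fun setT k -> (forall f, 0 <= k f) -> measurable_fun setT h ->
  mixture k = (\int[nu]_f (h f)%:E)%E.
Proof.
move=> kh mk k0' mh; apply: ae_eq_integral => //.
- exact: measurable_mixture_integrand.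
- exact/measurable_EFinP.
apply: (ae_mono numod) => f mf _; rewrite kh// -EFinM mulrCA mulVf ?mulr1//.
by rewrite gt_eqF// fine_gnorm_gt0.
Qed.

Lemma mixture_one : mixture (fun=> 1) = 1%E.
Proof.
rewrite (@mixtureE _ (fun=> 1))//.
  by rewrite (integral_cst nu measurableT 1) mul1e; exact: probability_setT.
by move=> f mf; rewrite mul1r fineK// gnorm_fin.
Qed.

Lemma mixtureD k k' : measurable_fun setT k -> measurable_fun setT k' ->
  (forall f, 0 <= k f) -> (forall f, 0 <= k' f) ->
  mixture (fun f => k f + k' f) = (mixture k + mixture k')%E.
Proof.
move=> mk mk' h h'; rewrite /mixture -ge0_integralD//; first last.
- exact: measurable_mixture_integrand.
- by move=> f _; exact: mixture_integrand_ge0.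
- exact: measurable_mixture_integrand.
- by move=> f _; exact: mixture_integrand_ge0.
by apply: eq_integral => f _; rewrite gsumD// ge0_muleDr// gsum_ge0.
Qed.

Lemma mixtureZ k c : measurable_fun setT k -> (forall f, 0 <= k f) -> 0 <= c ->
  mixture (fun f => c * k f) = (c%:E * mixture k)%E.
Proof.
move=> mk h c0; rewrite /mixture -ge0_integralZl//; first last.
- by move=> f _; exact: mixture_integrand_ge0.
- exact: measurable_mixture_integrand.
by apply: eq_integral => f _; rewrite gsumZ// muleCA.
Qed.

Lemma le_mixture k k' : measurable_fun setT k -> measurable_fun setT k' ->
  (forall f, 0 <= k f) -> (forall f, k f <= k' f) -> (mixture k <= mixture k')%E.
Proof.
move=> mk mk' h kk'; have h' f : 0 <= k' f by exact: le_trans (kk' f).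
apply: ge0_le_integral => //.
- by move=> f _; exact: mixture_integrand_ge0.
- exact: measurable_mixture_integrand.
- exact: measurable_mixture_integrand.
move=> f _; apply: lee_wpmul2l; last exact: le_gsum.
by rewrite lee_fin invr_ge0 fine_ge0// ltW// gnorm_gt0.
Qed.

Lemma mixture_ge0 k : (forall f, 0 <= k f) -> (0 <= mixture k)%E.
Proof. by move=> h; apply: integral_ge0 => f _; exact: mixture_integrand_ge0. Qed.

Lemma mixture_fin k : bounded_mfun k -> (forall f, 0 <= k f) -> mixture k \is a fin_num.
Proof.
move=> [mk [M kM]] h; rewrite ge0_fin_numE ?mixture_ge0//.
apply: (@le_lt_trans _ _ (mixture (fun f => `|M| * 1))).
  by apply: le_mixture => // f; rewrite mulr1 (le_trans (ler_norm _))// (le_trans (kM f))// ler_norm.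
by rewrite mixtureZ// mixture_one mule1 ltry.
Qed.

Lemma positive_linear_mixture : positive_linear (fun k => fine (mixture k)).
Proof.
split=> [h bh h0|f g bf bg f0 g0|c f c0 bf f0].
- by rewrite fine_ge0// mixture_ge0.
- have [mf _] := bf; have [mg _] := bg.
  by rewrite mixtureD// fineD//; exact: mixture_fin.
- by have [mf _] := bf; rewrite mixtureZ// fineM//; exact: mixture_fin.
Qed.

(** The resampled functional must be an actual probability measure before [char_fun_inj] can compare
    it with [nu]. *)
Lemma exists_mixture : exists M : probability conf R,
  (forall A, measurable A -> M A = mixture \1_A) /\
  (forall k, bounded_mfun k -> (forall f, 0 <= k f) -> (\int[M]_f k f)%R = fine (mixture k)).
Proof.
have mi (A : set conf) : measurable A -> measurable_fun setT (\1_A : conf -> R).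
  by move=> mA; exact: measurable_indic.
have i0 (A : set conf) (f : conf) : 0 <= \1_A f :> R by rewrite indicE.
have m0 : mixture \1_set0 = 0%E.
  have -> : \1_set0 = (fun f : conf => 0 * 1 : R) by apply/funext => f; rewrite indic0 mulr1.
  by rewrite mixtureZ// mul0e.
have m1 : mixture \1_setT = 1%E.
  by rewrite -mixture_one; congr mixture; apply/funext => f; rewrite indicT.
have mge A : (0 <= mixture \1_A)%E by exact: mixture_ge0.
have msig : semi_sigma_additive (fun A : set conf => mixture \1_A).
  move=> F mF tF mUF.
  have -> : mixture \1_(\bigcup_n F n) = (\sum_(n <oo) mixture \1_(F n))%E.
    rewrite /mixture -integral_nneseries//; first last.
    - by move=> n f _; exact: mixture_integrand_ge0.
    - by move=> n; apply: measurable_mixture_integrand => //; exact: mi.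
    apply: eq_integral => f _; rewrite nneseriesZl; last by move=> n _; exact: gsum_ge0.
    congr (_ * _)%E; rewrite /gsum -lebesgue_sites_nneseries; first last.
    - by move=> n f'; exact: weighted_ge0.
    - by move=> n; apply: measurable_weighted; exact: mi.
    apply: eq_lebesgue_sites => f' _; rewrite /weighted EFinM indic_bigcup//.
    by rewrite -nneseriesZl; [apply: eq_eseriesr => n _; rewrite EFinM|move=> n _; rewrite lee_fin].
  exact: is_cvg_nneseries.
have [M HM] := @exists_probability _ conf R (fun A => mixture \1_A) m0 mge msig m1.
exists M; split; first by move=> A _; exact: HM.
move=> k bk k0'; apply: (positive_linear_ext (positive_linear_exp M) positive_linear_mixture) => //.
by move=> A mA; rewrite exp_indic// HM.
Qed.

Local Notation cf := (cf nu).

Lemma measurable_gcos u th : measurable_fun setT (gcos u th : conf -> R).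
Proof.
apply: measurable_funB; apply: measurableT_comp => //; apply: measurable_gsum => //.
- exact: measurable_wave.
- exact: wave_ge0.
Qed.

Lemma gcos_bound u th f : moderate f -> `|gcos u th f / fine (gnorm f)| <= 1.
Proof.
move=> mf; have Z0 := fine_gnorm_gt0 mf.
rewrite normrM normfV (ger0_norm (ltW Z0)) ler_pdivrMr// mul1r.
have [g0 g2] : 0 <= gcos u th f + fine (gnorm f) /\ gcos u th f + fine (gnorm f) <= 2 * fine (gnorm f).
  rewrite -2!lee_fin -gsum_wave//; split; first by apply: gsum_ge0; exact: wave_ge0.
  rewrite EFinM fineK ?gnorm_fin// -gsumZ//; apply: le_gsum => //.
  - exact: measurable_wave.
  - exact: wave_ge0.
  - by move=> f'; rewrite mulr1; case/andP: (wave_le2 u th f').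
by rewrite ler_norml; move: g0 g2 Z0; move: (gcos _ _ _) (fine _) => A Z h1 h2 h3; apply/andP; split; lra.
Qed.

(** The ratio is known to lie in [[-1, 1]] on moderate functions only. Clipping changes nothing
    almost surely and gives a function bounded everywhere. *)
Lemma bounded_gcos u th : bounded_mfun (fun f : conf => Num.max (-1) (Num.min 1 (gcos u th f / fine (gnorm f))) : R).
Proof.
split; last first.
  exists 1 => f; rewrite ler_norml le_max lexx ge_max ge_min lexx /=.
  by rewrite (le_trans (lerN10 _)).
apply: measurable_maxr => //; apply: measurable_minr => //.
by apply: measurable_funM; [exact: measurable_gcos|exact: measurable_gnorm_inv].
Qed.

Lemma mixture_wave u th : fine (mixture (wave u th)) =
  1 + \int[nu]_f (gcos u th f / fine (gnorm f)).
Proof.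
pose h (f : conf) : R := Num.max (-1) (Num.min 1 (gcos u th f / fine (gnorm f))).
have bh : bounded_mfun h by exact: bounded_gcos.
have hE f : moderate f -> h f = gcos u th f / fine (gnorm f).
  move=> mf; have := gcos_bound u th mf; rewrite ler_norml => /andP[h1 h2].
  by rewrite /h (min_idPr h2) (max_idPr h1).
rewrite (@mixtureE _ (fun f => 1 + h f)).
- have -> : \int[nu]_f (gcos u th f / fine (gnorm f)) = \int[nu]_f h f.
    apply: exp_ae_eq; last by apply: (ae_mono numod) => f mf; rewrite hE.
    + by apply: measurable_funM; [exact: measurable_gcos|exact: measurable_gnorm_inv].
    + by case: bh.
  have <- : \int[nu]_f (1 + h f) = 1 + \int[nu]_f h f by rewrite (expD nu (bm_cst 1) bh) exp_cst.
  by [].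
- move=> f mf; rewrite gsum_wave// hE//; congr EFin.
  have := fine_gnorm_gt0 mf; move: (gcos _ _ _) (fine _) => A Z Z0.
  by field; rewrite gt_eqF.
- exact: measurable_wave.
- exact: wave_ge0.
- by apply: measurable_funD => //; case: bh.
Qed.

Lemma bounded_wave u th : bounded_mfun (wave u th).
Proof.
split; first exact: measurable_wave.
by exists 2 => f; rewrite ger0_norm ?wave_ge0//; case/andP: (wave_le2 u th f).
Qed.

Lemma exp_wave (M : probability conf R) u th : \int[M]_f wave u th f = 1 + \int[M]_f cos (pairing u f + th).
Proof.
rewrite (expD M (bm_cst 1)); first by rewrite exp_cst.
exact: bm_cos (measurable_phase G _ _).
Qed.

(** If resampling preserves [nu], then [cf] is the average of the normalised [gcos], and the
    one-site law passes through the average because its factor does not depend on [f]. *)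
Lemma mixture_site_law x : (forall A, measurable A -> mixture \1_A = nu A) -> x \in s ->
  site_law e nb w a cf x.
Proof.
move=> mnu xs.
have E u th : cf u th = \int[nu]_f (gcos u th f / fine (gnorm f)).
  apply: (@addrI _ 1); rewrite -mixture_wave /cf -exp_wave.
  apply: (positive_linear_ext (positive_linear_exp nu) positive_linear_mixture).
  - by move=> A mA; rewrite exp_indic// mnu.
  - exact: bounded_wave.
  - exact: wave_ge0.
move=> u c th ru; rewrite !E mulrC.
have bh : bounded_mfun (fun f : conf => Num.max (-1) (Num.min 1 (gcos u th f / fine (gnorm f))) : R) by exact: bounded_gcos.
have mg v : measurable_fun setT (fun f : conf => gcos v th f / fine (gnorm f)).
  by apply: measurable_funM; [exact: measurable_gcos|exact: measurable_gnorm_inv].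
have hE f v : moderate f -> Num.max (-1) (Num.min 1 (gcos v th f / fine (gnorm f))) = gcos v th f / fine (gnorm f).
  move=> mf; have := gcos_bound v th mf; rewrite ler_norml => /andP[h1 h2].
  by rewrite (min_idPr h2) (max_idPr h1).
have -> : \int[nu]_f (gcos u th f / fine (gnorm f)) =
    \int[nu]_f (Num.max (-1) (Num.min 1 (gcos u th f / fine (gnorm f)))).
  apply: exp_ae_eq => //; first by case: bh.
  by apply: (ae_mono numod) => f mf; rewrite hE.
rewrite -(expZ nu _ bh); apply: exp_ae_eq => //.
  by case: (bmZ (expR (- quad u (point x c))) bh).
apply: (ae_mono numod) => f mf; rewrite hE//.
have := gcos_site mf xs c th ru => ->.
by rewrite mulrAC mulrC.
Qed.

Definition points (l : seq (C * R)) (y : C) : R := \sum_(p <- l) point p.1 p.2 y.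

Lemma rapid_points l : rapid (points l).
Proof.
elim: l => [|p l IH].
  have -> : points [::] = (fun=> 0) by apply/funext => y; rewrite /points big_nil.
  exact: rapid0.
have -> : points (p :: l) = (fun y => point p.1 p.2 y + points l y).
  by apply/funext => y; rewrite /points big_cons.
by apply: rapidD => //; exact: (rapid_point G).
Qed.

Lemma pairing_points l f : pairing (points l) f = lincomb l f.
Proof.
suff [D E] : dominated q (fun y => points l y * f y) /\ S (fun y => points l y * f y) = lincomb l f.
  by rewrite (pairing_tsum (eK G) (ixK G) q0 cq).
elim: l => [|p l [IH1 IH2]].
  have -> : (fun y => points [::] y * f y) = (fun=> 0).
    by apply/funext => y; rewrite /points big_nil mul0r.
  by split; [exact: dominated0|rewrite tsum0 /lincomb big_nil].
have -> : (fun y => points (p :: l) y * f y) = (fun y => point p.1 p.2 y * f y + points l y * f y).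
  by apply/funext => y; rewrite /points big_cons mulrDl.
have dp : dominated q (fun y => point p.1 p.2 y * f y).
  exists (`|p.2 * f p.1| / q p.1) => y; rewrite /point; case: eqVneq => [->|_].
    by rewrite divfK// gt_eqF.
  by rewrite mul0r normr0 mulr_ge0 ?divr_ge0 ?(ltW (q0 _)).
split; first exact: dominatedD.
by rewrite (tsumD q0 cq)// (tsum_point G) IH2 /lincomb big_cons.
Qed.

(** With [lap v = - u] on [s], [gcos_solve] turns the functional of the resampled measure at [u]
    into [exp (quad u v)] times [cf] at [u + lap v], and the shift law says that this is [cf] at
    [u]. *)
Lemma shift_law_mixture A : shift_law e nb w a nu -> measurable A -> mixture \1_A = nu A.
Proof.
move=> sh mA; have [M [MA Mk]] := exists_mixture.
rewrite -MA//; apply: char_fun_inj => // l th.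
pose u := points l; have ru : rapid u by exact: rapid_points.
have uE f : pairing u f = lincomb l f by exact: pairing_points.
have cfE (m : probability conf R) : char_fun m l th = \int[m]_f cos (pairing u f + th).
  by apply: eq_Rintegral => f _; rewrite uE.
rewrite !cfE; apply: (@addrI _ 1); rewrite -!exp_wave Mk; [|exact: bounded_wave|exact: wave_ge0].
rewrite mixture_wave exp_wave; congr (1 + _).
have [v vs lv] := solvable (fun y => - u y).
have [f0 mf0] : exists f, moderate f by exists u; exact: rapid_moderate.
have rv : rapid v by have [] := site_law_seq G th (fun x xs => gcos_site mf0 xs) ru vs.
have -> : \int[nu]_f (gcos u th f / fine (gnorm f)) =
    \int[nu]_f (expR (quad u v) * cos (pairing (fun y => u y + lap v y) f + th)).
  apply: exp_ae_eq.
  - by apply: measurable_funM; [exact: measurable_gcos|exact: measurable_gnorm_inv].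
  - by apply: measurable_funM => //; exact: (bm_cos (measurable_phase G _ _)).1.
  apply: (ae_mono numod) => f mf; rewrite (gcos_solve th mf ru vs lv).
  have := fine_gnorm_gt0 mf; move: (fine _) (cos _) (expR _) => Z c r Z0.
  by field; rewrite gt_eqF.
rewrite (expZ nu); last exact: bm_cos (measurable_phase G _ _).
have := sh u v th ru rv; rewrite /cf => ->.
by rewrite mulrC -mulrA -expRD addNr expR0 mulr1.
Qed.

End Gibbs.

(** A Lebesgue number argument: local parameters become one parameter for the whole segment, because
    [Q] persists when the parameter shrinks. *)
Lemma segment_covering {R : realType} (T : R) (Q : R -> R -> Prop) :
  (forall d d' x, d' <= d -> 0 < d' -> Q d x -> Q d' x) ->
  (forall x, 0 <= x <= T -> exists2 d, 0 < d & forall y, 0 <= y <= T -> `|x - y| < d -> Q d y) ->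
  exists2 d, 0 < d & forall x, 0 <= x <= T -> Q d x.
Proof.
move=> mQ H.
have /compact_near_coveringP/(_ R (0 : R)^'+ (fun d x => 0 <= x <= T -> Q d x) _) := @segment_compact R 0 T.
case.
- move=> x /=; rewrite in_itv /= => xT; have [d d0 Hd] := H x xT.
  exists (ball x d, [set d' | 0 < d' < d]).
    split => /=; first exact: nbhsx_ballx.
    by near=> d'; apply/andP; split; near: d'; [exact: nbhs_right_gt|exact: nbhs_right_lt].
  move=> [y d'] /= [xy /andP[d'0 d'd]] yT; apply: (mQ d) => //; first exact: ltW.
  exact: Hd.
- move=> d /= d0 Hd; exists (d / 2); first by rewrite divr_gt0.
  move=> x xT; apply: (Hd (d / 2)) => //=.
    by rewrite sub0r normrN ger0_norm ?divr_ge0 ?ltW// ltr_pdivrMr// ltr_pMr// ltr1n.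
  by rewrite divr_gt0.
Unshelve. all: by end_near. Qed.

Lemma sandwich_step (R : realType) (A B c D x1 x2 x3 : R) :
  B - c <= A <= B - c + (x1 - x3) -> x1 <= c - D <= x2 ->
  B - D <= A + x2 <= B - D + (x2 - x3).
Proof. by move=> /andP[h1 h2] /andP[h3 h4]; apply/andP; split; lra. Qed.

(** * The law of the solution *)

Section SolutionPath.
Context {R : realType} {I : choiceType} (e : nat -> I) (ix : I -> nat).
Context (nb : I -> seq I) (w : I -> I -> R) (a : I -> R) (k0 k2 : nat) (K0 K1 : R).
Hypothesis G : weighted_graph e ix nb w a k0 k2 K0 K1.

Let q x := a x ^ (- k2%:Z).
Local Notation S := (@tsum R I e).
Local Notation lap := (lap nb w).
Local Notation bnd := (bnd a).
Local Notation heat := (heat nb w).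
Local Notation slow := (slow a).
Local Notation rapid := (rapid a).
Local Notation moderate := (moderate a).
Let q0 : forall x, 0 < q x := q_gt0 G.
Let cq : cvgn (series (fun i => q (e i))) := q_cvg G.

Variable flow : (I -> R) -> R -> I -> R.
Hypothesis flowP : forall f, rapid f -> [/\ heat (flow f), slow (flow f) & flow f 0 = f].
Local Notation noise_var := (noise_var e flow).

Definition path_continuous (z : R -> I -> R) (n : int) := forall t, 0 <= t ->
  (exists M, bnd M n (z t)) /\ forall eps, 0 < eps ->
  exists2 d, 0 < d & forall r, 0 <= r -> `|t - r| < d -> bnd eps n (fun x => z t x - z r x).

Definition path_solution (z b : R -> I -> R) := forall t x, 0 <= t ->
  z t x = z 0 x + primitive (fun s => - lap (z s) x) t + Num.sqrt 2 * b t x.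

Section Path.
Variables (z b : R -> I -> R) (n : int).
Hypothesis zc : path_continuous z n.
Hypothesis zE : path_solution z b.

Let c2 : R := Num.sqrt 2.

(** The covering parameter is used as the inverse of the bound, so that shrinking it weakens the
    property, as [segment_covering] demands. *)
Lemma path_bounded T : exists2 M, 0 <= M & forall t, 0 <= t <= T -> bnd M n (z t).
Proof.
have [||d d0 H] := @segment_covering _ T (fun d t => bnd d^-1 n (z t)).
- move=> d d' t dd d0; apply: (bnd_le G) => //.
  by rewrite lef_pV2 ?posrE// (lt_le_trans d0).
- move=> t /andP[t0 _]; have [[M bM] C] := zc t0; have [d d0 Hd] := C 1 ltr01.
  have M0 := bnd_ge0 G bM.
  pose d' := Num.min d (M + 1)^-1.
  have M1 : 0 < M + 1 by rewrite ltr_wpDl.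
  have d'0 : 0 < d' by rewrite lt_min d0 invr_gt0.
  have d'd : d' <= d by rewrite /d' ge_min lexx.
  exists d' => // r /andP[r0 _] tr; have b1 := Hd r r0 (lt_le_trans tr d'd).
  apply: (@bnd_le _ _ _ _ _ _ _ _ _ _ _ G (M + 1) n) => //.
    by rewrite -[leLHS]invrK lef_pV2 ?posrE ?invr_gt0// ge_min lexx orbT.
  have := bndB bM b1; congr (bnd _ _ _); by apply/funext => x; rewrite opprB addrC subrK.
by exists d^-1 => //; rewrite invr_ge0 ltW.
Qed.

Lemma path_uniform T eps : 0 < eps -> exists2 d, 0 < d &
  forall t r, 0 <= t <= T -> 0 <= r <= T -> `|t - r| < d -> bnd eps n (fun x => z t x - z r x).
Proof.
move=> eps0.
have [||d d0 H] := @segment_covering _ T (fun d t => forall r, 0 <= r <= T -> `|t - r| < d ->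
   bnd eps n (fun x => z t x - z r x)).
- by move=> d d' t dd d0 H r rT tr; apply: H => //; exact: lt_le_trans dd.
- move=> t /andP[t0 _]; have [_ C] := zc t0; have [|d d0 Hd] := C (eps / 2).
    by rewrite divr_gt0.
  have d2 : 0 < d / 2 by rewrite divr_gt0.
  exists (d / 2) => // t' /andP[t'0 _] tt' r /andP[r0 _] t'r.
  have h1 : `|t - t'| < d by rewrite (lt_trans tt')// ltr_pdivrMr// ltr_pMr// ltr1n.
  have h2 : `|t - r| < d.
    by rewrite -(subrK t' t) -addrA (le_lt_trans (ler_normD _ _))// [d]splitr ltrD.
  have := bndB (Hd r r0 h2) (Hd t' t'0 h1); rewrite -splitr; congr (bnd _ _ _).
  by apply/funext => x; ring.
by exists d => // t r tT; exact: H.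
Qed.

Lemma path_coord x T : {within `[0, T], continuous (z ^~ x)}.
Proof.
apply/within_itvP => t /andP[t0 _] eps eps0; have [_ C] := zc t0.
have [|d d0 Hd] := C (eps / a x ^ n); first by rewrite divr_gt0// (az_gt0 G).
exists d => // r /andP[r0 _] tr; have := Hd r r0 tr x.
by rewrite divfK// gt_eqF// (az_gt0 G).
Qed.

Let drift x s := - lap (z s) x.

Lemma drift_continuous x (T : R) : {within `[0, T], continuous (drift x)}.
Proof.
move=> t; apply: cvgN; move: t; apply: within_continuous_sum => y t.
by apply: cvgM; [exact: cvg_cst|apply: cvgB; exact: path_coord].
Qed.

Lemma drift_increment T : exists2 L, 0 <= L & forall p r, 0 <= p -> p <= r -> r <= T ->
  bnd (L * (r - p)) (k0%:Z + n) (fun x => primitive (drift x) r - primitive (drift x) p).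
Proof.
have [M M0 bM] := path_bounded T.
have L0 : 0 <= lapC K0 n * M.
  by rewrite mulr_ge0// /lapC mulr_ge0 ?(K0_ge0 G)// addr_ge0// exprn_ge0.
exists (lapC K0 n * M) => // p r p0; rewrite le_eqVlt => /orP[/eqP<- _ x|pr rT x].
  by rewrite !subrr normr0 mulr0 mul0r.
have dp y : y \in `]p, r[ -> is_derive y (1 : R) (primitive (drift x)) (drift x y).
  rewrite in_itv /= => /andP[py _]; apply: primitive_derive; last exact: le_lt_trans py.
  by move=> t; exact: drift_continuous.
have cp : {within `[p, r], continuous (primitive (drift x))}.
  apply: (within_sub p0); apply: primitive_continuous => t; exact: drift_continuous.
have [c] := MVT pr dp cp.
rewrite in_itv /= => /andP[pc cr] ->; rewrite normrM [X in _ * X]ger0_norm ?subr_ge0 ?(ltW pr)//.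
rewrite mulrAC ler_wpM2r ?subr_ge0 ?(ltW pr)// /drift normrN.
apply: (bnd_lap G); apply: bM; rewrite (ltW (le_lt_trans p0 pc)) /= (le_trans (ltW cr))//.
Qed.

(** The equation expresses the noise through the path and its drift. Continuity and growth of the
    whole noise field are thereby inherited from the solution. *)
Lemma path_noise p r x : 0 <= p -> 0 <= r ->
  c2 * (b r x - b p x) = z r x - z p x - (primitive (drift x) r - primitive (drift x) p).
Proof.
move=> p0 r0; rewrite (zE x p0) (zE x r0) -/c2 -/(drift x).
by move: (primitive _ _) (primitive _ _) => A B; ring.
Qed.

Lemma noise_small T eps : 0 < eps -> exists2 d, 0 < d & forall p r, 0 <= p -> p <= r -> r <= T ->
  r - p < d -> bnd eps (k0%:Z + n) (fun x => c2 * (b r x - b p x)).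
Proof.
move=> eps0; have e2 : 0 < eps / 2 by rewrite divr_gt0.
have [d d0 Hd] := path_uniform T e2; have [L L0 HL] := drift_increment T.
have L1 : 0 < L + 1 by rewrite ltr_wpDl.
exists (Num.min d (eps / 2 / (L + 1))); first by rewrite lt_min d0 divr_gt0.
move=> p r p0 pr rT; rewrite lt_min => /andP[h1 h2].
have r0 := le_trans p0 pr.
have b1 : bnd (eps / 2) (k0%:Z + n) (fun x => z r x - z p x).
  apply: (bnd_le G (lexx _)) (Hd r p _ _ _); first by rewrite lerDr.
  - by rewrite r0 rT.
  - by rewrite p0 (le_trans pr).
  - by rewrite ger0_norm ?subr_ge0.
have b2' : bnd (eps / 2) (k0%:Z + n) (fun x => primitive (drift x) r - primitive (drift x) p).
  apply: (bnd_le G _ (lexx _)) (HL p r p0 pr rT).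
  apply: (@le_trans _ _ ((L + 1) * (r - p))); first by rewrite ler_wpM2r ?subr_ge0// lerDl.
  by rewrite mulrC -ler_pdivlMr// ltW.
have := bndB b1 b2'; rewrite -splitr; congr (bnd _ _ _).
by apply/funext => x; rewrite path_noise.
Qed.

Lemma noise_bounded T : exists2 M, 0 <= M & forall p r, 0 <= p -> p <= r -> r <= T ->
  bnd M (k0%:Z + n) (fun x => c2 * (b r x - b p x)).
Proof.
have [M M0 bM] := path_bounded T; have [L L0 HL] := drift_increment T.
exists (M + M + `|L * T|); first by rewrite !addr_ge0.
move=> p r p0 pr rT; have r0 := le_trans p0 pr.
have b1 : bnd (M + M) (k0%:Z + n) (fun x => z r x - z p x).
  apply: (bnd_le G (lexx _)) (bndB (bM r _) (bM p _)); first by rewrite lerDr.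
  - by rewrite r0 rT.
  - by rewrite p0 (le_trans pr).
have b2' : bnd `|L * T| (k0%:Z + n) (fun x => primitive (drift x) r - primitive (drift x) p).
  apply: (bnd_le G _ (lexx _)) (HL p r p0 pr rT).
  by rewrite (le_trans _ (ler_norm _))// ler_wpM2l// (le_trans _ rT)// gerBl.
have := bndB b1 b2'; congr (bnd _ _ _).
by apply/funext => x; rewrite path_noise.
Qed.

(** Duhamel along one path. Without the noise accumulated since [p], the path is differentiable, and
    its pairing with [flow u (t - r')] has a derivative involving only that noise, of size [om]; the
    error over [[p, r]] is thus [om] times the length. *)
Lemma path_step u t : rapid u -> 0 <= t -> exists2 K, 0 <= K & forall p r om, 0 <= p -> p <= r -> r <= t ->
  (forall r', p <= r' <= r -> bnd om (k0%:Z + n) (fun x => c2 * (b r' x - b p x))) ->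
  `|S (fun x => flow u (t - r) x * z r x) - c2 * S (fun x => flow u (t - r) x * (b r x - b p x)) -
    S (fun x => flow u (t - p) x * z p x)| <= K * om * (r - p).
Proof.
move=> ru t0.
pose m := - k2%:Z - k0%:Z - (k0%:Z + n).
have [[dU cU] _ U0] := flowP ru.
have [M bU'] := flow_fast G flowP ru m t.
have [Mz Mz0 bz] := path_bounded t.
have bU tau : 0 <= tau <= t -> bnd M m (flow u tau) by exact: bU'.
have M0 : 0 <= M by apply: (bnd_ge0 G (bU 0 _)); rewrite lexx.
have bL tau : 0 <= tau <= t -> bnd (lapC K0 m * M) (k0%:Z + m) (lap (flow u tau)).
  by move=> h; apply: (bnd_lap G); exact: bU.
have L0 : 0 <= lapC K0 m * M by apply: (bnd_ge0 G (bL 0 _)); rewrite lexx.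
have Sq0 : 0 <= S q.
  by apply: (tsum_ge0 q0 cq) => [|x]; [exists 1 => x; rewrite mul1r ger0_norm// ltW|rewrite ltW].
exists (lapC K0 m * M * S q); first by rewrite mulr_ge0.
move=> p r om p0 pr rt bom; have r0 := le_trans p0 pr.
have om0 : 0 <= om by apply: (bnd_ge0 G (bom p _)); rewrite lexx.
pose A r' x := z r' x - c2 * (b r' x - b p x).
have AE r' x : 0 <= r' -> A r' x = z p x + (primitive (drift x) r' - primitive (drift x) p).
  by move=> r'0; rewrite /A path_noise//; ring.
have en : k0%:Z + m + (k0%:Z + n) = - k2%:Z by rewrite /m; ring.
have bA r' : p <= r' <= r -> bnd (Mz + om) (k0%:Z + n) (A r').
  move=> /andP[pr' r'r]; apply: bndB; last by apply: bom; rewrite pr'.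
  apply: (bnd_le G (lexx _)) (bz r' _); first by rewrite lerDr.
  by rewrite (le_trans p0 pr') (le_trans r'r).
have ti r' : p <= r' <= r -> 0 <= t - r' <= t.
  move=> /andP[pr' r'r]; rewrite subr_ge0 (le_trans r'r rt) /= gerBl; exact: le_trans pr'.
pose f r' x := flow u (t - r') x * A r' x.
pose f' r' x := lap (flow u (t - r')) x * A r' x + flow u (t - r') x * (- lap (z r') x).
have lz r' : p <= r' <= r -> bnd (lapC K0 n * Mz) (k0%:Z + n) (lap (z r')).
  move=> /andP[pr' r'r]; apply: (bnd_lap G); apply: bz.
  by rewrite (le_trans p0 pr') (le_trans r'r).
have pin r' : p < r' < r -> p <= r' <= r by move=> /andP[/ltW-> /ltW->].
have H1 r' : p < r' < r -> forall x, is_derive r' (1 : R) (f ^~ x) (f' r' x).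
  move=> prr x; have /andP[pr' r'r] := prr.
  have r'0 : 0 < r' by exact: le_lt_trans pr'.
  have tr' : 0 < t - r' by rewrite subr_gt0 (lt_le_trans r'r).
  have d1 : is_derive r' (1 : R) (fun s => flow u (t - s) x) (lap (flow u (t - r')) x).
    rewrite -[X in is_derive _ _ _ X]opprK; apply: (@is_derive_reflect _ (fun s => flow u s x)).
    exact: dU.
  have d2 : is_derive r' (1 : R) (A ^~ x) (- lap (z r') x).
    have d3 : is_derive r' (1 : R) (fun s => z p x + (primitive (drift x) s - primitive (drift x) p)) (drift x r').
      rewrite -[X in is_derive _ _ _ X]add0r; apply: is_deriveD.
      rewrite -[X in is_derive _ _ _ X]subr0; apply: is_deriveB.
      by apply: primitive_derive => // T; exact: drift_continuous.
    apply: (@near_eq_is_derive _ _ _ (fun s => z p x + (primitive (drift x) s - primitive (drift x) p))) => //.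
    apply/nbhs_ballP; exists r' => // s; rewrite /ball /= ltr_norml => /andP[_ h]; rewrite AE// ltW//.
    by move: h; rewrite ltrBlDr ltrDl.
  have := is_deriveM d1 d2; rewrite /GRing.scale /= /f' => h.
  by apply: is_derive_eq h _; rewrite mulrC addrC; congr (_ + _); rewrite mulrC.
have cA x : {within `[p, r], continuous (A ^~ x)}.
  have h : {within `[p, r], continuous (fun s => z p x + (primitive (drift x) s - primitive (drift x) p))}.
    move=> s; apply: cvgD; first exact: cvg_cst.
    apply: cvgB; last exact: cvg_cst.
    move: s; apply: (within_sub p0); apply: primitive_continuous => T; exact: drift_continuous.
  apply/within_itvP => s sp eps eps0; move/within_itvP: h => /(_ s sp eps eps0)[d d0 Hd].
  exists d => // y yp sy; rewrite !AE; [exact: Hd| |].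
    by case/andP: yp => h _; exact: le_trans h.
  by case/andP: sp => h _; exact: le_trans h.
have H2 x : {within `[p, r], continuous (f ^~ x)}.
  move=> s; apply: cvgM; last exact: cA.
  move: s; have := within_reflect (cU t x); apply: continuous_subspaceW => y /=.
  by rewrite !in_itv /= => /andP[py yr]; rewrite (le_trans p0 py) (le_trans yr rt).
have H3 r' : p < r' < r -> forall x, `|f' r' x| <= (lapC K0 m * M * (Mz + om) + M * (lapC K0 n * Mz)) * q x.
  move=> prr x; have pr' := pin _ prr; have tr' := ti _ pr'.
  have h1 := bndM G (bL _ tr') (bA _ pr') x; rewrite en in h1.
  have h2 := bndM G (bU _ tr') (lz _ pr') x.
  rewrite mulrDl; apply: (le_trans (ler_normD _ _)); apply: lerD; first exact: h1.
  rewrite mulrN normrN; apply: (le_trans h2); apply: ler_wpM2l; first exact: mulr_ge0 (bnd_ge0 G (lz _ pr')).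
  by apply: (az_le G); rewrite /m subrK gerBl.
have rU r' : p < r' < r -> rapid (flow u (t - r')).
  by move=> prr; apply: (flow_rapid G flowP) => //; case/andP: (ti _ (pin _ prr)).
have mA r' : p < r' < r -> moderate (A r') by move=> prr; exists (k0%:Z + n), (Mz + om); exact: bA (pin _ prr).
have mz r' : p < r' < r -> moderate (z r').
  move=> prr; exists n, Mz; apply: bz; have /andP[h1 h2] := pin _ prr.
  by rewrite (le_trans p0 h1) (le_trans h2).
have H4 r' : p < r' < r -> `|S (f' r')| <= lapC K0 m * M * S q * om.
  move=> prr; have pr' := pin _ prr; have tr' := ti _ pr'.
  have rl := rapid_lap G (rU _ prr).
  have -> : S (f' r') = S (fun x => lap (flow u (t - r')) x * (A r' x - z r' x)).
    rewrite (tsumD q0 cq); last 2 first.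
    - exact: (rapid_mul_dom G rl (mA _ prr)).
    - have := dominatedN (rapid_mul_dom G (rU _ prr) (moderate_lap G (mz _ prr))).
      by congr (dominated _ _); apply/funext => x; rewrite mulrN.
    have -> : S (fun x => flow u (t - r') x * (- lap (z r') x)) = - S (fun x => lap (flow u (t - r')) x * z r' x).
      rewrite (lap_symS G (rU _ prr) (mz _ prr)) -(tsumN q0 cq); last first.
        exact: (rapid_mul_dom G (rU _ prr) (moderate_lap G (mz _ prr))).
      by apply: eq_tsum => x; rewrite mulrN.
    rewrite -(tsumB q0 cq); [|exact: (rapid_mul_dom G rl (mA _ prr))|exact: (rapid_mul_dom G rl (mz _ prr))].
    by apply: eq_tsum => x; rewrite -mulrBr.
  rewrite mulrAC; apply: (ler_norm_tsum q0 cq) => x.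
  have -> : A r' x - z r' x = - (c2 * (b r' x - b p x)) by rewrite /A; ring.
  by rewrite mulrN normrN; have := bndM G (bL _ tr') (bom _ pr') x; rewrite en.
have Ap : A p = z p by apply/funext => x; rewrite /A subrr mulr0 subr0.
have rUp : rapid (flow u (t - p)) by apply: (flow_rapid G flowP) => //; rewrite subr_ge0 (le_trans pr).
have rUr : rapid (flow u (t - r)) by apply: (flow_rapid G flowP) => //; rewrite subr_ge0.
have mzp : moderate (z p) by exists n, Mz; apply: bz; rewrite p0 (le_trans pr).
have mzr : moderate (z r) by exists n, Mz; apply: bz; rewrite r0.
have mB : moderate (fun x => b r x - b p x).
  exists (k0%:Z + n), (`|c2^-1| * om) => x.
  have := bndZ c2^-1 (bom r ltac:(by rewrite pr lexx)) x.
  by rewrite mulrA mulVf ?mul1r// gt_eqF// sqrtr_gt0.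
have H5 : dominated q (f p) by rewrite /f Ap; exact: (rapid_mul_dom G).
have := tsum_mvt_norm q0 cq pr H1 H2 H3 H4 H5.
rewrite /f Ap.
have -> // : S (fun x => flow u (t - r) x * A r x) =
  S (fun x => flow u (t - r) x * z r x) - c2 * S (fun x => flow u (t - r) x * (b r x - b p x)).
rewrite -(tsumZ q0 cq); last exact: (rapid_mul_dom G).
rewrite -(tsumB q0 cq); [|exact: (rapid_mul_dom G)|exact: dominatedZ (rapid_mul_dom G rUr mB)].
by apply: eq_tsum => x; rewrite /A; ring.
Unshelve. all: by end_near. Qed.

Definition grid (s t : R) (N k : nat) : R := s + (t - s) * k%:R / N%:R.

Lemma grid0 s t N : grid s t N 0 = s.
Proof. by rewrite /grid mulr0 mul0r addr0. Qed.

Lemma gridN s t N : grid s t N.+1 N.+1 = t.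
Proof. by rewrite /grid mulfK ?pnatr_eq0// addrC subrK. Qed.

Lemma gridS s t N k : grid s t N k.+1 = grid s t N k + (t - s) / N%:R.
Proof. by rewrite /grid -natr1; ring. Qed.

Lemma grid_le s t N k l : s <= t -> (k <= l)%N -> grid s t N k <= grid s t N l.
Proof.
move=> st kl; rewrite /grid lerD2l; apply: ler_wpM2r; first by rewrite invr_ge0.
by apply: ler_wpM2l; rewrite ?subr_ge0// ler_nat.
Qed.

Definition noise_sum u s t N (b' : R -> I -> R) : R := \sum_(k < N)
  S (fun x => flow u (t - grid s t N k.+1) x * (b' (grid s t N k.+1) x - b' (grid s t N k) x)).

(** The errors of [path_step] add up to a multiple of [om * (t - s)], where [om] bounds the noise
    within one mesh interval and tends to 0. The sums converge path by path, with no stochastic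
    integral defined. *)
Lemma path_limit u s t : rapid u -> 0 <= s -> s <= t ->
  (S (fun x => flow u (t - s) x * z s x) + c2 * noise_sum u s t N.+1 b) @[N --> \oo] -->
  S (fun x => u x * z t x).
Proof.
move=> ru s0 st; have t0 := le_trans s0 st.
have [K K_0 HK] := path_step ru t0.
apply/cvgrPdist_le => eps eps0.
have c1 : 0 < K * (t - s) + 1 by rewrite ltr_wpDl// mulr_ge0// subr_ge0.
have om0 : 0 < eps / (K * (t - s) + 1) by rewrite divr_gt0.
have [d d0 Hd] := noise_small t om0.
set om := eps / _ in om0 Hd.
exists (Num.bound ((t - s) / d)) => // N /= dN.
have N0 : 0 < N.+1%:R :> R by rewrite ltr0n.
have mesh : (t - s) / N.+1%:R < d.
  rewrite ltr_pdivrMr// mulrC -ltr_pdivrMr// (lt_le_trans (archi_boundP _))//.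
    by rewrite divr_ge0 ?subr_ge0// ltW.
  by rewrite ler_nat leqW.
pose tk k := grid s t N.+1 k.
have tk0 k : 0 <= tk k by rewrite (le_trans s0)// -[leLHS](grid0 s t N.+1) grid_le.
have tkt k : (k <= N.+1)%N -> tk k <= t by move=> kN; rewrite -[leRHS](gridN s t N) grid_le.
pose X k := S (fun x => flow u (t - tk k) x * z (tk k) x).
have step k : (k < N.+1)%N -> `|X k.+1 - c2 * S (fun x => flow u (t - tk k.+1) x * (b (tk k.+1) x - b (tk k) x)) - X k|
    <= K * om * ((t - s) / N.+1%:R).
  move=> kN; have kk : tk k <= tk k.+1 by rewrite grid_le.
  have -> : (t - s) / N.+1%:R = tk k.+1 - tk k by rewrite /tk gridS [RHS]addrC addKr.
  apply: HK => //; first exact: tkt.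
  move=> r' /andP[h1 h2]; apply: Hd => //; first exact: le_trans h2 (tkt _ kN).
  apply: le_lt_trans mesh; rewrite lerBlDl; apply: (le_trans h2).
  by rewrite /tk gridS.
have tele j : (j <= N.+1)%N -> `|X j - X 0%N - c2 * \sum_(k < j) S (fun x => flow u (t - tk k.+1) x * (b (tk k.+1) x - b (tk k) x))|
    <= j%:R * (K * om * ((t - s) / N.+1%:R)).
  elim: j => [_|j IH nN]; first by rewrite big_ord0 mulr0 !subrr normr0 mul0r.
  rewrite big_ord_recr /= -natr1 mulrDl mul1r mulrDr.
  have := lerD (IH (ltnW nN)) (step j nN); apply: le_trans.
  apply: le_trans (ler_normD _ _).
  by rewrite le_eqVlt; apply/orP; left; apply/eqP; congr (`|_|); ring.
have := tele N.+1 (leqnn _); rewrite /X /tk gridN grid0 subrr (flow0 flowP)//.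
have -> : N.+1%:R * (K * om * ((t - s) / N.+1%:R)) = om * (K * (t - s)).
  by field; rewrite gt_eqF.
rewrite opprD addrA => /le_trans; apply.
by rewrite /om -mulrA ler_piMr ?(ltW eps0)// mulrC ler_pdivrMr// mul1r lerDl.
Qed.

(** Riemann sums of a monotone function: by [noise_var_step] each term lies above an increment of
    [noise_var], and the total excess telescopes to at most one mesh length times the largest
    value. *)
Lemma noise_var_grid u s t : rapid u -> 0 <= s -> s <= t ->
  (\sum_(k < N.+1) (t - s) / N.+1%:R * S (fun x => flow u (t - grid s t N.+1 k.+1) x ^+ 2))
    @[N --> \oo] --> noise_var (t - s) u.
Proof.
move=> ru s0 st; have ts : 0 <= t - s by rewrite subr_ge0.
pose Q r := S (fun x => flow u r x ^+ 2).
apply/cvgrPdist_le => eps eps0.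
have Q0 r : 0 <= r -> 0 <= Q r.
  move=> r0; apply: (tsum_ge0 q0 cq) => [|x]; last exact: sqr_ge0.
  have rf := flow_rapid G flowP ru r0.
  by apply: (rapid_mul_dom G) => //; exact: rapid_moderate.
exists (Num.bound ((t - s) * Q 0 / eps)) => // N /= dN.
have N0 : 0 < N.+1%:R :> R by rewrite ltr0n.
have h0 : 0 <= (t - s) / N.+1%:R by rewrite divr_ge0.
pose tk k := grid s t N.+1 k.
have tkt k : (k <= N.+1)%N -> tk k <= t by move=> kN; rewrite -[leRHS](gridN s t N) grid_le.
have E k : (k < N.+1)%N -> Q (t - tk k) * ((t - s) / N.+1%:R) <=
    noise_var (t - tk k) u - noise_var (t - tk k.+1) u <= Q (t - tk k.+1) * ((t - s) / N.+1%:R).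
  move=> kN; have -> : (t - s) / N.+1%:R = (t - tk k) - (t - tk k.+1) by rewrite /tk gridS; ring.
  apply: (noise_var_step G flowP) => //; first by rewrite subr_ge0 tkt.
  by rewrite lerD2l lerN2 grid_le.
have tele j : (j <= N.+1)%N ->
    noise_var (t - tk 0%N) u - noise_var (t - tk j) u <= \sum_(k < j) (t - s) / N.+1%:R * Q (t - tk k.+1) <=
    noise_var (t - tk 0%N) u - noise_var (t - tk j) u + (t - s) / N.+1%:R * (Q (t - tk j) - Q (t - tk 0%N)).
  elim: j => [_|j IH nN]; first by rewrite big_ord0 !subrr mulr0 addr0 lexx.
  have /andP[a1 a2] := IH (ltnW nN); have /andP[b1 b2'] := E j nN.
  rewrite big_ord_recr /=; move: a1 a2 b1 b2'.
  move: (\sum_(k < j) _) (noise_var (t - tk 0%N) u) (noise_var (t - tk j) u) (noise_var (t - tk j.+1) u) => A B c D.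
  move: ((t - s) / _) (Q (t - tk j)) (Q (t - tk j.+1)) (Q (t - tk 0%N)) => h q1 q2 q3.
  rewrite !mulrBr !(mulrC _ h); move: (h * q1) (h * q2) (h * q3) => x1 x2 x3 a1 a2 b1 b3.
  by apply: (@sandwich_step _ _ _ c _ x1); rewrite ?a1 ?b1.
have EN : tk N.+1 = t := gridN s t N.
have E0 : tk 0%N = s := grid0 s t N.+1.
have V0 : noise_var 0 u = 0 by rewrite /noise_var mulr0 green_form0 mulr0.
have := tele N.+1 (leqnn _); rewrite EN E0 subrr V0 subr0 => /andP[l1 l2].
rewrite distrC ger0_norm ?subr_ge0// lerBlDl.
apply: (le_trans l2); rewrite lerD2l.
apply: (@le_trans _ _ ((t - s) / N.+1%:R * Q 0)).
  by apply: ler_wpM2l => //; rewrite gerBl Q0.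
rewrite mulrAC ler_pdivrMr// -ler_pdivrMl// [leLHS]mulrC (le_trans (ltW (archi_boundP _)))//.
  by rewrite divr_ge0 ?(ltW eps0)// mulr_ge0// Q0.
by rewrite ler_nat leqW.
Qed.

End Path.
End SolutionPath.

(** * Adapted variables and Gaussian increments *)

Section Adapted.
Context {R : realType} {d : nat} {C : set 'rV[int]_d}.
Local Notation conf := (configuration R C).
Context {dT : measure_display} {T : measurableType dT}.
Variable (F : R -> set (set T)).
Hypothesis hF : filtration F.

Definition adapted_at t (X : T -> R) := forall Y : set R, measurable Y -> F t (X @^-1` Y).

(** [F t] is already a sigma-algebra, so generating from it adds nothing; adapted variables become
    measurable functions on a space of their own. *)
Lemma filtration_measurable t A : 0 <= t -> F t A <->
  (measurable : set (set (g_sigma_algebraType (F t)))) A.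
Proof.
have [sF _ _] := hF; move=> t0; have {}sF := sF t t0; split => [FA|].
  exact: sub_sigma_algebra.
by move=> /(_ (F t)); apply; split.
Qed.

Lemma adapted_atP t (X : T -> R) : 0 <= t -> adapted_at t X <->
  measurable_fun setT (X : g_sigma_algebraType (F t) -> R).
Proof.
move=> t0; split => [h _ Y mY|h Y mY].
  by rewrite setTI; apply/filtration_measurable => //; exact: h.
apply/filtration_measurable => //.
by have := h measurableT Y mY; rewrite setTI.
Qed.

Lemma adapted_at_measurable t X : 0 <= t -> adapted_at t X -> measurable_fun setT X.
Proof.
have [_ sF _] := hF; move=> t0 h _ Y mY; rewrite setTI; exact: sF (h _ mY).
Qed.

Lemma adapted_at_le s t X : 0 <= s -> s <= t -> adapted_at s X -> adapted_at t X.
Proof. by have [_ _ mF] := hF; move=> s0 st h Y mY; exact: mF (h _ mY). Qed.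

Lemma adapted_atD t X Y : 0 <= t -> adapted_at t X -> adapted_at t Y -> adapted_at t (fun o => X o + Y o).
Proof.
move=> t0 /adapted_atP-/(_ t0) hX /adapted_atP-/(_ t0) hY; apply/adapted_atP => //.
exact: measurable_funD.
Qed.

Lemma adapted_atZ t c X : 0 <= t -> adapted_at t X -> adapted_at t (fun o => c * X o).
Proof.
move=> t0 /adapted_atP-/(_ t0) hX; apply/adapted_atP => //; exact: measurable_funM.
Qed.

Lemma adapted_at_comp t (z : T -> conf) (k : conf -> R) : 0 <= t -> measurable_fun setT k ->
  (forall x, adapted_at t (fun o => z o x)) -> adapted_at t (fun o => k (z o)).
Proof.
move=> t0 mk h; apply/adapted_atP => //.
have mz : measurable_fun setT (z : g_sigma_algebraType (F t) -> conf).
  by apply: measurable_to_conf => x; apply/adapted_atP.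
exact: measurableT_comp mk mz.
Qed.

End Adapted.

Section Factor.
Context {R : realType} {dT dT' : measure_display} {T : measurableType dT} {T' : measurableType dT'}.
Variables (P : probability T R) (P' : probability T' R).
Variables (X g : T -> R) (X' : T' -> R) (kap : R).
Hypotheses (mX : measurable_fun setT X) (mX' : measurable_fun setT X').
Hypotheses (bg : bounded_mfun g) (g0 : forall o, 0 <= g o) (kap0 : 0 <= kap).
Hypothesis indicE' : forall Y : set R, measurable Y ->
  \int[P]_o (\1_Y (X o) * g o) = kap * \int[P']_o \1_Y (X' o).

Lemma bm_comp (k : R -> R) : bounded_mfun k -> bounded_mfun (fun o => k (X o)).
Proof. by move=> [mk [M kM]]; split; [exact: measurableT_comp|exists M]. Qed.

(** A product formula known for events extends to bounded functions by [positive_linear_ext]; a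
    function without sign is first raised by the constant [|M|]. *)
Lemma factor (k : R -> R) : bounded_mfun k ->
  \int[P]_o (k (X o) * g o) = kap * \int[P']_o k (X' o).
Proof.
have bm' (h : R -> R) : bounded_mfun h -> bounded_mfun (fun o => h (X' o)).
  by move=> [mh [M hM]]; split; [exact: measurableT_comp|exists M].
have P1 : positive_linear (fun h : R -> R => \int[P]_o (h (X o) * g o)).
  split=> [h _ h0|f h bf bh _ _|c f _ bf _].
  - by apply: exp_ge0 => o; rewrite mulr_ge0.
  - rewrite -expD; [|exact: bmM (bm_comp bf) bg|exact: bmM (bm_comp bh) bg].
    by apply: eq_Rintegral => o _; rewrite mulrDl.
  - rewrite -expZ; last exact: bmM (bm_comp bf) bg.
    by apply: eq_Rintegral => o _; rewrite mulrA.
have P2 : positive_linear (fun h : R -> R => kap * \int[P']_o h (X' o)).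
  split=> [h _ h0|f h bf bh _ _|c f _ bf _].
  - by rewrite mulr_ge0//; apply: exp_ge0.
  - by rewrite expD ?mulrDr//; exact: bm'.
  - by rewrite (expZ P' c (bm' _ bf)) mulrCA.
have pos h : bounded_mfun h -> (forall y, 0 <= h y) ->
    \int[P]_o (h (X o) * g o) = kap * \int[P']_o h (X' o).
  by move=> bh h0; apply: (positive_linear_ext P1 P2).
move=> bk; have [mk [M kM]] := bk.
have b1 : bounded_mfun (fun _ : R => `|M| : R) by exact: bm_cst.
have b2 : bounded_mfun (fun y => k y + `|M|) by exact: bmD.
have := pos _ b2; rewrite (expD P' (bm' _ bk) (bm' _ b1)).
have -> : \int[P]_o ((k (X o) + `|M|) * g o) = \int[P]_o (k (X o) * g o) + \int[P]_o (`|M| * g o).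
  rewrite -expD; [|exact: bmM (bm_comp bk) bg|exact: bmZ].
  by apply: eq_Rintegral => o _; rewrite mulrDl.
have := pos _ b1; move=> -> //; rewrite mulrDr => E; apply: (addIr (kap * \int[P']_o `|M|)); apply: E.
move=> y; rewrite -lerBlDr sub0r; have := kM y; rewrite ler_norml => /andP[h _].
by rewrite (le_trans _ h)// lerN2 ler_norm.
Qed.

End Factor.

Section GaussianIncrements.
Context {R : realType} {d : nat} {C : set 'rV[int]_d}.
Local Notation conf := (configuration R C).
Context {dT : measure_display} {T : measurableType dT} (P : probability T R).
Variables (F : R -> set (set T)) (B : R -> T -> C -> R).
Hypothesis hF : filtration F.
Hypothesis hB : brownian_family P F B.
Variables (s t : R).
Hypotheses (s0 : 0 <= s) (st : s < t).

Let t0 : 0 <= t. Proof. exact: le_trans s0 (ltW st). Qed.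
Let sig : R := Num.sqrt (t - s).
Let sig0 : 0 < sig. Proof. by rewrite sqrtr_gt0 subr_gt0. Qed.
Let Del (x : C) (o : T) : R := B t o x - B s o x.

Lemma adapted_brownian r x : 0 <= r -> adapted_at F r (fun o => B r o x).
Proof. by have [h _ _ _] := hB; move=> r0 Y mY; exact: h. Qed.

Let mDel x : measurable_fun setT (Del x).
Proof.
by apply: measurable_funB; apply: (adapted_at_measurable hF) (adapted_brownian _ _).
Qed.

Definition lin (l : seq (C * R)) (o : T) : R := \sum_(p <- l) p.2 * Del p.1 o.

Lemma measurable_lin l : measurable_fun setT (lin l).
Proof. by apply: measurable_sum => p; apply: measurable_funM. Qed.

Let event (A : set T) (J : {fset C}) (Y : C -> set R) : set T :=
  A `&` [set o | forall x, x \in J -> Y x (Del x o)].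

Let weight (A : set T) (J : {fset C}) (Y : C -> set R) : R :=
  fine (P A) * \prod_(x <- J) fine (normal_prob 0 sig (Y x)).

Let measurable_event A J Y : F s A -> (forall x, measurable (Y x)) -> measurable (event A J Y).
Proof.
have [_ sF _] := hF; move=> FA mY; apply: measurableI; first exact: sF FA.
have -> : [set o | forall x, x \in J -> Y x (Del x o)] = \bigcap_(x in [set` J]) (Del x @^-1` Y x).
  by apply/seteqP; split => o h x /= xJ; exact: h.
apply: fin_bigcap_measurable; first exact: finite_fset.
by move=> x _; rewrite -[X in measurable X]setTI; exact: mDel.
Qed.

Let weightE A J Y : F s A -> (forall x, measurable (Y x)) -> \int[P]_o \1_(event A J Y) o = weight A J Y.
Proof.
have [_ _ _ indep] := hB; move=> FA mY; rewrite exp_indic; last exact: measurable_event.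
have -> : P (event A J Y) = (P A * \prod_(x <- J) normal_prob 0 sig (Y x))%E.
  exact: indep.
have -> : (\prod_(x <- J) normal_prob 0 sig (Y x) = (\prod_(x <- J) fine (normal_prob 0 sig (Y x)))%:E)%E.
  rewrite -prodEFin; apply: eq_bigr => x _; rewrite fineK//.
  by apply: fin_num_measure; exact: mY.
have [_ sF _] := hF.
by rewrite fineM ?fin_num_measure//; exact: sF FA.
Qed.

Let weight_ge0 A J Y : 0 <= weight A J Y.
Proof. by rewrite /weight mulr_ge0 ?fine_ge0// prodr_ge0// => x _; rewrite fine_ge0. Qed.

Definition damp (l : seq (C * R)) : R := expR (- ((t - s) / 2 * \sum_(p <- l) p.2 ^+ 2)).

Lemma damp_le1 l : damp l <= 1.
Proof.
rewrite /damp -expR0 ler_expR oppr_le0 mulr_ge0//; first by rewrite divr_ge0// subr_ge0 ltW.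
by apply: sumr_ge0 => p _; exact: sqr_ge0.
Qed.

Lemma damp_ge0 l : 0 <= damp l.
Proof. exact: expR_ge0. Qed.

Lemma one_cos_damp_ge0 (c : R) l : 0 <= 1 + cos c * damp l.
Proof.
rewrite -lerBlDl sub0r; have := damp_le1 l; have := damp_ge0 l.
have : `|cos c * damp l| <= 1.
  have h : `|cos c| <= 1 by rewrite ler_norml cos_geN1 cos_le1.
  by rewrite normrM (ger0_norm (damp_ge0 l)) mulr_ile1 ?damp_ge0 ?damp_le1.
by rewrite ler_norml => /andP[].
Qed.

Lemma cos_shift_pihalf (c : R) : cos (c - pi / 2) = sin c.
Proof. by rewrite cosB cos_pihalf sin_pihalf mulr0 mulr1 add0r. Qed.

Lemma normal_cos (be : R) : \int[normal_prob 0 sig]_y cos (be * y) = expR (- ((t - s) / 2 * be ^+ 2)).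
Proof.
have := normal_prob_cos 0 0 be sig0; rewrite cos0 mul1r sqr_sqrtr ?subr_ge0 ?ltW// => h.
transitivity (expR (- ((t - s) * be ^+ 2 / 2))); last by congr (expR (- _)); field.
by rewrite -h; apply: eq_Rintegral => y _; rewrite add0r subr0.
Qed.

Lemma normal_sin (be : R) : \int[normal_prob 0 sig]_y sin (be * y) = 0.
Proof.
have := normal_prob_cos 0 (- (pi / 2)) be sig0; rewrite cosN cos_pihalf mul0r => h.
transitivity (\int[normal_prob 0 sig]_y cos (- (pi / 2) + be * (y - 0))); last exact: h.
by apply: eq_Rintegral => y _; rewrite subr0 addrC cos_shift_pihalf.
Qed.

Let bm_cosR (be : R) : bounded_mfun (fun y : R => cos (be * y)).
Proof. by apply: bm_cos; apply: measurable_funM. Qed.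

Let bm_sinR (be : R) : bounded_mfun (fun y : R => sin (be * y)).
Proof.
split; last by exists 1 => y; rewrite ler_norml sin_geN1 sin_le1.
apply: (measurableT_comp (continuous_measurable_fun (@continuous_sin R))).
exact: measurable_funM.
Qed.

(** Independence is given for events only. The induction moves the sites of [l] one at a time into
    the index set [J] of the event, and each site moved contributes one Gaussian factor. *)
Lemma gaussian_block (l : seq (C * R)) A (J : {fset C}) (Y : C -> set R) al : uniq [seq p.1 | p <- l] ->
  (forall p, p \in l -> p.1 \notin J) -> F s A -> (forall x, measurable (Y x)) ->
  \int[P]_o (\1_(event A J Y) o * cos (al + lin l o)) = weight A J Y * (cos al * damp l).
Proof.
elim: l J Y al => [|[x be] l IH] J Y al ul lJ FA mY.
  rewrite /damp big_nil mulr0 oppr0 expR0 mulr1 -(weightE J FA mY).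
  transitivity (\int[P]_o (cos al * \1_(event A J Y) o)).
    by apply: eq_Rintegral => o _; rewrite /lin big_nil addr0 mulrC.
  by rewrite (expZ P (cos al) (bm_indic (measurable_event _ FA mY))) mulrC.
have /andP[xl ul'] : (x \notin [seq p.1 | p <- l]) && uniq [seq p.1 | p <- l] := ul.
have xJ : x \notin J by exact: (lJ (x, be) (mem_head _ _)).
pose E := event A J Y.
have mE : measurable E by exact: measurable_event.
have bE : bounded_mfun (\1_E : T -> R) by exact: bm_indic.
have bl c : bounded_mfun (fun o => cos (c + lin l o)).
  by apply: bm_cos; apply: measurable_funD => //; exact: measurable_lin.
have lJ' p : p \in l -> p.1 \notin (x |` J)%fset.
  move=> pl; rewrite !inE negb_or lJ ?inE ?pl ?orbT// andbT.
  by apply: contraNN xl => /eqP<-; exact: map_f.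
have IHc c : \int[P]_o (\1_E o * cos (c + lin l o)) = weight A J Y * (cos c * damp l).
  by apply: IH => // p pl; apply: lJ; rewrite inE pl orbT.
(* For an indicator [k] this is the induction hypothesis on the event enlarged by [x]. As [factor]
   asks for a nonnegative weight, it is used with 1 and with [1 + cos], and the results are
   subtracted. *)
have K c (k : R -> R) : bounded_mfun k ->
    \int[P]_o (k (Del x o) * (\1_E o * cos (c + lin l o))) =
    weight A J Y * (cos c * damp l) * \int[normal_prob 0 sig]_y k y.
  move=> bk.
  have ev (Y0 : set R) : measurable Y0 -> exists Y', [/\ forall z, measurable (Y' z),
      (forall o, \1_Y0 (Del x o) * \1_E o = \1_(event A (x |` J)%fset Y') o :> R) &
      weight A (x |` J)%fset Y' = weight A J Y * fine (normal_prob 0 sig Y0)].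
    move=> mY0; exists (fun z => if z == x then Y0 else Y z); split.
    - by move=> z; case: ifP.
    - move=> o; rewrite !indicE -natrM mulnb; congr (_%:R); congr nat_of_bool.
      apply/andP/idP.
        move=> []; rewrite !inE => h1 [h2 h3].
        split => // z; rewrite !inE => /orP[/eqP->|zJ]; first by rewrite eqxx.
        by rewrite ifN; [exact: h3|apply: contraNneq xJ => <-].
      rewrite !inE => -[h2 h3]; split; first by have := h3 x; rewrite !inE eqxx => /(_ isT).
      split => // z zJ; have := h3 z; rewrite !inE zJ orbT => /(_ isT).
      by rewrite ifN//; apply: contraNneq xJ => <-.
    - rewrite /weight big_fsetU1//= eqxx -mulrA [X in _ * X]mulrC; congr (_ * (_ * _)).
      rewrite big_seq [RHS]big_seq; apply: eq_bigr => z zJ.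
      by rewrite ifN//; apply: contraNneq xJ => <-.
  have f1 : \int[P]_o (k (Del x o) * \1_E o) = weight A J Y * \int[normal_prob 0 sig]_y k y.
    apply: (@factor _ _ _ _ _ P (normal_prob 0 sig) (Del x) _ id) => //.
    move=> Y0 mY0; have [Y' [mY' e1 e2]] := ev Y0 mY0.
    rewrite exp_indic// -e2 -weightE//; apply: eq_Rintegral => o _; exact: e1.
  have f2 : \int[P]_o (k (Del x o) * (\1_E o * (1 + cos (c + lin l o)))) =
      weight A J Y * (1 + cos c * damp l) * \int[normal_prob 0 sig]_y k y.
    have b2 : bounded_mfun (fun o => \1_E o * (1 + cos (c + lin l o)) : R).
      by apply: bmM => //; apply: bmD => //; exact: bm_cst.
    have p2 o : 0 <= \1_E o * (1 + cos (c + lin l o)) :> R.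
      by rewrite mulr_ge0// -lerBlDl sub0r cos_geN1.
    have p3 : 0 <= weight A J Y * (1 + cos c * damp l) by rewrite mulr_ge0// one_cos_damp_ge0.
    apply: (@factor _ _ _ _ _ P (normal_prob 0 sig) (Del x) _ id _ _ _ b2 p2 p3) => //.
    move=> Y0 mY0; have [Y' [mY' e1 e2]] := ev Y0 mY0.
    rewrite exp_indic//.
    transitivity (\int[P]_o (\1_(event A (x |` J)%fset Y') o + \1_(event A (x |` J)%fset Y') o * cos (c + lin l o))).
      by apply: eq_Rintegral => o _; rewrite -e1; ring.
    have bE' : bounded_mfun (\1_(event A (x |` J)%fset Y') : T -> R).
      by apply: bm_indic; exact: measurable_event.
    rewrite (expD P bE' (bmM bE' (bl c))) weightE// IH// e2.
    by rewrite -mulrA; move: (weight _ _ _) (fine _) => a b; ring.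
  have bkD : bounded_mfun (fun o => k (Del x o)) by exact: bm_comp.
  have : \int[P]_o (k (Del x o) * (\1_E o * (1 + cos (c + lin l o)))) =
     \int[P]_o (k (Del x o) * \1_E o) + \int[P]_o (k (Del x o) * (\1_E o * cos (c + lin l o))).
    rewrite -expD; [|exact: bmM|by apply: bmM => //; exact: bmM].
    by apply: eq_Rintegral => o _; ring.
  rewrite f1 f2 => E1; apply: (addrI (weight A J Y * \int[normal_prob 0 sig]_y k y)).
  by rewrite -E1; ring.
have -> : \int[P]_o (\1_E o * cos (al + lin ((x, be) :: l) o)) =
   \int[P]_o (cos (be * Del x o) * (\1_E o * cos (al + lin l o))) -
   \int[P]_o (sin (be * Del x o) * (\1_E o * cos (al - pi / 2 + lin l o))).
  rewrite -expB.
  - apply: eq_Rintegral => o _; rewrite /lin big_cons /= -/(lin l o).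
    have -> : al - pi / 2 + lin l o = (al + lin l o) - pi / 2 by rewrite addrAC.
    move: (lin l o) (be * Del x o) (\1_E o) => L D E1.
    have -> : al + (D + L) = D + (al + L) by ring.
    by rewrite (cosD D (al + L)) cos_shift_pihalf; ring.
  - by apply: bmM; [exact: (bm_comp _ (bm_cosR be))|exact: bmM].
  - by apply: bmM; [exact: (bm_comp _ (bm_sinR be))|exact: bmM].
rewrite (K _ (fun y => cos (be * y)) (bm_cosR be)) (K _ (fun y => sin (be * y)) (bm_sinR be)).
rewrite normal_cos normal_sin mulr0 subr0 -mulrA; congr (_ * _).
rewrite -mulrA; congr (_ * _); rewrite /damp big_cons /= -expRD; congr expR; ring.
Qed.

(** The same argument with a variable of the past: events on [th] belong to [F s], so
    [gaussian_block] with an empty [J] is the case of indicators. *)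
Lemma gaussian_finite (l : seq (C * R)) (th : T -> R) : uniq [seq p.1 | p <- l] -> adapted_at F s th ->
  \int[P]_o cos (th o + lin l o) = \int[P]_o cos (th o) * damp l.
Proof.
move=> ul ath.
have mth : measurable_fun setT th by exact: (adapted_at_measurable hF s0 ath).
have bl c : bounded_mfun (fun o => cos (c + lin l o)).
  by apply: bm_cos; apply: measurable_funD => //; exact: measurable_lin.
have K c (k : R -> R) : bounded_mfun k ->
    \int[P]_o (k (th o) * cos (c + lin l o)) = cos c * damp l * \int[P]_o k (th o).
  move=> bk; have bkt : bounded_mfun (fun o => k (th o)) by exact: (bm_comp mth bk).
  have b1 : bounded_mfun (fun _ : T => 1 : R) by exact: bm_cst.
  have f : \int[P]_o (k (th o) * (1 + cos (c + lin l o))) = (1 + cos c * damp l) * \int[P]_o k (th o).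
    have b2 : bounded_mfun (fun o => 1 + cos (c + lin l o)) by exact: bmD.
    have p2 o : 0 <= 1 + cos (c + lin l o) by rewrite -lerBlDl sub0r cos_geN1.
    apply: (factor mth mth b2 p2 (one_cos_damp_ge0 _ _)) => //.
    move=> Y mY; pose A := th @^-1` Y.
    have FA : F s A by exact: ath.
    have EA : event A fset0 (fun=> setT) = A.
      by apply/seteqP; split => [y [h _]|y Ay] //; split => // x; rewrite inE.
    have WA : weight A fset0 (fun=> setT) = \int[P]_o \1_Y (th o).
      by rewrite -weightE// EA.
    have bA : bounded_mfun (fun o => \1_Y (th o) : R).
      by apply: (bm_comp mth); exact: bm_indic.
    transitivity (\int[P]_o (\1_Y (th o) + \1_Y (th o) * cos (c + lin l o))).
      by apply: eq_Rintegral => o _; ring.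
    rewrite (expD P bA (bmM bA (bl c))) mulrDl mul1r; congr (_ + _).
    have := @gaussian_block l A fset0 (fun=> setT) c ul _ FA _; rewrite EA WA => h.
    by rewrite mulrC -h.
  have : \int[P]_o (k (th o) * (1 + cos (c + lin l o))) =
      \int[P]_o k (th o) + \int[P]_o (k (th o) * cos (c + lin l o)).
    by rewrite -expD//; [apply: eq_Rintegral => o _; ring|exact: bmM].
  by rewrite f => E1; apply: (addrI (\int[P]_o k (th o))); rewrite -E1; ring.
have bs : bounded_mfun (fun y : R => sin y).
  by have := bm_sinR 1; congr bounded_mfun; apply/funext => y; rewrite mul1r.
have bc : bounded_mfun (fun y : R => cos y).
  by have := bm_cosR 1; congr bounded_mfun; apply/funext => y; rewrite mul1r.
have -> : \int[P]_o cos (th o + lin l o) = \int[P]_o (cos (th o) * cos (0 + lin l o)) -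
   \int[P]_o (sin (th o) * cos (- (pi / 2) + lin l o)).
  rewrite -expB; [|exact: bmM (bm_comp mth bc) (bl _)|exact: bmM (bm_comp mth bs) (bl _)].
  by apply: eq_Rintegral => o _; rewrite cosD add0r [- _ + _]addrC cos_shift_pihalf.
by rewrite !K// cos0 cosN cos_pihalf !mul0r subr0 mul1r mulrC.
Qed.

End GaussianIncrements.

(** * The conditional characteristic functional of a solution *)

Section SolutionLaw.
Context {R : realType} {d : nat} {C : set 'rV[int]_d}.
Local Notation conf := (configuration R C).
Context (e : nat -> C) (ix : C -> nat).
Context (nb : C -> seq C) (w : C -> C -> R) (a : C -> R) (k0 k2 : nat) (K0 K1 : R).
Hypothesis G : weighted_graph e ix nb w a k0 k2 K0 K1.

Let q x := a x ^ (- k2%:Z).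
Local Notation S := (@tsum R C e).
Local Notation lap := (lap nb w).
Local Notation heat := (heat nb w).
Local Notation slow := (slow a).
Local Notation rapid := (rapid a).
Local Notation moderate := (moderate a).
Let q0 : forall x, 0 < q x := q_gt0 G.
Let cq : cvgn (series (fun i => q (e i))) := q_cvg G.

Variable flow : (C -> R) -> R -> C -> R.
Hypothesis flowP : forall f, rapid f -> [/\ heat (flow f), slow (flow f) & flow f 0 = f].
Local Notation flow_rapid := (flow_rapid G flowP).
Local Notation noise_var := (noise_var e flow).

Context {dT : measure_display} {T : measurableType dT} (P : probability T R).
Variables (F : R -> set (set T)) (B : R -> T -> C -> R).
Hypothesis hF : filtration F.
Hypothesis hB : brownian_family P F B.
Hypothesis noise_moderate : {ae P, forall o, forall s t, 0 <= s -> s <= t ->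
  moderate (fun x => B t o x - B s o x)}.

Local Notation noise u s t := (fun o => pairing u (fun x => B t o x - B s o x)).

Lemma adapted_noise u s t : 0 <= s -> s <= t -> adapted_at F t (noise u s t).
Proof.
move=> s0 st; have t0 := le_trans s0 st.
apply: (@adapted_at_comp _ _ _ _ _ F hF t (fun o => (fun x => B t o x - B s o x) : conf) (pairing u)) => //.
  exact: (measurable_pair G).
move=> x; have -> : (fun o => B t o x - B s o x) = (fun o => B t o x + -1 * B s o x).
  by apply/funext => o; rewrite mulN1r.
apply: adapted_atD => //; first exact: (adapted_brownian hB).
by apply: adapted_atZ => //; apply: (adapted_at_le hF s0 st); exact: (adapted_brownian hB).
Qed.

(** [gaussian_finite] on the first [n] sites, then [n] to infinity; the noise pairs with [u] almost
    surely because its growth is moderate. The coefficient [sqrt 2] cancels the one half in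
    [damp]. *)
Lemma gaussian_step u s t (th : T -> R) : rapid u -> 0 <= s -> s < t -> adapted_at F s th ->
  \int[P]_o cos (th o + Num.sqrt 2 * noise u s t o) =
  \int[P]_o cos (th o) * expR (- ((t - s) * S (fun x => u x ^+ 2))).
Proof.
move=> ru s0 st ath; have st' := ltW st; have t0 := le_trans s0 st'.
pose c := Num.sqrt 2 : R.
pose l n := [seq (e i, c * u (e i)) | i <- iota 0 n].
have ul n : uniq [seq p.1 | p <- l n].
  rewrite -map_comp map_inj_uniq ?iota_uniq// => i j /= h; exact: (can_inj (eK G) h).
have mth : measurable_fun setT th by exact: (adapted_at_measurable hF s0 ath).
have mu2 : dominated q (fun x => u x ^+ 2) by apply: (rapid_mul_dom G) => //; exact: rapid_moderate.
have linE n o : lin B s t (l n) o = c * series (fun i => u (e i) * (B t o (e i) - B s o (e i))) n.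
  rewrite /lin big_map /series /= mulr_sumr /index_iota subn0.
  by apply: eq_bigr => i _; rewrite /= mulrA.
have c1 : \int[P]_o cos (th o + lin B s t (l n) o) @[n --> \oo] --> \int[P]_o cos (th o + c * noise u s t o).
  apply: (@exp_cvg _ _ _ _ _ _ 1) => [n||n o|].
  - by apply: (bm_cos _).1; apply: measurable_funD => //; exact: (measurable_lin hF hB s0 st).
  - apply: (bm_cos _).1; apply: measurable_funD => //; apply: measurable_funM => //.
    by apply: (adapted_at_measurable hF t0); exact: adapted_noise.
  - by rewrite ler_norml cos_geN1 cos_le1.
  apply: (ae_mono noise_moderate) => o mo; apply: continuous_cvg; first exact: continuous_cos.
  apply: cvgD; first exact: cvg_cst.
  have -> : (fun n => lin B s t (l n) o) = (fun n => c * series (fun i => u (e i) * (B t o (e i) - B s o (e i))) n).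
    by apply/funext => n; rewrite linE.
  apply: cvgM; first exact: cvg_cst.
  rewrite (pairingE G ru (mo s t s0 st')).
  exact: (dominated_cvg_tsum q0 cq (rapid_mul_dom G ru (mo s t s0 st'))).
have c2 : \int[P]_o cos (th o) * damp s t (l n) @[n --> \oo] -->
    \int[P]_o cos (th o) * expR (- ((t - s) * S (fun x => u x ^+ 2))).
  apply: cvgM; first exact: cvg_cst.
  apply: continuous_cvg; first exact: continuous_expR.
  apply: cvgN.
  have -> : (fun n => (t - s) / 2 * \sum_(p <- l n) p.2 ^+ 2) =
      (fun n => (t - s) * series (fun i => u (e i) ^+ 2) n).
    apply/funext => n; rewrite big_map /series /= /index_iota subn0 -mulrA; congr (_ * _).
    rewrite mulr_sumr; apply: eq_bigr => i _ /=.
    by rewrite exprMn sqr_sqrtr//; field.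
  apply: cvgM; first exact: cvg_cst.
  exact: (dominated_cvg_tsum q0 cq mu2).
refine (cvg_unique _ c1 _); first exact: norm_hausdorff.
have -> // : (fun n => \int[P]_o cos (th o + lin B s t (l n) o)) = (fun n => \int[P]_o cos (th o) * damp s t (l n)).
by apply/funext => n; exact: (gaussian_finite hF hB s0 st (ul n) ath).
Qed.

Variables (Z : R -> T -> C -> R) (nZ : int).
Hypothesis adZ : adapted F Z.
Hypothesis pathZ : {ae P, forall o,
  path_continuous a (fun t => Z t o) nZ /\ path_solution nb w (fun t => Z t o) (fun t => B t o)}.

Lemma adapted_pairing u t : 0 <= t -> adapted_at F t (fun o => pairing u (Z t o)).
Proof.
move=> t0; apply: (@adapted_at_comp _ _ _ _ _ F hF t (fun o => Z t o : conf) (pairing u)) => //.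
  exact: (measurable_pair G).
by move=> x Y mY; exact: adZ.
Qed.

(** The arbitrary adapted phase [th] makes this a Markov property. The increments of the Riemann sum
    are removed one at a time, latest first, each by [gaussian_step] with everything earlier as
    phase. *)
Lemma solution_law u s t (th : T -> R) : rapid u -> 0 <= s -> s <= t -> adapted_at F s th ->
  \int[P]_o cos (th o + pairing u (Z t o)) =
  \int[P]_o cos (th o + pairing (flow u (t - s)) (Z s o)) * expR (- noise_var (t - s) u).
Proof.
move=> ru s0; rewrite le_eqVlt => /orP[/eqP<-|st] ath.
  rewrite subrr (flow0 flowP)//.
  have -> : noise_var 0 u = 0 by rewrite /noise_var mulr0 green_form0 mulr0.
  by rewrite oppr0 expR0 mulr1.
have st' := ltW st; have t0 := le_trans s0 st'.
have ts : 0 <= t - s by rewrite subr_ge0.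
have rU := flow_rapid ru ts.
have mth : measurable_fun setT th by exact: (adapted_at_measurable hF s0 ath).
pose c := Num.sqrt 2 : R.
pose th0 o := th o + pairing (flow u (t - s)) (Z s o).
have ath0 : adapted_at F s th0 by apply: adapted_atD => //; exact: adapted_pairing.
pose tk N k := grid s t N.+1 k.
have tk0 N k : s <= tk N k by rewrite -[leLHS](grid0 s t N.+1) grid_le.
have tkt N k : (k <= N.+1)%N -> tk N k <= t by move=> kN; rewrite -[leRHS](gridN s t N) grid_le.
have tk_lt N k : tk N k < tk N k.+1 by rewrite /tk gridS ltrDl divr_gt0// subr_gt0.
have tkp N k : 0 <= tk N k := le_trans s0 (tk0 N k).
pose U N k := flow u (t - tk N k).
have rUk N k : (k <= N.+1)%N -> rapid (U N k).
  by move=> kN; apply: flow_rapid => //; rewrite subr_ge0 tkt.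
pose X N n o := th0 o + c * \sum_(k < n) noise (U N k.+1) (tk N k) (tk N k.+1) o.
have aX N n : adapted_at F (tk N n) (X N n).
  elim: n => [|n IH].
    have -> : X N 0%N = th0 by apply/funext => o; rewrite /X big_ord0 mulr0 addr0.
    exact: (adapted_at_le hF s0 (tk0 N 0%N)).
  have -> : X N n.+1 = (fun o => X N n o + c * noise (U N n.+1) (tk N n) (tk N n.+1) o).
    by apply/funext => o; rewrite /X big_ord_recr /= mulrDr addrA.
  apply: adapted_atD => //; first exact: (adapted_at_le hF (tkp N n) (ltW (tk_lt N n))).
  by apply: adapted_atZ => //; apply: adapted_noise => //; exact: ltW.
have law N n : (n <= N.+1)%N -> \int[P]_o cos (X N n o) = \int[P]_o cos (th0 o) *
    expR (- \sum_(k < n) (t - s) / N.+1%:R * S (fun x => U N k.+1 x ^+ 2)).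
  elim: n => [_|n IH nN].
    rewrite big_ord0 oppr0 expR0 mulr1; apply: eq_Rintegral => o _.
    by rewrite /X big_ord0 mulr0 addr0.
  have := gaussian_step (rUk N n.+1 nN) (tkp N n) (tk_lt N n) (aX N n).
  rewrite (IH (ltnW nN)) -mulrA -expRD => h.
  transitivity (\int[P]_o cos (X N n o + c * noise (U N n.+1) (tk N n) (tk N n.+1) o)).
    by apply: eq_Rintegral => o _; rewrite /X big_ord_recr /= mulrDr addrA.
  have dt : tk N n.+1 - tk N n = (t - s) / N.+1%:R by rewrite /tk gridS addrAC subrr add0r.
  pose g (k : nat) := (t - s) / N.+1%:R * S (fun x => U N k.+1 x ^+ 2).
  have E : \sum_(k < n.+1) g k = \sum_(k < n) g k + g n by rewrite big_ord_recr.
  by rewrite h dt -/(g n) -[in RHS]/(\sum_(k < n.+1) g k) E opprD.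
have aXt N : measurable_fun setT (X N N.+1) by exact: (adapted_at_measurable hF (tkp N N.+1)).
have aZt : measurable_fun setT (fun o => pairing u (Z t o)).
  by apply: (adapted_at_measurable hF t0); exact: adapted_pairing.
have c1 : \int[P]_o cos (X N N.+1 o) @[N --> \oo] --> \int[P]_o cos (th o + pairing u (Z t o)).
  apply: (@exp_cvg _ _ _ _ _ _ 1) => [N||N o|].
  - exact: (bm_cos (aXt N)).1.
  - by apply: (bm_cos _).1; exact: measurable_funD.
  - by rewrite ler_norml cos_geN1 cos_le1.
  apply: (ae_mono (ae_and pathZ noise_moderate)) => o [[zc zE] mo].
  apply: continuous_cvg; first exact: continuous_cos.
  have mZ r : 0 <= r -> moderate (Z r o) by move=> r0; have [[M b] _] := zc r r0; exists nZ, M.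
  have := path_limit G flowP zc zE ru s0 st'.
  rewrite (pairingE G ru (mZ t t0)) => h.
  have -> : (fun N => X N N.+1 o) = (fun N => th o +
     (S (fun x => flow u (t - s) x * Z s o x) + c * noise_sum e flow u s t N.+1 (fun r => B r o))).
    apply/funext => N; rewrite /X /th0 (pairingE G rU (mZ s s0)) addrA; congr (_ + _ + c * _).
    apply: eq_bigr => k _; rewrite (pairingE G)//; first exact: rUk.
    by apply: mo => //; exact: ltW.
  by apply: cvgD; [exact: cvg_cst|exact: h].
have c2 : \int[P]_o cos (th0 o) * expR (- \sum_(k < N.+1) (t - s) / N.+1%:R * S (fun x => U N k.+1 x ^+ 2))
    @[N --> \oo] --> \int[P]_o cos (th0 o) * expR (- noise_var (t - s) u).
  apply: cvgM; first exact: cvg_cst.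
  apply: continuous_cvg; first exact: continuous_expR.
  by apply: cvgN; exact: (noise_var_grid G flowP ru s0 st').
refine (cvg_unique _ c1 _); first exact: norm_hausdorff.
have -> // : (fun N => \int[P]_o cos (X N N.+1 o)) = (fun N => \int[P]_o cos (th0 o) *
    expR (- \sum_(k < N.+1) (t - s) / N.+1%:R * S (fun x => U N k.+1 x ^+ 2))).
by apply/funext => N; exact: law.
Qed.

End SolutionLaw.

(** * The lattice *)

Section LatticeBracket.
Context {R : realType} {d : nat}.
Implicit Types x y : 'rV[int]_d.

Let sq x : R := \sum_(i < d) (x 0 i)%:~R ^+ 2.

Lemma bracket_sqr x : bracket x ^+ 2 = 1 + sq x :> R.
Proof. by rewrite sqr_sqrtr// addr_ge0// sumr_ge0// => i _; exact: sqr_ge0. Qed.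

Lemma bracket_ge1 x : 1 <= bracket x :> R.
Proof.
rewrite -[leLHS]sqrtr1 ler_wsqrtr// lerDl; apply: sumr_ge0 => i _; exact: sqr_ge0.
Qed.

Lemma bracket_coord x i : `|x 0 i|%:~R <= bracket x :> R.
Proof.
have h : (x 0 i)%:~R ^+ 2 <= bracket x ^+ 2 :> R.
  rewrite bracket_sqr /sq (bigD1 i)//= addrCA lerDl addr_ge0// sumr_ge0// => j _; exact: sqr_ge0.
have b0 : 0 <= bracket x :> R by rewrite (le_trans ler01)// bracket_ge1.
by rewrite intr_norm -(ger0_norm b0) -[leLHS]sqrtr_sqr -[leRHS]sqrtr_sqr ler_wsqrtr.
Qed.

(** In a difference of squares each coordinate contributes [|x_i - y_i| |x_i + y_i|]. The second
    factor is at most the sum of the two brackets, and the first ones add up to 1. *)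
Lemma bracket_lip x y : neighbour x y -> `|bracket x - bracket y| <= 1 :> R.
Proof.
move=> /eqP nxy; have bx := bracket_ge1 x; have b_y := bracket_ge1 y.
have b0 : 0 < bracket x + bracket y :> R by rewrite addr_gt0// (lt_le_trans ltr01).
rewrite -(ler_pM2r b0) mul1r -{1}(ger0_norm (ltW b0)) -normrM -subr_sqr !bracket_sqr.
rewrite opprD addrACA subrr add0r -sumrB.
apply: (le_trans (ler_norm_sum _ _ _)).
have -> : bracket x + bracket y = (\sum_(i < d) `|x 0 i - y 0 i|)%:~R * (bracket x + bracket y) :> R.
  by rewrite nxy mul1r.
rewrite rmorph_sum /= mulr_suml; apply: ler_sum => i _.
rewrite subr_sqr normrM intr_norm rmorphB /=; apply: ler_wpM2l => //.
rewrite (le_trans (ler_normD _ _))// lerD// -intr_norm; exact: bracket_coord.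
Qed.

Lemma neighbour_sym x y : neighbour x y = neighbour y x.
Proof. by rewrite /neighbour; congr (_ == _); apply: eq_bigr => i _; rewrite distrC. Qed.

Lemma neighbour_irr x : neighbour x x = false.
Proof. by rewrite /neighbour big1// => i _; rewrite subrr normr0. Qed.

Lemma neighbours_finite x : finite_set [set y | neighbour x y].
Proof.
pose g (f : {ffun 'I_d -> 'I_3}) : 'rV[int]_d := \row_i (x 0 i + (f i)%:Z - 1).
apply: (@sub_finite_set _ _ (g @` setT)); last exact/finite_image/finite_finset.
move=> y /= /eqP nxy; have yi i : `|x 0 i - y 0 i| <= 1.
  have <- : \sum_(j < d) `|x 0 j - y 0 j| = 1 by [].
  by rewrite (bigD1 i)//= lerDl; apply: sumr_ge0.
exists [ffun i => inord (absz (y ord0 i - x ord0 i + 1)%R)] => //.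
apply/rowP => i; rewrite mxE ffunE inordK; have := yi i.
  by move: (x 0 i) (y 0 i) => p q h; lia.
by move: (x 0 i) (y 0 i) => p q h; lia.
Qed.

End LatticeBracket.

Lemma ler_sum_subset {R : realType} (T : eqType) (s1 s2 : seq T) (f : T -> R) :
  uniq s1 -> {subset s1 <= s2} -> (forall x, 0 <= f x) ->
  \sum_(x <- s1) f x <= \sum_(x <- s2) f x.
Proof.
move=> u1 s12 f0; elim: s1 u1 s2 s12 => [_|x s1 IH /= /andP[xs1 u1]] s2 s12.
  by rewrite big_nil sumr_ge0.
have xs2 : x \in s2 by apply: s12; exact: mem_head.
rewrite (perm_big _ (perm_to_rem xs2)) !big_cons lerD2l; apply: IH => // y ys1.
have yx : y != x by apply: contraNneq xs1 => <-.
have := s12 y; rewrite inE ys1 orbT => /(_ isT).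
by rewrite (perm_mem (perm_to_rem xs2)) inE (negbTE yx).
Qed.

Section LatticeSum.
Context {R : realType}.

Lemma inverse_square_step (n : R) : 1 <= n -> (1 + n ^+ 2)^-1 <= 2 / n - 2 / (n + 1).
Proof.
move=> n1; have n0 : 0 < n by exact: lt_le_trans n1.
have n10 : 0 < n + 1 by rewrite ltr_wpDr.
have -> : 2 / n - 2 / (n + 1) = 2 / (n * (n + 1)) by field; rewrite !gt_eqF.
rewrite -[leLHS]div1r ler_pdivrMr; last by rewrite ltr_pwDl// sqr_ge0.
by rewrite mulrAC ler_pdivlMr ?mulr_gt0//; nra.
Qed.

Lemma inverse_square_sum L : \sum_(k < L.+1) (1 + (k%:R : R) ^+ 2)^-1 <= 3.
Proof.
suff H n : \sum_(k < n.+1) (1 + (k%:R : R) ^+ 2)^-1 <= 3 - 2 / n.+1%:R.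
  by rewrite (le_trans (H L))// gerBl divr_ge0.
elim: n => [|n IH].
  by rewrite big_ord_recl big_ord0 addr0 /= expr0n addr0 invr1; lra.
rewrite big_ord_recr/= (le_trans (lerD IH (@inverse_square_step n.+1%:R _)))//; first by rewrite ler1n.
by rewrite addrA subrK natr1.
Qed.

(** [bracket x ^+ (2 * d)] dominates the product of the [1 + x_i^2], so the sum over a cube
    factorises. In one dimension it is at most 3 for each of the two signs, whence [6 ^+ d]. *)
Lemma lattice_sum d (s : seq 'rV[int]_d) : uniq s ->
  \sum_(x <- s) (bracket x ^+ (2 * d))^-1 <= (6 : R) ^+ d.
Proof.
move=> us.
pose L := (\max_(x <- s) \max_(i < d) `|x ord0 i|%N)%N.
pose pt (f : {ffun 'I_d -> bool * 'I_L.+1}) : 'rV[int]_d :=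
  \row_i (if (f i).1 then (f i).2%:Z else - (f i).2%:Z).
pose g (p : bool * 'I_L.+1) : R := (1 + (p.2%:R : R) ^+ 2)^-1.
have s_le x i : x \in s -> (`|x ord0 i|%N <= L)%N.
  move=> xs; apply: (@leq_trans (\max_(i < d) `|x ord0 i|%N)).
    exact: (leq_bigmax (F := fun i : 'I_d => `|x ord0 i|%N)).
  by rewrite /L (big_rem x)//= leq_maxl.
have sub : {subset s <= [seq pt f | f <- enum {: {ffun 'I_d -> bool * 'I_L.+1}}]}.
  move=> x xs; apply/mapP; exists [ffun i => (0 <= x ord0 i, inord `|x ord0 i|%N)]; first by rewrite mem_enum.
  apply/rowP => i; rewrite mxE ffunE/= inordK ?ltnS ?s_le//.
  case: ifP => h; first by rewrite gez0_abs.
  by rewrite ltz0_abs ?opprK// ltNge h.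
have b0 (x : 'rV[int]_d) : 0 <= (bracket x ^+ (2 * d))^-1 :> R.
  by rewrite invr_ge0 exprn_ge0// (le_trans ler01)// bracket_ge1.
have h := ler_sum_subset us sub b0; apply: (le_trans h); rewrite big_map big_enum/=.
apply: (@le_trans _ _ (\sum_(f : {ffun 'I_d -> bool * 'I_L.+1}) \prod_(i < d) g (f i))).
  apply: ler_sum => f _; rewrite prodfV lef_pV2 ?posrE; last 2 first.
  - by rewrite exprn_gt0// (lt_le_trans ltr01)// bracket_ge1.
  - by apply: prodr_gt0 => i _; rewrite ltr_pwDl// sqr_ge0.
  rewrite exprM -[X in _ <= _ ^+ X]card_ord -prodr_const; apply: ler_prod => i _.
  rewrite addr_ge0 ?sqr_ge0//= bracket_sqr lerD2l (bigD1 i)//= mxE.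
  have -> : ((if (f i).1 then (f i).2%:Z else - (f i).2%:Z)%:~R : R) ^+ 2 = (f i).2%:R ^+ 2.
    by case: ifP => _; rewrite ?rmorphN ?sqrrN// pmulrn.
  by rewrite lerDl sumr_ge0// => j _; exact: sqr_ge0.
rewrite -(bigA_distr_bigA (fun i p => g p)) prodr_const card_ord.
apply: lerXn2r; rewrite ?nnegrE//.
  by apply: sumr_ge0 => p _; rewrite invr_ge0 addr_ge0// sqr_ge0.
rewrite -(pair_big xpredT xpredT (fun b k => g (b, k)))/= big_bool/=.
by have := inverse_square_sum L; rewrite /g /=; lra.
Qed.

End LatticeSum.

(** * Connectedness, the Dirichlet problem and the Hamiltonian of the cluster *)

Section Cluster.
Context {R : realType} {d : nat} {C : set 'rV[int]_d}.
Variable w : 'rV[int]_d -> 'rV[int]_d -> R.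

Definition nbC (x : C) : seq C :=
  enum_fset (fset_set [set y : C | neighbour (val x) (val y)]).
Definition wC (x y : C) : R := w (val x) (val y).

Lemma finite_nbC (x : C) : finite_set [set y : C | neighbour (val x) (val y)].
Proof.
apply: (@finite_preimage _ _ [set z | neighbour (val x) z] (@set_val _ C)).
  by move=> y z _ _; exact: val_inj.
exact: neighbours_finite.
Qed.

Lemma mem_nbC (x y : C) : (y \in nbC x) = neighbour (val x) (val y).
Proof.
rewrite /nbC (_ : (y \in enum_fset _) = (y \in fset_set [set y : C | neighbour (val x) (val y)]))//.
rewrite in_fset_set; last exact: finite_nbC.
by apply/idP/idP; rewrite inE.
Qed.

Lemma sum_nbC (F : C -> R) (x : C) :
  \sum_(y \in [set y : C | neighbour (val x) (val y)]) F y = \sum_(y <- nbC x) F y.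
Proof. by rewrite fsbig_finite//; exact: finite_nbC. Qed.

Hypothesis hw : conductances w.
Hypothesis hC : unique_infinite_component w C.

(** Connectedness as an induction principle: a property carried along edges of positive conductance
    holds everywhere once it holds somewhere. *)
Lemma cluster_ind (Q : C -> Prop) :
  (forall x y : C, 0 < wC x y -> Q x -> Q y) -> forall x y : C, Q x -> Q y.
Proof.
move=> Qw; case: hC => -[x0 CE] _ _.
have x0C : C x0 by rewrite CE; exists [::].
pose z0 : C := exist _ x0 (mem_set x0C).
suff H p (z : C) (hz : joined w x0 (val z)) y : path (fun a b => 0 < w a b) (val z) p ->
    last (val z) p = val y -> Q z <-> Q y.
  have z0E (y : C) : Q z0 <-> Q y.
    have : C (val y) by exact: set_valP.
    rewrite {1}CE /= => -[p pp py]; apply: (H p z0) => //.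
    by exists [::].
  by move=> x y /z0E Qx; apply/z0E.
elim: p z hz => [|b p IH] z hz /=; first by move=> _ /val_inj ->.
move=> /andP[zb bp] py.
have hb : joined w x0 b.
  case: hz => p1 p1p p1z; exists (rcons p1 b); last by rewrite last_rcons.
  by rewrite rcons_path p1p p1z.
have bC : C b by rewrite CE.
have h := IH (exist _ b (mem_set bC)) hb bp py.
split=> [Qz|Qy].
  by apply/h; apply: (Qw z) => //.
apply: (Qw (exist _ b (mem_set bC))); last exact/h.
by rewrite /wC /=; case: hw => _ -> _.
Qed.

Lemma infinite_cluster : infinite_set [set: C].
Proof.
case: hC => _ iC _ fC; apply: iC.
rewrite (_ : C = val @` [set: C]); first exact: finite_image.
apply/seteqP; split=> [x xC|_ [x _ <-]]; last exact: set_valP.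
by exists (exist _ x (mem_set xC)).
Qed.

Lemma other_site (s : seq C) : exists x : C, x \notin s.
Proof.
apply: contrapT => h; apply: infinite_cluster.
apply: (@sub_finite_set _ _ [set` s]); last exact: finite_seq.
move=> x _ /=; apply/negPn/negP => xs; apply: h; by exists x.
Qed.

Lemma cluster_enum : exists (e : nat -> C) (ix : C -> nat), cancel e ix /\ cancel ix e.
Proof.
have /card_set_bijP[f] : ([set: C] #= [set: nat])%card.
  rewrite card_eq_le; apply/andP; split; first exact: countableP.
  exact/infiniteP/infinite_cluster.
by rewrite setTT_bijective => -[g fK gK]; exists g, f.
Qed.

Lemma degreeE (x : C) : degree nbC wC x = \sum_(y <- nbC x) wC x y.
Proof.
rewrite /degree /lap big_seq [RHS]big_seq; apply: eq_bigr => y.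
rewrite mem_nbC /point eqxx; case: eqP => [->|_ _]; first by rewrite neighbour_irr.
by rewrite subr0 mulr1.
Qed.

Lemma degree_gt0 (x : C) : 0 < degree nbC wC x.
Proof.
case: hw => w0 ws wn.
have [y yx] := other_site [:: x].
rewrite degreeE lt_neqAle sumr_ge0 ?andbT; last by move=> z _; exact: w0.
apply/eqP => /esym/eqP; rewrite psumr_eq0; last by move=> z _; exact: w0.
move=> /allP h.
suff : y = x by move=> yx'; rewrite yx' mem_head in yx.
apply: (@cluster_ind (fun z => z = x)) (erefl x) => z z' wz zx; subst z.
suff : wC x z' == 0 by move=> /eqP z0; rewrite z0 ltxx in wz.
have [zn|zn] := boolP (z' \in nbC x); first exact: (h _ zn).
by rewrite /wC wn// -mem_nbC.
Qed.

Lemma seq_max (T : eqType) (f : T -> R) (s : seq T) : s != [::] ->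
  exists2 m, m \in s & forall y, y \in s -> f y <= f m.
Proof.
elim: s => // x s IH _; have [->|/IH[m ms fm]] := eqVneq s [::].
  by exists x => [|y]; rewrite ?mem_head// inE => /eqP ->.
have [xm|mx] := leP (f x) (f m).
  by exists m => [|y]; rewrite inE ?ms ?orbT// => /orP[/eqP ->|/fm].
by exists x => [|y]; rewrite ?mem_head// inE => /orP[/eqP ->//|/fm ym]; exact: le_trans ym (ltW mx).
Qed.

(* A harmonic function attaining its maximum is constant on the cluster. *)
Lemma dirichlet_le0 (s : seq C) (v : C -> R) :
  (forall y, y \notin s -> v y = 0) -> (forall y, y \in s -> lap nbC wC v y = 0) ->
  forall x, v x <= 0.
Proof.
move=> v0 hv x; rewrite leNgt; apply/negP => vx.
have xs : x \in s by apply/negPn/negP => /v0 vx0; rewrite vx0 ltxx in vx.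
case: hw => w_0 ws wn.
have [|m ms vm] := @seq_max _ v s; first by apply: contraTneq xs => ->.
have vm0 : 0 < v m by rewrite (lt_le_trans vx)// vm.
have vmax y : v y <= v m.
  by have [/vm//|/v0 ->] := boolP (y \in s); exact: ltW.
have [y ys] := other_site s.
suff : y \in s /\ v y = v m by case=> ys'; rewrite ys' in ys.
apply: (@cluster_ind (fun z => z \in s /\ v z = v m) _ m) => // z z' wz [zs zm].
have z'n : z' \in nbC z.
  rewrite mem_nbC; apply/negPn/negP => h.
  by move: wz; rewrite /wC wn// ltxx.
have /eqP := hv z zs; rewrite /lap psumr_eq0; last first.
  by move=> u _; rewrite mulr_ge0 ?w_0// subr_ge0 zm.
move=> /allP/(_ _ z'n); rewrite mulf_eq0 gt_eqF//= subr_eq0 => /eqP zz'.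
have vz' : v z' = v m by rewrite -zz'.
split=> //; apply/negPn/negP => /v0 h; by rewrite -vz' h ltxx in vm0.
Qed.

Lemma dirichlet_eq0 (s : seq C) (v : C -> R) :
  (forall y, y \notin s -> v y = 0) -> (forall y, y \in s -> lap nbC wC v y = 0) ->
  forall x, v x = 0.
Proof.
move=> v0 hv x; apply/eqP; rewrite eq_le (dirichlet_le0 v0 hv)/= -oppr_le0 -mulN1r.
apply: (@dirichlet_le0 s (fun y => -1 * v y)) => y ys; first by rewrite v0 ?mulr0.
by rewrite lapZ hv ?mulr0.
Qed.

(** A square linear system: uniqueness from the maximum principle makes the matrix invertible. *)
Lemma dirichlet_solvable (s : seq C) (u : C -> R) : uniq s ->
  exists2 v, forall y, y \notin s -> v y = 0 & forall y, y \in s -> lap nbC wC v y = u y.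
Proof.
move=> us.
pose ext (r : 'rV[R]_(size s)) (y : C) : R := \sum_(j < size s) r ord0 j * point (tnth (in_tuple s) j) 1 y.
pose A : 'M[R]_(size s) := \matrix_(j, i) lap nbC wC (point (tnth (in_tuple s) j) 1) (tnth (in_tuple s) i).
have ext0 r y : y \notin s -> ext r y = 0.
  move=> ys; apply: big1 => j _; rewrite /point; case: eqP => [yj|_]; last by rewrite mulr0.
  by rewrite yj mem_tnth in ys.
have extE r i : ext r (tnth (in_tuple s) i) = r ord0 i.
  rewrite /ext (bigD1 i)//= /point eqxx mulr1 big1 ?addr0// => j ji.
  case: eqP => [/eqP|]; last by rewrite mulr0.
  by rewrite (inj_eq (elimT (tuple_uniqP (in_tuple s)) us)) eq_sym (negbTE ji).
have lap_ext r x : lap nbC wC (ext r) x = \sum_(j < size s) r ord0 j * lap nbC wC (point (tnth (in_tuple s) j) 1) x.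
  rewrite /lap (eq_bigr (fun y => \sum_(j < size s) r ord0 j *
      (wC x y * (point (tnth (in_tuple s) j) 1 x - point (tnth (in_tuple s) j) 1 y)))).
    by rewrite exchange_big; apply: eq_bigr => j _; rewrite mulr_sumr.
  by move=> y _; rewrite /ext -sumrB mulr_sumr; apply: eq_bigr => j _; ring.
have lapA r i : lap nbC wC (ext r) (tnth (in_tuple s) i) = (r *m A) ord0 i.
  by rewrite lap_ext mxE; apply: eq_bigr => j _; rewrite mxE.
have uA : A \in unitmx.
  rewrite -row_free_unit; apply: inj_row_free => r rA.
  apply/rowP => i; rewrite [RHS]mxE -extE.
  apply: (@dirichlet_eq0 s); first by move=> y; exact: ext0.
  move=> y ys; have [j ->] := tnthP _ _ (ys : y \in in_tuple s).
  by rewrite lapA rA mxE.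
exists (ext ((\row_i u (tnth (in_tuple s) i)) *m invmx A)) => y ys; first exact: ext0.
have [i ->] := tnthP _ _ (ys : y \in in_tuple s).
by rewrite lapA -mulmxA mulVmx// mulmx1 mxE.
Qed.

Definition edges (L : {fset C}) : set (C * C) :=
  [set e : C * C | neighbour (val e.1) (val e.2) /\ ((e.1 \in L) || (e.2 \in L))].

Lemma finite_edges (L : {fset C}) : finite_set (edges L).
Proof.
pose E := \bigcup_(x in [set` L]) ([set (x, y) | y in [set` nbC x]] `|` [set (y, x) | y in [set` nbC x]]).
apply: (@sub_finite_set _ _ E).
  move=> [x y] [/= xy /orP[xL|yL]].
    by exists x => //; left; exists y; rewrite //= mem_nbC.
  by exists y => //; right; exists x; rewrite //= mem_nbC neighbour_sym.
apply: bigcup_finite; first exact: finite_fset.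
by move=> x _; rewrite finite_setU; split; apply/finite_image/finite_seq.
Qed.

Lemma mem_edges (L : {fset C}) e : (e \in enum_fset (fset_set (edges L))) =
  neighbour (val e.1) (val e.2) && ((e.1 \in L) || (e.2 \in L)).
Proof.
rewrite (_ : (e \in enum_fset _) = (e \in fset_set (edges L)))// in_fset_set; last exact: finite_edges.
by apply/idP/idP; rewrite inE => /andP.
Qed.

Lemma hamiltonianE (L : {fset C}) f : hamiltonian w L f =
  4^-1 * \sum_(e <- fset_set (edges L)) wC e.1 e.2 * (f e.1 - f e.2) ^+ 2.
Proof. by rewrite /hamiltonian fsbig_finite//; exact: finite_edges. Qed.

Lemma hamiltonian_ge0 (L : {fset C}) f : 0 <= hamiltonian w L f.
Proof.
case: hw => w0 _ _; rewrite hamiltonianE mulr_ge0 ?invr_ge0//.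
by apply: sumr_ge0 => e _; rewrite mulr_ge0 ?w0// sqr_ge0.
Qed.

Lemma sum_edges_from (L : {fset C}) x (h : C -> R) : x \in L ->
  \sum_(e <- fset_set (edges L)) (if e.1 == x then h e.2 else 0) = \sum_(y <- nbC x) h y.
Proof.
move=> xL; rewrite -big_mkcond -big_filter.
rewrite -[RHS](big_map (fun y => (x, y)) xpredT (fun e => h e.2)).
apply: perm_big; apply: uniq_perm; first by rewrite filter_uniq// fset_uniq.
  by rewrite map_inj_uniq ?fset_uniq// => y z [].
move=> [y z]; rewrite mem_filter mem_edges /=.
apply/andP/mapP => [[/eqP -> /andP[xz _]]|[u un [-> ->]]]; first by exists z; rewrite ?mem_nbC.
by rewrite eqxx -mem_nbC un xL.
Qed.

Lemma sum_edges_to (L : {fset C}) x (h : C -> R) : x \in L ->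
  \sum_(e <- fset_set (edges L)) (if e.2 == x then h e.1 else 0) = \sum_(y <- nbC x) h y.
Proof.
move=> xL; rewrite -big_mkcond -big_filter.
rewrite -[RHS](big_map (fun y => (y, x)) xpredT (fun e => h e.1)).
apply: perm_big; apply: uniq_perm; first by rewrite filter_uniq// fset_uniq.
  by rewrite map_inj_uniq ?fset_uniq// => y z [].
move=> [y z]; rewrite mem_filter mem_edges /=.
apply/andP/mapP => [[/eqP -> /andP[yx _]]|[u un [-> ->]]].
  by exists y; rewrite ?mem_nbC// neighbour_sym.
by rewrite eqxx neighbour_sym -mem_nbC un xL orbT.
Qed.

(** Only the ordered edges leaving or entering [x] change. The two families contribute equally,
    which turns the 1/4 for ordered pairs into 1/2. *)
Lemma hamiltonian_shift (L : {fset C}) x f t : x \in L ->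
  hamiltonian w L (fun y => f y + point x t y) =
  hamiltonian w L f + t * lap nbC wC f x + 2^-1 * t ^+ 2 * degree nbC wC x.
Proof.
move=> xL; case: hw => w_0 ws wn; rewrite !hamiltonianE degreeE /lap.
pose h y := wC x y * (2 * t * (f x - f y) + t ^+ 2).
have -> : \sum_(e <- fset_set (edges L)) wC e.1 e.2 * (f e.1 + point x t e.1 - (f e.2 + point x t e.2)) ^+ 2 =
  \sum_(e <- fset_set (edges L)) wC e.1 e.2 * (f e.1 - f e.2) ^+ 2 +
  (\sum_(e <- fset_set (edges L)) (if e.1 == x then h e.2 else 0) +
   \sum_(e <- fset_set (edges L)) (if e.2 == x then h e.1 else 0)).
  rewrite -!big_split /= big_seq [RHS]big_seq; apply: eq_bigr => -[y z].
  rewrite mem_edges /= => /andP[yz _]; rewrite /point.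
  case: eqP => [yx|_]; case: eqP => [zx|_].
  - by rewrite yx zx neighbour_irr in yz.
  - by rewrite yx /h; ring.
  - by rewrite zx /h /wC (ws _ (val x)); ring.
  - by ring.
rewrite sum_edges_from// sum_edges_to// /h.
have -> : \sum_(y <- nbC x) wC x y * (2 * t * (f x - f y) + t ^+ 2) =
  2 * t * (\sum_(y <- nbC x) wC x y * (f x - f y)) + t ^+ 2 * \sum_(y <- nbC x) wC x y.
  by rewrite !mulr_sumr -big_split; apply: eq_bigr => y _ /=; ring.
by field.
Qed.

Lemma measurable_hamiltonian (L : {fset C}) :
  measurable_fun [set: configuration R C] (hamiltonian w L).
Proof.
rewrite (_ : hamiltonian w L = fun f => 4^-1 * \sum_(e <- fset_set (edges L)) wC e.1 e.2 * (f e.1 - f e.2) ^+ 2).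
  apply: measurable_funM => //; apply: measurable_sum => e.
  apply: measurable_funM => //; apply: measurable_funX; apply: measurable_funB; exact: measurable_coord.
by apply/funext => f; rewrite hamiltonianE.
Qed.

End Cluster.

(** * The cluster as a weighted graph *)

Section LatticeGraph.
Context {R : realType} {d : nat} {C : set 'rV[int]_d}.
Variable w : 'rV[int]_d -> 'rV[int]_d -> R.
Hypothesis hw : conductances w.
Hypothesis hC : unique_infinite_component w C.
Local Notation nb := (@nbC d C).
Local Notation wC := (@wC R d C w).

(* The weight is the root of order [n + 1] of [bracket], with [n + 1 >= 2 / eps], so that the growth bound turns into integer powers of it. *)
Definition aC (n : nat) (x : C) : R := bracket (val x) `^ (n.+1%:R^-1).

Lemma aC_pow n x : aC n x ^+ n.+1 = bracket (val x).
Proof.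
have b0 : 0 <= bracket (val x) :> R by rewrite (le_trans ler01)// bracket_ge1.
by rewrite -powR_mulrn ?powR_ge0// -powRrM mulVf ?pnatr_eq0// powRr1.
Qed.

Lemma aC_ge1 n x : 1 <= aC n x.
Proof.
by rewrite -(powRr0 (bracket (val x))) ler_powR ?invr_ge0// bracket_ge1.
Qed.

Lemma aC_powR n x (r : R) : bracket (val x) `^ r = aC n x `^ (n.+1%:R * r).
Proof. by rewrite -powRrM mulrA mulVf ?mul1r ?pnatr_eq0. Qed.

(** [bracket] is Lipschitz and equals [a^(n+1)]; in the factorisation of the difference of powers,
    the term [a x ^+ n] alone gives the bound. *)
Lemma aC_lip n (x y : C) : neighbour (val x) (val y) -> `|aC n x - aC n y| * aC n x ^+ n <= 1.
Proof.
move=> xy; have := bracket_lip xy (R := R).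
rewrite -!(aC_pow n) subrXX normrM => h; apply: le_trans h.
have a0 z : 0 <= aC n z by rewrite (le_trans ler01)// aC_ge1.
apply: ler_wpM2l => //; apply: le_trans (ler_norm _).
rewrite big_ord_recl /= subn0 expr0 mulr1 lerDl; apply: sumr_ge0 => i _.
by rewrite mulr_ge0// exprn_ge0.
Qed.

Lemma total_conductance_nb (x : C) : \sum_(y <- nb x) wC x y <= total_conductance w (val x).
Proof.
case: hw => w0 _ _.
rewrite /total_conductance fsbig_finite; last exact: neighbours_finite.
rewrite -(big_map val xpredT (w (val x))); apply: ler_sum_subset => //.
  by rewrite map_inj_uniq ?fset_uniq//; exact: val_inj.
move=> z /mapP[y]; rewrite mem_nbC => xy ->.
rewrite (_ : (_ \in enum_fset _) = (val y \in fset_set [set y : 'rV[int]_d | neighbour (val x) y]))//.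
by rewrite in_fset_set ?inE//; exact: neighbours_finite.
Qed.

Lemma growth_nb (eps : R) : 0 < eps -> growth_bound w eps ->
  exists n K, 0 <= K /\ forall x : C, \sum_(y <- nb x) wC x y <= K * aC n x ^+ (2 * n).
Proof.
move=> eps0 [K hK]; exists (Num.bound (2 / eps)), (Num.max K 0).
set n := Num.bound _; split=> [|x]; first by rewrite le_max lexx orbT.
have b1 : 1 <= bracket (val x) :> R by exact: bracket_ge1.
have b0 : 0 < bracket (val x) :> R by exact: lt_le_trans b1.
apply: le_trans (total_conductance_nb x) _.
have : bracket (val x) `^ (- 2 + eps) * total_conductance w (val x) <= K by apply: hK; exists (val x).
rewrite mulrC -ler_pdivlMr ?powR_gt0// -powRN => h; apply: (le_trans h).
apply: (@le_trans _ _ (Num.max K 0 * bracket (val x) `^ (- (- 2 + eps)))).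
  by apply: ler_wpM2r; rewrite ?powR_ge0// le_max lexx.
apply: ler_wpM2l; first by rewrite le_max lexx orbT.
rewrite -powR_mulrn ?powR_ge0// (aC_powR n) ler_powR ?aC_ge1//.
(* With [n > 2 / eps] one has [(n + 1)(2 - eps) <= 2n], so the growth of the conductances is at most
   [a^(2n)]. *)
have h1 : 2 / eps < n%:R by exact: archi_boundP (ltW (divr_gt0 _ eps0)).
rewrite ltr_pdivrMr// in h1.
by rewrite natrM -natr1; nra.
Qed.

Lemma lattice_graph : (exists2 eps : R, 0 < eps & growth_bound w eps) ->
  exists n (e : nat -> C) ix K,
    weighted_graph e ix nb wC (aC n) (2 * n) (2 * d * n.+1) K K.
Proof.
move=> [eps eps0 /(growth_nb eps0)[n [K [K0 hK]]]].
have [e [ix [eK ixK]]] := cluster_enum hC.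
have [w0 ws wn] := hw.
have a1 := aC_ge1 n; have a0 x : 0 < aC n x by exact: lt_le_trans (a1 x).
have nbs x y : (y \in nb x) = (x \in nb y) by rewrite !mem_nbC neighbour_sym.
exists n, e, ix, K; split=> //.
- by move=> x; exact: fset_uniq.
- by move=> x y; exact: w0.
- by move=> x y; exact: ws.
- by move=> x y; rewrite mem_nbC => /wn.
- move=> x y; rewrite mem_nbC => /(aC_lip n); have := a1 x.
  have : 1 <= aC n x ^+ n by exact: exprn_ege1.
  move: (aC n x) (aC n y) (aC n x ^+ n) => p q r r1 p1 h.
  have : `|p - q| <= 1 by apply: le_trans h; rewrite ler_peMr.
  by rewrite ler_norml => /andP[]; lra.
(* The carre du champ bound: the squared gradient [a^(-2n)] of [aC_lip] cancels exactly the growth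
   [a^(2n)] of the conductances. *)
- move=> x; have an : 0 < aC n x ^+ (2 * n) by exact: exprn_gt0.
  apply: (@le_trans _ _ (\sum_(y <- nb x) wC x y * (aC n x ^+ (2 * n))^-1)).
    rewrite big_seq [leRHS]big_seq; apply: ler_sum => y; rewrite mem_nbC => /(aC_lip n) h.
    apply: ler_wpM2l; first exact: w0.
    rewrite -[leRHS]div1r ler_pdivlMr// mulnC exprM -exprMn -[leLHS]ger0_norm ?sqr_ge0//.
    by rewrite normrX normrM (ger0_norm (exprn_ge0 n (ltW (a0 x)))) exprn_ile1// mulr_ge0// exprn_ge0// ltW.
  by rewrite -mulr_suml ler_pdivrMr.
- apply: nondecreasing_is_cvgn.
    apply/nondecreasing_seqP => k; rewrite seriesSr lerDl exprz_ge0// ltW//.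
  exists (6 ^+ d) => _ [k _ <-]; rewrite /series /=.
  rewrite (eq_bigr (fun i => (bracket (val (e i)) ^+ (2 * d))^-1 : R)); last first.
    by move=> i _; rewrite -(aC_pow n) -exprM -exprnN mulnC.
  rewrite -(big_map (fun i => val (e i)) xpredT (fun x => (bracket x ^+ (2 * d))^-1 : R)).
  apply: lattice_sum; rewrite map_inj_uniq ?iota_uniq// => i j /val_inj.
  exact: (can_inj eK).
Qed.

Variables (n : nat) (e : nat -> C) (ix : C -> nat) (k2 : nat) (K : R).
Hypothesis G : weighted_graph e ix nb wC (aC n) (2 * n) k2 K K.
Local Notation bnd := (bnd (aC n)).
Let q x := aC n x ^ (- k2%:Z).
Let q0 : forall x, 0 < q x := q_gt0 G.
Let cq : cvgn (series (fun i => q (e i))) := q_cvg G.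

Lemma weighted_norm2_bnd (s : R) f : (weighted_norm2 s f < +oo)%E ->
  forall z : int, - (n.+1%:R * s) <= z%:~R -> bnd (Num.sqrt (fine (weighted_norm2 s f))) z f.
Proof.
move=> fs z sz x.
have b0 : 0 < bracket (val x) :> R by exact: lt_le_trans ltr01 (bracket_ge1 _).
have h y : (0 <= (bracket (val y) `^ (2 * s) * f y ^+ 2)%:E :> \bar R)%E.
  by rewrite lee_fin mulr_ge0 ?powR_ge0 ?sqr_ge0.
have : ((bracket (val x) `^ (2 * s) * f x ^+ 2)%:E <= weighted_norm2 s f)%E.
  by apply: esum_ge; exists [set x]; rewrite ?fsbig_set1//; split=> //; exact: finite_set1.
have ff : weighted_norm2 s f \is a fin_num.
  by rewrite ge0_fin_numE//; apply: esum_ge0.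
rewrite -{1}(fineK ff) lee_fin => h1.
have az : 0 < aC n x ^ z by exact: (az_gt0 G).
rewrite -(@ger0_norm _ (Num.sqrt _ * _)); last by rewrite mulr_ge0 ?sqrtr_ge0// ltW.
rewrite -ler_sqr ?nnegrE// !real_normK ?num_real// exprMn sqr_sqrtr ?fine_ge0 ?esum_ge0//.
rewrite mulrC in h1; rewrite -ler_pdivlMr ?powR_gt0// in h1; apply: (le_trans h1).
apply: ler_wpM2l; first by rewrite fine_ge0// esum_ge0.
rewrite -powRN (aC_powR n) -powR_intmul; last exact: ltW (a_gt0 G x).
rewrite -[leRHS]powR_mulrn; last exact: powR_ge0.
rewrite -(powRrM (aC n x)).
apply: ler_powR.
  exact: aC_ge1.
by lra.
Qed.

(** Passing from a pointwise bound to a square sum costs a fixed number of powers of the weight.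
    This is harmless for [rapidP] and [moderateP], which range over all orders. *)
Lemma bnd_weighted_norm2 M (z : int) f (s : R) : bnd M z f ->
  n.+1%:R * (2 * s) + 2 * z%:~R <= - k2%:R -> (weighted_norm2 s f < +oo)%E.
Proof.
move=> fb sz; rewrite /weighted_norm2 (esum_tsum (eK G) (ixK G) q0 cq) ?ltry//; last first.
  by move=> x; rewrite mulr_ge0 ?powR_ge0 ?sqr_ge0.
exists (M ^+ 2) => x; have M0 := bnd_ge0 G fb.
rewrite ger0_norm; last by apply: mulr_ge0; [exact: powR_ge0|exact: sqr_ge0].
have az : 0 < aC n x ^ z by exact: (az_gt0 G).
apply: (@le_trans _ _ (bracket (val x) `^ (2 * s) * (M * aC n x ^ z) ^+ 2)).
  apply: ler_wpM2l; first exact: powR_ge0.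
  by rewrite -(real_normK (num_real (f x))); apply: lerXn2r; rewrite ?nnegrE// mulr_ge0// ltW.
rewrite exprMn mulrCA; apply: ler_wpM2l; first exact: sqr_ge0.
have a0 := ltW (a_gt0 G x).
rewrite /q -!powR_intmul// -[X in _ * X]powR_mulrn ?powR_ge0// -(powRrM (aC n x)) (aC_powR n).
rewrite -powRD; last by apply/implyP => _; rewrite gt_eqF// (a_gt0 G).
by rewrite ler_powR ?aC_ge1// rmorphN /=; move: sz; rewrite -pmulrn; lra.
Qed.

Lemma rapidP u : rapid (aC n) u <-> rapidly_decreasing u.
Proof.
split=> [ru N N0|ru z].
  pose k := (Num.bound (n.+1%:R * N) + k2)%N.
  have [M uM] := ru (- k%:Z).
  apply: (bnd_weighted_norm2 uM).
  have h : n.+1%:R * N < (Num.bound (n.+1%:R * N))%:R by apply: archi_boundP; rewrite mulr_ge0.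
  have k20 : 0 <= k2%:R :> R by [].
  by rewrite rmorphN /= -pmulrn /k natrD; lra.
have uN : (weighted_norm2 `|z|%:R u < +oo)%E by apply: ru; rewrite /= ler0n.
exists (Num.sqrt (fine (weighted_norm2 `|z|%:R u))); apply: (weighted_norm2_bnd uN).
rewrite -natrM pmulrn -rmorphN ler_int; lia.
Qed.

Lemma moderateP f : moderate (aC n) f <-> tempered f.
Proof.
split=> [[z [M fM]]|[N /= N0 fN]].
  exists (`|z|%N + k2)%:R; first by rewrite /= ler0n.
  apply: (bnd_weighted_norm2 fM).
  have h : n.+1%:R * (`|z|%N + k2)%:R >= z%:~R + k2%:R :> R.
    by rewrite -!natrM !pmulrn -rmorphD ler_int; lia.
  have k20 : 0 <= k2%:R :> R by [].
  by rewrite mulrN mulrN; lra.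
exists (Num.bound (n.+1%:R * N)), (Num.sqrt (fine (weighted_norm2 (- N) f))).
apply: (weighted_norm2_bnd fN); rewrite mulrN opprK -pmulrn ltW//.
by apply: archi_boundP; rewrite mulr_ge0.
Qed.

Lemma temperedE : tempered = \bigcup_N (box (aC n) N).
Proof.
apply/seteqP; split=> f.
  by move=> /moderateP/(moderate_box G)[N h]; exists N => //; exact: h.
by move=> [N _ /box_moderate /moderateP].
Qed.

Lemma measurable_tempered : measurable (@tempered R d C).
Proof. by rewrite temperedE; apply: bigcupT_measurable => N; exact: (measurable_box G). Qed.

Lemma sde_path dT (T : measurableType dT) (P : probability T R) F (B : R -> T -> C -> R) f0 Z :
  sde_solution w P F B f0 Z -> exists nZ, {ae P, forall o,
    path_continuous (aC n) (Z^~ o) nZ /\ path_solution nb wC (Z^~ o) (B^~ o)}.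
Proof.
move=> [_ _ [N N0 hN] hZ].
pose nZ := (Num.bound (n.+1%:R * N))%:Z; exists nZ.
have nzN : - (n.+1%:R * - N) <= nZ%:~R.
  by rewrite mulrN opprK -pmulrn ltW//; apply: archi_boundP; rewrite mulr_ge0.
apply: (ae_mono hZ) => o ho; split.
  move=> t t0; have [Zt Zc] := hN o t t0; split.
    by exists (Num.sqrt (fine (weighted_norm2 (- N) (Z t o)))); exact: weighted_norm2_bnd.
  move=> eps eps0.
  have /fine_cvgP[ff /cvgrPdist_le fc] := Zc.
  have e2 : 0 < eps ^+ 2 by exact: exprn_gt0.
  have [r /= r0 hr] := (nbhs_ballP _ _).1 (filterI ff (fc _ e2)).
  exists r => // s s0 ts; rewrite (_ : (fun x => _) = fun x => - (Z s o x - Z t o x)); last by apply/funext => x; rewrite opprB.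
  have [] := hr s ts; first by rewrite /= in_itv /= s0.
  move=> sf; rewrite sub0r normrN => se.
  apply: bndN; apply: (bnd_le G _ (lexx nZ)); last first.
    apply: (@weighted_norm2_bnd (- N)) => //; by rewrite ltey_eq sf.
  rewrite -(ger0_norm (ltW eps0)) -sqrtr_sqr ler_wsqrtr// (le_trans _ se)//.
  exact: ler_norm.
move=> t x t0; rewrite (ho t x t0); congr (_ + _ + _).
apply: eq_Rintegral => s _; rewrite sum_nbC /lap -sumrN; apply: eq_bigr => y _.
by rewrite -mulrN opprB.
Unshelve. all: by end_near. Qed.

End LatticeGraph.

Lemma ae_exists {dT} {T : measurableType dT} {R : realType} (P : probability T R) (Q : T -> Prop) :
  {ae P, forall o, Q o} -> exists o, Q o.
Proof.
move=> [A [mA PA QA]]; apply: contrapT => nQ.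
have AT : A = setT.
  by apply/seteqP; split=> // o _; apply: QA => Qo; apply: nQ; exists o.
by move: PA; rewrite AT probability_setT => /eqP; rewrite onee_eq0.
Qed.

Lemma complex_eq {R : realType} (x y x' y' : R) :
  (x +i* y)%C = (x' +i* y')%C -> x = x' /\ y = y'.
Proof. by move=> [-> ->]. Qed.

Section PathDifference.
Context {R : realType} {I : choiceType} (e : nat -> I) (ix : I -> nat).
Context (nb : I -> seq I) (w : I -> I -> R) (a : I -> R) (k0 k2 : nat) (K0 K1 : R).
Hypothesis G : weighted_graph e ix nb w a k0 k2 K0 K1.
Variables (z z' b : R -> I -> R) (n n' : int).
Hypotheses (zc : path_continuous a z n) (zE : path_solution nb w z b).
Hypotheses (zc' : path_continuous a z' n') (zE' : path_solution nb w z' b).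

Lemma path_difference :
  heat nb w (fun t x => z t x - z' t x) /\ slow a (fun t x => z t x - z' t x).
Proof.
split; first split.
- move=> r r0 x.
  have d1 : is_derive r (1 : R) (primitive (fun s => - lap nb w (z s) x)) (- lap nb w (z r) x).
    by apply: primitive_derive => // T; exact: (drift_continuous G zc).
  have d2 : is_derive r (1 : R) (primitive (fun s => - lap nb w (z' s) x)) (- lap nb w (z' r) x).
    by apply: primitive_derive => // T; exact: (drift_continuous G zc').
  have -> : - lap nb w (fun x => z r x - z' r x) x = - lap nb w (z r) x - (- lap nb w (z' r) x).
    by rewrite lapB opprB opprK addrC.
  pose k s := (z 0 x - z' 0 x) +
    (primitive (fun s => - lap nb w (z s) x) s - primitive (fun s => - lap nb w (z' s) x) s).
  apply: (@near_eq_is_derive _ _ _ k) => //.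
    near=> s; have s0 : 0 <= s by apply: ltW; near: s; exact: lt_nbhsr.
    by rewrite /k (zE x s0) (zE' x s0); ring.
  by rewrite /k -[X in is_derive _ _ _ X]add0r; apply: is_deriveD; exact: is_deriveB.
- move=> t x s; apply: cvgB; first exact: (path_coord G zc).
  exact: (path_coord G zc').
exists (Order.max n n') => T.
have [M M0 HM] := path_bounded G zc T; have [M' M0' HM'] := path_bounded G zc' T.
exists (M + M') => t tT; apply: bndB.
  by apply: (bnd_le G _ _ (HM t tT)); rewrite ?le_max lexx.
by apply: (bnd_le G _ _ (HM' t tT)); rewrite ?le_max lexx ?orbT.
Unshelve. all: by end_near. Qed.

End PathDifference.

(** * Equivalence *)

Section Dynamics.
Context {R : realType} {d : nat} {C : set 'rV[int]_d}.
Local Notation conf := (configuration R C).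
Context (e : nat -> C) (ix : C -> nat).
Context (nb : C -> seq C) (w : C -> C -> R) (a : C -> R) (k0 k2 : nat) (K0 K1 : R).
Hypothesis G : weighted_graph e ix nb w a k0 k2 K0 K1.

Let q x := a x ^ (- k2%:Z).
Local Notation S := (@tsum R C e).
Local Notation heat := (heat nb w).
Local Notation slow := (slow a).
Local Notation rapid := (rapid a).
Local Notation moderate := (moderate a).
Let q0 : forall x, 0 < q x := q_gt0 G.
Let cq : cvgn (series (fun i => q (e i))) := q_cvg G.

Context {dT : measure_display} {T : measurableType dT} (P : probability T R).
Variables (F : R -> set (set T)) (B : R -> T -> C -> R) (Phi : (C -> R) -> R -> T -> C -> R).
Hypothesis hF : filtration F.
Hypothesis hB : brownian_family P F B.
Hypothesis adPhi : forall f, moderate f -> adapted F (Phi f).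
Hypothesis Phi0 : forall f, moderate f -> {ae P, forall o, Phi f 0 o = f}.
Hypothesis mPhi : forall f t o, moderate f -> 0 <= t -> moderate (Phi f t o).
Hypothesis pathPhi : forall f, moderate f -> exists n, {ae P, forall o,
  path_continuous a (fun t => Phi f t o) n /\ path_solution nb w (fun t => Phi f t o) (fun t => B t o)}.

Let m0 : moderate (fun=> 0). Proof. exact: rapid_moderate (rapid0 a). Qed.

(** The growth of the Brownian field is read off from the solution started at zero, through
    [noise_bounded]. *)
Lemma noise_moderate : {ae P, forall o, forall s t, 0 <= s -> s <= t ->
  moderate (fun x => B t o x - B s o x)}.
Proof.
have [n hn] := pathPhi m0.
apply: (ae_mono hn) => o [c E] s t s0 st; have [M M0 HM] := noise_bounded G c E t.
exists (k0%:Z + n), (`|(Num.sqrt 2)^-1| * M).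
have := bndZ (Num.sqrt 2)^-1 (HM s t s0 st (lexx t)).
congr (bnd _ _ _ _); apply/funext => x.
by rewrite mulrA mulVf ?mul1r// gt_eqF// sqrtr_gt0.
Qed.

Lemma Phi_difference f : moderate f -> {ae P, forall o,
  [/\ heat (fun t x => Phi f t o x - Phi (fun=> 0) t o x),
      slow (fun t x => Phi f t o x - Phi (fun=> 0) t o x)
    & (fun x => Phi f 0 o x - Phi (fun=> 0) 0 o x) = f]}.
Proof.
move=> mf; have [n hn] := pathPhi mf; have [n' hn'] := pathPhi m0.
apply: (ae_mono (ae_and (ae_and hn hn') (ae_and (Phi0 mf) (Phi0 m0)))).
move=> o [[[c E] [c' E']] [-> ->]]; have [h s] := path_difference G c E c' E'.
by split=> //; apply/funext => x; rewrite subr0.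
Qed.

(* The heat flow comes for free: subtracting two solutions driven by the same noise removes the noise. *)
Lemma exists_flow : exists flow : (C -> R) -> R -> C -> R,
  forall f, rapid f -> [/\ heat (flow f), slow (flow f) & flow f 0 = f].
Proof.
suff /choice[flow h] : forall f, exists D, rapid f -> [/\ heat D, slow D & D 0 = f] by exists flow.
move=> f; have [rf|nf] := pselect (rapid f); last by exists (fun=> f).
have [om [h s z]] := ae_exists (Phi_difference (rapid_moderate rf)).
by exists (fun t x => Phi f t om x - Phi (fun=> 0) t om x).
Qed.

Variable flow : (C -> R) -> R -> C -> R.
Hypothesis flowP : forall f, rapid f -> [/\ heat (flow f), slow (flow f) & flow f 0 = f].
Local Notation flow_rapid := (flow_rapid G flowP).
Local Notation green_form := (green_form e flow).
Local Notation noise_var := (noise_var e flow).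

Lemma adapted_Phi f u t : moderate f -> 0 <= t -> adapted_at F t (fun o => pairing u (Phi f t o)).
Proof. by move=> mf t0; apply: (adapted_pairing G hF (adPhi mf)). Qed.

Lemma adapted_cst t (c : R) : 0 <= t -> adapted_at F t (fun=> c).
Proof. by move=> t0; apply/(adapted_atP hF) => //; exact: measurable_cst. Qed.

Lemma measurable_Phi f u t : moderate f -> 0 <= t -> measurable_fun setT (fun o => pairing u (Phi f t o)).
Proof. by move=> mf t0; apply: (adapted_at_measurable hF t0); exact: adapted_Phi. Qed.

Lemma Phi_law f u s t (th : T -> R) : moderate f -> rapid u -> 0 <= s -> s <= t -> adapted_at F s th ->
  \int[P]_o cos (th o + pairing u (Phi f t o)) =
  \int[P]_o cos (th o + pairing (flow u (t - s)) (Phi f s o)) * expR (- noise_var (t - s) u).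
Proof.
move=> mf ru s0 st ath; have [n hn] := pathPhi mf.
exact: (solution_law G flowP hF hB noise_moderate (adPhi mf) hn).
Qed.

Lemma mean_cos f u t th : moderate f -> rapid u -> 0 <= t ->
  \int[P]_o cos (pairing u (Phi f t o) + th) =
  cos (pairing (flow u t) f + th) * expR (- noise_var t u).
Proof.
move=> mf ru t0; have := Phi_law mf ru (lexx 0) t0 (adapted_cst th (lexx 0)); rewrite subr0.
under eq_Rintegral do rewrite addrC.
move=> ->; congr (_ * _); rewrite -[RHS](exp_cst P); apply: exp_ae_eq => //.
  apply: (bm_cos _).1; apply: measurable_funD => //; exact: measurable_Phi.
by apply: (ae_mono (Phi0 mf)) => o ->; rewrite addrC.
Qed.

(** Conditioning at time [s] replaces [u] at time [t] by [flow u (t - s)] at time [s], where it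
    joins [v]; [mean_cos] then goes back to time 0. *)
Lemma mean_cos2 f u v s t th : moderate f -> rapid u -> rapid v -> 0 <= s -> s <= t ->
  let u' x := flow u (t - s) x + v x in
  \int[P]_o cos (pairing u (Phi f t o) + pairing v (Phi f s o) + th) =
  cos (pairing (flow u' s) f + th) * expR (- noise_var s u') * expR (- noise_var (t - s) u).
Proof.
move=> mf ru rv s0 st u'; have ts : 0 <= t - s by rewrite subr_ge0.
have rf := flow_rapid ru ts; have ru' : rapid u' by exact: rapidD.
rewrite -(mean_cos th mf ru' s0).
have ad : adapted_at F s (fun o => th + pairing v (Phi f s o)).
  by apply: (adapted_atD hF) => //; [exact: adapted_cst|exact: adapted_Phi].
have := Phi_law mf ru s0 st ad.
rewrite (_ : (\int[P]_o _) = \int[P]_o cos (pairing u (Phi f t o) + pairing v (Phi f s o) + th)); last first.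
  by apply: eq_Rintegral => o _; congr (cos _); ring.
move=> ->; congr (_ * _); apply: eq_Rintegral => o _.
have mo := mPhi o mf s0.
by rewrite /u' (pairingD G rf rv mo); congr (cos _); ring.
Qed.

Variable nu : probability conf R.
Hypothesis temperedP : forall f, moderate f <-> tempered f.
Hypothesis rapidP : forall u, rapid u <-> rapidly_decreasing u.
Hypothesis mtempered : measurable (@tempered R d C).
Hypothesis hnu : nu tempered = 1%E.

Lemma tempered_ae : {ae nu, forall f, moderate f}.
Proof.
exists (~` tempered); split; first exact: measurableC.
  by rewrite probability_setC// hnu subee.
by move=> f nf /temperedP.
Qed.
Local Notation numod := tempered_ae.

Lemma exp_tempered h : measurable_fun setT h ->
  \int[nu]_(f in tempered) h f = \int[nu]_f h f.
Proof.
move=> mh; rewrite Rintegral_mkcond; apply: exp_ae_eq => //.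
  by apply/(measurable_restrictT _ mtempered); exact: measurable_funTS.
by apply: (ae_mono numod) => f /temperedP tf; rewrite patchE mem_set.
Qed.

Definition pair_law (s t : R) (u v : C -> R) (th : R) : R := \int[nu]_(f in tempered) \int[P]_o
  cos (pairing u (Phi f t o) + pairing v (Phi f s o) + th).

Lemma pair_lawE s t u v th : rapid u -> rapid v -> 0 <= s -> s <= t ->
  let u' x := flow u (t - s) x + v x in
  pair_law s t u v th =
  cf nu (flow u' s) th * expR (- noise_var s u') * expR (- noise_var (t - s) u).
Proof.
move=> ru rv s0 st u'; rewrite /pair_law.
under eq_Rintegral => f /set_mem /temperedP mf do rewrite (mean_cos2 th mf ru rv s0 st).
have bc := bm_cos (measurable_phase G (flow u' s) th).
rewrite exp_tempered; last by apply: measurable_funM => //; apply: measurable_funM => //; case: bc.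
rewrite /cf -!mulrA [RHS]mulrC -(expZ nu _ bc); apply: eq_Rintegral => f _; rewrite -/u'.
by move: (expR _) (expR _) (cos _) => x y z; ring.
Qed.

Definition pair_symmetric := forall s t u v th, 0 <= s -> s < t -> rapid u -> rapid v ->
  pair_law s t u v th = pair_law s t v u th.

(** By the difference law, the two-time functional equals [cf (u + v)] times the exponential of
    [green_form (t - s) u v], visibly symmetric in [u] and [v]. *)
Lemma flow_law_symmetric : flow_law e a nu flow -> pair_symmetric.
Proof.
move=> fl s t u v th s0 st ru rv; have ts : 0 < t - s by rewrite subr_gt0.
have dl := flow_law_dif G numod flowP fl.
suff H u1 v1 : rapid u1 -> rapid v1 -> pair_law s t u1 v1 th =
    cf nu (fun x => u1 x + v1 x) th * expR (green_form (t - s) u1 v1).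
  rewrite (H u v ru rv) (H v u rv ru) (green_form_sym G flowP rv ru (ltW ts)).
  rewrite (_ : (fun x => v x + u x) = (fun x => u x + v x))//.
  by apply/funext => x; rewrite addrC.
move=> r1 r2; rewrite pair_lawE// ?ltW//.
have rf := flow_rapid r1 (ltW ts).
rewrite -fl//; last exact: rapidD.
rewrite (dif_law_flow G flowP th dl r1 r2 ts) -mulrA -expRD opprD.
by congr (_ * expR _); ring.
Qed.

Lemma expi_pair_law s t u v : 0 <= s -> 0 <= t ->
  cintegral nu tempered (fun f => cintegral P setT (fun o =>
      expi (pairing u (Phi f t o) + pairing v (Phi f s o)))) =
  (pair_law s t u v 0 +i* pair_law s t u v (- (pi / 2)))%C.
Proof.
move=> s0 t0; rewrite {1}/cintegral; congr (_ +i* _)%C.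
  by apply: eq_Rintegral => f _; apply: eq_Rintegral => o _; rewrite addr0.
by apply: eq_Rintegral => f _; apply: eq_Rintegral => o _; rewrite cosBpihalf.
Qed.

Lemma pair_lawC s t u v th : pair_law s t u v th = pair_law t s v u th.
Proof.
apply: eq_Rintegral => f _; apply: eq_Rintegral => o _.
by rewrite [pairing u _ + _]addrC.
Qed.

Lemma symmetric_reversible : pair_symmetric -> reversible P Phi nu.
Proof.
move=> sym s t u v s0 st ru rv; have t0 := le_trans s0 (ltW st).
have {}ru := (rapidP u).2 ru; have {}rv := (rapidP v).2 rv.
rewrite (expi_pair_law u v s0 t0) (expi_pair_law u v t0 s0).
rewrite (pair_lawC t s u v 0) (pair_lawC t s u v (- (pi / 2))).
by rewrite (sym s t u v 0 s0 st ru rv) (sym s t u v (- (pi / 2)) s0 st ru rv).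
Qed.

Lemma flow_zero t x : 0 <= t -> flow (fun=> 0) t x = 0.
Proof.
move=> t0; have r0 : rapid (fun=> 0) by exact: rapid0.
have := flowB G flowP r0 r0 t0 => /(congr1 (fun f => f x)).
by rewrite subr0 subrr.
Qed.

Lemma noise_var_null u : noise_var 0 u = 0.
Proof. by rewrite /noise_var mulr0 green_form0 mulr0. Qed.

Lemma pair_law_left u t th : rapid u -> 0 <= t ->
  pair_law 0 t u (fun=> 0) th = cf nu (flow u t) th * expR (- noise_var t u).
Proof.
move=> ru t0; have r0 : rapid (fun=> 0) by exact: rapid0.
rewrite (pair_lawE th ru r0 (lexx 0) t0) noise_var_null oppr0 expR0 mulr1 addr0.
rewrite (_ : (fun x => flow u t x + 0) = flow u t); last by apply/funext => x; rewrite addr0.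
by rewrite (flow0 flowP (flow_rapid ru t0)).
Qed.

Lemma pair_law_right u t th : rapid u -> 0 <= t -> pair_law 0 t (fun=> 0) u th = cf nu u th.
Proof.
move=> ru t0; have r0 : rapid (fun=> 0) by exact: rapid0.
rewrite (pair_lawE th r0 ru (lexx 0) t0) noise_var_null oppr0 expR0 mulr1 addr0.
rewrite (_ : (fun x => flow (fun=> 0) t x + u x) = u); last by apply/funext => x; rewrite flow_zero ?add0r.
rewrite (flow0 flowP ru) /noise_var /green_form (@eq_tsum _ _ e _ (fun=> 0)) ?tsum0; last by move=> x; rewrite mulr0.
by rewrite mulr0 oppr0 expR0 mulr1.
Qed.

(** Recovers every phase from 0 and [- pi / 2], the only two present in the complex identity of
    reversibility. *)
Lemma cf_phase u th : cf nu u th = cos th * cf nu u 0 - sin th * cf nu u (- (pi / 2)).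
Proof.
have b c := bm_cos (measurable_phase G u c).
rewrite /cf -(expZ nu _ (b 0)) -(expZ nu _ (b (- (pi / 2)))).
rewrite -(expB nu (bmZ _ (b 0)) (bmZ _ (b (- (pi / 2))))).
by apply: eq_Rintegral => f _; rewrite addr0 cosBpihalf cosD; ring.
Qed.

Lemma reversible_pair_law s t u v : reversible P Phi nu -> 0 <= s -> s < t -> rapid u -> rapid v ->
  pair_law s t u v 0 = pair_law s t v u 0 /\
  pair_law s t u v (- (pi / 2)) = pair_law s t v u (- (pi / 2)).
Proof.
move=> rev s0 st ru rv; have t0 := le_trans s0 (ltW st).
have := rev s t u v s0 st ((rapidP u).1 ru) ((rapidP v).1 rv).
rewrite (expi_pair_law u v s0 t0) (expi_pair_law u v t0 s0).
move=> H.
have [E0 E1] := complex_eq H.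
have C0 := pair_lawC t s u v 0.
have C1 := pair_lawC t s u v (- (pi / 2)).
by split; [rewrite E0|rewrite E1].
Qed.

(** Reversibility with [s = 0] and one of the two test functions equal to 0 equates the laws at
    times 0 and [t]. *)
Lemma reversible_flow_law : reversible P Phi nu -> flow_law e a nu flow.
Proof.
move=> rev u t th ru; rewrite le_eqVlt => /orP[/eqP <-|t0].
  by rewrite (flow0 flowP ru) noise_var_null oppr0 expR0 mulr1.
have r0 : rapid (fun=> 0) by exact: rapid0.
have [] := reversible_pair_law rev (lexx 0) t0 ru r0.
rewrite 2!(pair_law_left _ ru (ltW t0)) 2!(pair_law_right _ ru (ltW t0)) => E0 E1.
by rewrite (cf_phase u) -E0 -E1 [cf nu (flow u t) th]cf_phase; ring.
Qed.

Lemma stationary_flow_law : stationary P Phi nu -> flow_law e a nu flow.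
Proof.
move=> st u t th ru t0.
have bc v := bm_cos (measurable_phase G v th).
have mh : measurable_fun tempered (fun f : conf => cos (pairing u f + th)).
  by apply: measurable_funTS; exact: (bc u).1.
have := st _ mh _ t t0 => /(_ ltac:(by exists 1 => f _; rewrite ler_norml cos_geN1 cos_le1)).
rewrite (exp_tempered (bc u).1) {1}/cf => <-; rewrite /semigroup.
rewrite (_ : (\int[nu]_(f in tempered) _) = \int[nu]_(f in tempered) (expR (- noise_var t u) * cos (pairing (flow u t) f + th))); last first.
  by apply: eq_Rintegral => f /set_mem /temperedP mf; rewrite (mean_cos th mf ru t0) mulrC.
rewrite exp_tempered; last exact: (bmZ _ (bc _)).1.
by rewrite (expZ nu _ (bc _)) mulrC.
Qed.

(** Nothing is assumed about how [Phi f] depends on [f]. This splitting into the flow of [f] and the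
    solution from zero gives a version that is jointly measurable in [f] and the noise. *)
Lemma Phi_split f t : moderate f -> 0 <= t ->
  {ae P, forall o, Phi f t o = (fun x => pairing (flow (point x 1) t) f + Phi (fun=> 0) t o x)}.
Proof.
move=> mf t0; apply: (ae_mono (Phi_difference mf)) => o [h s D0]; apply/funext => x.
have rp := rapid_point G x 1.
have := flow_dual G flowP rp h s t0.
rewrite (tsum_point G) mul1r (@eq_tsum _ _ e _ (fun y => flow (point x 1) t y * f y)); last first.
  by move=> y; rewrite -[in RHS]D0.
rewrite -(pairingE G (flow_rapid rp t0) mf) => <-.
by rewrite subrK.
Qed.

Definition split_path (t : R) (p : conf * T) : conf :=
  fun x => pairing (flow (point x 1) t) p.1 + Phi (fun=> 0) t p.2 x.

Lemma measurable_split_path t : 0 <= t -> measurable_fun setT (split_path t).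
Proof.
move=> t0; apply: measurable_to_conf => x; apply: measurable_funD.
  exact: (measurableT_comp (measurable_pair G _) measurable_fst).
have mP : measurable_fun setT (fun o => Phi (fun=> 0) t o x).
  by apply: (adapted_at_measurable hF t0) => Y mY; exact: (adPhi m0).
exact: (measurableT_comp mP measurable_snd).
Qed.

Lemma exp_product (h : conf * T -> R) : bounded_mfun h ->
  \int[(nu \x P)%E]_p h p = \int[nu]_f \int[P]_o h (f, o).
Proof.
move=> bh; have [mh [M hM]] := bh.
rewrite /Rintegral; congr fine.
rewrite -integral12_prod_meas1; last exact: (bm_integrable (nu \x P)%E bh).
apply: eq_integral => f _; rewrite fineK//; apply: integrable_fin_num => //.
apply: bm_integrable; split; last by exists M.
exact: (measurableT_comp mh (pair1_measurable f)).
Qed.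

Lemma measurable_mean (h : conf * T -> R) : bounded_mfun h ->
  measurable_fun setT (fun f => \int[P]_o h (f, o)).
Proof.
move=> bh; apply: (measurableT_comp (fine_measurable measurableT)).
exact: (measurable_fubini_F (bm_integrable (nu \x P)%E bh)).
Qed.

(** The law at time [t] started from [nu], as the image of [nu \x P] under [split_path].
    Stationarity then becomes an equality of two measures. *)
Lemma path_law t : 0 <= t -> exists mu : probability conf R, forall k, bounded_mfun k ->
  \int[mu]_f k f = \int[nu]_(f in tempered) \int[P]_o k (Phi f t o).
Proof.
move=> t0; have mZ := measurable_split_path t0.
pose Z : {mfun (conf * T)%type >-> conf} := HB.pack (split_path t) (isMeasurableFun.Build _ _ _ _ (split_path t) mZ).
exists (distribution (nu \x P)%E Z) => k bk; have [mk [M kM]] := bk.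
have bkZ : bounded_mfun (fun p => k (split_path t p)).
  by split; [exact: measurableT_comp mk mZ|exists M].
transitivity (\int[(nu \x P)%E]_p k (split_path t p)).
  rewrite /Rintegral; congr fine.
  apply: (@integral_distribution _ _ _ _ _ _ Z (EFin \o k)); first exact/measurable_EFinP.
  exact: bm_integrable bkZ.
rewrite (exp_product bkZ) -(exp_tempered (measurable_mean bkZ)).
apply: eq_Rintegral => f /set_mem /temperedP mf; apply: exp_ae_eq.
- exact: (measurableT_comp bkZ.1 (pair1_measurable f)).
- apply: (measurableT_comp mk); apply: measurable_to_conf => x.
  by apply: (adapted_at_measurable hF t0) => Y mY; exact: adPhi.
- by apply: (ae_mono (Phi_split mf t0)) => o ->.
Qed.

Lemma flow_law_stationary : flow_law e a nu flow -> stationary P Phi nu.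
Proof.
move=> fl g mg [M gM] t t0; have [mu muE] := path_law t0.
have M0 : 0 <= M.
  have [f /temperedP tf] := ae_exists numod; exact: le_trans (normr_ge0 _) (gM f tf).
have E A : measurable A -> mu A = nu A.
  apply: char_fun_inj => l th; rewrite /char_fun muE; last first.
    by apply: bm_cos; apply: measurable_funD => //; exact: measurable_lincomb.
  have rp := rapid_points G l.
  have -> : \int[nu]_f cos (lincomb l f + th) = cf nu (points l) th.
    by apply: eq_Rintegral => f _; rewrite (pairing_points G).
  have bc := bm_cos (measurable_phase G (flow (points l) t) th).
  rewrite (fl _ t th rp t0) mulrC -(expZ nu _ bc) -(exp_tempered (bmZ _ bc).1).
  apply: eq_Rintegral => f /set_mem /temperedP mf.
  rewrite mulrC -(mean_cos th mf rp t0); apply: eq_Rintegral => o _.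
  by rewrite (pairing_points G).
(* Test functions for stationarity are controlled on [tempered] only, which the solution never
   leaves; the extension by 0 is bounded and measurable everywhere. *)
pose g' : conf -> R := g \_ tempered.
have mg' : measurable_fun setT g' by apply/(measurable_restrictT _ mtempered).
have bg' : bounded_mfun g'.
  split=> //; exists M => f; rewrite /g' patchE; case: ifPn => [/set_mem/gM//|_].
  by rewrite normr0.
transitivity (\int[mu]_f g' f).
  rewrite muE//; apply: eq_Rintegral => f /set_mem /temperedP mf.
  apply: eq_Rintegral => o _; rewrite /g' patchE mem_set//.
  by apply/temperedP; exact: mPhi.
transitivity (\int[nu]_f g' f); last by rewrite [RHS]Rintegral_mkcond.
by rewrite /Rintegral; congr fine; apply: eq_measure_integral => A mA _; exact: E.
Qed.

End Dynamics.

(** * The Gibbs property and the law of shifts *)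

Section GibbsSpecification.
Context {R : realType} {d : nat} {C : set 'rV[int]_d}.
Local Notation conf := (configuration R C).
Variable w : 'rV[int]_d -> 'rV[int]_d -> R.
Hypothesis hw : conductances w.
Hypothesis hC : unique_infinite_component w C.
Local Notation nb := (@nbC d C).
Local Notation wC := (@wC R d C w).
Variables (n : nat) (e : nat -> C) (ix : C -> nat) (k2 : nat) (K : R).
Hypothesis G : weighted_graph e ix nb wC (aC n) (2 * n) k2 K K.
Variable nu : probability conf R.
Hypothesis numod : {ae nu, forall f, moderate (aC n) f}.
Local Notation moderate := (moderate (aC n)).

Let gsumL (L : {fset C}) := @gsum R d C L (hamiltonian w L).
Let gnormL (L : {fset C}) := @gnorm R d C L (hamiltonian w L).
Let mixtureL (L : {fset C}) := @mixture R d C L (hamiltonian w L) nu.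

Let degree_pos (L : {fset C}) : forall x, x \in (L : seq C) -> 0 < degree nb wC x.
Proof. by move=> x _; exact: (degree_gt0 hw hC). Qed.
Let solv (L : {fset C}) := fun u => dirichlet_solvable hw hC u (fset_uniq L).
Let HE (L : {fset C}) x f t (xL : x \in (L : seq C)) := hamiltonian_shift hw f t (xL : x \in L).

Lemma partitionE (L : {fset C}) f : partition_function w L f = gnormL L f.
Proof. by apply: eq_lebesgue_sites => f' _; rewrite /weighted mulr1. Qed.

Lemma specificationE (L : {fset C}) (B : set conf) f : measurable B -> moderate f ->
  (specification w L B f)%:E = ((fine (gnormL L f))^-1%:E * gsumL L \1_B f)%E.
Proof.
move=> mB mf.
rewrite /specification partitionE mulrC EFinM fineK//.
have h : gsumL L \1_B f \is a fin_num; last exact: h.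
apply: (gsum_fin G (fset_uniq L) (measurable_hamiltonian w L) (hamiltonian_ge0 hw L) (HE (L := L)) (@solv L) (M := 1)) => //.
by move=> f'; rewrite indicE; case: (_ \in _); rewrite ?lexx ler01.
Qed.

Lemma sigma_coordinates_measurable (D : set C) (A : set conf) :
  sigma_coordinates D A -> measurable A.
Proof.
apply: sub_smallest2r; first exact: smallest_sigma_algebra.
by move=> B [x _ hx]; exists x.
Qed.

(** The conditional probability integrated over the whole space, with the specification as its
    version. *)
Lemma gibbs_mixture : gibbs w nu -> forall (L : {fset C}) B, measurable B -> mixtureL L \1_B = nu B.
Proof.
move=> [_ gib] L B mB; have [g [gF gB] gE] := gib L B mB.
have mg : measurable_fun setT (g : conf -> R).
  by move=> _ Y mY; rewrite setTI; exact: sigma_coordinates_measurable (gF Y mY).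
have <- : (\int[nu]_(f in setT) (g f)%:E)%E = nu B.
  rewrite gB ?setTI//.
  exact: (@measurableT _ (g_sigma_algebraType (coordinate_sets [set x | x \notin L]))).
apply: ae_eq_integral => //.
- apply: (@measurable_mixture_integrand _ _ _ L _ (measurable_hamiltonian w L) \1_B) => //.
- exact/measurable_EFinP.
apply: (ae_mono (ae_and numod gE)) => f [mf ->] _.
by rewrite specificationE.
Qed.

(** The one-point sets already give the law of shifts at every site. *)
Lemma gibbs_shift_law : gibbs w nu -> shift_law e nb wC (aC n) nu.
Proof.
move=> gib; apply: (site_law_shift G numod) => x.
pose L : {fset C} := [fset x]%fset.
apply: (mixture_site_law G (fset_uniq L) (measurable_hamiltonian w L) (hamiltonian_ge0 hw L) (HE (L := L)) (@degree_pos L) (@solv L) numod).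
  by move=> A mA; exact: gibbs_mixture.
exact: fset11.
Qed.

Lemma lebesgue_sites_local (s : seq C) (h : conf -> \bar R) f f' :
  (forall x, x \notin s -> f x = f' x) -> lebesgue_sites s h f = lebesgue_sites s h f'.
Proof.
elim: s f f' => [|x s IH] f f' ff'; first by congr h; apply/funext => x; exact: ff'.
apply: eq_integral => b _; apply: IH => y ys /=.
by case: eqP => // /eqP yx; apply: ff'; rewrite inE negb_or yx.
Qed.

(** A function that ignores the sites of [L] factors through this map, which is measurable with
    respect to the coordinates outside [L]; this yields the measurability demanded of a conditional
    probability. *)
Definition clear (L : {fset C}) (f : conf) : conf := fun x => if x \in L then 0 else f x.

Lemma clear_sigma (L : {fset C}) (A : set conf) : measurable A ->
  sigma_coordinates [set x | x \notin L] (clear L @^-1` A).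
Proof.
move=> mA.
have mz : measurable_fun setT (clear L : g_sigma_algebraType (coordinate_sets [set x | x \notin L]) -> conf).
  apply: measurable_to_conf => x; have [xL|xL] := boolP (x \in L).
    rewrite (_ : (fun f => clear L f x) = cst 0); last by apply/funext => f; rewrite /clear xL.
    exact: measurable_cst.
  rewrite (_ : (fun f => clear L f x) = (fun f => f x)); last by apply/funext => f; rewrite /clear (negbTE xL).
  move=> _ Y mY; rewrite setTI; apply: sub_sigma_algebra; exists x => //.
  by exists Y => //; rewrite setTI.
by have := mz measurableT A mA; rewrite setTI.
Qed.

Lemma sigma_clear (L : {fset C}) (A : set conf) : sigma_coordinates [set x | x \notin L] A ->
  forall f f', (forall x, x \notin L -> f x = f' x) -> A f -> A f'.
Proof.
move=> FA f f' ff'.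
suff H : sigma_coordinates [set x | x \notin L] `<=` [set A | A f <-> A f'] by have [] := H A FA.
apply: smallest_sub.
  split=> [|B /= BB|B BB]; first by [].
    by rewrite /setD /=; split => -[_ h]; split => // /BB.
  by split=> -[i _ h]; exists i => //; exact/BB.
by move=> B [x xL [Y mY <-]] /=; rewrite ff'.
Qed.

(** An event [A] of the outside coordinates is constant under the integrals over [L], so the
    specification of the intersection of [A] and [B] is that of [B] restricted to [A]. Invariance of
    [nu] under resampling, applied to this intersection, is the defining identity of the conditional
    probability. *)
Lemma mixture_gibbs : nu tempered = 1%E -> shift_law e nb wC (aC n) nu -> gibbs w nu.
Proof.
move=> hnu sh; split=> // L B mB.
have mH := measurable_hamiltonian w L.
have i0 (D : set conf) f : 0 <= \1_D f :> R by rewrite indicE.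
have loc (D : set conf) f f' : (forall x, x \notin L -> f x = f' x) -> specification w L D f = specification w L D f'.
  by move=> ff'; rewrite /specification /partition_function; congr (fine _ / fine _); exact: lebesgue_sites_local.
exists (specification w L B); last exact: aeW.
have mix D : measurable D -> mixtureL L \1_D = nu D.
  exact: (shift_law_mixture G (fset_uniq L) mH (hamiltonian_ge0 hw L) (HE (L := L)) (@degree_pos L) (@solv L) numod sh).
have mg : measurable_fun setT (specification w L B : conf -> R).
  rewrite (_ : specification w L B = fun f => fine (gsumL L \1_B f) * (fine (gnormL L f))^-1); last first.
    by apply/funext => f; rewrite /specification partitionE.
  apply: measurable_funM; last exact: measurable_gnorm_inv.
  apply: (measurableT_comp (fine_measurable measurableT)); apply: measurable_gsum => //.
split=> [Y mY|A FA].
  have -> : specification w L B @^-1` Y = clear L @^-1` (specification w L B @^-1` Y).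
    apply/seteqP; split=> f /=; rewrite (loc B f (clear L f))//.
      by move=> x xL; rewrite /clear (negbTE xL).
    by move=> x xL; rewrite /clear (negbTE xL).
  by apply: clear_sigma; rewrite -[X in measurable X]setTI; exact: mg.
have mA := sigma_coordinates_measurable FA.
rewrite -(mix (A `&` B)); last exact: measurableI.
rewrite integral_mkcond; apply: ae_eq_integral => //.
- by apply/(measurable_restrictT _ mA); apply: measurable_funTS; exact/measurable_EFinP.
- apply: (@measurable_mixture_integrand _ _ _ L _ mH \1_(A `&` B)) => //.
  by apply: measurable_indic; exact: measurableI.
apply: (ae_mono numod) => f mf _; rewrite patchE.
case: ifPn => fA.
  rewrite (specificationE L mB mf); congr (_ * _)%E; apply: eq_lebesgue_sites => f' ff'.
  rewrite /weighted !indicE in_setI; have -> : f' \in A.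
    by apply/mem_set; apply: (sigma_clear FA _ (set_mem fA)) => x xL; rewrite ff'.
  by [].
rewrite (_ : gsum _ _ _ _ = gsum L (hamiltonian w L) (fun f' => 0 * \1_B f') f).
  by rewrite gsumZ// mul0e mule0.
apply: eq_lebesgue_sites => f' ff'; rewrite /weighted mul0r indicE in_setI (_ : f' \in A = false) ?mulr0//.
apply/negbTE; apply: contra fA => /set_mem f'A; apply/mem_set.
by apply: (sigma_clear FA _ f'A) => x xL; rewrite ff'.
Qed.

End GibbsSpecification.

Theorem theorem2p7 (R : realType) (d : nat) (hd : (0 < d)%N)
  (w : 'rV[int]_d -> 'rV[int]_d -> R) (C : set 'rV[int]_d)
  (hw : conductances w) (hC : unique_infinite_component w C)
  (dX : measure_display) (TX : measurableType dX)
  (PX : C -> probability TX R) (X : R -> TX -> C)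
  (hX : variable_speed_walk w PX X)
  (htrans : transient PX X) (hgreen : tempered_green PX X)
  (hgrowth : exists2 eps : R, 0 < eps & growth_bound w eps)
  (dT : measure_display) (T : measurableType dT) (P : probability T R)
  (F : R -> set (set T)) (hF : filtration F)
  (B : R -> T -> C -> R) (hB : brownian_family P F B)
  (Phi : (C -> R) -> R -> T -> C -> R)
  (hPhi : forall f, tempered f -> sde_solution w P F B f (Phi f))
  (nu : probability (configuration R C) R) (hnu : nu tempered = 1%E) :
  (stationary P Phi nu <-> reversible P Phi nu) /\
  (reversible P Phi nu <-> gibbs w nu).
Proof.
have [n [e [ix [K G]]]] := lattice_graph hw hC hgrowth.
have tP (f : C -> R) : moderate (aC n) f <-> tempered f by exact: (moderateP G).
have rP (u : C -> R) : rapid (aC n) u <-> rapidly_decreasing u by exact: (rapidP G).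
have mt := measurable_tempered G.
have numod := tempered_ae tP mt hnu.
have adPhi (f : C -> R) : moderate (aC n) f -> adapted F (Phi f) by move=> /tP/hPhi[].
have Phi0 (f : C -> R) : moderate (aC n) f -> {ae P, forall o, Phi f 0 o = f} by move=> /tP/hPhi[].
have mPhi (f : C -> R) t o : moderate (aC n) f -> 0 <= t -> moderate (aC n) (Phi f t o).
  move=> /tP/hPhi[_ _ [N N0 hN] _] t0; apply/tP; exists N => //.
  exact: (hN o t t0).1.
have pathPhi (f : C -> R) : moderate (aC n) f -> exists nZ, {ae P, forall o,
    path_continuous (aC n) (fun t => Phi f t o) nZ /\
    path_solution (@nbC d C) (wC w) (fun t => Phi f t o) (fun t => B t o)}.
  by move=> /tP/hPhi/(sde_path G).
have [flow flowP] := exists_flow G Phi0 pathPhi.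
have SF : stationary P Phi nu -> flow_law e (aC n) nu flow.
  exact: (stationary_flow_law G hF hB adPhi Phi0 pathPhi flowP tP mt hnu).
have FS : flow_law e (aC n) nu flow -> stationary P Phi nu.
  exact: (flow_law_stationary G hF hB adPhi Phi0 mPhi pathPhi flowP tP mt hnu).
have RF : reversible P Phi nu -> flow_law e (aC n) nu flow.
  exact: (reversible_flow_law G hF hB adPhi Phi0 mPhi pathPhi flowP tP rP mt hnu).
have FR : flow_law e (aC n) nu flow -> reversible P Phi nu.
  move=> fl; apply: (symmetric_reversible rP).
  exact: (flow_law_symmetric G hF hB adPhi Phi0 mPhi pathPhi flowP tP mt hnu fl).
have BF : gibbs w nu -> flow_law e (aC n) nu flow.
  move=> /(gibbs_shift_law hw hC G numod) sh.
  exact: (dif_flow_law G flowP (shift_law_dif G flowP sh)).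
have FB : flow_law e (aC n) nu flow -> gibbs w nu.
  move=> fl; apply: (mixture_gibbs hw hC G numod hnu).
  exact: (dif_law_shift G numod flowP (flow_law_dif G numod flowP fl)).
by split; split; [move=> /SF/FR|move=> /RF/FS|move=> /RF/FB|move=> /BF/FR].
Qed.
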